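(* Let $\lambda(x,y)$ be the solution of $$\lambda_{x}(x,y)(x^2-2xy-x)+\lambda_{y}(x,y)(y^2-2xy-y)=-\lambda(x,y),\qquad \lim_{z\to0}\frac{\lambda(xz,yz)}{z}=x .$$ Put $\varsigma=\varsigma(x,y)=[xy(x-y)]^{1/3}$ (any choice of the cube root, used consistently), $s=\mathrm{sm}(\varsigma)$, $c=\mathrm{cm}(\varsigma)$. Then $$\lambda(x,y)=\frac{\varsigma\left(c\varsigma^2-sc^2y\varsigma+s^2xy\right)^{2}}{y\left(x-c^3y\right)\left(c^2\varsigma^2-sx\varsigma+s^2cxy\right)},\qquad \lambda(y,x)=\frac{\varsigma\left(c^2\varsigma^2-sx\varsigma+s^2cxy\right)^{2}}{x\left(x-c^3y\right)\left(c\varsigma^2-sc^2y\varsigma+s^2xy\right)}.$$ In particular, $\lambda(x,y)$ is a single-valued analytic function of two variables. Moreover, $\lambda$ and $\Lambda(x,y)=(\lambda(x,y),\lambda(y,x))$ have the following properties. (PDE) $\lambda$ satisfies the partial differential equation $\lambda_{x}(x,y)(x^2-2xy-x)+\lambda_{y}(x,y)(y^2-2xy-y)=-\lambda(x,y)$ and the boundary condition $\lim_{z\to0}\frac{\lambda(xz,yz)}{z}=x$. (FLOW) $(1-z)\Lambda(\mathbf{x})=\Lambda\left(\Lambda(\mathbf{x}z)\frac{1-z}{z}\right)$ for $\mathbf{x}=(x,y)\in\mathbb{C}^2$, $z\in\mathbb{C}$. (SYMM) $\gamma^{-1}\circ\Lambda\circ\gamma=\Lambda$ for every $\gamma$ in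 the six-element group $\Sigma\cong S_3$ of linear maps generated by $\sigma(x,y)=(y,x)$ and $\tau(x,y)=(x-y,-y)$; in particular $$\lambda(x,y)+\lambda(-y,x-y)+\lambda(y-x,-x)=0,\qquad \lambda(x,y)+\lambda(-x,y-x)=0 .$$ (ELL) For fixed $x,y$ with $xy(x-y)\neq0$, the pair $(X(z),Y(z))=\left(\frac{\lambda(xz,yz)}{z},\frac{\lambda(yz,xz)}{z}\right)$ parametrizes the elliptic curve $XY(X-Y)=xy(x-y)$; thus $$\frac{\lambda(xz,yz)}{z}\cdot\frac{\lambda(yz,xz)}{z}\cdot\left(\frac{\lambda(xz,yz)}{z}-\frac{\lambda(yz,xz)}{z}\right)\equiv xy(x-y).$$
   Context: The Dixonian elliptic functions $\mathrm{sm},\mathrm{cm}$ are the meromorphic functions on $\mathbb{C}$ determined by $\mathrm{sm}(0)=0$, $\mathrm{cm}(0)=1$, $\mathrm{sm}'=\mathrm{cm}^2$, $\mathrm{cm}'=-\mathrm{sm}^2$; they satisfy $\mathrm{sm}^3+\mathrm{cm}^3\equiv1$. The function $\lambda$ is the unique solution, analytic near the origin of $\mathbb{C}^2$, of the PDE $\lambda_{x}(x,y)(x^2-2xy-x)+\lambda_{y}(x,y)(y^2-2xy-y)=-\lambda(x,y)$ with the boundary condition $\lim_{z\to0}\frac{\lambda(xz,yz)}{z}=x$, analytically continued. All identities are understood as identities between functions that may have poles along curves (i.e. they hold wherever both sides are defined). *)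

(* Defs.v *)
From Stdlib Require Import Reals.
From Coquelicot Require Import Coquelicot.
From mathcomp Require Import ssreflect ssrfun ssrbool fintype fingroup perm.

Set Implicit Arguments.
Unset Strict Implicit.
Unset Printing Implicit Defensive.

Local Open Scope C_scope.

(** * Analytic and meromorphic functions

    A meromorphic function is represented by a total function whose values at
    its singular points are junk; the places where it is defined are the points
    where it is analytic. *)

Definition analytic1_at (f : C -> C) (z0 : C) : Prop :=
  exists (a : nat -> C) (r : R),
    (0 < r)%R /\
    forall z, (Cmod (z - z0) < r)%R ->
      is_series (fun n => a n * (z - z0) ^ n) (f z).

(** The bound on the coefficients makes the double series absolutely convergent
    on the open polydisc of radius [r], so that summing it by total degree is
    only a choice of order. *)
Definition analytic2_at (f : C * C -> C) (p : C * C) : Prop :=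
  exists (a : nat -> nat -> C) (r M : R),
    (0 < r)%R /\
    (forall i j, (Cmod (a i j) * r ^ (i + j) <= M)%R) /\
    forall x y, (Cmod (x - fst p) < r)%R -> (Cmod (y - snd p) < r)%R ->
      is_series
        (fun n => sum_n (fun i => a i (n - i)%nat
                          * (x - fst p) ^ i * (y - snd p) ^ (n - i)) n)
        (f (x, y)).

(** The second clause removes the removable singularities: a function which
    off a thin set coincides with an analytic one is itself analytic there. Hence
    the non-analytic points of a meromorphic function are exactly its poles (and,
    in two variables, its points of indeterminacy). *)
Definition meromorphic1 (f : C -> C) : Prop :=
  forall z0 : C,
    (exists g h : C -> C,
        analytic1_at g z0 /\ analytic1_at h z0 /\
        ~ locally z0 (fun z => h z = 0) /\
        locally z0 (fun z => h z <> 0 -> f z = g z / h z)) /\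
    (forall g h : C -> C,
        analytic1_at g z0 -> analytic1_at h z0 ->
        ~ locally z0 (fun z => h z = 0) ->
        locally z0 (fun z => h z <> 0 -> f z = g z) ->
        analytic1_at f z0).

Definition meromorphic2 (f : C * C -> C) : Prop :=
  forall p : C * C,
    (exists g h : C * C -> C,
        analytic2_at g p /\ analytic2_at h p /\
        ~ locally p (fun q => h q = 0) /\
        locally p (fun q => h q <> 0 -> f q = g q / h q)) /\
    (forall g h : C * C -> C,
        analytic2_at g p -> analytic2_at h p ->
        ~ locally p (fun q => h q = 0) ->
        locally p (fun q => h q <> 0 -> f q = g q) ->
        analytic2_at f p).

(** * The Dixonian elliptic functions *)

Definition dixonian (sm cm : C -> C) : Prop :=
  meromorphic1 sm /\ meromorphic1 cm /\
  analytic1_at sm 0 /\ analytic1_at cm 0 /\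
  sm 0 = 0 /\ cm 0 = 1 /\
  forall z, analytic1_at sm z -> analytic1_at cm z ->
    is_derive sm z (cm z ^ 2) /\ is_derive cm z (- sm z ^ 2).

(** * The differential equation *)

Definition pde_at (f : C * C -> C) (p : C * C) : Prop :=
  let x := fst p in
  let y := snd p in
  exists fx fy : C,
    is_derive (fun t => f (t, y)) x fx /\
    is_derive (fun t => f (x, t)) y fy /\
    fx * (x ^ 2 - 2 * x * y - x) + fy * (y ^ 2 - 2 * x * y - y) = - f (x, y).

Definition boundary_condition (f : C * C -> C) : Prop :=
  forall x y : C,
    filterlim (fun z : C => f (x * z, y * z) / z) (locally' (0 : C)) (locally x).

Definition local_solution (f : C * C -> C) : Prop :=
  analytic2_at f (0 : C, 0 : C) /\
  locally (0 : C, 0 : C) (pde_at f) /\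
  boundary_condition f.

(** * The projective flow and its symmetries *)

Definition swap (p : C * C) : C * C := (snd p, fst p).

Definition tau (p : C * C) : C * C := (fst p - snd p, - snd p).

Definition Lambda (lam : C * C -> C) (p : C * C) : C * C :=
  (lam p, lam (swap p)).

Definition Lambda_defined (lam : C * C -> C) (p : C * C) : Prop :=
  analytic2_at lam p /\ analytic2_at lam (swap p).

Definition scale (k : C) (p : C * C) : C * C := (k * fst p, k * snd p).

Definition mutually_inverse (f g : C * C -> C * C) : Prop :=
  (forall p, g (f p) = p) /\ (forall p, f (g p) = p).

Inductive Sigma : (C * C -> C * C) -> Prop :=
| Sigma_id : Sigma (fun p => p)
| Sigma_swap : Sigma swap
| Sigma_tau : Sigma tau
| Sigma_comp f g : Sigma f -> Sigma g -> Sigma (fun p => f (g p))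
| Sigma_inv f g : Sigma f -> mutually_inverse f g -> Sigma g.

(** In ['S_3] the product [s * t] applies [s] first. *)
Definition isomorphic_to_S3 (G : (C * C -> C * C) -> Prop) : Prop :=
  exists phi : {perm 'I_3} -> C * C -> C * C,
    (forall (s t : {perm 'I_3}) p, phi (s * t)%g p = phi t (phi s p)) /\
    (forall s t, (forall p, phi s p = phi t p) -> s = t) /\
    (forall f, G f <-> exists s, forall p, f p = phi s p).

(* Main.v *)
Require Import Defs.
From Stdlib Require Import Reals ZArith Lra Lia Classical ClassicalEpsilon FunctionalExtensionality.
From Coquelicot Require Import Coquelicot.
From mathcomp Require ssrbool fintype fingroup perm.

(** Let [u] be a parameter with [(x, y) = Phi vs u], where
    [Phi vs u = (vs / (sm u cm u), vs cm u ^ 2 / sm u)]; as [sm ^ 3 + cm ^ 3 = 1],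
    [Phi vs] uniformizes the level curve [x y (x - y) = vs ^ 3]. The explicit
    formula for [lam] is the addition theorem in disguise: it says that [Lambda]
    is the translation [Phi vs u |-> Phi vs (u + vs)]. Scaling a point by [z]
    replaces [vs] by [z vs] and keeps [u], so the flow equation becomes
    [u + vs = (u + z vs) + (1 - z) vs], the curve of (ELL) is the image of a line,
    and the symmetries are [u |-> - u] and [u |-> 2 K - u] with [cm K = 0]. Identities
    proved for generic parameters extend to all points of analyticity by density,
    since [Phi] is onto the points of non-zero level; this uses that [sm] takes
    every value, a consequence of its double periodicity and Liouville's theorem.
    Differentiating the flow equation at [z = 0] gives the differential equation.
    Any solution [mu] is constant on [t |-> (1 - t) Lambda(t p) / t] up to the factor
    [1 - t]; comparing [t -> 0] with [t -> 1] gives [mu p = lam p]. *)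

Local Open Scope C_scope.

(** Three obstacles shape the proof. Power series behave badly under composition, so analyticity is
    translated into continuous complex differentiability and translated back by Cauchy's integral
    formula. The functions [sm] and [cm] carry junk values at their poles, so every identity between
    them is first proved on punctured neighbourhoods, where it only concerns meromorphic germs, and
    then moved to points of analyticity by limits. Finally, the cube root branches along the three
    lines [x = 0], [y = 0], [x = y], which meet at the origin, and there the closed formulas read
    0/0. The rule [sm (om z) = om sm z] makes the formula invariant under [v |-> om v], hence a
    function of [v ^ 3], and this carries it across the lines.

    The formula defining [lam] is not the one of the statement: its factors are exactly the
    numerators and the denominator of the addition formulas, and the stated one agrees with it
    modulo [sm ^ 3 + cm ^ 3 = 1]. Generic points are always reached along rays [t |-> t p] with [t]
    near 1. They change [vs] but not [u], so that genericity becomes a question about meromorphic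
    functions of the single variable [t]. *)

Definition dst (p q : C * C) : R :=
  (Cmod (fst q - fst p) + Cmod (snd q - snd p))%R.

Lemma dst_ge_0 p q : (0 <= dst p q)%R.
Proof.
  unfold dst. pose proof (Cmod_ge_0 (fst q - fst p)).
  pose proof (Cmod_ge_0 (snd q - snd p)). lra.
Qed.

Lemma dst_fst p q : (Cmod (fst q - fst p) <= dst p q)%R.
Proof. unfold dst. pose proof (Cmod_ge_0 (snd q - snd p)). lra. Qed.

Lemma dst_snd p q : (Cmod (snd q - snd p) <= dst p q)%R.
Proof. unfold dst. pose proof (Cmod_ge_0 (fst q - fst p)). lra. Qed.

Lemma Cmod_minus_sym (a b : C) : Cmod (a - b) = Cmod (b - a).
Proof. rewrite <- Cmod_opp. f_equal. ring. Qed.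

Lemma Cmod_minus_0 (a : C) : Cmod (a - a) = 0%R.
Proof. replace (a - a) with (RtoC 0) by ring. apply Cmod_0. Qed.

Lemma dst_refl p : dst p p = 0%R.
Proof. unfold dst. rewrite !Cmod_minus_0. lra. Qed.

Lemma dst_triangle p q s : (dst p s <= dst p q + dst q s)%R.
Proof.
  unfold dst.
  replace (fst s - fst p) with ((fst q - fst p) + (fst s - fst q)) by ring.
  replace (snd s - snd p) with ((snd q - snd p) + (snd s - snd q)) by ring.
  pose proof (Cmod_triangle (fst q - fst p) (fst s - fst q)).
  pose proof (Cmod_triangle (snd q - snd p) (snd s - snd q)). lra.
Qed.

Lemma Cmod_triangle_minus (a b : C) : (Cmod (a - b) <= Cmod a + Cmod b)%R.
Proof. unfold Cminus. rewrite <- (Cmod_opp b). apply Cmod_triangle. Qed.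

Lemma Cmod_triangle_3 (a b c : C) : (Cmod (a - c) <= Cmod (a - b) + Cmod (b - c))%R.
Proof. replace (a - c) with ((a - b) + (b - c)) by ring. apply Cmod_triangle. Qed.

(** * Neighbourhoods in the complex line and plane *)

Definition locally_dst (p : C * C) (P : C * C -> Prop) : Prop :=
  exists r : R, (0 < r)%R /\ forall q, (dst p q < r)%R -> P q.

(** The balls of [C] as a product space are comparable with discs for [Cmod] only up to the factor
    [sqrt 2], so radii are halved when passing between them. *)
Lemma sqrt2_bounds : (1 < sqrt 2 < 2)%R.
Proof.
  pose proof (sqrt_pos 2). assert (sqrt 2 * sqrt 2 = 2)%R by (apply sqrt_sqrt; lra).
  split; nra.
Qed.

Lemma locally_Cmod (z : C) (P : C -> Prop) :
  locally z P <-> exists r : R, (0 < r)%R /\ forall y, (Cmod (y - z) < r)%R -> P y.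
Proof.
  split.
  - intros [e He]. exists e. split; [apply cond_pos|].
    intros y Hy. apply He. now apply C_NormedModule_mixin_compat1.
  - intros [r [Hr H]].
    assert (Hr2 : (0 < r / 2)%R) by lra.
    exists (mkposreal _ Hr2). intros y Hy. apply H.
    apply (C_NormedModule_mixin_compat2 z y (mkposreal _ Hr2)) in Hy.
    change (Cmod (y - z) < sqrt 2 * (r / 2))%R in Hy.
    destruct sqrt2_bounds as [_ S].
    apply (Rmult_lt_compat_r (r / 2)) in S; [lra|easy].
Qed.

(** [is_derive] takes its neighbourhoods in the uniform space of the absolute ring, which is a
    different structure from the one of [locally_Cmod]; both reduce to discs. *)
Lemma locally_C_AbsRing (z : C) (P : C -> Prop) :
  @locally (AbsRing_UniformSpace C_AbsRing) z P <->
  exists r : R, (0 < r)%R /\ forall y, (Cmod (y - z) < r)%R -> P y.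
Proof.
  split.
  - intros [e He]. exists e. split; [apply cond_pos|]. intros y Hy. now apply He.
  - intros [r [Hr H]]. exists (mkposreal _ Hr). intros y Hy. now apply H.
Qed.

Lemma locally_CC (p : C * C) (P : C * C -> Prop) :
  locally p P <-> locally_dst p P.
Proof.
  split.
  - intros [e He]. exists e. split; [apply cond_pos|].
    intros q Hq. apply He. split.
    + apply C_NormedModule_mixin_compat1. change (Cmod (fst q - fst p) < e)%R.
      pose proof (dst_fst p q). lra.
    + apply C_NormedModule_mixin_compat1. change (Cmod (snd q - snd p) < e)%R.
      pose proof (dst_snd p q). lra.
  - intros [r [Hr H]].
    assert (Hr2 : (0 < r / 4)%R) by lra.
    exists (mkposreal _ Hr2). intros [q1 q2] [Hq1 Hq2]. apply H.
    apply (C_NormedModule_mixin_compat2 _ _ (mkposreal _ Hr2)) in Hq1.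
    apply (C_NormedModule_mixin_compat2 _ _ (mkposreal _ Hr2)) in Hq2.
    unfold dst.
    change (Cmod (q1 - fst p) < sqrt 2 * (r / 4))%R in Hq1.
    change (Cmod (q2 - snd p) < sqrt 2 * (r / 4))%R in Hq2.
    destruct sqrt2_bounds as [_ S].
    apply (Rmult_lt_compat_r (r / 4)) in S; [simpl; lra|easy].
Qed.

Lemma locally_dst_and p P Q :
  locally_dst p P -> locally_dst p Q -> locally_dst p (fun q => P q /\ Q q).
Proof.
  intros [r [Hr H]] [r' [Hr' H']]. exists (Rmin r r').
  split; [now apply Rmin_glb_lt|].
  intros q Hq. pose proof (Rmin_l r r'). pose proof (Rmin_r r r').
  split; [apply H|apply H']; lra.
Qed.

Lemma locally_dst_imp p (P Q : C * C -> Prop) :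
  (forall q, P q -> Q q) -> locally_dst p P -> locally_dst p Q.
Proof. intros I [r [Hr H]]. exists r. eauto. Qed.

Lemma locally_dst_self p P : locally_dst p P -> P p.
Proof. intros [r [Hr H]]. apply H. now rewrite dst_refl. Qed.

Lemma locally_dst_open p P : locally_dst p P -> locally_dst p (fun q => locally_dst q P).
Proof.
  intros [r [Hr H]]. exists (r / 2)%R. split; [lra|].
  intros q Hq. exists (r / 2)%R. split; [lra|].
  intros s Hs. apply H. pose proof (dst_triangle p q s). lra.
Qed.

(** * Continuity and total differentiability *)

Definition cont2 (f : C * C -> C) (p : C * C) : Prop :=
  forall e, (0 < e)%R -> locally_dst p (fun q => (Cmod (f q - f p) < e)%R).

(** Total differentiability with a complex linear differential. Unlike the mere existence of partial
    derivatives it is stable under composition. *)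
Definition D2 (f : C * C -> C) (p : C * C) (a b : C) : Prop :=
  forall e, (0 < e)%R ->
  locally_dst p (fun q =>
    (Cmod (f q - f p - (a * (fst q - fst p) + b * (snd q - snd p)))
     <= e * dst p q)%R).

Lemma lin_bound (a b : C) p q :
  (Cmod (a * (fst q - fst p) + b * (snd q - snd p)) <= (Cmod a + Cmod b) * dst p q)%R.
Proof.
  eapply Rle_trans; [apply Cmod_triangle|]. rewrite !Cmod_mult. unfold dst.
  pose proof (Cmod_ge_0 a). pose proof (Cmod_ge_0 b).
  pose proof (Cmod_ge_0 (fst q - fst p)). pose proof (Cmod_ge_0 (snd q - snd p)). nra.
Qed.

Lemma D2_lip f p a b : D2 f p a b ->
  locally_dst p (fun q => (Cmod (f q - f p) <= (Cmod a + Cmod b + 1) * dst p q)%R).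
Proof.
  intros H. specialize (H 1%R Rlt_0_1). revert H. apply locally_dst_imp. intros q Hq.
  replace (f q - f p) with
    ((f q - f p - (a * (fst q - fst p) + b * (snd q - snd p)))
     + (a * (fst q - fst p) + b * (snd q - snd p))) by ring.
  eapply Rle_trans; [apply Cmod_triangle|].
  pose proof (lin_bound a b p q). lra.
Qed.

Lemma D2_cont f p a b : D2 f p a b -> cont2 f p.
Proof.
  intros H e He. destruct (D2_lip _ _ _ _ H) as [r [Hr Hl]].
  set (K := (Cmod a + Cmod b + 1)%R) in *.
  assert (HK : (0 < K)%R)
    by (unfold K; pose proof (Cmod_ge_0 a); pose proof (Cmod_ge_0 b); lra).
  exists (Rmin r (e / K)). split.
  - apply Rmin_glb_lt; [easy|]. now apply Rdiv_lt_0_compat.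
  - intros q Hq. pose proof (Rmin_l r (e / K)). pose proof (Rmin_r r (e / K)).
    eapply Rle_lt_trans; [apply Hl; lra|].
    apply Rlt_le_trans with (K * (e / K))%R; [apply Rmult_lt_compat_l; lra|].
    right. field. lra.
Qed.

Lemma cont2_pair F g h p :
  cont2 F (g p, h p) -> cont2 g p -> cont2 h p -> cont2 (fun q => F (g q, h q)) p.
Proof.
  intros HF Hg Hh e He. destruct (HF e He) as [r [Hr H]].
  assert (Hr2 : (0 < r / 2)%R) by lra.
  pose proof (locally_dst_and _ _ _ (Hg _ Hr2) (Hh _ Hr2)) as L.
  revert L. apply locally_dst_imp. intros q [H1 H2]. apply H. unfold dst. simpl. lra.
Qed.

(** The chain rule, from which the rules for the algebraic operations follow: [F] is then the sum,
    the product or the inverse, a unary [F] ignoring its second coordinate. *)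
Lemma D2_pair F g h p A B a1 b1 a2 b2 :
  D2 F (g p, h p) A B -> D2 g p a1 b1 -> D2 h p a2 b2 ->
  D2 (fun q => F (g q, h q)) p (A * a1 + B * a2) (A * b1 + B * b2).
Proof.
  intros HF Hg Hh e He.
  set (K1 := (Cmod a1 + Cmod b1 + 1)%R). set (K2 := (Cmod a2 + Cmod b2 + 1)%R).
  assert (HK1 : (1 <= K1)%R)
    by (unfold K1; pose proof (Cmod_ge_0 a1); pose proof (Cmod_ge_0 b1); lra).
  assert (HK2 : (1 <= K2)%R)
    by (unfold K2; pose proof (Cmod_ge_0 a2); pose proof (Cmod_ge_0 b2); lra).
  pose proof (Cmod_ge_0 A) as HA. pose proof (Cmod_ge_0 B) as HB.
  (* Half of [e] goes to the remainder of [F], taken at a displacement of size at most [K1 + K2]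
     times the original one, and half to the remainders of [g] and [h], which get multiplied by [A]
     and [B]. *)
  assert (He1 : (0 < e / (2 * (K1 + K2)))%R) by (apply Rdiv_lt_0_compat; lra).
  assert (He2 : (0 < e / (2 * (Cmod A + Cmod B + 1)))%R) by (apply Rdiv_lt_0_compat; lra).
  destruct (HF _ He1) as [r [Hr H]].
  assert (Hr2 : (0 < r / 2)%R) by lra.
  pose proof (locally_dst_and _ _ _ (D2_cont _ _ _ _ Hg _ Hr2) (D2_cont _ _ _ _ Hh _ Hr2)) as L1.
  pose proof (locally_dst_and _ _ _ (Hg _ He2) (Hh _ He2)) as L2.
  pose proof (locally_dst_and _ _ _ (D2_lip _ _ _ _ Hg) (D2_lip _ _ _ _ Hh)) as L3.
  pose proof (locally_dst_and _ _ _ L1 (locally_dst_and _ _ _ L2 L3)) as L.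
  revert L. apply locally_dst_imp. clear L1 L2 L3.
  intros q [[C1 C2] [[G1 G2] [M1 M2]]].
  assert (HH := H (g q, h q)).
  unfold dst at 1 in HH. simpl in HH. specialize (HH ltac:(lra)).
  unfold dst in HH at 1; simpl in HH.
  fold K1 in M1. fold K2 in M2.
  set (d := dst p q) in *. assert (Hd : (0 <= d)%R) by apply dst_ge_0.
  set (x := fst q - fst p) in *. set (y := snd q - snd p) in *.
  set (R1 := g q - g p - (a1 * x + b1 * y)) in *.
  set (R2 := h q - h p - (a2 * x + b2 * y)) in *.
  set (T := F (g q, h q) - F (g p, h p) - (A * (g q - g p) + B * (h q - h p))) in *.
  replace (F (g q, h q) - F (g p, h p) - ((A * a1 + B * a2) * x + (A * b1 + B * b2) * y))
    with (T + (A * R1 + B * R2)) by (unfold T, R1, R2; ring).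
  eapply Rle_trans; [apply Cmod_triangle|].
  assert (B1 : (Cmod T <= e / 2 * d)%R).
  { eapply Rle_trans; [apply HH|].
    replace (e / 2 * d)%R with (e / (2 * (K1 + K2)) * (K1 * d + K2 * d))%R by (field; lra).
    apply Rmult_le_compat_l; lra. }
  assert (B2 : (Cmod (A * R1 + B * R2) <= e / 2 * d)%R).
  { eapply Rle_trans; [apply Cmod_triangle|]. rewrite !Cmod_mult.
    set (e2 := (e / (2 * (Cmod A + Cmod B + 1)))%R) in *.
    apply Rle_trans with ((Cmod A + Cmod B) * (e2 * d))%R; [nra|].
    replace (e / 2 * d)%R with ((Cmod A + Cmod B + 1) * (e2 * d))%R
      by (unfold e2; field; lra).
    apply Rmult_le_compat_r; [|lra]. apply Rmult_le_pos; lra. }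
  lra.
Qed.

Lemma D2_ext f g p a b :
  locally_dst p (fun q => f q = g q) -> D2 f p a b -> D2 g p a b.
Proof.
  intros L H e He. pose proof (locally_dst_self _ _ L) as E.
  pose proof (locally_dst_and _ _ _ L (H e He)) as L2.
  revert L2. apply locally_dst_imp. intros q [E1 H1]. now rewrite <- E1, <- E.
Qed.

Lemma D2_const (c : C) p : D2 (fun _ => c) p 0 0.
Proof.
  intros e He. exists 1%R. split; [lra|]. intros q _.
  replace (c - c - _) with (RtoC 0) by ring. rewrite Cmod_0.
  pose proof (dst_ge_0 p q). nra.
Qed.

Lemma D2_fst p : D2 fst p 1 0.
Proof.
  intros e He. exists 1%R. split; [lra|]. intros q _.
  replace (fst q - fst p - _) with (RtoC 0) by ring. rewrite Cmod_0.
  pose proof (dst_ge_0 p q). nra.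
Qed.

Lemma D2_snd p : D2 snd p 0 1.
Proof.
  intros e He. exists 1%R. split; [lra|]. intros q _.
  replace (snd q - snd p - _) with (RtoC 0) by ring. rewrite Cmod_0.
  pose proof (dst_ge_0 p q). nra.
Qed.

Lemma D2_add p : D2 (fun q => fst q + snd q) p 1 1.
Proof.
  intros e He. exists 1%R. split; [lra|]. intros q _.
  replace (fst q + snd q - _ - _) with (RtoC 0) by ring. rewrite Cmod_0.
  pose proof (dst_ge_0 p q). nra.
Qed.

Lemma D2_mul p : D2 (fun q => fst q * snd q) p (snd p) (fst p).
Proof.
  intros e He. exists e. split; [lra|]. intros q Hq.
  replace (fst q * snd q - _ - _) with ((fst q - fst p) * (snd q - snd p)) by ring.
  rewrite Cmod_mult. pose proof (dst_fst p q). pose proof (dst_snd p q).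
  pose proof (Cmod_ge_0 (fst q - fst p)). pose proof (Cmod_ge_0 (snd q - snd p)).
  pose proof (dst_ge_0 p q). nra.
Qed.

Lemma D2_opp_fst p : D2 (fun q => - fst q) p (- (1)) 0.
Proof.
  intros e He. exists 1%R. split; [lra|]. intros q _.
  replace (- fst q - _ - _) with (RtoC 0) by ring. rewrite Cmod_0.
  pose proof (dst_ge_0 p q). nra.
Qed.

Lemma D2_inv_fst (p : C * C) : fst p <> 0 -> D2 (fun q => / fst q) p (- / (fst p * fst p)) 0.
Proof.
  intros Hp e He. set (m := Cmod (fst p)).
  assert (Hm : (0 < m)%R) by now apply Cmod_gt_0.
  (* For an increment [h] at [a] the remainder is [h ^ 2 / (a ^ 2 (a + h))]. The first radius keeps
     [a + h] at modulus at least [m / 2], the second then bounds the quotient by [e] times the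
     distance. *)
  exists (Rmin (m / 2) (e * (m * m * m) / 2)). split.
  { apply Rmin_glb_lt; [lra|]. apply Rdiv_lt_0_compat; [|lra].
    repeat apply Rmult_lt_0_compat; lra. }
  intros q Hq.
  pose proof (Rmin_l (m / 2) (e * (m * m * m) / 2)) as M1.
  pose proof (Rmin_r (m / 2) (e * (m * m * m) / 2)) as M2.
  pose proof (dst_fst p q) as HF.
  assert (Hq1 : (m / 2 <= Cmod (fst q))%R).
  { unfold m. pose proof (Cmod_triangle_minus (fst q) (fst q - fst p)) as T.
    replace (fst q - (fst q - fst p)) with (fst p) in T by ring. fold m in T |- *. lra. }
  assert (Hq0 : fst q <> 0) by (apply Cmod_gt_0; lra).
  set (h := fst q - fst p) in *.
  replace (/ fst q - / fst p - (- / (fst p * fst p) * h + 0 * (snd q - snd p)))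
    with (h * h / (fst p * fst p * fst q)) by (unfold h; field; auto).
  rewrite Cmod_div by (repeat apply Cmult_neq_0; auto).
  rewrite !Cmod_mult. fold m.
  pose proof (Cmod_ge_0 h) as Hh. pose proof (dst_ge_0 p q) as Hd.
  assert (D : (0 < m * m * Cmod (fst q))%R) by (repeat apply Rmult_lt_0_compat; lra).
  apply Rle_div_l; [easy|].
  apply Rle_trans with (Cmod h * dst p q)%R; [nra|].
  replace (e * dst p q * (m * m * Cmod (fst q)))%R
    with ((e * (m * m * Cmod (fst q))) * dst p q)%R by ring.
  apply Rmult_le_compat_r; [easy|].
  apply Rle_trans with (e * (m * m * m) / 2)%R; [lra|].
  replace (e * (m * m * m) / 2)%R with (e * (m * m * (m / 2)))%R by field.
  apply Rmult_le_compat_l; [lra|]. apply Rmult_le_compat_l; nra.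
Qed.

Lemma D2_unique f p a b a' b' : D2 f p a b -> D2 f p a' b' -> a = a' /\ b = b'.
Proof.
  intros H H'.
  assert (G : forall u v : C, (Cmod u + Cmod v = 1)%R ->
              (a - a') * u + (b - b') * v = 0).
  { intros u v Huv. apply Cmod_eq_0.
    apply Rle_antisym; [|apply Cmod_ge_0]. apply le_epsilon. intros e He.
    assert (He2 : (0 < e / 2)%R) by lra.
    destruct (locally_dst_and _ _ _ (H _ He2) (H' _ He2)) as [r [Hr L]].
    set (t := RtoC (r / 2)).
    assert (Ht : Cmod t = (r / 2)%R) by (unfold t; rewrite Cmod_R; apply Rabs_pos_eq; lra).
    set (q := (fst p + t * u, snd p + t * v)).
    assert (E1 : fst q - fst p = t * u) by (simpl; ring).
    assert (E2 : snd q - snd p = t * v) by (simpl; ring).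
    assert (Dq : dst p q = (r / 2)%R).
    { unfold dst. rewrite E1, E2, !Cmod_mult, Ht.
      rewrite <- Rmult_plus_distr_l, Huv. ring. }
    destruct (L q) as [L1 L2]; [lra|]. rewrite E1, E2, Dq in L1, L2.
    set (X1 := f q - f p - (a * (t * u) + b * (t * v))) in *.
    set (X2 := f q - f p - (a' * (t * u) + b' * (t * v))) in *.
    assert (E : t * ((a - a') * u + (b - b') * v) = X2 - X1) by (unfold X1, X2; ring).
    apply (f_equal Cmod) in E. rewrite Cmod_mult, Ht in E.
    pose proof (Cmod_triangle_minus X2 X1) as T.
    apply Rmult_le_reg_l with (r / 2)%R; [lra|]. rewrite E.
    replace (r / 2 * (0 + e))%R with (e / 2 * (r / 2) + e / 2 * (r / 2))%R by field. lra. }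
  split.
  - assert (E := G 1 0). rewrite Cmod_1, Cmod_0 in E. specialize (E ltac:(lra)).
    replace a with ((a - a') * 1 + (b - b') * 0 + a') by ring. rewrite E. ring.
  - assert (E := G 0 1). rewrite Cmod_1, Cmod_0 in E. specialize (E ltac:(lra)).
    replace b with ((a - a') * 0 + (b - b') * 1 + b') by ring. rewrite E. ring.
Qed.

Lemma is_derive_C (f : C -> C) (z l : C) :
  is_derive f z l <->
  forall e, (0 < e)%R -> exists r, (0 < r)%R /\ forall y, (Cmod (y - z) < r)%R ->
    (Cmod (f y - f z - l * (y - z)) <= e * Cmod (y - z))%R.
Proof.
  split.
  - intros [_ H] e He. specialize (H z (fun P h => h) (mkposreal e He)).
    apply locally_C_AbsRing in H. destruct H as [r [Hr H]]. exists r. split; [easy|].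
    intros y Hy. specialize (H y Hy).
    change (Cmod (f y - f z - (y - z) * l) <= e * Cmod (y - z))%R in H.
    now rewrite (Cmult_comm l).
  - intros H. split; [apply is_linear_scal_l|].
    intros x Hx. apply (is_filter_lim_locally_unique (V := AbsRing_NormedModule C_AbsRing)) in Hx. subst x.
    intros e. apply locally_C_AbsRing. destruct (H e (cond_pos e)) as [r [Hr L]].
    exists r. split; [easy|]. intros y Hy. specialize (L y Hy).
    change (Cmod (f y - f z - (y - z) * l) <= e * Cmod (y - z))%R.
    now rewrite (Cmult_comm _ l).
Qed.

Lemma D2_is_derive_fst f p a b : D2 f p a b -> is_derive (fun t => f (t, snd p)) (fst p) a.
Proof.
  intros H. apply is_derive_C. intros e He. destruct (H e He) as [r [Hr L]].
  exists r. split; [easy|]. intros y Hy. specialize (L (y, snd p)).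
  unfold dst in L. simpl in L. rewrite Cmod_minus_0, Rplus_0_r in L. specialize (L Hy).
  replace (a * (y - fst p) + b * (snd p - snd p)) with (a * (y - fst p)) in L by ring.
  now rewrite <- surjective_pairing.
Qed.

Lemma D2_is_derive_snd f p a b : D2 f p a b -> is_derive (fun t => f (fst p, t)) (snd p) b.
Proof.
  intros H. apply is_derive_C. intros e He. destruct (H e He) as [r [Hr L]].
  exists r. split; [easy|]. intros y Hy. specialize (L (fst p, y)).
  unfold dst in L. simpl in L. rewrite Cmod_minus_0, Rplus_0_l in L. specialize (L Hy).
  replace (a * (fst p - fst p) + b * (y - snd p)) with (b * (y - snd p)) in L by ring.
  now rewrite <- surjective_pairing.
Qed.

Lemma is_derive_D2 (f : C -> C) (p : C * C) a :
  is_derive f (fst p) a <-> D2 (fun q => f (fst q)) p a 0.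
Proof.
  rewrite is_derive_C. split.
  - intros H e He. destruct (H e He) as [r [Hr L]]. exists r. split; [easy|].
    intros q Hq. pose proof (dst_fst p q) as D.
    replace (a * (fst q - fst p) + 0 * (snd q - snd p)) with (a * (fst q - fst p)) by ring.
    eapply Rle_trans; [apply L; lra|]. apply Rmult_le_compat_l; lra.
  - intros H e He. destruct (H e He) as [r [Hr L]]. exists r. split; [easy|].
    intros y Hy. specialize (L (y, snd p)). unfold dst in L. simpl in L.
    rewrite Cmod_minus_0, Rplus_0_r in L. specialize (L Hy).
    replace (a * (y - fst p) + 0 * (snd p - snd p)) with (a * (y - fst p)) in L by ring.
    easy.
Qed.

(** * Holomorphic functions of two variables *)

(** Equivalent to [analytic2_at], by [analytic2_hol2_iff] below, but stable under
    algebraic operations and composition without manipulating series. *)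
Definition hol2 (f : C * C -> C) (p : C * C) : Prop :=
  exists fx fy : C * C -> C,
    locally_dst p (fun q => D2 f q (fx q) (fy q) /\ cont2 fx q /\ cont2 fy q).

Lemma cont2_const c p : cont2 (fun _ => c) p.
Proof. eapply D2_cont, D2_const. Qed.

Lemma cont2_add f g p : cont2 f p -> cont2 g p -> cont2 (fun q => f q + g q) p.
Proof.
  intros Hf Hg. apply (cont2_pair (fun q => fst q + snd q) f g); auto.
  eapply D2_cont, D2_add.
Qed.

Lemma cont2_mul f g p : cont2 f p -> cont2 g p -> cont2 (fun q => f q * g q) p.
Proof.
  intros Hf Hg. apply (cont2_pair (fun q => fst q * snd q) f g); auto.
  eapply D2_cont, D2_mul.
Qed.

Lemma hol2_cont f p : hol2 f p -> cont2 f p.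
Proof.
  intros (fx & fy & H). apply locally_dst_self in H. destruct H as [H _].
  eapply D2_cont, H.
Qed.

Lemma hol2_D2 f p : hol2 f p -> exists a b, D2 f p a b.
Proof. intros (fx & fy & H). apply locally_dst_self in H. destruct H as [H _]. eauto. Qed.

Lemma hol2_open f p : hol2 f p -> locally_dst p (hol2 f).
Proof.
  intros (fx & fy & H). apply locally_dst_open in H. revert H. apply locally_dst_imp.
  intros q Hq. now exists fx, fy.
Qed.

Lemma hol2_ext f g p : locally_dst p (fun q => f q = g q) -> hol2 f p -> hol2 g p.
Proof.
  intros E (fx & fy & H). exists fx, fy.
  apply locally_dst_open in E. pose proof (locally_dst_and _ _ _ E H) as L.
  revert L. apply locally_dst_imp. intros q (E' & H1 & H2).
  split; [|easy]. now apply (D2_ext f).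
Qed.

Lemma hol2_pair F g h p :
  hol2 F (g p, h p) -> hol2 g p -> hol2 h p -> hol2 (fun q => F (g q, h q)) p.
Proof.
  intros (Fx & Fy & HF) Hg Hh. pose proof (hol2_cont _ _ Hg) as Cg.
  pose proof (hol2_cont _ _ Hh) as Ch.
  destruct Hg as (gx & gy & Hg), Hh as (hx & hy & Hh).
  exists (fun q => Fx (g q, h q) * gx q + Fy (g q, h q) * hx q),
    (fun q => Fx (g q, h q) * gy q + Fy (g q, h q) * hy q).
  destruct HF as [r [Hr HF]]. assert (Hr2 : (0 < r / 2)%R) by lra.
  pose proof (locally_dst_and _ _ _ (Cg _ Hr2) (Ch _ Hr2)) as L1.
  pose proof (locally_dst_and _ _ _ L1 (locally_dst_and _ _ _ Hg Hh)) as L.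
  revert L. apply locally_dst_imp. clear L1.
  intros q [[B1 B2] [(G1 & G2 & G3) (H1 & H2 & H3)]].
  destruct (HF (g q, h q)) as (F1 & F2 & F3).
  { unfold dst. simpl. lra. }
  split; [|split].
  - now apply D2_pair.
  - apply cont2_add; apply cont2_mul; auto; apply (cont2_pair _ g h);
    auto; eapply D2_cont; eauto.
  - apply cont2_add; apply cont2_mul; auto; apply (cont2_pair _ g h);
    auto; eapply D2_cont; eauto.
Qed.

Lemma hol2_const c p : hol2 (fun _ => c) p.
Proof.
  exists (fun _ => RtoC 0), (fun _ => RtoC 0). exists 1%R. split; [lra|]. intros q _.
  split; [apply D2_const|split; apply cont2_const].
Qed.

Lemma hol2_fst p : hol2 fst p.
Proof.
  exists (fun _ => RtoC 1), (fun _ => RtoC 0). exists 1%R. split; [lra|]. intros q _.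
  split; [apply D2_fst|split; apply cont2_const].
Qed.

Lemma hol2_snd p : hol2 snd p.
Proof.
  exists (fun _ => RtoC 0), (fun _ => RtoC 1). exists 1%R. split; [lra|]. intros q _.
  split; [apply D2_snd|split; apply cont2_const].
Qed.

Lemma hol2_add f g p : hol2 f p -> hol2 g p -> hol2 (fun q => f q + g q) p.
Proof.
  intros Hf Hg. apply (hol2_pair (fun q => fst q + snd q) f g); auto.
  exists (fun _ => RtoC 1), (fun _ => RtoC 1). exists 1%R. split; [lra|]. intros q _.
  split; [apply D2_add|split; apply cont2_const].
Qed.

Lemma hol2_mul f g p : hol2 f p -> hol2 g p -> hol2 (fun q => f q * g q) p.
Proof.
  intros Hf Hg. apply (hol2_pair (fun q => fst q * snd q) f g); auto.
  exists snd, fst. exists 1%R. split; [lra|]. intros q _.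
  split; [apply D2_mul|split; eapply D2_cont; [apply D2_snd|apply D2_fst]].
Qed.

Lemma hol2_opp f p : hol2 f p -> hol2 (fun q => - f q) p.
Proof.
  intros Hf. apply (hol2_ext (fun q => RtoC (-1) * f q)).
  - exists 1%R. split; [lra|]. intros q _. ring.
  - apply hol2_mul; [apply hol2_const|easy].
Qed.

Lemma hol2_sub f g p : hol2 f p -> hol2 g p -> hol2 (fun q => f q - g q) p.
Proof. intros Hf Hg. apply hol2_add; [easy|now apply hol2_opp]. Qed.

Lemma hol2_pow f n p : hol2 f p -> hol2 (fun q => f q ^ n) p.
Proof.
  intros Hf. induction n; simpl; [apply hol2_const|now apply hol2_mul].
Qed.

Lemma cont2_nz f p : cont2 f p -> f p <> 0 -> locally_dst p (fun q => f q <> 0).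
Proof.
  intros H N. apply Cmod_gt_0 in N. specialize (H _ N). revert H.
  apply locally_dst_imp. intros q Hq E. rewrite E in Hq.
  replace (0 - f p) with (- f p) in Hq by ring. rewrite Cmod_opp in Hq. lra.
Qed.

Lemma hol2_inv f p : hol2 f p -> f p <> 0 -> hol2 (fun q => / f q) p.
Proof.
  intros Hf N. apply (hol2_pair (fun q => / fst q) f (fun _ => RtoC 0));
    [|easy|apply hol2_const].
  exists (fun q => - / (fst q * fst q)), (fun _ => RtoC 0).
  assert (L := cont2_nz fst (f p, RtoC 0) (D2_cont _ _ _ _ (D2_fst _)) N).
  revert L. apply locally_dst_imp. intros q Hq.
  split; [|split; [|apply cont2_const]].
  - now apply D2_inv_fst.
  - assert (I : D2 (fun s => / fst s) q (- / (fst q * fst q)) 0) by now apply D2_inv_fst.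
    apply D2_cont in I.
    pose proof (cont2_mul _ _ _ (cont2_const (RtoC (-1)) q) (cont2_mul _ _ _ I I)) as Cn.
    intros e He. specialize (Cn e He).
    pose proof (cont2_nz fst q (D2_cont _ _ _ _ (D2_fst _)) Hq) as L.
    pose proof (locally_dst_and _ _ _ Cn L) as LL. revert LL. apply locally_dst_imp.
    intros s [H1 H2].
    replace (- / (fst s * fst s)) with (RtoC (-1) * (/ fst s * / fst s))
      by (field; auto).
    replace (- / (fst q * fst q)) with (RtoC (-1) * (/ fst q * / fst q))
      by (field; auto).
    easy.
Qed.

Lemma hol2_div f g p : hol2 f p -> hol2 g p -> g p <> 0 -> hol2 (fun q => f q / g q) p.
Proof. intros Hf Hg N. apply hol2_mul; [easy|now apply hol2_inv]. Qed.

(** [hol2] hides the partial derivatives behind an existential that depends on the base point.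
    Choosing them by [epsilon] gives global functions, as Cauchy's formula on a whole circle
    requires. *)
Definition dx (f : C * C -> C) (q : C * C) : C :=
  epsilon (inhabits (RtoC 0)) (fun a => exists b, D2 f q a b).

Definition dy (f : C * C -> C) (q : C * C) : C :=
  epsilon (inhabits (RtoC 0)) (fun b => exists a, D2 f q a b).

Lemma D2_dx_dy f q a b : D2 f q a b -> dx f q = a /\ dy f q = b.
Proof.
  intros H. split.
  - assert (E : exists b', D2 f q (dx f q) b').
    { apply (epsilon_spec (inhabits (RtoC 0)) (fun a => exists b, D2 f q a b)). eauto. }
    destruct E as [b' E]. now apply (D2_unique f q _ b' _ b).
  - assert (E : exists a', D2 f q a' (dy f q)).
    { apply (epsilon_spec (inhabits (RtoC 0)) (fun b => exists a, D2 f q a b)). eauto. }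
    destruct E as [a' E]. now apply (D2_unique f q a' _ a _).
Qed.

Lemma cont2_ext f g p : locally_dst p (fun q => f q = g q) -> cont2 f p -> cont2 g p.
Proof.
  intros L H e He. pose proof (locally_dst_self _ _ L) as E.
  generalize (locally_dst_and _ _ _ L (H e He)). apply locally_dst_imp.
  intros q [E1 H1]. now rewrite <- E1, <- E.
Qed.

Lemma hol2_partials f p : hol2 f p -> D2 f p (dx f p) (dy f p) /\ cont2 (dx f) p /\ cont2 (dy f) p.
Proof.
  intros (fx & fy & H).
  assert (E : locally_dst p (fun q => fx q = dx f q /\ fy q = dy f q)).
  { revert H. apply locally_dst_imp. intros q [H _].
    destruct (D2_dx_dy _ _ _ _ H). now split. }
  destruct (locally_dst_self _ _ H) as (H1 & H2 & H3).
  destruct (locally_dst_self _ _ E) as [E1 E2].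
  split; [now rewrite <- E1, <- E2|]. split.
  - apply (cont2_ext fx); [|easy]. revert E. apply locally_dst_imp. easy.
  - apply (cont2_ext fy); [|easy]. revert E. apply locally_dst_imp. easy.
Qed.

Lemma is_series_Cmod_le (u : nat -> C) (U : C) (b : nat -> R) (B : R) :
  is_series u U -> is_series b B -> (forall n, (Cmod (u n) <= b n)%R) -> (Cmod U <= B)%R.
Proof.
  intros Hu Hb H.
  assert (L : is_lim_seq (fun n => @norm _ C_NormedModule (sum_n u n)) (Cmod U)).
  { exact (filterlim_comp _ _ _ _ _ _ _ _ Hu (filterlim_norm (V := C_NormedModule) U)). }
  apply (is_lim_seq_le _ _ (Finite (Cmod U)) (Finite B)) with (3 := Hb) in L.
  - exact L.
  - intros n. eapply Rle_trans; [apply (norm_sum_n_m (V := C_NormedModule))|].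
    apply sum_n_m_le. intros k. apply H.
Qed.

Lemma ex_series_C (u : nat -> C) (b : nat -> R) :
  (forall n, (Cmod (u n) <= b n)%R) -> ex_series b -> exists U : C, is_series u U.
Proof.
  intros H Hb. apply (ex_series_le (V := C_CompleteNormedModule) u b); [|easy].
  intros n. apply H.
Qed.

(** Bernoulli's inequality absorbs the factor [n + 1], the number of monomials of degree [n], into
    the larger ratio [q'] halfway between [q] and 1. *)
Lemma ex_series_nq (c q : R) : (0 < q < 1)%R -> ex_series (fun n => (c * (INR (S n) * q ^ n))%R).
Proof.
  intros Hq. apply (ex_series_scal (V := R_NormedModule)).
  set (q' := ((1 + q) / 2)%R). set (e := (q' / q - 1)%R).
  assert (E : (q' = q * (1 + e))%R) by (unfold e; field; lra).
  assert (He : (0 < e)%R).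
  { unfold e. assert (1 < q' / q)%R; [|lra]. apply Rlt_div_r; unfold q'; lra. }
  apply (ex_series_le (V := R_CompleteNormedModule) _ (fun n => ((1 + / e) * q' ^ n)%R)).
  - intros n. change (Rabs (INR (S n) * q ^ n) <= (1 + / e) * q' ^ n)%R.
    assert (Q : (0 < q ^ n)%R) by (apply pow_lt; lra).
    rewrite Rabs_pos_eq by (apply Rmult_le_pos; [apply pos_INR|lra]).
    rewrite E, Rpow_mult_distr. pose proof (poly n e He) as P.
    rewrite S_INR. pose proof (pos_INR n) as N.
    replace ((1 + / e) * (q ^ n * (1 + e) ^ n))%R
      with (((1 + / e) * (1 + e) ^ n) * q ^ n)%R by ring.
    apply Rmult_le_compat_r; [lra|].
    apply Rle_trans with ((1 + / e) * (1 + INR n * e))%R.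
    + assert (I : (/ e * e = 1)%R) by (field; lra).
      assert (0 < / e)%R by now apply Rinv_0_lt_compat.
      replace ((1 + / e) * (1 + INR n * e))%R
        with (1 + / e + INR n * e + INR n * (/ e * e))%R by ring.
      rewrite I. assert (0 <= INR n * e)%R by (apply Rmult_le_pos; lra). lra.
    + apply Rmult_le_compat_l; [|easy].
      assert (0 < / e)%R by now apply Rinv_0_lt_compat. lra.
  - apply (ex_series_scal (V := R_NormedModule)). exists (/ (1 - q'))%R. apply is_series_geom.
    unfold q'. rewrite Rabs_pos_eq; lra.
Qed.

(** * Term-by-term differentiation *)

(** One summable sequence [b] dominates the derivatives, their Lipschitz constants and the quadratic
    Taylor remainders of the terms. Summing these bounds gives the same three bounds for the
    limit. *)
Lemma hol2_series (u ux uy : nat -> C * C -> C) (f : C * C -> C) (b : nat -> R) p r :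
  (0 < r)%R -> ex_series b ->
  (forall q, (dst p q < r)%R -> is_series (fun n => u n q) (f q)) ->
  (forall n q, (dst p q < r)%R -> (Cmod (ux n q) <= b n)%R /\ (Cmod (uy n q) <= b n)%R) ->
  (forall n q q', (dst p q < r)%R -> (dst p q' < r)%R ->
     (Cmod (ux n q' - ux n q) <= b n * dst q q')%R /\
     (Cmod (uy n q' - uy n q) <= b n * dst q q')%R /\
     (Cmod (u n q' - u n q - (ux n q * (fst q' - fst q) + uy n q * (snd q' - snd q)))
      <= b n * (dst q q' * dst q q'))%R) ->
  hol2 f p.
Proof.
  intros Hr [B HB] Hf Hb Hd.
  set (fx := fun q => epsilon (inhabits (RtoC 0)) (is_series (fun n => ux n q))).
  set (fy := fun q => epsilon (inhabits (RtoC 0)) (is_series (fun n => uy n q))).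
  assert (Sx : forall q, (dst p q < r)%R -> is_series (fun n => ux n q) (fx q)).
  { intros q Hq. unfold fx. apply epsilon_spec. apply ex_series_C with b.
    - intros n. now apply Hb.
    - now exists B. }
  assert (Sy : forall q, (dst p q < r)%R -> is_series (fun n => uy n q) (fy q)).
  { intros q Hq. unfold fy. apply epsilon_spec. apply ex_series_C with b.
    - intros n. now apply Hb.
    - now exists B. }
  assert (B0 : (0 <= B)%R).
  { assert (D : (dst p p < r)%R) by now rewrite dst_refl.
    eapply Rle_trans; [apply (Cmod_ge_0 (fx p))|].
    apply is_series_Cmod_le with (1 := Sx p D) (2 := HB). intros n. now apply Hb. }
  exists fx, fy.
  assert (O : locally_dst p (fun q => locally_dst q (fun q' => (dst p q' < r)%R))).
  { apply locally_dst_open. now exists r. }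
  revert O. apply locally_dst_imp. intros q O.
  assert (Hq := locally_dst_self _ _ O).
  destruct O as [r' [Hr' O]].
  (* Turns the quadratic bound [B d ^ 2] into [e d]. Dividing by [B + 1] avoids the case [B = 0]. *)
  assert (LIM : forall e, (0 < e)%R -> exists d, (0 < d)%R /\ (d <= r')%R /\ (B * d < e)%R).
  { intros e He. exists (Rmin r' (e / (B + 1))). split; [|split].
    - apply Rmin_glb_lt; [easy|]. apply Rdiv_lt_0_compat; lra.
    - apply Rmin_l.
    - apply Rle_lt_trans with (B * (e / (B + 1)))%R.
      + apply Rmult_le_compat_l; [easy|apply Rmin_r].
      + apply Rlt_le_trans with ((B + 1) * (e / (B + 1)))%R.
        * apply Rmult_lt_compat_r; [apply Rdiv_lt_0_compat|]; lra.
        * right. field. lra. }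
  split; [|split].
  - intros e He. destruct (LIM e He) as (d & Hd0 & Hd1 & Hd2). exists d. split; [easy|].
    intros q' Hq'. assert (Pq' : (dst p q' < r)%R) by (apply O; lra).
    set (h1 := fst q' - fst q). set (h2 := snd q' - snd q).
    assert (SS : is_series (fun n => u n q' - u n q - (ux n q * h1 + uy n q * h2))
                   (f q' - f q - (fx q * h1 + fy q * h2))).
    { apply (is_series_minus (V := C_NormedModule)).
      - apply (is_series_minus (V := C_NormedModule)); now apply Hf.
      - apply (is_series_plus (V := C_NormedModule)).
        + apply (is_series_ext (fun n => scal h1 (ux n q))).
          { intros n. change (h1 * ux n q = ux n q * h1). ring. }
          rewrite (Cmult_comm (fx q)). apply (is_series_scal (V := C_NormedModule)). now apply Sx.
        + apply (is_series_ext (fun n => scal h2 (uy n q))).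
          { intros n. change (h2 * uy n q = uy n q * h2). ring. }
          rewrite (Cmult_comm (fy q)). apply (is_series_scal (V := C_NormedModule)). now apply Sy. }
    pose proof (dst_ge_0 q q') as D0.
    apply Rle_trans with ((dst q q' * dst q q') * B)%R.
    + apply is_series_Cmod_le with (1 := SS)
        (b := fun n => ((dst q q' * dst q q') * b n)%R).
      * apply (is_series_scal (V := R_NormedModule)). exact HB.
      * intros n. rewrite Rmult_comm. now apply Hd.
    + replace (dst q q' * dst q q' * B)%R with ((B * dst q q') * dst q q')%R by ring.
      apply Rmult_le_compat_r; [easy|]. apply Rle_trans with (B * d)%R; [|lra].
      apply Rmult_le_compat_l; lra.
  - intros e He. destruct (LIM e He) as (d & Hd0 & Hd1 & Hd2). exists d. split; [easy|].
    intros q' Hq'. assert (Pq' : (dst p q' < r)%R) by (apply O; lra).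
    apply Rle_lt_trans with (dst q q' * B)%R.
    + eapply is_series_Cmod_le with (b := fun n => (dst q q' * b n)%R).
      * apply (is_series_minus (V := C_NormedModule)); now apply Sx.
      * apply (is_series_scal (V := R_NormedModule)). exact HB.
      * intros n. rewrite Rmult_comm. now apply Hd.
    + rewrite Rmult_comm. apply Rle_lt_trans with (B * d)%R; [|easy].
      apply Rmult_le_compat_l; lra.
  - intros e He. destruct (LIM e He) as (d & Hd0 & Hd1 & Hd2). exists d. split; [easy|].
    intros q' Hq'. assert (Pq' : (dst p q' < r)%R) by (apply O; lra).
    apply Rle_lt_trans with (dst q q' * B)%R.
    + eapply is_series_Cmod_le with (b := fun n => (dst q q' * b n)%R).
      * apply (is_series_minus (V := C_NormedModule)); now apply Sy.
      * apply (is_series_scal (V := R_NormedModule)). exact HB.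
      * intros n. rewrite Rmult_comm. now apply Hd.
    + rewrite Rmult_comm. apply Rle_lt_trans with (B * d)%R; [|easy].
      apply Rmult_le_compat_l; lra.
Qed.

(** The derivative [i x ^ (i - 1)] of [x ^ i], in the form given by the product rule, so that
    inductions need no predecessor. *)
Fixpoint dpow (x : C) (i : nat) : C :=
  match i with O => 0 | S i => x ^ i + x * dpow x i end.

Lemma Cmod_pow_le (x : C) rho i : (Cmod x <= rho)%R -> (Cmod (x ^ i) <= rho ^ i)%R.
Proof. intros H. rewrite Cmod_pow. apply pow_incr. split; [apply Cmod_ge_0|easy]. Qed.

Section PowerBounds.

(** Differentiating [x ^ i] on the disc of radius [rho] costs a factor [i]. The larger radius [rho']
    absorbs it at the price of one factor [K] per derivative; [H2], which says
    [K >= 1 / (rho' - rho)], is what closes each induction on [i]. *)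
Variables (rho rho' K : R).
Hypotheses (H0 : (0 <= rho)%R) (H1 : (rho <= rho')%R) (HK : (0 <= K)%R)
  (H2 : (1 + rho * K <= K * rho')%R).

Lemma dpow_bound x i : (Cmod x <= rho)%R -> (Cmod (dpow x i) <= K * rho' ^ i)%R.
Proof.
  intros Hx. induction i as [|i IH]; simpl.
  - rewrite Cmod_0. lra.
  - eapply Rle_trans; [apply Cmod_triangle|]. rewrite Cmod_mult.
    pose proof (Cmod_pow_le x rho i Hx). pose proof (pow_incr rho rho' i (conj H0 H1)).
    pose proof (pow_le rho' i ltac:(lra)). pose proof (Cmod_ge_0 x).
    pose proof (Cmod_ge_0 (dpow x i)).
    assert (Cmod x * Cmod (dpow x i) <= rho * (K * rho' ^ i))%R
      by (apply Rmult_le_compat; lra).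
    apply Rle_trans with ((1 + rho * K) * rho' ^ i)%R; [lra|].
    replace (K * (rho' * rho' ^ i))%R with ((K * rho') * rho' ^ i)%R by ring.
    now apply Rmult_le_compat_r.
Qed.

Lemma pow_lip x x' i : (Cmod x <= rho)%R -> (Cmod x' <= rho)%R ->
  (Cmod (x' ^ i - x ^ i) <= K * rho' ^ i * Cmod (x' - x))%R.
Proof.
  intros Hx Hx'. pose proof (Cmod_ge_0 (x' - x)) as D. set (d := Cmod (x' - x)) in *.
  induction i as [|i IH]; simpl.
  - rewrite Cmod_minus_0. nra.
  - replace (x' * x' ^ i - x * x ^ i) with (x' * (x' ^ i - x ^ i) + (x' - x) * x ^ i) by ring.
    eapply Rle_trans; [apply Cmod_triangle|]. rewrite !Cmod_mult. fold d.
    pose proof (Cmod_pow_le x rho i Hx) as A1.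
    pose proof (pow_incr rho rho' i (conj H0 H1)) as A2.
    pose proof (pow_le rho' i ltac:(lra)) as A3. pose proof (Cmod_ge_0 x').
    pose proof (Cmod_ge_0 (x' ^ i - x ^ i)).
    assert (A4 : (Cmod x' * Cmod (x' ^ i - x ^ i) <= rho * (K * rho' ^ i * d))%R)
      by (apply Rmult_le_compat; lra).
    assert (A5 : (d * Cmod (x ^ i) <= d * rho' ^ i)%R) by (apply Rmult_le_compat_l; lra).
    apply Rle_trans with ((1 + rho * K) * (rho' ^ i * d))%R; [lra|].
    replace (K * (rho' * rho' ^ i) * d)%R with ((K * rho') * (rho' ^ i * d))%R by ring.
    apply Rmult_le_compat_r; [|easy]. now apply Rmult_le_pos.
Qed.

Lemma pow_quad x x' i : (Cmod x <= rho)%R -> (Cmod x' <= rho)%R ->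
  (Cmod (x' ^ i - x ^ i - dpow x i * (x' - x)) <=
   K * K * rho' ^ i * (Cmod (x' - x) * Cmod (x' - x)))%R.
Proof.
  intros Hx Hx'. pose proof (Cmod_ge_0 (x' - x)) as D.
  induction i as [|i IH]; simpl.
  - replace (1 - 1 - 0 * (x' - x)) with (RtoC 0) by ring. rewrite Cmod_0.
    repeat apply Rmult_le_pos; lra.
  - pose proof (pow_lip x x' i Hx Hx') as L.
    replace (x' * x' ^ i - x * x ^ i - (x ^ i + x * dpow x i) * (x' - x)) with
      (x * (x' ^ i - x ^ i - dpow x i * (x' - x)) + (x' - x) * (x' ^ i - x ^ i)) by ring.
    eapply Rle_trans; [apply Cmod_triangle|]. rewrite !Cmod_mult.
    set (d := Cmod (x' - x)) in *. set (Q := Cmod (x' ^ i - x ^ i - dpow x i * (x' - x))) in *.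
    pose proof (pow_le rho' i ltac:(lra)) as A3. pose proof (Cmod_ge_0 x).
    assert (0 <= Q)%R by apply Cmod_ge_0.
    assert (A4 : (Cmod x * Q <= rho * (K * K * rho' ^ i * (d * d)))%R)
      by (apply Rmult_le_compat; lra).
    assert (A5 : (d * Cmod (x' ^ i - x ^ i) <= d * (K * rho' ^ i * d))%R)
      by (apply Rmult_le_compat_l; lra).
    apply Rle_trans with ((1 + rho * K) * (K * rho' ^ i * (d * d)))%R; [lra|].
    replace (K * K * (rho' * rho' ^ i) * (d * d))%R
      with ((K * rho') * (K * rho' ^ i * (d * d)))%R by ring.
    apply Rmult_le_compat_r; [|easy]. repeat apply Rmult_le_pos; lra.
Qed.

Lemma dpow_lip x x' i : (Cmod x <= rho)%R -> (Cmod x' <= rho)%R ->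
  (Cmod (dpow x' i - dpow x i) <= 2 * (K * K) * rho' ^ i * Cmod (x' - x))%R.
Proof.
  intros Hx Hx'. pose proof (Cmod_ge_0 (x' - x)) as D.
  induction i as [|i IH]; simpl.
  - rewrite Cmod_minus_0. repeat apply Rmult_le_pos; lra.
  - pose proof (pow_lip x x' i Hx Hx') as L. pose proof (dpow_bound x i Hx) as P.
    replace (x' ^ i + x' * dpow x' i - (x ^ i + x * dpow x i)) with
      ((x' ^ i - x ^ i) + (x' * (dpow x' i - dpow x i) + (x' - x) * dpow x i)) by ring.
    eapply Rle_trans; [apply Cmod_triangle|].
    eapply Rle_trans; [apply Rplus_le_compat_l, Cmod_triangle|]. rewrite !Cmod_mult.
    set (d := Cmod (x' - x)) in *. set (Q := Cmod (dpow x' i - dpow x i)) in *.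
    pose proof (pow_le rho' i ltac:(lra)) as A3. pose proof (Cmod_ge_0 x').
    assert (0 <= Q)%R by apply Cmod_ge_0.
    assert (A4 : (Cmod x' * Q <= rho * (2 * (K * K) * rho' ^ i * d))%R)
      by (apply Rmult_le_compat; lra).
    assert (A5 : (d * Cmod (dpow x i) <= d * (K * rho' ^ i))%R)
      by (apply Rmult_le_compat_l; lra).
    apply Rle_trans with ((1 + rho * K) * (2 * K * rho' ^ i * d))%R; [lra|].
    replace (2 * (K * K) * (rho' * rho' ^ i) * d)%R
      with ((K * rho') * (2 * K * rho' ^ i * d))%R by ring.
    apply Rmult_le_compat_r; [|easy]. repeat apply Rmult_le_pos; lra.
Qed.

End PowerBounds.

Lemma Cmod_sum_n_le (t : nat -> C) (B : R) n :
  (forall i, (i <= n)%nat -> (Cmod (t i) <= B)%R) -> (Cmod (sum_n t n) <= INR (S n) * B)%R.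
Proof.
  induction n as [|n IH]; intros H.
  - rewrite sum_O. simpl. rewrite Rmult_1_l. now apply H.
  - rewrite sum_Sn. eapply Rle_trans; [apply Cmod_triangle|].
    rewrite (S_INR (S n)). specialize (IH ltac:(auto)). specialize (H (S n) (le_n _)). lra.
Qed.

Lemma sum_n_minus_C (u v : nat -> C) n :
  sum_n u n - sum_n v n = sum_n (fun i => u i - v i) n.
Proof.
  induction n as [|n IH].
  - now rewrite !sum_O.
  - rewrite !sum_Sn, <- IH. unfold plus; simpl. ring.
Qed.

Lemma sum_n_scal_C (u : nat -> C) c n : sum_n u n * c = sum_n (fun i => u i * c) n.
Proof.
  induction n as [|n IH].
  - now rewrite !sum_O.
  - rewrite !sum_Sn, <- IH. unfold plus; simpl. ring.
Qed.

Lemma sum_n_plus_C (u v : nat -> C) n :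
  sum_n u n + sum_n v n = sum_n (fun i => u i + v i) n.
Proof.
  induction n as [|n IH].
  - now rewrite !sum_O.
  - rewrite !sum_Sn, <- IH. unfold plus; simpl. ring.
Qed.

Lemma analytic2_hol2 f p : analytic2_at f p -> hol2 f p.
Proof.
  intros (a & r & M & Hr & HM & Hf).
  (* [K] is [1 / (rho' - rho)], and passing from [r] to [rho'] leaves a factor [(1 / 2) ^ n] on the
     terms of degree [n]. *)
  set (rho := (r / 4)%R). set (rho' := (r / 2)%R). set (K := (4 / r)%R).
  assert (HK : (0 < K)%R) by (apply Rdiv_lt_0_compat; lra).
  assert (H2 : (1 + rho * K <= K * rho')%R) by (right; unfold rho, rho', K; field; lra).
  assert (H0 : (0 <= rho)%R) by (unfold rho; lra).
  assert (H1 : (rho <= rho')%R) by (unfold rho, rho'; lra).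
  assert (HK' := Rlt_le _ _ HK).
  assert (A : forall n i, (i <= n)%nat ->
            (Cmod (a i (n - i)%nat) * (rho' ^ i * rho' ^ (n - i)) <= M * (1 / 2) ^ n)%R).
  { intros n i Hi. specialize (HM i (n - i)%nat).
    rewrite <- pow_add. replace (i + (n - i))%nat with n in * by lia.
    replace rho' with (r * (1 / 2))%R by (unfold rho'; field).
    rewrite Rpow_mult_distr, <- Rmult_assoc. apply Rmult_le_compat_r; [|easy].
    apply pow_le. lra. }
  assert (M0 : (0 <= M)%R).
  { eapply Rle_trans; [|apply (HM O O)]. simpl. rewrite Rmult_1_r. apply Cmod_ge_0. }
  (* [K] bounds the partial derivatives; [3 K ^ 2] bounds both their Lipschitz constants, as
     [2 K ^ 2 + K ^ 2], and the Taylor remainder, a sum of three terms. *)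
  set (c := (M * (K + 3 * (K * K)))%R).
  assert (KK : (0 <= K * K)%R) by now apply Rmult_le_pos.
  assert (c1 : forall n, (M * (1 / 2) ^ n * K <= c * (1 / 2) ^ n)%R).
  { intros n. unfold c. assert (0 <= (1 / 2) ^ n)%R by (apply pow_le; lra).
    assert (0 <= M * (1 / 2) ^ n)%R by now apply Rmult_le_pos.
    assert (0 <= M * (1 / 2) ^ n * (K * K))%R by now apply Rmult_le_pos. lra. }
  assert (c2 : forall n, (M * (1 / 2) ^ n * (3 * (K * K)) <= c * (1 / 2) ^ n)%R).
  { intros n. unfold c. assert (0 <= (1 / 2) ^ n)%R by (apply pow_le; lra).
    assert (0 <= M * (1 / 2) ^ n)%R by now apply Rmult_le_pos.
    assert (0 <= M * (1 / 2) ^ n * K)%R by now apply Rmult_le_pos. lra. }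
  assert (TB : forall n i (T : C) X Y, (i <= n)%nat -> (0 <= X)%R ->
     (Cmod T <= rho' ^ i * rho' ^ (n - i) * X)%R ->
     (M * (1 / 2) ^ n * X <= Y)%R -> (Cmod (a i (n - i)%nat * T) <= Y)%R).
  { intros n i T X Y Hi HX HT HY. rewrite Cmod_mult.
    eapply Rle_trans; [apply Rmult_le_compat_l; [apply Cmod_ge_0|apply HT]|].
    rewrite <- Rmult_assoc. eapply Rle_trans; [|apply HY].
    apply Rmult_le_compat_r; [easy|]. now apply A. }
  assert (P' : forall i, (0 <= rho' ^ i)%R) by (intros; apply pow_le; lra).
  assert (Pb := dpow_bound rho rho' K H0 H1 HK' H2).
  assert (Xl := pow_lip rho rho' K H0 H1 HK' H2).
  assert (Xq := pow_quad rho rho' K H0 H1 HK' H2).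
  assert (Pl := dpow_lip rho rho' K H0 H1 HK' H2).
  assert (Xb : forall x i, (Cmod x <= rho)%R -> (Cmod (x ^ i) <= rho' ^ i)%R).
  { intros x i Hx. apply Cmod_pow_le. lra. }
  assert (F1 : forall q, (dst p q < rho)%R -> (Cmod (fst q - fst p) <= rho)%R)
    by (intros q Hq; pose proof (dst_fst p q); lra).
  assert (F2 : forall q, (dst p q < rho)%R -> (Cmod (snd q - snd p) <= rho)%R)
    by (intros q Hq; pose proof (dst_snd p q); lra).
  apply (hol2_series
    (fun n q => sum_n (fun i => a i (n - i)%nat * (fst q - fst p) ^ i * (snd q - snd p) ^ (n - i)) n)
    (fun n q => sum_n (fun i => a i (n - i)%nat * (dpow (fst q - fst p) i * (snd q - snd p) ^ (n - i))) n)
    (fun n q => sum_n (fun i => a i (n - i)%nat * ((fst q - fst p) ^ i * dpow (snd q - snd p) (n - i))) n)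
    f (fun n => (c * (INR (S n) * (1 / 2) ^ n))%R) p rho).
  - unfold rho. lra.
  - apply ex_series_nq. lra.
  - intros q Hq. specialize (F1 q Hq). specialize (F2 q Hq).
    rewrite (surjective_pairing q). apply Hf; simpl; unfold rho in *; lra.
  - intros n q Hq. specialize (F1 q Hq). specialize (F2 q Hq).
    replace (c * (INR (S n) * (1 / 2) ^ n))%R with (INR (S n) * (c * (1 / 2) ^ n))%R by ring.
    split; apply Cmod_sum_n_le; intros i Hi; apply TB with (X := K); auto; rewrite Cmod_mult.
    + replace (rho' ^ i * rho' ^ (n - i) * K)%R with ((K * rho' ^ i) * rho' ^ (n - i))%R by ring.
      apply Rmult_le_compat; try apply Cmod_ge_0; auto.
    + replace (rho' ^ i * rho' ^ (n - i) * K)%R with (rho' ^ i * (K * rho' ^ (n - i)))%R by ring.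
      apply Rmult_le_compat; try apply Cmod_ge_0; auto.
  - intros n q q' Hq Hq'.
    assert (X1 := F1 q Hq). assert (Y1 := F2 q Hq).
    assert (X2 := F1 q' Hq'). assert (Y2 := F2 q' Hq').
    set (x := fst q - fst p) in *. set (y := snd q - snd p) in *.
    set (x' := fst q' - fst p) in *. set (y' := snd q' - snd p) in *.
    assert (Ex : fst q' - fst q = x' - x) by (unfold x, x'; ring).
    assert (Ey : snd q' - snd q = y' - y) by (unfold y, y'; ring).
    assert (D : dst q q' = (Cmod (x' - x) + Cmod (y' - y))%R) by (unfold dst; now rewrite Ex, Ey).
    rewrite Ex, Ey, D. clear Ex Ey D.
    set (d1 := Cmod (x' - x)). set (d2 := Cmod (y' - y)).
    assert (D1 : (0 <= d1)%R) by apply Cmod_ge_0. assert (D2 : (0 <= d2)%R) by apply Cmod_ge_0.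
    set (w := (d1 + d2)%R). assert (W : (0 <= w)%R) by (unfold w; lra).
    replace (c * (INR (S n) * (1 / 2) ^ n) * w)%R
      with (INR (S n) * ((c * (1 / 2) ^ n) * w))%R by ring.
    replace (c * (INR (S n) * (1 / 2) ^ n) * (w * w))%R
      with (INR (S n) * ((c * (1 / 2) ^ n) * (w * w)))%R by ring.
    assert (K3 : (0 <= 3 * (K * K))%R) by lra.
    assert (G1 : (M * (1 / 2) ^ n * (3 * (K * K) * w) <= c * (1 / 2) ^ n * w)%R).
    { rewrite <- Rmult_assoc. now apply Rmult_le_compat_r. }
    assert (G2 : (M * (1 / 2) ^ n * (3 * (K * K) * (w * w)) <= c * (1 / 2) ^ n * (w * w))%R).
    { rewrite <- Rmult_assoc. apply Rmult_le_compat_r; [now apply Rmult_le_pos|easy]. }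
    split; [|split].
    + rewrite sum_n_minus_C. apply Cmod_sum_n_le. intros i Hi.
      replace (a i (n - i)%nat * (dpow x' i * y' ^ (n - i)) - a i (n - i)%nat * (dpow x i * y ^ (n - i)))
        with (a i (n - i)%nat * ((dpow x' i - dpow x i) * y' ^ (n - i)
              + dpow x i * (y' ^ (n - i) - y ^ (n - i)))) by ring.
      apply TB with (X := (3 * (K * K) * w)%R); [easy|now apply Rmult_le_pos| |easy].
      eapply Rle_trans; [apply Cmod_triangle|]. rewrite !Cmod_mult.
      set (Z := (rho' ^ i * rho' ^ (n - i))%R).
      assert (HZ : (0 <= Z)%R) by (apply Rmult_le_pos; auto).
      assert (T1 : (Cmod (dpow x' i - dpow x i) * Cmod (y' ^ (n - i)) <= 2 * (K * K) * rho' ^ i * d1 * rho' ^ (n - i))%R)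
        by (apply Rmult_le_compat; try apply Cmod_ge_0; auto; now apply Pl).
      assert (T2 : (Cmod (dpow x i) * Cmod (y' ^ (n - i) - y ^ (n - i)) <= K * rho' ^ i * (K * rho' ^ (n - i) * d2))%R)
        by (apply Rmult_le_compat; try apply Cmod_ge_0; auto; now apply Xl).
      assert (T3 : (0 <= Z * (K * K) * d1)%R) by (apply Rmult_le_pos; [apply Rmult_le_pos|]; auto).
      assert (T4 : (0 <= Z * (K * K) * d2)%R) by (apply Rmult_le_pos; [apply Rmult_le_pos|]; auto).
      unfold w, Z in *. nra.
    + rewrite sum_n_minus_C. apply Cmod_sum_n_le. intros i Hi.
      replace (a i (n - i)%nat * (x' ^ i * dpow y' (n - i)) - a i (n - i)%nat * (x ^ i * dpow y (n - i)))
        with (a i (n - i)%nat * (x' ^ i * (dpow y' (n - i) - dpow y (n - i))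
              + (x' ^ i - x ^ i) * dpow y (n - i))) by ring.
      apply TB with (X := (3 * (K * K) * w)%R); [easy|now apply Rmult_le_pos| |easy].
      eapply Rle_trans; [apply Cmod_triangle|]. rewrite !Cmod_mult.
      set (Z := (rho' ^ i * rho' ^ (n - i))%R).
      assert (HZ : (0 <= Z)%R) by (apply Rmult_le_pos; auto).
      assert (T1 : (Cmod (x' ^ i) * Cmod (dpow y' (n - i) - dpow y (n - i)) <= rho' ^ i * (2 * (K * K) * rho' ^ (n - i) * d2))%R)
        by (apply Rmult_le_compat; try apply Cmod_ge_0; auto; now apply Pl).
      assert (T2 : (Cmod (x' ^ i - x ^ i) * Cmod (dpow y (n - i)) <= K * rho' ^ i * d1 * (K * rho' ^ (n - i)))%R)
        by (apply Rmult_le_compat; try apply Cmod_ge_0; auto; now apply Xl).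
      assert (T3 : (0 <= Z * (K * K) * d1)%R) by (apply Rmult_le_pos; [apply Rmult_le_pos|]; auto).
      assert (T4 : (0 <= Z * (K * K) * d2)%R) by (apply Rmult_le_pos; [apply Rmult_le_pos|]; auto).
      unfold w, Z in *. nra.
    + rewrite !sum_n_scal_C, sum_n_plus_C, !sum_n_minus_C. apply Cmod_sum_n_le. intros i Hi.
      (* The Taylor remainder of [x ^ i y ^ j] splits into a quadratic remainder in [x], a product
         of two increments and a quadratic remainder in [y]. *)
      match goal with |- (Cmod ?t <= _)%R => replace t with
        (a i (n - i)%nat * ((x' ^ i - x ^ i - dpow x i * (x' - x)) * y' ^ (n - i)
          + (dpow x i * (x' - x) * (y' ^ (n - i) - y ^ (n - i))
          + x ^ i * (y' ^ (n - i) - y ^ (n - i) - dpow y (n - i) * (y' - y))))) by ring end.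
      apply TB with (X := (3 * (K * K) * (w * w))%R);
        [easy|apply Rmult_le_pos; [easy|now apply Rmult_le_pos]| |easy].
      eapply Rle_trans; [apply Cmod_triangle|].
      eapply Rle_trans; [apply Rplus_le_compat_l, Cmod_triangle|]. rewrite !Cmod_mult.
      set (Z := (rho' ^ i * rho' ^ (n - i))%R). fold d1.
      assert (HZ : (0 <= Z)%R) by (apply Rmult_le_pos; auto).
      assert (T1 : (Cmod (x' ^ i - x ^ i - dpow x i * (x' - x)) * Cmod (y' ^ (n - i)) <= K * K * rho' ^ i * (d1 * d1) * rho' ^ (n - i))%R)
        by (apply Rmult_le_compat; try apply Cmod_ge_0; auto; now apply Xq).
      assert (T2 : (Cmod (dpow x i) * d1 * Cmod (y' ^ (n - i) - y ^ (n - i)) <= K * rho' ^ i * d1 * (K * rho' ^ (n - i) * d2))%R).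
      { apply Rmult_le_compat.
        - apply Rmult_le_pos; auto. apply Cmod_ge_0.
        - apply Cmod_ge_0.
        - apply Rmult_le_compat_r; auto.
        - now apply Xl. }
      assert (T3 : (Cmod (x ^ i) * Cmod (y' ^ (n - i) - y ^ (n - i) - dpow y (n - i) * (y' - y)) <= rho' ^ i * (K * K * rho' ^ (n - i) * (d2 * d2)))%R)
        by (apply Rmult_le_compat; try apply Cmod_ge_0; auto; now apply Xq).
      assert (T4 : (0 <= Z * (K * K))%R) by (apply Rmult_le_pos; auto).
      assert (T5 : (d1 * d1 + d1 * d2 + d2 * d2 <= 3 * (w * w))%R) by (unfold w; nra).
      apply (Rmult_le_compat_l _ _ _ T4) in T5. unfold Z in *. nra.
Qed.

(** * Complex limits along a filter *)

(** One set of limit rules for neighbourhoods, punctured neighbourhoods, sequences and one-sided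
    limits alike. *)
Definition Clim {T : Type} (F : (T -> Prop) -> Prop) (f : T -> C) (l : C) : Prop :=
  forall e, (0 < e)%R -> F (fun t => (Cmod (f t - l) < e)%R).

Section Clim.

Context {T : Type} {F : (T -> Prop) -> Prop} {FF : Filter F}.

Lemma Clim_pair (Phi : C * C -> C) g h l m :
  cont2 Phi (l, m) -> Clim F g l -> Clim F h m ->
  Clim F (fun t => Phi (g t, h t)) (Phi (l, m)).
Proof.
  intros HP Hg Hh e He. destruct (HP e He) as [r [Hr H]].
  assert (Hr2 : (0 < r / 2)%R) by lra.
  generalize (filter_and _ _ (Hg _ Hr2) (Hh _ Hr2)). apply filter_imp.
  intros t [H1 H2]. apply H. unfold dst. simpl. lra.
Qed.

Lemma Clim_const (c : C) : Clim F (fun _ => c) c.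
Proof.
  intros e He. apply filter_forall. intros t. now rewrite Cmod_minus_0.
Qed.

Lemma Clim_add g h l m : Clim F g l -> Clim F h m -> Clim F (fun t => g t + h t) (l + m).
Proof.
  intros Hg Hh. apply (Clim_pair (fun q => fst q + snd q) g h l m); auto.
  eapply D2_cont, D2_add.
Qed.

Lemma Clim_mul g h l m : Clim F g l -> Clim F h m -> Clim F (fun t => g t * h t) (l * m).
Proof.
  intros Hg Hh. apply (Clim_pair (fun q => fst q * snd q) g h l m); auto.
  eapply D2_cont, D2_mul.
Qed.

Lemma Clim_ext_eq g h l m : F (fun t => g t = h t) -> l = m -> Clim F g l -> Clim F h m.
Proof.
  intros E <- H e He. generalize (filter_and _ _ E (H e He)). apply filter_imp.
  now intros t [<- Ht].
Qed.

Lemma Clim_opp g l : Clim F g l -> Clim F (fun t => - g t) (- l).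
Proof.
  intros H. apply (Clim_ext_eq (fun t => RtoC (-1) * g t) _ (RtoC (-1) * l)).
  - apply filter_forall. intros t. ring.
  - simpl; ring.
  - apply Clim_mul; [apply Clim_const|easy].
Qed.

Lemma Clim_sub g h l m : Clim F g l -> Clim F h m -> Clim F (fun t => g t - h t) (l - m).
Proof. intros Hg Hh. apply Clim_add; [easy|now apply Clim_opp]. Qed.

Lemma Clim_pow g l n : Clim F g l -> Clim F (fun t => g t ^ n) (l ^ n).
Proof. intros H. induction n; simpl; [apply Clim_const|now apply Clim_mul]. Qed.

Lemma Clim_inv g l : Clim F g l -> l <> 0 -> Clim F (fun t => / g t) (/ l).
Proof.
  intros H N. apply (Clim_pair (fun q => / fst q) g (fun _ => RtoC 0) l 0); auto.
  - eapply D2_cont, D2_inv_fst. easy.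
  - apply Clim_const.
Qed.

Lemma Clim_div g h l m :
  Clim F g l -> Clim F h m -> m <> 0 -> Clim F (fun t => g t / h t) (l / m).
Proof. intros Hg Hh N. apply Clim_mul; [easy|now apply Clim_inv]. Qed.

Lemma Clim_nz g l : Clim F g l -> l <> 0 -> F (fun t => g t <> 0).
Proof.
  intros H N. apply Cmod_gt_0 in N. generalize (H _ N). apply filter_imp.
  intros t Ht E. rewrite E in Ht. replace (0 - l) with (- l) in Ht by ring.
  rewrite Cmod_opp in Ht. lra.
Qed.

End Clim.

Lemma Clim_unique {T} {F : (T -> Prop) -> Prop} {FF : ProperFilter F} g l m :
  Clim F g l -> Clim F g m -> l = m.
Proof.
  intros H1 H2. apply NNPP. intros N.
  assert (P : (0 < Cmod (l - m) / 2)%R).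
  { assert (0 < Cmod (l - m))%R; [|lra]. apply Cmod_gt_0. intros E. apply N.
    replace l with (l - m + m) by ring. rewrite E. ring. }
  destruct (filter_ex _ (filter_and _ _ (H1 _ P) (H2 _ P))) as [t [A B]].
  pose proof (Cmod_triangle_3 l (g t) m). rewrite (Cmod_minus_sym l (g t)) in H. lra.
Qed.

Lemma Clim_cont2 {T} {F : (T -> Prop) -> Prop} {FF : Filter F} Phi (g h : T -> C) p :
  cont2 Phi p -> Clim F g (fst p) -> Clim F h (snd p) ->
  Clim F (fun t => Phi (g t, h t)) (Phi p).
Proof. destruct p. apply Clim_pair. Qed.

(** * Curves and integrals *)

(** The velocity of a curve with real parameter. Its real and imaginary parts are ordinary
    derivatives, to which real integration and the mean value theorem apply. *)
Definition dR (c : R -> C) (t : R) (l : C) : Prop :=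
  forall e, (0 < e)%R -> exists r, (0 < r)%R /\ forall s, (Rabs (s - t) < r)%R ->
    (Cmod (c s - c t - l * RtoC (s - t)) <= e * Rabs (s - t))%R.

Lemma Re_le_Cmod (z : C) : (Rabs (Re z) <= Cmod z)%R.
Proof. apply re_le_Cmod. Qed.

Lemma Im_le_Cmod (z : C) : (Rabs (Im z) <= Cmod z)%R.
Proof. eapply Rle_trans; [apply Rmax_r|apply Rmax_Cmod]. Qed.

Lemma Cmod_le_ReIm (z : C) : (Cmod z <= Rabs (Re z) + Rabs (Im z))%R.
Proof.
  replace z with (RtoC (Re z) + Ci * RtoC (Im z)) at 1.
  - eapply Rle_trans; [apply Cmod_triangle|].
    rewrite Cmod_mult, Cmod_Ci, !Cmod_R. lra.
  - destruct z as [a b]. unfold Ci, RtoC, Cplus, Cmult, Re, Im. simpl. f_equal; ring.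
Qed.

Lemma is_derive_R (f : R -> R) (t l : R) :
  is_derive f t l <->
  forall e, (0 < e)%R -> exists r, (0 < r)%R /\ forall s, (Rabs (s - t) < r)%R ->
    (Rabs (f s - f t - l * (s - t)) <= e * Rabs (s - t))%R.
Proof.
  split.
  - intros [_ H] e He. specialize (H t (fun P h => h) (mkposreal e He)).
    destruct H as [r H]. exists r. split; [apply cond_pos|]. intros s Hs.
    specialize (H s Hs). rewrite (Rmult_comm l). exact H.
  - intros H. split; [apply is_linear_scal_l|].
    intros x Hx. apply (is_filter_lim_locally_unique (V := AbsRing_NormedModule R_AbsRing)) in Hx.
    subst x. intros e. destruct (H e (cond_pos e)) as [r [Hr L]].
    exists (mkposreal _ Hr). intros s Hs. specialize (L s Hs). rewrite (Rmult_comm l) in L.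
    exact L.
Qed.

Lemma dR_Re c t l : dR c t l -> is_derive (fun s => Re (c s)) t (Re l).
Proof.
  intros H. apply is_derive_R. intros e He. destruct (H e He) as [r [Hr L]].
  exists r. split; [easy|]. intros s Hs. eapply Rle_trans; [|apply L, Hs].
  eapply Rle_trans; [|apply Re_le_Cmod]. right. f_equal.
  unfold Re, RtoC, Cminus, Cplus, Cmult, Copp. simpl. ring.
Qed.

Lemma dR_Im c t l : dR c t l -> is_derive (fun s => Im (c s)) t (Im l).
Proof.
  intros H. apply is_derive_R. intros e He. destruct (H e He) as [r [Hr L]].
  exists r. split; [easy|]. intros s Hs. eapply Rle_trans; [|apply L, Hs].
  eapply Rle_trans; [|apply Im_le_Cmod]. right. f_equal.
  unfold Im, RtoC, Cminus, Cplus, Cmult, Copp. simpl. ring.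
Qed.

Lemma dR_ReIm (c : R -> C) t (l : C) :
  is_derive (fun s => Re (c s)) t (Re l) -> is_derive (fun s => Im (c s)) t (Im l) -> dR c t l.
Proof.
  intros H1 H2 e He. rewrite is_derive_R in H1, H2.
  assert (He2 : (0 < e / 2)%R) by lra.
  destruct (H1 _ He2) as [r1 [R1 L1]], (H2 _ He2) as [r2 [R2 L2]].
  exists (Rmin r1 r2). split; [now apply Rmin_glb_lt|]. intros s Hs.
  pose proof (Rmin_l r1 r2). pose proof (Rmin_r r1 r2).
  specialize (L1 s ltac:(lra)). specialize (L2 s ltac:(lra)).
  eapply Rle_trans; [apply Cmod_le_ReIm|].
  replace (Re (c s - c t - l * RtoC (s - t))) with (Re (c s) - Re (c t) - Re l * (s - t))%R
    by (unfold Re, Im, RtoC, Cminus, Cplus, Cmult, Copp; simpl; ring).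
  replace (Im (c s - c t - l * RtoC (s - t))) with (Im (c s) - Im (c t) - Im l * (s - t))%R
    by (unfold Re, Im, RtoC, Cminus, Cplus, Cmult, Copp; simpl; ring).
  lra.
Qed.

Lemma dR_lip c t l : dR c t l ->
  exists r, (0 < r)%R /\ forall s, (Rabs (s - t) < r)%R ->
    (Cmod (c s - c t) <= (Cmod l + 1) * Rabs (s - t))%R.
Proof.
  intros H. destruct (H 1%R Rlt_0_1) as [r [Hr L]]. exists r. split; [easy|].
  intros s Hs. specialize (L s Hs).
  replace (c s - c t) with ((c s - c t - l * RtoC (s - t)) + l * RtoC (s - t)) by ring.
  eapply Rle_trans; [apply Cmod_triangle|]. rewrite Cmod_mult, Cmod_R. lra.
Qed.

Lemma dR_Clim c t l : dR c t l -> Clim (locally t) c (c t).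
Proof.
  intros H e He. destruct (dR_lip c t l H) as [r [Hr L]].
  set (K := (Cmod l + 1)%R). assert (HK : (0 < K)%R)
    by (unfold K; pose proof (Cmod_ge_0 l); lra).
  assert (P : (0 < Rmin r (e / K))%R).
  { apply Rmin_glb_lt; [easy|]. now apply Rdiv_lt_0_compat. }
  exists (mkposreal _ P). intros s Hs. change (Rabs (s - t) < Rmin r (e / K))%R in Hs.
  pose proof (Rmin_l r (e / K)). pose proof (Rmin_r r (e / K)).
  eapply Rle_lt_trans; [apply L; lra|]. fold K.
  apply Rlt_le_trans with (K * (e / K))%R; [apply Rmult_lt_compat_l; lra|].
  right. field. lra.
Qed.

Lemma dR_pair F g h t A B l m :
  D2 F (g t, h t) A B -> dR g t l -> dR h t m ->
  dR (fun s => F (g s, h s)) t (A * l + B * m).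
Proof.
  intros HF Hg Hh e He.
  pose proof (Cmod_ge_0 A) as HA. pose proof (Cmod_ge_0 B) as HB.
  set (K := (Cmod l + Cmod m + 2)%R).
  assert (HK : (0 < K)%R) by (unfold K; pose proof (Cmod_ge_0 l); pose proof (Cmod_ge_0 m); lra).
  assert (He1 : (0 < e / (2 * K))%R) by (apply Rdiv_lt_0_compat; lra).
  assert (He2 : (0 < e / (2 * (Cmod A + Cmod B + 1)))%R) by (apply Rdiv_lt_0_compat; lra).
  destruct (HF _ He1) as [r [Hr H]].
  destruct (dR_lip _ _ _ Hg) as (r1 & Hr1 & L1). destruct (dR_lip _ _ _ Hh) as (r2 & Hr2 & L2).
  destruct (Hg _ He2) as (r3 & Hr3 & L3). destruct (Hh _ He2) as (r4 & Hr4 & L4).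
  exists (Rmin (r / K) (Rmin (Rmin r1 r2) (Rmin r3 r4))). split.
  { repeat apply Rmin_glb_lt; auto. now apply Rdiv_lt_0_compat. }
  intros s Hs.
  pose proof (Rmin_l (r / K) (Rmin (Rmin r1 r2) (Rmin r3 r4))) as M1.
  pose proof (Rmin_r (r / K) (Rmin (Rmin r1 r2) (Rmin r3 r4))) as M2.
  pose proof (Rmin_l (Rmin r1 r2) (Rmin r3 r4)). pose proof (Rmin_r (Rmin r1 r2) (Rmin r3 r4)).
  pose proof (Rmin_l r1 r2). pose proof (Rmin_r r1 r2).
  pose proof (Rmin_l r3 r4). pose proof (Rmin_r r3 r4).
  specialize (L1 s ltac:(lra)). specialize (L2 s ltac:(lra)).
  specialize (L3 s ltac:(lra)). specialize (L4 s ltac:(lra)).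
  set (d := Rabs (s - t)) in *. assert (Hd : (0 <= d)%R) by apply Rabs_pos.
  assert (D : (dst (g t, h t) (g s, h s) <= K * d)%R).
  { unfold dst. simpl. unfold K. lra. }
  specialize (H (g s, h s)).
  assert (D' : (K * d < r)%R).
  { apply Rlt_le_trans with (K * (r / K))%R; [apply Rmult_lt_compat_l; lra|]. right. field. lra. }
  specialize (H ltac:(lra)). simpl in H.
  set (T := F (g s, h s) - F (g t, h t) - (A * (g s - g t) + B * (h s - h t))) in *.
  set (R1 := g s - g t - l * RtoC (s - t)) in *.
  set (R2 := h s - h t - m * RtoC (s - t)) in *.
  replace (F (g s, h s) - F (g t, h t) - (A * l + B * m) * RtoC (s - t))
    with (T + (A * R1 + B * R2)) by (unfold T, R1, R2; ring).
  eapply Rle_trans; [apply Cmod_triangle|].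
  assert (B1 : (Cmod T <= e / 2 * d)%R).
  { eapply Rle_trans; [apply H|].
    replace (e / 2 * d)%R with (e / (2 * K) * (K * d))%R by (field; lra).
    apply Rmult_le_compat_l; lra. }
  assert (B2 : (Cmod (A * R1 + B * R2) <= e / 2 * d)%R).
  { eapply Rle_trans; [apply Cmod_triangle|]. rewrite !Cmod_mult.
    set (e2 := (e / (2 * (Cmod A + Cmod B + 1)))%R) in *.
    apply Rle_trans with ((Cmod A + Cmod B) * (e2 * d))%R; [nra|].
    replace (e / 2 * d)%R with ((Cmod A + Cmod B + 1) * (e2 * d))%R
      by (unfold e2; field; lra).
    apply Rmult_le_compat_r; [|lra]. apply Rmult_le_pos; lra. }
  lra.
Qed.

Lemma dR_const c t : dR (fun _ => c) t 0.
Proof.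
  intros e He. exists 1%R. split; [lra|]. intros s _.
  replace (c - c - 0 * RtoC (s - t)) with (RtoC 0) by ring. rewrite Cmod_0.
  pose proof (Rabs_pos (s - t)). nra.
Qed.

Lemma dR_id t : dR RtoC t 1.
Proof.
  intros e He. exists 1%R. split; [lra|]. intros s _.
  rewrite RtoC_minus. replace (s - t - 1 * (s - t)) with (RtoC 0) by ring. rewrite Cmod_0.
  pose proof (Rabs_pos (s - t)). nra.
Qed.

Lemma dR_eq c t l m : l = m -> dR c t l -> dR c t m.
Proof. now intros <-. Qed.

Lemma dR_add g h t l m : dR g t l -> dR h t m -> dR (fun s => g s + h s) t (l + m).
Proof.
  intros Hg Hh. eapply dR_eq; [|apply (dR_pair (fun q => fst q + snd q) g h t 1 1); eauto].
  - simpl; ring.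
  - apply D2_add.
Qed.

Lemma dR_mul g h t l m : dR g t l -> dR h t m -> dR (fun s => g s * h s) t (h t * l + g t * m).
Proof.
  intros Hg Hh. apply (dR_pair (fun q => fst q * snd q) g h t); auto. apply D2_mul.
Qed.

Lemma dR_comp (G : C -> C) (c : R -> C) t G' l :
  is_derive G (c t) G' -> dR c t l -> dR (fun s => G (c s)) t (G' * l).
Proof.
  intros HG Hc. apply dR_eq with (G' * l + 0 * 0); [ring|].
  apply (dR_pair (fun q => G (fst q)) c (fun _ => RtoC 0) t G' 0).
  - now apply (is_derive_D2 G (c t, RtoC 0)).
  - exact Hc.
  - apply dR_const.
Qed.

Lemma dR_opp g t l : dR g t l -> dR (fun s => - g s) t (- l).
Proof.
  intros Hg. apply dR_eq with (- (1) * l + 0 * 0); [ring|].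
  apply (dR_pair (fun q => - fst q) g (fun _ => RtoC 0) t).
  - apply D2_opp_fst.
  - exact Hg.
  - apply dR_const.
Qed.

Lemma dR_sub g h t l m : dR g t l -> dR h t m -> dR (fun s => g s - h s) t (l - m).
Proof. intros Hg Hh. apply dR_add; [easy|now apply dR_opp]. Qed.

Lemma dR_inv g t l : dR g t l -> g t <> 0 -> dR (fun s => / g s) t (- l / (g t * g t)).
Proof.
  intros Hg N. eapply dR_eq; [|apply (dR_pair (fun q => / fst q) g (fun _ => RtoC 0) t)].
  2: now apply (D2_inv_fst (g t, RtoC 0)).
  2: exact Hg.
  2: apply dR_const.
  simpl. field. auto.
Qed.

Lemma dR_zero_const (c : R -> C) a b :
  (a <= b)%R -> (forall t, (a <= t <= b)%R -> dR c t 0) -> c a = c b.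
Proof.
  intros Hab H.
  assert (E : forall f : R -> R, (forall t, (a <= t <= b)%R -> is_derive f t 0%R) -> f a = f b).
  { intros f Hf. destruct Hab as [Hab| ->]; [|easy].
    apply (eq_is_derive (V := R_NormedModule) f a b); auto. }
  assert (E1 := E (fun s => Re (c s)) (fun t Ht => dR_Re _ _ _ (H t Ht))).
  assert (E2 := E (fun s => Im (c s)) (fun t Ht => dR_Im _ _ _ (H t Ht))).
  simpl in E1, E2. destruct (c a), (c b). unfold Re, Im in *. simpl in *. congruence.
Qed.

Definition expi (t : R) : C := (cos t, sin t).

Lemma Cmod_expi t : Cmod (expi t) = 1%R.
Proof.
  unfold Cmod, expi. simpl. rewrite !Rmult_1_r. rewrite Rplus_comm.
  pose proof (sin2_cos2 t). unfold Rsqr in H. rewrite H. apply sqrt_1.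
Qed.

Lemma dR_expi t : dR expi t (Ci * expi t).
Proof.
  apply dR_ReIm; unfold expi, Re, Im, Ci, Cmult; simpl.
  - replace (0 * cos t - 1 * sin t)%R with (- sin t)%R by ring. apply is_derive_cos.
  - replace (0 * sin t + 1 * cos t)%R with (cos t)%R by ring. apply is_derive_sin.
Qed.

Lemma expi_2PI : expi (2 * PI) = expi 0.
Proof. unfold expi. now rewrite cos_2PI, sin_2PI, cos_0, sin_0. Qed.

Definition CInt (f : R -> C) : C :=
  (RInt (fun t => Re (f t)) 0 (2 * PI), RInt (fun t => Im (f t)) 0 (2 * PI)).

Definition contR (f : R -> C) : Prop := forall t, Clim (locally t) f (f t).

Lemma contR_Re f : contR f -> forall t, continuous (fun s => Re (f s)) t.
Proof.
  intros H t. apply filterlim_locally. intros e.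
  generalize (H t e (cond_pos e)). apply filter_imp. intros s Hs.
  change (Rabs (Re (f s) - Re (f t)) < e)%R.
  eapply Rle_lt_trans; [|exact Hs]. eapply Rle_trans; [|apply Re_le_Cmod]. right. f_equal.
Qed.

Lemma contR_Im f : contR f -> forall t, continuous (fun s => Im (f s)) t.
Proof.
  intros H t. apply filterlim_locally. intros e.
  generalize (H t e (cond_pos e)). apply filter_imp. intros s Hs.
  change (Rabs (Im (f s) - Im (f t)) < e)%R.
  eapply Rle_lt_trans; [|exact Hs]. eapply Rle_trans; [|apply Im_le_Cmod]. right. f_equal.
Qed.

Lemma ex_RInt_Re f a b : contR f -> ex_RInt (fun t => Re (f t)) a b.
Proof. intros H. apply (ex_RInt_continuous (V := R_CompleteNormedModule)). intros; now apply contR_Re. Qed.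

Lemma ex_RInt_Im f a b : contR f -> ex_RInt (fun t => Im (f t)) a b.
Proof. intros H. apply (ex_RInt_continuous (V := R_CompleteNormedModule)). intros; now apply contR_Im. Qed.

Lemma CInt_ext f g : (forall t, f t = g t) -> CInt f = CInt g.
Proof. intros H. replace g with f; [easy|]. now apply functional_extensionality. Qed.

Lemma CInt_add f g : contR f -> contR g -> CInt (fun t => f t + g t) = CInt f + CInt g.
Proof.
  intros Hf Hg. unfold CInt, Cplus. simpl. f_equal.
  - rewrite <- (RInt_plus (V := R_CompleteNormedModule)); auto using ex_RInt_Re.
  - rewrite <- (RInt_plus (V := R_CompleteNormedModule)); auto using ex_RInt_Im.
Qed.

Lemma CInt_scal (c : C) f : contR f -> CInt (fun t => c * f t) = c * CInt f.
Proof.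
  intros Hf. destruct c as [a b]. unfold CInt, Cmult. simpl. f_equal.
  - rewrite <- (RInt_scal (V := R_CompleteNormedModule) _ _ _ a) by auto using ex_RInt_Re.
    rewrite <- (RInt_scal (V := R_CompleteNormedModule) _ _ _ b) by auto using ex_RInt_Im.
    rewrite <- (RInt_minus (V := R_CompleteNormedModule)); auto;
    apply (ex_RInt_scal (V := R_CompleteNormedModule)); auto using ex_RInt_Re, ex_RInt_Im.
  - rewrite <- (RInt_scal (V := R_CompleteNormedModule) _ _ _ a) by auto using ex_RInt_Im.
    rewrite <- (RInt_scal (V := R_CompleteNormedModule) _ _ _ b) by auto using ex_RInt_Re.
    rewrite <- (RInt_plus (V := R_CompleteNormedModule)); auto;
    apply (ex_RInt_scal (V := R_CompleteNormedModule)); auto using ex_RInt_Re, ex_RInt_Im.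
Qed.

Lemma CInt_const (c : C) : CInt (fun _ => c) = RtoC (2 * PI) * c.
Proof.
  unfold CInt. rewrite !RInt_const. destruct c as [a b]. unfold Cmult, RtoC, Re, Im. simpl.
  unfold scal; simpl; unfold mult; simpl. f_equal; ring.
Qed.

(** The constant is twice the sharp one because real and imaginary parts are bounded separately. *)
Lemma CInt_le f M : contR f -> (forall t, (Cmod (f t) <= M)%R) -> (Cmod (CInt f) <= 4 * PI * M)%R.
Proof.
  intros Hf HM. eapply Rle_trans; [apply Cmod_le_ReIm|]. unfold CInt. simpl.
  pose proof PI_RGT_0 as P.
  pose proof (abs_RInt_le_const (fun t => Re (f t)) 0 (2 * PI) M ltac:(lra)
    (ex_RInt_Re _ _ _ Hf) (fun t _ => Rle_trans _ _ _ (Re_le_Cmod _) (HM t))).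
  pose proof (abs_RInt_le_const (fun t => Im (f t)) 0 (2 * PI) M ltac:(lra)
    (ex_RInt_Im _ _ _ Hf) (fun t _ => Rle_trans _ _ _ (Im_le_Cmod _) (HM t))).
  lra.
Qed.

Lemma contR_mul f g : contR f -> contR g -> contR (fun t => f t * g t).
Proof. intros Hf Hg t. now apply (Clim_mul f g). Qed.

Lemma contR_const c : contR (fun _ => c).
Proof. intros t. apply Clim_const. Qed.

(** Homotopy invariance. The integral of [h t] has derivative the integral of [ht t]; [t] times the
    latter is the integral of the derivative of a function with equal end values, hence zero, and
    [t > 0] can be cancelled. The margin [eta] allows differentiation under the integral also at
    [t = 0] and [t = 1]. *)
Lemma RInt_deform (h ht g : R -> R -> R) (eta : R) : (0 < eta)%R ->
  (forall t x, (- eta < t < 1 + eta)%R -> is_derive (fun t => h t x) t (ht t x)) ->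
  (forall t x, (- eta < t < 1 + eta)%R -> continuity_2d_pt ht t x) ->
  (forall t, (- eta < t < 1 + eta)%R -> ex_RInt (h t) 0 (2 * PI)) ->
  (forall t x, (0 < t < 1)%R -> is_derive (g t) x (t * ht t x)%R) ->
  (forall t, (0 < t < 1)%R -> g t 0%R = g t (2 * PI)%R) ->
  RInt (h 1%R) 0 (2 * PI) = RInt (h 0%R) 0 (2 * PI).
Proof.
  intros He Hh Hc Hi Hg Hp.
  assert (O : forall t, (- eta < t < 1 + eta)%R -> locally t (fun t => (- eta < t < 1 + eta)%R)).
  { intros t Ht. apply filter_and.
    - apply (open_gt (- eta)). lra.
    - apply (open_lt (1 + eta)). lra. }
  assert (D : forall t, (- eta < t < 1 + eta)%R ->
    is_derive (fun t => RInt (h t) 0 (2 * PI)) t (RInt (ht t) 0 (2 * PI))).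
  { intros t Ht.
    replace (RInt (ht t) 0 (2 * PI)) with (RInt (fun x => Derive (fun u => h u x) t) 0 (2 * PI)).
    - apply (is_derive_RInt_param h).
      + generalize (O t Ht). apply filter_imp. intros s Hs x _. eexists. apply Hh. easy.
      + intros x _. apply continuity_2d_pt_ext_loc with ht; [|now apply Hc].
        destruct (O t Ht) as [d Od]. exists d. intros u v Hu _. symmetry.
        apply is_derive_unique. apply Hh. now apply Od.
      + generalize (O t Ht). apply filter_imp. intros s Hs. now apply Hi.
    - apply RInt_ext. intros x _. apply is_derive_unique. now apply Hh. }
  assert (Z : forall t, (0 < t < 1)%R -> RInt (ht t) 0 (2 * PI) = 0%R).
  { intros t Ht.
    assert (C1 : forall x, continuous (ht t) x).
    { intros x. apply continuity_pt_filterlim.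
      assert (Q := Hc t x ltac:(lra)). intros e Hep. destruct (Q (mkposreal e Hep)) as [d Hd].
      exists d. split; [apply cond_pos|]. intros y [_ Hy]. apply Hd; [|exact Hy].
      rewrite Rminus_diag. rewrite Rabs_R0. apply cond_pos. }
    assert (I : is_RInt (fun x => t * ht t x)%R 0 (2 * PI) (minus (g t (2 * PI)) (g t 0))%R).
    { apply (is_RInt_derive (V := R_CompleteNormedModule)).
      - intros x _. now apply Hg.
      - intros x _. apply (continuous_mult (K := R_AbsRing) (fun _ => t) (ht t));
          [apply continuous_const|apply C1]. }
    rewrite (Hp t Ht) in I. apply (is_RInt_unique (V := R_CompleteNormedModule)) in I.
    rewrite (RInt_scal (V := R_CompleteNormedModule)) in I.
    - unfold minus, plus, opp, scal in I; simpl in I; unfold mult in I; simpl in I.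
      apply Rmult_eq_reg_l with t; [|lra]. rewrite I. ring.
    - apply (ex_RInt_continuous (V := R_CompleteNormedModule)). intros; apply C1. }
  destruct (MVT_gen (fun t => RInt (h t) 0 (2 * PI)) 0 1 (fun _ => 0%R)) as [c [_ Ec]].
  - rewrite Rmin_left, Rmax_right by lra. intros t Ht. assert (Q := D t ltac:(lra)). rewrite (Z t Ht) in Q. exact Q.
  - rewrite Rmin_left, Rmax_right by lra. intros t Ht.
    apply continuity_pt_filterlim.
    apply (ex_derive_continuous (V := R_NormedModule) (fun t => RInt (h t) 0 (2 * PI))).
    exists (RInt (ht t) 0 (2 * PI)). apply D. lra.
  - simpl in Ec. lra.
Qed.

Lemma CInt_deform (h ht g : R -> R -> C) (eta : R) : (0 < eta)%R ->
  (forall t x, (- eta < t < 1 + eta)%R -> dR (fun t => h t x) t (ht t x)) ->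
  (forall t x, (- eta < t < 1 + eta)%R ->
     Clim (locally (t, x)) (fun p : R * R => ht (fst p) (snd p)) (ht t x)) ->
  (forall t, (- eta < t < 1 + eta)%R -> contR (h t)) ->
  (forall t x, (0 < t < 1)%R -> dR (g t) x (RtoC t * ht t x)) ->
  (forall t, (0 < t < 1)%R -> g t 0%R = g t (2 * PI)%R) ->
  CInt (h 1%R) = CInt (h 0%R).
Proof.
  intros He Hh Hc Hi Hg Hp. unfold CInt. apply injective_projections; simpl.
  - apply (RInt_deform (fun t x => Re (h t x)) (fun t x => Re (ht t x)) (fun t x => Re (g t x)) eta He).
    + intros t x Ht. apply (dR_Re (fun t => h t x)). now apply Hh.
    + intros t x Ht. apply continuity_2d_pt_filterlim. apply filterlim_locally. intros e.
      generalize (Hc t x Ht e (cond_pos e)). apply filter_imp. intros s Hs.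
      change (Rabs (Re (ht (fst s) (snd s)) - Re (ht t x)) < e)%R.
      eapply Rle_lt_trans; [|exact Hs]. eapply Rle_trans; [|apply Re_le_Cmod]. right. f_equal.
    + intros t Ht. apply ex_RInt_Re. now apply Hi.
    + intros t x Ht. replace (t * Re (ht t x))%R with (Re (RtoC t * ht t x)).
      * apply dR_Re. now apply Hg.
      * unfold Re, Cmult, RtoC. simpl. ring.
    + intros t Ht. now rewrite Hp.
  - apply (RInt_deform (fun t x => Im (h t x)) (fun t x => Im (ht t x)) (fun t x => Im (g t x)) eta He).
    + intros t x Ht. apply (dR_Im (fun t => h t x)). now apply Hh.
    + intros t x Ht. apply continuity_2d_pt_filterlim. apply filterlim_locally. intros e.
      generalize (Hc t x Ht e (cond_pos e)). apply filter_imp. intros s Hs.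
      change (Rabs (Im (ht (fst s) (snd s)) - Im (ht t x)) < e)%R.
      eapply Rle_lt_trans; [|exact Hs]. eapply Rle_trans; [|apply Im_le_Cmod]. right. f_equal.
    + intros t Ht. apply ex_RInt_Im. now apply Hi.
    + intros t x Ht. replace (t * Im (ht t x))%R with (Im (RtoC t * ht t x)).
      * apply dR_Im. now apply Hg.
      * unfold Im, Cmult, RtoC. simpl. ring.
    + intros t Ht. now rewrite Hp.
Qed.

Lemma Clim_comp {T} {F : (T -> Prop) -> Prop} {FF : Filter F} (G : C -> C) (c : T -> C) (z l : C) :
  Clim (locally z) G l -> Clim F c z -> Clim F (fun t => G (c t)) l.
Proof.
  intros HG Hc e He. specialize (HG e He).
  destruct (proj1 (locally_Cmod _ _) HG) as [r [Hr H]]. generalize (Hc r Hr). apply filter_imp.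
  intros t Ht. now apply H.
Qed.

Lemma is_derive_Clim (G : C -> C) (z l : C) : is_derive G z l -> Clim (locally z) G (G z).
Proof.
  intros H. apply (is_derive_D2 G (z, RtoC 0)) in H. apply D2_cont in H.
  intros e He. apply locally_Cmod. destruct (H e He) as [r [Hr L]].
  exists r. split; [easy|]. intros y Hy. apply (L (y, RtoC 0)).
  unfold dst. simpl. rewrite Cmod_minus_0. lra.
Qed.

Lemma Clim_locally_fst (f : R -> C) (t x : R) l :
  Clim (locally t) f l -> Clim (locally (t, x)) (fun p : R * R => f (fst p)) l.
Proof.
  intros H e He. destruct (H e He) as [d Hd]. exists d. intros [u v] [Hu _]. now apply Hd.
Qed.

Lemma Clim_locally_snd (f : R -> C) (t x : R) l :
  Clim (locally x) f l -> Clim (locally (t, x)) (fun p : R * R => f (snd p)) l.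
Proof.
  intros H e He. destruct (H e He) as [d Hd]. exists d. intros [u v] [_ Hv]. now apply Hd.
Qed.

Lemma RtoC_Clim t : Clim (locally t) RtoC (RtoC t).
Proof. apply (dR_Clim RtoC t 1), dR_id. Qed.

Lemma expi_Clim t : Clim (locally t) expi (expi t).
Proof. eapply dR_Clim, dR_expi. Qed.

(** * Cauchy's formula on a circle *)

Section Cauchy.

Variables (rho : R).
Hypothesis Hrho : (0 < rho)%R.

(** The form [dz / (i (z - b))] pulled back to the circle [z = rho e ^ (i x)]. *)
Definition ker (b : C) (x : R) : C := RtoC rho * expi x / (RtoC rho * expi x - b).

Lemma Cmod_rho_expi x : Cmod (RtoC rho * expi x) = rho.
Proof. rewrite Cmod_mult, Cmod_expi, Cmod_R, Rabs_pos_eq; lra. Qed.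

Lemma ker_den b x : (Cmod b < rho)%R -> RtoC rho * expi x - b <> 0.
Proof.
  intros Hb E. assert (Eb : RtoC rho * expi x = b).
  { replace b with (b + 0) by ring. rewrite <- E. ring. }
  rewrite <- Eb, Cmod_rho_expi in Hb. lra.
Qed.

Lemma contR_expi : contR expi.
Proof. intros t. apply expi_Clim. Qed.

Lemma contR_rho_expi : contR (fun x => RtoC rho * expi x).
Proof. apply contR_mul; [apply contR_const|apply contR_expi]. Qed.

Lemma contR_ker b : (Cmod b < rho)%R -> contR (ker b).
Proof.
  intros Hb t. unfold ker. apply Clim_div.
  - apply contR_rho_expi.
  - apply Clim_sub; [apply contR_rho_expi|apply Clim_const].
  - now apply ker_den.
Qed.

Lemma dR_rho_expi x : dR (fun x => RtoC rho * expi x) x (Ci * (RtoC rho * expi x)).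
Proof.
  eapply dR_eq; [|apply dR_mul; [apply dR_const|apply dR_expi]]. cbv beta; ring.
Qed.

Lemma Ci2 : Ci * Ci = - (1).
Proof. unfold Ci, Cmult, Copp, RtoC. simpl. f_equal; ring. Qed.

(** The pole is moved from [b] to the centre along [t b], where the kernel is constantly 1; [Ci]
    times the kernel serves as the periodic primitive. *)
Lemma CInt_ker b : (Cmod b < rho)%R -> CInt (ker b) = RtoC (2 * PI).
Proof.
  intros Hb.
  pose proof (Cmod_ge_0 b) as B0.
  set (eta := ((rho - Cmod b) / (2 * (Cmod b + 1)))%R).
  assert (He : (0 < eta)%R) by (apply Rdiv_lt_0_compat; lra).
  assert (Hs : forall t, (- eta < t < 1 + eta)%R -> (Cmod (RtoC t * b) < rho)%R).
  { intros t Ht. rewrite Cmod_mult, Cmod_R.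
    apply Rle_lt_trans with ((1 + eta) * Cmod b)%R.
    - apply Rmult_le_compat_r; [easy|]. apply Rabs_le. lra.
    - replace ((1 + eta) * Cmod b)%R with (Cmod b + eta * Cmod b)%R by ring.
      assert (eta * Cmod b <= eta * (Cmod b + 1))%R by (apply Rmult_le_compat_l; lra).
      assert (eta * (Cmod b + 1) = (rho - Cmod b) / 2)%R by (unfold eta; field; lra). lra. }
  replace (RtoC (2 * PI)) with (CInt (ker (RtoC 0 * b))).
  2:{ transitivity (CInt (fun _ => RtoC 1)); [|now rewrite CInt_const, Cmult_1_r].
      apply CInt_ext. intros x. unfold ker. replace (RtoC rho * expi x - 0 * b) with (RtoC rho * expi x) by ring.
      unfold Cdiv. apply Cinv_r. intros E. apply (f_equal Cmod) in E. rewrite Cmod_rho_expi, Cmod_0 in E. lra. }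
  replace (ker b) with (ker (RtoC 1 * b)) by (f_equal; ring).
  apply (CInt_deform (fun t => ker (RtoC t * b))
    (fun t x => RtoC rho * expi x * b *
       / ((RtoC rho * expi x - RtoC t * b) * (RtoC rho * expi x - RtoC t * b)))
    (fun t x => Ci * ker (RtoC t * b) x) eta He).
  - intros t x Ht. unfold ker.
    assert (N : RtoC rho * expi x - RtoC t * b <> 0) by (apply ker_den; auto).
    assert (D : dR (fun t => RtoC rho * expi x - RtoC t * b) t (- b)).
    { eapply dR_eq; [|apply dR_sub; [apply dR_const|apply dR_mul; [apply dR_id|apply dR_const]]].
      cbv beta; ring. }
    eapply dR_eq; [|apply dR_mul; [apply dR_const|apply dR_inv; [exact D|exact N]]].
    cbv beta; field. exact N.
  - intros t x Ht. assert (N : RtoC rho * expi x - RtoC t * b <> 0) by (apply ker_den; auto).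
    assert (L1 : Clim (locally (t, x)) (fun p : R * R => RtoC rho * expi (snd p)) (RtoC rho * expi x)).
    { apply (Clim_locally_snd (fun x => RtoC rho * expi x)). apply contR_rho_expi. }
    assert (L2 : Clim (locally (t, x)) (fun p : R * R => RtoC (fst p)) (RtoC t)).
    { apply (Clim_locally_fst RtoC). apply RtoC_Clim. }
    assert (L3 : Clim (locally (t, x)) (fun p : R * R => RtoC rho * expi (snd p) - RtoC (fst p) * b)
      (RtoC rho * expi x - RtoC t * b)).
    { apply Clim_sub; [exact L1|]. apply Clim_mul; [exact L2|apply Clim_const]. }
    apply Clim_div.
    + apply Clim_mul; [exact L1|apply Clim_const].
    + now apply Clim_mul.
    + now apply Cmult_neq_0.
  - intros t Ht. apply contR_ker. auto.
  - intros t x Ht. unfold ker.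
    assert (N : RtoC rho * expi x - RtoC t * b <> 0) by (apply ker_den; apply Hs; lra).
    assert (D : dR (fun x => RtoC rho * expi x - RtoC t * b) x (Ci * (RtoC rho * expi x))).
    { eapply dR_eq; [|apply dR_sub; [apply dR_rho_expi|apply dR_const]]. cbv beta; ring. }
    eapply dR_eq; [|apply dR_mul; [apply dR_const|apply dR_mul;
      [apply dR_rho_expi|apply dR_inv; [exact D|exact N]]]].
    cbv beta. set (u := RtoC rho * expi x) in *.
    replace (/ (u - t * b) * (Ci * u) + u * (- (Ci * u) / ((u - t * b) * (u - t * b))))
      with (- Ci * (u * t * b / ((u - t * b) * (u - t * b)))) by (field; exact N).
    replace (Ci * (- Ci * (u * t * b / ((u - t * b) * (u - t * b)))))
      with (- (Ci * Ci) * (u * t * b / ((u - t * b) * (u - t * b)))) by ring.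
    rewrite Ci2. field. exact N.
  - intros t Ht. unfold ker. now rewrite expi_2PI.
Qed.

(** The circle is contracted to [a] along the segments [a + t w x]. The factor [w] produced by
    differentiation in [t] cancels the denominator of the kernel, and at [t = 0] only [G a] times
    the integral of the kernel is left. *)
Lemma cauchy1 (G G' : C -> C) (z0 : C) (R : R) (a : C) :
  (forall z : C, (Cmod (z - z0) < R)%R -> is_derive G z (G' z)) ->
  (forall z : C, (Cmod (z - z0) < R)%R -> Clim (locally z) G' (G' z)) ->
  (rho < R)%R -> (Cmod (a - z0) < rho)%R ->
  CInt (fun x => ker (a - z0) x * G (z0 + RtoC rho * expi x)) = RtoC (2 * PI) * G a.
Proof.
  intros HG HG' HR Ha.
  pose proof (Cmod_ge_0 (a - z0)) as A0.
  (* For [t] within [eta] of the unit interval the contracted circle stays within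
     [(1 + 2 eta) rho < R] of the centre. *)
  set (eta := ((R - rho) / (4 * rho))%R).
  assert (He : (0 < eta)%R) by (apply Rdiv_lt_0_compat; lra).
  set (w := fun x => RtoC rho * expi x - (a - z0)).
  assert (Hw : forall x, w x <> 0) by (intros x; now apply ker_den).
  assert (Hin : forall t x, (- eta < t < 1 + eta)%R -> (Cmod (a + RtoC t * w x - z0) < R)%R).
  { intros t x Ht. unfold w.
    replace (a + RtoC t * (RtoC rho * expi x - (a - z0)) - z0)
      with (RtoC (1 - t) * (a - z0) + RtoC t * (RtoC rho * expi x))
      by (rewrite RtoC_minus; ring).
    eapply Rle_lt_trans; [apply Cmod_triangle|].
    rewrite !Cmod_mult, Cmod_expi, !Cmod_R, Rmult_1_r, (Rabs_pos_eq rho) by lra.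
    apply Rle_lt_trans with ((Rabs (1 - t) + Rabs t) * rho)%R.
    - rewrite Rmult_plus_distr_r. apply Rplus_le_compat_r.
      apply Rmult_le_compat_l; [apply Rabs_pos|lra].
    - apply Rle_lt_trans with ((1 + 2 * eta) * rho)%R.
      + apply Rmult_le_compat_r; [lra|].
        unfold Rabs. destruct (Rcase_abs (1 - t)), (Rcase_abs t); lra.
      + assert (eta * rho = (R - rho) / 4)%R by (unfold eta; field; lra). lra. }
  rewrite <- (CInt_ker (a - z0) Ha).
  rewrite Cmult_comm, <- CInt_scal by now apply contR_ker.
  rewrite (CInt_ext _ (fun x => ker (a - z0) x * G (a + RtoC 1 * w x)))
    by (intros x; f_equal; f_equal; unfold w; ring).
  rewrite (CInt_ext (fun t => G a * ker (a - z0) t) (fun x => ker (a - z0) x * G (a + RtoC 0 * w x)))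
    by (intros x; replace (a + 0 * w x) with a by ring; ring).
  assert (Dw : forall x, dR w x (Ci * (RtoC rho * expi x))).
  { intros x. eapply dR_eq; [|apply dR_sub; [apply dR_rho_expi|apply dR_const]]. cbv beta; ring. }
  apply (CInt_deform (fun t x => ker (a - z0) x * G (a + RtoC t * w x))
    (fun t x => RtoC rho * expi x * G' (a + RtoC t * w x))
    (fun t x => - Ci * G (a + RtoC t * w x)) eta He).
  - intros t x Ht.
    assert (D : dR (fun t => a + RtoC t * w x) t (w x)).
    { eapply dR_eq; [|apply dR_add; [apply dR_const|apply dR_mul; [apply dR_id|apply dR_const]]]. cbv beta; ring. }
    eapply dR_eq; [|apply dR_mul; [apply dR_const|
      apply (dR_comp G (fun t => a + RtoC t * w x) t); [apply HG; auto|exact D]]].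
    cbv beta. unfold ker. fold (w x). field. apply Hw.
  - intros t x Ht.
    assert (L1 : Clim (locally (t, x)) (fun p : Rdefinitions.R * Rdefinitions.R => RtoC rho * expi (snd p)) (RtoC rho * expi x)).
    { apply (Clim_locally_snd (fun x => RtoC rho * expi x)). apply contR_rho_expi. }
    apply Clim_mul; [exact L1|].
    apply (Clim_comp G' _ (a + RtoC t * w x)); [apply HG'; auto|].
    apply Clim_add; [apply Clim_const|].
    apply Clim_mul; [apply (Clim_locally_fst RtoC), RtoC_Clim|].
    apply Clim_sub; [exact L1|apply Clim_const].
  - intros t Ht. apply contR_mul; [now apply contR_ker|].
    intros x. apply (Clim_comp G _ (a + RtoC t * w x)).
    + eapply is_derive_Clim, HG. auto.
    + apply Clim_add; [apply Clim_const|]. apply Clim_mul; [apply Clim_const|].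
      eapply dR_Clim, Dw.
  - intros t x Ht.
    assert (D : dR (fun x => a + RtoC t * w x) x (RtoC t * (Ci * (RtoC rho * expi x)))).
    { eapply dR_eq; [|apply dR_add; [apply dR_const|apply dR_mul; [apply dR_const|apply Dw]]]. cbv beta; ring. }
    eapply dR_eq; [|apply dR_mul; [apply dR_const|
      apply (dR_comp G (fun x => a + RtoC t * w x) x); [apply HG; apply Hin; lra|exact D]]].
    cbv beta. transitivity (- (Ci * Ci) * (t * (rho * expi x * G' (a + t * w x)))); [ring|].
    rewrite Ci2. ring.
  - intros t Ht. unfold w. now rewrite expi_2PI.
Qed.

End Cauchy.

Lemma filterlim_Clim {T} (F : (T -> Prop) -> Prop) {FF : Filter F} (f : T -> C) (l : C) :
  filterlim f F (locally l) <-> Clim F f l.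
Proof.
  split.
  - intros H e He. apply (H (fun z => (Cmod (z - l) < e)%R)). apply locally_Cmod. now exists e.
  - intros H P HP. apply locally_Cmod in HP. destruct HP as [r [Hr HP]].
    change (F (fun t => P (f t))). generalize (H r Hr). apply filter_imp. intros t Ht. now apply HP.
Qed.

(** * Double integrals over the torus *)

Definition contRR (W : R -> R -> C) : Prop :=
  forall t x, Clim (locally (t, x)) (fun p : R * R => W (fst p) (snd p)) (W t x).

Lemma contRR_mul V W : contRR V -> contRR W -> contRR (fun t x => V t x * W t x).
Proof. intros HV HW t x. now apply Clim_mul. Qed.

Lemma contRR_add V W : contRR V -> contRR W -> contRR (fun t x => V t x + W t x).
Proof. intros HV HW t x. now apply Clim_add. Qed.

Lemma contRR_sub V W : contRR V -> contRR W -> contRR (fun t x => V t x - W t x).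
Proof. intros HV HW t x. now apply Clim_sub. Qed.

Lemma contRR_fst c : contR c -> contRR (fun t _ => c t).
Proof. intros H t x. apply Clim_locally_fst. apply H. Qed.

Lemma contRR_snd c : contR c -> contRR (fun _ x => c x).
Proof. intros H t x. apply Clim_locally_snd. apply H. Qed.

Lemma contRR_slice W t : contRR W -> contR (W t).
Proof.
  intros H x e He. destruct (H t x e He) as [d Hd]. exists d. intros y Hy.
  apply (Hd (t, y)). split; [apply ball_center|exact Hy].
Qed.

Lemma RInt_param_continuous (f : R -> R -> R) :
  (forall t x, continuity_2d_pt f t x) -> (forall t, ex_RInt (f t) 0 (2 * PI)) ->
  forall t e, (0 < e)%R -> exists d, (0 < d)%R /\ forall s, (Rabs (s - t) < d)%R ->
    (Rabs (RInt (f s) 0 (2 * PI) - RInt (f t) 0 (2 * PI)) < e)%R.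
Proof.
  intros Hf Hi t e He. pose proof PI_RGT_0 as P.
  assert (He2 : (0 < e / (4 * PI))%R) by (apply Rdiv_lt_0_compat; lra).
  destruct (uniform_continuity_2d f (t - 1) (t + 1) 0 (2 * PI)
    (fun x y _ _ => Hf x y) (mkposreal _ He2)) as [d Hd].
  exists (Rmin d 1). split; [apply Rmin_glb_lt; [apply cond_pos|lra]|].
  intros s Hs. pose proof (Rmin_l d 1). pose proof (Rmin_r d 1).
  assert (S1 := Rle_abs (s - t)). assert (S2 := Rle_abs (- (s - t))). rewrite Rabs_Ropp in S2.
  rewrite <- (RInt_minus (V := R_CompleteNormedModule) (f s) (f t)) by auto.
  apply Rle_lt_trans with ((2 * PI - 0) * (e / (4 * PI)))%R.
  - apply (abs_RInt_le_const (fun x => f s x - f t x)%R); [lra| |].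
    + apply (ex_RInt_minus (V := R_CompleteNormedModule)); auto.
    + intros x Hx. left. apply (Hd t x s x); try lra.
      rewrite Rminus_diag, Rabs_R0. apply cond_pos.
  - replace ((2 * PI - 0) * (e / (4 * PI)))%R with (e / 2)%R by (field; lra). lra.
Qed.

Lemma CInt_param_continuous W : contRR W -> contR (fun t => CInt (W t)).
Proof.
  intros H t e He.
  assert (C1 : forall t x, continuity_2d_pt (fun t x => Re (W t x)) t x).
  { intros t' x. apply continuity_2d_pt_filterlim. apply filterlim_locally. intros e'.
    generalize (H t' x e' (cond_pos e')). apply filter_imp. intros s Hs.
    change (Rabs (Re (W (fst s) (snd s)) - Re (W t' x)) < e')%R.
    eapply Rle_lt_trans; [|exact Hs]. eapply Rle_trans; [|apply Re_le_Cmod]. right. f_equal. }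
  assert (C2 : forall t x, continuity_2d_pt (fun t x => Im (W t x)) t x).
  { intros t' x. apply continuity_2d_pt_filterlim. apply filterlim_locally. intros e'.
    generalize (H t' x e' (cond_pos e')). apply filter_imp. intros s Hs.
    change (Rabs (Im (W (fst s) (snd s)) - Im (W t' x)) < e')%R.
    eapply Rle_lt_trans; [|exact Hs]. eapply Rle_trans; [|apply Im_le_Cmod]. right. f_equal. }
  assert (He2 : (0 < e / 2)%R) by lra.
  destruct (RInt_param_continuous _ C1 (fun t => ex_RInt_Re _ _ _ (contRR_slice W t H)) t _ He2)
    as (d1 & D1 & H1).
  destruct (RInt_param_continuous _ C2 (fun t => ex_RInt_Im _ _ _ (contRR_slice W t H)) t _ He2)
    as (d2 & D2 & H2).
  assert (D : (0 < Rmin d1 d2)%R) by now apply Rmin_glb_lt.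
  exists (mkposreal _ D). intros s Hs. change (Rabs (s - t) < Rmin d1 d2)%R in Hs.
  pose proof (Rmin_l d1 d2). pose proof (Rmin_r d1 d2).
  specialize (H1 s ltac:(lra)). specialize (H2 s ltac:(lra)).
  eapply Rle_lt_trans; [apply Cmod_le_ReIm|]. unfold CInt.
  replace e with (e / 2 + e / 2)%R by field. apply Rplus_lt_compat; [exact H1|exact H2].
Qed.

Lemma contRR_const c : contRR (fun _ _ => c).
Proof. intros t x. apply Clim_const. Qed.

Lemma contR_pow c n : contR c -> contR (fun t => c t ^ n).
Proof. intros H t. apply Clim_pow. apply H. Qed.

Definition II (W : R -> R -> C) : C := CInt (fun t => CInt (W t)).

Lemma II_ext V W : (forall t x, V t x = W t x) -> II V = II W.
Proof. intros H. apply CInt_ext. intros t. now apply CInt_ext. Qed.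

Lemma II_add V W : contRR V -> contRR W -> II (fun t x => V t x + W t x) = II V + II W.
Proof.
  intros HV HW. unfold II. rewrite <- CInt_add by now apply CInt_param_continuous.
  apply CInt_ext. intros t. apply CInt_add; now apply contRR_slice.
Qed.

Lemma II_scal c W : contRR W -> II (fun t x => c * W t x) = c * II W.
Proof.
  intros HW. unfold II. rewrite <- CInt_scal by now apply CInt_param_continuous.
  apply CInt_ext. intros t. apply CInt_scal; now apply contRR_slice.
Qed.

Lemma II_sub V W : contRR V -> contRR W -> II (fun t x => V t x - W t x) = II V - II W.
Proof.
  intros HV HW. rewrite (II_ext _ (fun t x => V t x + - (1) * W t x)) by (intros; ring).
  rewrite II_add, II_scal; auto; [ring|].
  apply contRR_mul; [intros t x; apply Clim_const|easy].
Qed.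

Lemma II_sum (f : nat -> R -> R -> C) n : (forall i, contRR (f i)) ->
  contRR (fun t x => sum_n (fun i => f i t x) n) /\
  II (fun t x => sum_n (fun i => f i t x) n) = sum_n (fun i => II (f i)) n.
Proof.
  intros H. induction n as [|n [IH1 IH2]].
  - replace (fun t x => sum_n (fun i => f i t x) 0) with (f O).
    + now rewrite sum_O.
    + apply functional_extensionality. intros t. apply functional_extensionality. intros x.
      now rewrite sum_O.
  - replace (fun t x => sum_n (fun i => f i t x) (S n))
      with (fun t x => sum_n (fun i => f i t x) n + f (S n) t x).
    + split; [now apply contRR_add|]. rewrite II_add by auto. rewrite IH2, sum_Sn. easy.
    + apply functional_extensionality. intros t. apply functional_extensionality. intros x.
      now rewrite sum_Sn.
Qed.

Lemma II_le W M : contRR W -> (forall t x, (Cmod (W t x) <= M)%R) ->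
  (Cmod (II W) <= 16 * (PI * PI) * M)%R.
Proof.
  intros HW HM. replace (16 * (PI * PI) * M)%R with (4 * PI * (4 * PI * M))%R by ring.
  apply CInt_le; [now apply CInt_param_continuous|]. intros t.
  apply CInt_le; [now apply contRR_slice|]. auto.
Qed.

(** * Cauchy expansions *)

(** The part of degree [n] in the expansion of [1 / ((1 - X) (1 - Y))], since [analytic2_at] sums by
    total degree. *)
Definition hsum (X Y : C) (n : nat) : C := sum_n (fun i => X ^ i * Y ^ (n - i)) n.

Lemma hsum_S X Y n : hsum X Y (S n) = Y * hsum X Y n + X ^ S n.
Proof.
  unfold hsum. rewrite sum_Sn. replace (S n - S n)%nat with O by lia.
  change (plus ?a ?b) with (a + b).
  f_equal; [|simpl; ring]. rewrite Cmult_comm, sum_n_scal_C.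
  apply sum_n_ext_loc. intros i Hi. replace (S n - i)%nat with (S (n - i)) by lia.
  simpl. ring.
Qed.

(** The double geometric series telescopes exactly when summed by degree, so its remainder can be
    estimated without any rearrangement of double series. *)
Lemma hsum_total X Y N :
  (1 - X) * (1 - Y) * sum_n (hsum X Y) N = 1 - X ^ S N - (1 - X) * Y * hsum X Y N.
Proof.
  induction N as [|N IH].
  - rewrite sum_O. unfold hsum. rewrite sum_O. simpl. ring.
  - rewrite sum_Sn. change (plus ?a ?b) with (a + b).
    rewrite Cmult_plus_distr_l, IH, !hsum_S. simpl. ring.
Qed.

Lemma hsum_le X Y q n : (Cmod X <= q)%R -> (Cmod Y <= q)%R ->
  (Cmod (hsum X Y n) <= INR (S n) * q ^ n)%R.
Proof.
  intros HX HY. apply Cmod_sum_n_le. intros i Hi.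
  rewrite Cmod_mult. replace n with (i + (n - i))%nat at 2 by lia. rewrite pow_add.
  apply Rmult_le_compat; try apply Cmod_ge_0; now apply Cmod_pow_le.
Qed.

Lemma hsum_remainder X Y q N : (0 <= q < 1)%R -> (Cmod X <= q)%R -> (Cmod Y <= q)%R ->
  (Cmod (/ (1 - X) * / (1 - Y) - sum_n (hsum X Y) N)
   <= 3 / ((1 - q) * (1 - q)) * (INR (S N) * q ^ N))%R.
Proof.
  intros Hq HX HY.
  assert (A : forall Z, (Cmod Z <= q)%R -> (1 - q <= Cmod (1 - Z))%R).
  { intros Z HZ. pose proof (Cmod_triangle (1 - Z) Z) as T.
    replace (1 - Z + Z) with (RtoC 1) in T by ring. rewrite Cmod_1 in T. lra. }
  pose proof (A X HX) as AX. pose proof (A Y HY) as AY.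
  assert (NX : 1 - X <> 0) by (apply Cmod_gt_0; lra).
  assert (NY : 1 - Y <> 0) by (apply Cmod_gt_0; lra).
  replace (/ (1 - X) * / (1 - Y) - sum_n (hsum X Y) N)
    with ((X ^ S N + (1 - X) * Y * hsum X Y N) * / ((1 - X) * (1 - Y))).
  2:{ pose proof (hsum_total X Y N) as E.
      replace (X ^ S N + (1 - X) * Y * hsum X Y N)
        with (1 - (1 - X) * (1 - Y) * sum_n (hsum X Y) N) by (rewrite E; ring).
      field. auto. }
  rewrite Cmod_mult, Cmod_inv, Cmod_mult by now apply Cmult_neq_0.
  set (P := (INR (S N) * q ^ N)%R).
  assert (Q : (0 <= q ^ N)%R) by (apply pow_le; lra).
  assert (IN : (1 <= INR (S N))%R) by (rewrite S_INR; pose proof (pos_INR N); lra).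
  assert (P1 : (q ^ N <= P)%R) by (unfold P; nra).
  assert (B1 : (Cmod (X ^ S N + (1 - X) * Y * hsum X Y N) <= 3 * P)%R).
  { eapply Rle_trans; [apply Cmod_triangle|]. rewrite !Cmod_mult.
    pose proof (hsum_le X Y q N HX HY) as H1. fold P in H1.
    pose proof (Cmod_pow_le X q (S N) HX) as H2. simpl in H2.
    pose proof (Cmod_triangle_minus 1 X) as H3. rewrite Cmod_1 in H3.
    pose proof (Cmod_ge_0 (1 - X)). pose proof (Cmod_ge_0 Y). pose proof (Cmod_ge_0 (hsum X Y N)).
    pose proof (Cmod_ge_0 X).
    assert (H9 : (Cmod (1 - X) * Cmod Y * Cmod (hsum X Y N) <= 2 * 1 * P)%R).
    { apply Rmult_le_compat; auto; [now apply Rmult_le_pos|].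
      apply Rmult_le_compat; auto; lra. }
    assert (q * q ^ N <= q ^ N)%R by nra. simpl. lra. }
  assert (B2 : (/ (Cmod (1 - X) * Cmod (1 - Y)) <= / ((1 - q) * (1 - q)))%R).
  { apply Rinv_le_contravar; [apply Rmult_lt_0_compat; lra|].
    apply Rmult_le_compat; lra. }
  replace (3 / ((1 - q) * (1 - q)) * P)%R with (3 * P * / ((1 - q) * (1 - q)))%R
    by (field; lra).
  apply Rmult_le_compat; auto.
  - apply Cmod_ge_0.
  - left. apply Rinv_0_lt_compat. apply Rmult_lt_0_compat; lra.
Qed.

(** Cauchy's formula in each variable writes [f] as an integral over a torus against two kernels,
    and the kernels are expanded in geometric series. The 4 in the coefficient bound is
    [16 PI ^ 2 / (4 PI ^ 2)], due to the crude constant of [CInt_le]. *)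
Lemma cauchy_expansion f p Rad rho M : (0 < rho < Rad)%R ->
  (forall q, (Cmod (fst q - fst p) < Rad)%R -> (Cmod (snd q - snd p) < Rad)%R -> hol2 f q) ->
  (forall q, (Cmod (fst q - fst p) < Rad)%R -> (Cmod (snd q - snd p) < Rad)%R -> (Cmod (f q) <= M)%R) ->
  exists a : nat -> nat -> C,
    (forall i j, (Cmod (a i j) * rho ^ (i + j) <= 4 * M)%R) /\
    forall x y, (Cmod (x - fst p) < rho)%R -> (Cmod (y - snd p) < rho)%R ->
      is_series (fun n => sum_n (fun i => a i (n - i)%nat * (x - fst p) ^ i
                                          * (y - snd p) ^ (n - i)) n) (f (x, y)).
Proof.
  intros [Hrho HR] Hf HM. destruct p as [x0 y0]. simpl in *.
  pose proof PI_RGT_0 as PI0.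
  (* With this notation [ker rho b t] is [1 / (1 - b u t)], the sum of a geometric series of ratio
     [b u t]. *)
  set (u := fun t => / (RtoC rho * expi t)).
  set (F := fun t x => f (x0 + RtoC rho * expi t, y0 + RtoC rho * expi x)).
  assert (RE : forall t, Cmod (RtoC rho * expi t) = rho) by (intros; now apply Cmod_rho_expi).
  assert (REnz : forall t, RtoC rho * expi t <> 0)
    by (intros t; apply Cmod_gt_0; rewrite RE; lra).
  assert (Hin : forall z t, (Cmod (z + RtoC rho * expi t - z) < Rad)%R).
  { intros z t. replace (z + RtoC rho * expi t - z) with (RtoC rho * expi t) by ring.
    now rewrite RE. }
  assert (CF : contRR F).
  { intros t x. unfold F.
    apply (Clim_pair f (fun p : R * R => x0 + RtoC rho * expi (fst p))
        (fun p => y0 + RtoC rho * expi (snd p))).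
    - apply hol2_cont. apply Hf; simpl; apply Hin.
    - apply Clim_add; [apply Clim_const|]. apply (Clim_locally_fst (fun t => RtoC rho * expi t)).
      apply contR_rho_expi.
    - apply Clim_add; [apply Clim_const|]. apply (Clim_locally_snd (fun t => RtoC rho * expi t)).
      apply contR_rho_expi. }
  assert (Cu : contR u).
  { intros t. apply Clim_inv; [apply contR_rho_expi|apply REnz]. }
  assert (Cup : forall i, contR (fun t => u t ^ i)).
  { intros i t. apply Clim_pow. apply Cu. }
  assert (Mu : forall t, Cmod (u t) = (/ rho)%R).
  { intros t. unfold u. rewrite Cmod_inv by apply REnz. now rewrite RE. }
  assert (MF : forall t x, (Cmod (F t x) <= M)%R).
  { intros t x. apply HM; simpl; apply Hin. }
  set (c := / (RtoC (2 * PI) * RtoC (2 * PI))).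
  assert (PI2 : RtoC (2 * PI) <> 0).
  { intros E. apply RtoC_inj in E. lra. }
  assert (Cm : Cmod c = (/ (4 * (PI * PI)))%R).
  { unfold c. rewrite Cmod_inv by now apply Cmult_neq_0.
    rewrite Cmod_mult, Cmod_R, Rabs_pos_eq by lra. f_equal. ring. }
  assert (CW : forall i j, contRR (fun t x => u t ^ i * u x ^ j * F t x)).
  { intros i j. apply contRR_mul; [|exact CF].
    apply contRR_mul; [apply (contRR_fst (fun t => u t ^ i))|apply (contRR_snd (fun t => u t ^ j))];
    apply Cup. }
  set (a := fun i j => c * II (fun t x => u t ^ i * u x ^ j * F t x)).
  exists a. split.
  { intros i j. unfold a. rewrite Cmod_mult, Cm.
    assert (B : (Cmod (II (fun t x => (u t ^ i * u x ^ j * F t x)%C))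
                 <= 16 * (PI * PI) * (/ rho ^ (i + j) * M))%R).
    { apply II_le; [apply CW|]. intros t x. rewrite !Cmod_mult, !Cmod_pow, !Mu.
      rewrite <- pow_add, pow_inv. apply Rmult_le_compat_l; [|apply MF].
      left. apply Rinv_0_lt_compat. now apply pow_lt. }
    assert (RP : (0 < rho ^ (i + j))%R) by now apply pow_lt.
    apply Rle_trans with (/ (4 * (PI * PI)) * (16 * (PI * PI) * (/ rho ^ (i + j) * M)) * rho ^ (i + j))%R.
    - apply Rmult_le_compat_r; [lra|]. apply Rmult_le_compat_l; [|exact B].
      left. apply Rinv_0_lt_compat. nra.
    - right. field. repeat split; lra. }
  intros x y Hx Hy. set (xi := x - x0) in *. set (et := y - y0) in *.
  assert (Kx : forall (b : C) t, (Cmod b < rho)%R -> ker rho b t = / (1 - b * u t)).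
  { intros b t Hb. pose proof (ker_den rho Hrho b t Hb) as N. pose proof (REnz t) as E0.
    unfold ker, u. set (E := RtoC rho * expi t) in *.
    replace (1 - b * / E) with ((E - b) / E) by (field; exact E0).
    field. split; assumption. }
  assert (FORM : f (x, y) = c * II (fun t s => ker rho xi t * ker rho et s * F t s)).
  { assert (S1 : forall t, CInt (fun s => ker rho et s * F t s)
                 = RtoC (2 * PI) * f (x0 + RtoC rho * expi t, y)).
    { intros t. unfold F, et.
      apply (cauchy1 rho Hrho (fun z => f (x0 + RtoC rho * expi t, z))
        (fun z => dy f (x0 + RtoC rho * expi t, z)) y0 Rad y); auto.
      - intros z Hz. destruct (hol2_partials f (x0 + RtoC rho * expi t, z)) as [D _].
        + apply Hf; simpl; [apply Hin|exact Hz].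
        + apply (D2_is_derive_snd _ _ _ _ D).
      - intros z Hz. destruct (hol2_partials f (x0 + RtoC rho * expi t, z)) as (_ & _ & D).
        + apply Hf; simpl; [apply Hin|exact Hz].
        + apply (Clim_pair (dy f) (fun _ => x0 + RtoC rho * expi t) (fun z => z)); auto.
          * apply Clim_const.
          * intros e He. apply locally_Cmod. exists e. auto. }
    assert (S2 : CInt (fun t => ker rho xi t * f (x0 + RtoC rho * expi t, y))
                 = RtoC (2 * PI) * f (x, y)).
    { unfold xi.
      apply (cauchy1 rho Hrho (fun z => f (z, y)) (fun z => dx f (z, y)) x0 Rad x); auto.
      - intros z Hz. destruct (hol2_partials f (z, y)) as [D _].
        + apply Hf; simpl; [exact Hz|unfold et in Hy; lra].
        + apply (D2_is_derive_fst _ _ _ _ D).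
      - intros z Hz. destruct (hol2_partials f (z, y)) as (_ & D & _).
        + apply Hf; simpl; [exact Hz|unfold et in Hy; lra].
        + apply (Clim_pair (dx f) (fun z => z) (fun _ => y)); auto.
          * intros e He. apply locally_Cmod. exists e. auto.
          * apply Clim_const. }
    unfold II. rewrite (CInt_ext _ (fun t => RtoC (2 * PI) * (ker rho xi t * f (x0 + RtoC rho * expi t, y)))).
    - rewrite CInt_scal.
      + rewrite S2. unfold c. set (P2 := RtoC (2 * PI)) in *. field. exact PI2.
      + apply contR_mul; [now apply contR_ker|].
        intros t. apply (Clim_pair f (fun t => x0 + RtoC rho * expi t) (fun _ => y)).
        * apply hol2_cont. apply Hf; simpl; [apply Hin|unfold et in Hy; lra].
        * apply Clim_add; [apply Clim_const|apply contR_rho_expi].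
        * apply Clim_const.
    - intros t. rewrite (CInt_ext _ (fun s => ker rho xi t * (ker rho et s * F t s)))
        by (intros; ring).
      rewrite CInt_scal, S1; [ring|].
      apply contR_mul; [now apply contR_ker|now apply contRR_slice]. }
  set (q := (Rmax (Cmod xi) (Cmod et) / rho)%R).
  assert (Q0 : (0 <= q < 1)%R).
  { unfold q. split.
    - apply Rdiv_le_0_compat; [|easy]. eapply Rle_trans; [apply (Cmod_ge_0 xi)|apply Rmax_l].
    - apply Rlt_div_l; [easy|]. rewrite Rmult_1_l. now apply Rmax_lub_lt. }
  assert (Qx : forall t, (Cmod (xi * u t) <= q)%R).
  { intros t. rewrite Cmod_mult, Mu. unfold q, Rdiv. apply Rmult_le_compat_r.
    - left. now apply Rinv_0_lt_compat.
    - apply Rmax_l. }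
  assert (Qy : forall t, (Cmod (et * u t) <= q)%R).
  { intros t. rewrite Cmod_mult, Mu. unfold q, Rdiv. apply Rmult_le_compat_r.
    - left. now apply Rinv_0_lt_compat.
    - apply Rmax_r. }
  assert (TERM : forall n, sum_n (fun i => a i (n - i)%nat * xi ^ i * et ^ (n - i)) n
     = c * II (fun t s => hsum (xi * u t) (et * u s) n * F t s)).
  { intros n.
    rewrite (II_ext _ (fun t s => sum_n (fun i => (xi ^ i * et ^ (n - i)) * (u t ^ i * u s ^ (n - i) * F t s)) n)).
    - rewrite (proj2 (II_sum (fun i t s => (xi ^ i * et ^ (n - i)) * (u t ^ i * u s ^ (n - i) * F t s)) n
        (fun i => contRR_mul _ _ (contRR_const _) (CW i (n - i)%nat)))).
      rewrite (Cmult_comm c), sum_n_scal_C. apply sum_n_ext. intros i.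
      rewrite II_scal by apply CW. unfold a.
      match goal with |- ?a = ?b => change (@eq C a b) end. ring.
    - intros t s. unfold hsum. rewrite sum_n_scal_C. apply sum_n_ext. intros i.
      rewrite !Cpow_mult_l.
      match goal with |- ?a = ?b => change (@eq C a b) end. ring. }
  assert (CH : forall n, contRR (fun t s => hsum (xi * u t) (et * u s) n * F t s)).
  { intros n. apply contRR_mul; [|exact CF].
    apply (proj1 (II_sum (fun i t s => (xi * u t) ^ i * (et * u s) ^ (n - i)) n
      (fun i => contRR_mul _ _
        (contRR_fst _ (contR_pow _ i (contR_mul _ _ (contR_const xi) Cu)))
        (contRR_snd _ (contR_pow _ (n - i) (contR_mul _ _ (contR_const et) Cu)))))). }
  assert (PART : forall N, sum_n (fun n => sum_n (fun i => a i (n - i)%nat * xi ^ i * et ^ (n - i)) n) N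
     = c * II (fun t s => sum_n (hsum (xi * u t) (et * u s)) N * F t s)).
  { intros N. rewrite (sum_n_ext _ _ N TERM).
    rewrite (II_ext _ (fun t s => sum_n (fun n => hsum (xi * u t) (et * u s) n * F t s) N))
      by (intros; apply sum_n_scal_C).
    rewrite (proj2 (II_sum (fun n t s => hsum (xi * u t) (et * u s) n * F t s) N CH)).
    rewrite (Cmult_comm c), sum_n_scal_C. apply sum_n_ext. intros n.
    exact (Cmult_comm _ _). }
  assert (CP : forall N, contRR (fun t s => sum_n (hsum (xi * u t) (et * u s)) N * F t s)).
  { intros N. replace (fun t s => sum_n (hsum (xi * u t) (et * u s)) N * F t s)
      with (fun t s => sum_n (fun n => hsum (xi * u t) (et * u s) n * F t s) N).
    - apply (proj1 (II_sum (fun n t s => hsum (xi * u t) (et * u s) n * F t s) N CH)).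
    - apply functional_extensionality. intros t. apply functional_extensionality. intros s.
      now rewrite sum_n_scal_C. }
  assert (CK : contRR (fun t s => ker rho xi t * ker rho et s * F t s)).
  { apply contRR_mul; [|exact CF].
    apply contRR_mul; [apply contRR_fst|apply contRR_snd]; now apply contR_ker. }
  assert (M0 : (0 <= M)%R) by (eapply Rle_trans; [apply Cmod_ge_0|apply (MF 0%R 0%R)]).
  set (K := (4 * (3 / ((1 - q) * (1 - q))) * M)%R).
  assert (ERR : forall N, (Cmod (sum_n (fun n => sum_n (fun i => a i (n - i)%nat * xi ^ i * et ^ (n - i))%C n) N
      - f (x, y)) <= K * (INR (S N) * q ^ N))%R).
  { intros N. rewrite PART, FORM, Cmod_minus_sym.
    replace (c * II (fun t s => ker rho xi t * ker rho et s * F t s) -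
      c * II (fun t s => sum_n (hsum (xi * u t) (et * u s)) N * F t s))
      with (c * II (fun t s => ker rho xi t * ker rho et s * F t s -
         sum_n (hsum (xi * u t) (et * u s)) N * F t s)) by (rewrite II_sub; auto; ring).
    rewrite Cmod_mult, Cm.
    assert (B : (Cmod (II (fun t s => (ker rho xi t * ker rho et s * F t s -
         sum_n (hsum (xi * u t) (et * u s)) N * F t s)%C))
         <= 16 * (PI * PI) * (3 / ((1 - q) * (1 - q)) * (INR (S N) * q ^ N) * M))%R).
    { apply II_le; [now apply contRR_sub|]. intros t s.
      replace (ker rho xi t * ker rho et s * F t s - sum_n (hsum (xi * u t) (et * u s)) N * F t s)
        with ((ker rho xi t * ker rho et s - sum_n (hsum (xi * u t) (et * u s)) N) * F t s) by ring.
      rewrite Cmod_mult, !Kx by assumption. apply Rmult_le_compat; try apply Cmod_ge_0; auto.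
      now apply hsum_remainder. }
    eapply Rle_trans; [apply Rmult_le_compat_l; [|exact B]|].
    - left. apply Rinv_0_lt_compat. nra.
    - right. unfold K. field. repeat split; lra. }
  assert (LIM : is_lim_seq (fun N => (K * (INR (S N) * q ^ N))%R) 0%R).
  (* At the centre [q = 0], which [ex_series_nq] excludes; the terms then vanish from [N = 1] on. *)
  { destruct (Req_dec q 0) as [E|NE].
    - apply is_lim_seq_ext_loc with (fun _ => 0%R); [|apply is_lim_seq_const].
      exists 1%nat. intros n Hn. rewrite E. rewrite pow_i by lia. ring.
    - apply ex_series_lim_0. apply ex_series_nq. lra. }
  apply (proj2 (filterlim_Clim eventually _ _)). intros e He.
  apply is_lim_seq_spec in LIM. destruct (LIM (mkposreal e He)) as [N HN].
  exists N. intros n Hn. specialize (HN n Hn). simpl in HN.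
  eapply Rle_lt_trans; [apply ERR|]. eapply Rle_lt_trans; [|exact HN].
  rewrite Rminus_0_r. apply Rle_abs.
Qed.

(** Near [p] the function is holomorphic and, by continuity, bounded by [Cmod (f p) + 1], which is
    all that [cauchy_expansion] asks for. *)
Lemma hol2_analytic2 f p : hol2 f p -> analytic2_at f p.
Proof.
  intros H. assert (C1 := hol2_cont _ _ H 1%R Rlt_0_1).
  destruct (locally_dst_and _ _ _ (hol2_open _ _ H) C1) as (r & Hr & L).
  assert (B : forall q, (Cmod (fst q - fst p) < r / 2)%R -> (Cmod (snd q - snd p) < r / 2)%R ->
    (dst p q < r)%R) by (intros q H1 H2; unfold dst; lra).
  destruct (cauchy_expansion f p (r / 2) (r / 4) (Cmod (f p) + 1)) as (a & Ha & Hs).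
  - lra.
  - intros q H1 H2. now apply L, B.
  - intros q H1 H2. destruct (L q (B q H1 H2)) as [_ L1].
    replace (f q) with (f p + (f q - f p)) by ring.
    eapply Rle_trans; [apply Cmod_triangle|]. lra.
  - exists a, (r / 4)%R, (4 * (Cmod (f p) + 1))%R. split; [lra|]. now split.
Qed.

Lemma analytic2_hol2_iff f p : analytic2_at f p <-> hol2 f p.
Proof. split; [apply analytic2_hol2|apply hol2_analytic2]. Qed.

(** * Holomorphic functions of one variable, treated as functions of two with a dummy second
    variable *)

Definition hol1 (f : C -> C) (z : C) : Prop := hol2 (fun q => f (fst q)) (z, RtoC 0).

Lemma hol2_of_hol1 (F : C -> C) (f : C * C -> C) p :
  hol1 F (f p) -> hol2 f p -> hol2 (fun q => F (f q)) p.
Proof.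
  intros HF Hf. apply (hol2_pair (fun q => F (fst q)) f (fun _ => RtoC 0)); auto.
  apply hol2_const.
Qed.

Lemma hol1_hol2_fst F p : hol1 F (fst p) -> hol2 (fun q => F (fst q)) p.
Proof. intros H. apply hol2_of_hol1; [easy|apply hol2_fst]. Qed.

Lemma hol1_of_hol2 (f : C * C -> C) (g h : C -> C) (z : C) :
  hol2 f (g z, h z) -> hol1 g z -> hol1 h z -> hol1 (fun t => f (g t, h t)) z.
Proof. intros Hf Hg Hh. apply (hol2_pair f (fun q => g (fst q)) (fun q => h (fst q))); auto. Qed.

Lemma hol1_comp (F g : C -> C) (z : C) : hol1 F (g z) -> hol1 g z -> hol1 (fun t => F (g t)) z.
Proof. intros HF Hg. apply (hol2_of_hol1 F (fun q => g (fst q))); auto. Qed.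

Lemma hol1_const c z : hol1 (fun _ => c) z.
Proof. apply hol2_const. Qed.

Lemma hol1_id z : hol1 (fun t => t) z.
Proof. apply hol2_fst. Qed.

Lemma hol1_add f g z : hol1 f z -> hol1 g z -> hol1 (fun t => f t + g t) z.
Proof. apply hol2_add. Qed.

Lemma hol1_sub f g z : hol1 f z -> hol1 g z -> hol1 (fun t => f t - g t) z.
Proof. apply hol2_sub. Qed.

Lemma hol1_mul f g z : hol1 f z -> hol1 g z -> hol1 (fun t => f t * g t) z.
Proof. apply hol2_mul. Qed.

Lemma hol1_opp f z : hol1 f z -> hol1 (fun t => - f t) z.
Proof. apply hol2_opp. Qed.

Lemma hol1_pow f n z : hol1 f z -> hol1 (fun t => f t ^ n) z.
Proof. apply hol2_pow. Qed.

Lemma hol1_inv f z : hol1 f z -> f z <> 0 -> hol1 (fun t => / f t) z.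
Proof. intros H N. now apply hol2_inv. Qed.

Lemma hol1_div f g z : hol1 f z -> hol1 g z -> g z <> 0 -> hol1 (fun t => f t / g t) z.
Proof. intros H H' N. now apply hol2_div. Qed.

Lemma locally_dst_fst (z : C) (P : C -> Prop) :
  locally_dst (z, RtoC 0) (fun q => P (fst q)) <-> locally z P.
Proof.
  rewrite locally_Cmod. split; intros [r [Hr H]]; exists r; (split; [easy|]).
  - intros y Hy. apply (H (y, RtoC 0)). unfold dst. simpl. rewrite Cmod_minus_0. lra.
  - intros q Hq. apply H. pose proof (dst_fst (z, RtoC 0) q). simpl in *. lra.
Qed.

Lemma hol1_ext (f g : C -> C) (z : C) : locally z (fun t => f t = g t) -> hol1 f z -> hol1 g z.
Proof. intros E. apply hol2_ext. exact (proj2 (locally_dst_fst z (fun t => f t = g t)) E). Qed.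

Lemma hol1_open f (z : C) : hol1 f z -> locally z (hol1 f).
Proof.
  intros H. apply (proj1 (locally_dst_fst z (hol1 f))). apply hol2_open in H. revert H. apply locally_dst_imp.
  intros q Hq. apply (hol2_pair (fun q => f (fst q)) fst (fun _ => snd q) (fst q, RtoC 0)).
  - simpl. now rewrite <- surjective_pairing.
  - apply hol2_fst.
  - apply hol2_const.
Qed.

Lemma hol1_derive f (z : C) : hol1 f z -> exists l, is_derive f z l.
Proof.
  intros H. destruct (hol2_D2 _ _ H) as (a & b & D). exists a.
  apply (D2_is_derive_fst _ _ _ _ D).
Qed.

Lemma hol1_Clim f (z : C) : hol1 f z -> Clim (locally z) f (f z).
Proof. intros H. destruct (hol1_derive f z H) as [l D]. now apply is_derive_Clim in D. Qed.

Lemma is_derive_C_unique (f : C -> C) (z l m : C) : is_derive f z l -> is_derive f z m -> l = m.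
Proof.
  intros H1 H2. apply (is_derive_D2 f (z, RtoC 0)) in H1, H2.
  apply (D2_unique _ _ _ _ _ _ H1 H2).
Qed.

Lemma sum_n_single (t : nat -> C) n : (forall i, (i < n)%nat -> t i = 0) -> sum_n t n = t n.
Proof.
  destruct n as [|n]; intros H; [apply sum_O|].
  rewrite sum_Sn. change (sum_n t n + t (S n) = t (S n)).
  assert (E : sum_n t n = RtoC 0).
  { clear - H. induction n as [|n IH]; [rewrite sum_O; apply H; lia|].
    rewrite sum_Sn. change (sum_n t n + t (S n) = RtoC 0). rewrite IH by auto.
    rewrite H by lia. ring. }
  rewrite E. ring.
Qed.

Lemma Cpow_0 n : (0 < n)%nat -> 0 ^ n = 0.
Proof. destruct n; [lia|]. intros _. simpl. ring. Qed.

Lemma is_series_bounded (u : nat -> C) U : is_series u U -> exists M, forall n, (Cmod (u n) <= M)%R.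
Proof.
  intros H.
  destruct (filterlim_bounded (V := C_NormedModule) (sum_n u) (ex_intro _ U H)) as [M HM].
  change (forall n, (Cmod (sum_n u n) <= M)%R) in HM.
  exists (M + M)%R. intros [|n].
  - pose proof (HM O) as H0. rewrite sum_O in H0. pose proof (Cmod_ge_0 (u O)). lra.
  - replace (u (S n)) with (sum_n u (S n) - sum_n u n).
    + eapply Rle_trans; [apply Cmod_triangle_minus|]. apply Rplus_le_compat; apply HM.
    + rewrite sum_Sn. change (sum_n u n + u (S n) - sum_n u n = u (S n)). ring.
Qed.

Lemma is_series_first (u : nat -> C) : (forall n, u (S n) = 0) -> is_series u (u O).
Proof.
  intros H. apply (proj2 (filterlim_Clim eventually _ _)). intros e He. exists O. intros n _.
  assert (E : @sum_n (NormedModule.AbelianMonoid C_AbsRing C_NormedModule) u n = u O).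
  { induction n as [|n IH]; [apply sum_O|]. rewrite sum_Sn, IH, H.
    change (u O + 0 = u O). ring. }
  rewrite E. now rewrite Cmod_minus_0.
Qed.

Lemma is_series_C_unique (u : nat -> C) U V : is_series u U -> is_series u V -> U = V.
Proof.
  intros H1 H2. apply (proj1 (filterlim_Clim eventually _ _)) in H1, H2.
  apply (Clim_unique _ _ _ H1 H2).
Qed.

Lemma analytic1_hol1 f (z : C) : analytic1_at f z -> hol1 f z.
Proof.
  intros (a & r & Hr & H). apply analytic2_hol2.
  (* Convergence at the point [z + r / 2] bounds the numbers [a i (r / 2) ^ i], the coefficient
     bound demanded by [analytic2_at]. *)
  assert (Hh : (Cmod (z + RtoC (r / 2) - z) < r)%R).
  { replace (z + RtoC (r / 2) - z) with (RtoC (r / 2)) by ring.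
    rewrite Cmod_R, Rabs_pos_eq; lra. }
  destruct (is_series_bounded _ _ (H _ Hh)) as [M HM].
  exists (fun i j => match j with O => a i | _ => RtoC 0 end), (r / 2)%R, M.
  split; [lra|split].
  - intros i j. destruct j as [|j].
    + specialize (HM i). replace (z + RtoC (r / 2) - z) with (RtoC (r / 2)) in HM by ring.
      rewrite Cmod_mult, Cmod_pow, Cmod_R, Rabs_pos_eq in HM by lra.
      now rewrite Nat.add_0_r.
    + rewrite Cmod_0, Rmult_0_l. eapply Rle_trans; [apply Cmod_ge_0|apply (HM O)].
  - intros x y Hx Hy. simpl in *.
    apply (is_series_ext (fun n => a n * (x - z) ^ n)); [|apply H; lra].
    intros n. rewrite sum_n_single.
    + rewrite Nat.sub_diag. simpl.
      match goal with |- ?a = ?b => change (@eq C a b) end. ring.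
    + intros i Hi. destruct (n - i)%nat eqn:E; [lia|]. ring.
Qed.

Lemma hol1_series (f : C -> C) (z : C) a r :
  (0 < r)%R ->
  (forall x y, (Cmod (x - z) < r)%R -> (Cmod (y - 0) < r)%R ->
    is_series (fun n => sum_n (fun i => a i (n - i)%nat * (x - z) ^ i * (y - 0) ^ (n - i)) n) (f x)) ->
  forall x, (Cmod (x - z) < r)%R -> is_series (fun n => a n O * (x - z) ^ n) (f x).
Proof.
  intros Hr H x Hx. assert (H0 : (Cmod (0 - 0) < r)%R) by now rewrite Cmod_minus_0.
  refine (is_series_ext _ _ _ _ (H x 0 Hx H0)). intros n.
  rewrite sum_n_single.
  - rewrite Nat.sub_diag. simpl.
    match goal with |- ?a = ?b => change (@eq C a b) end. ring.
  - intros i Hi. replace (0 - 0) with (RtoC 0) by ring. rewrite Cpow_0 by lia. ring.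
Qed.

Lemma hol1_analytic1 f (z : C) : hol1 f z -> analytic1_at f z.
Proof.
  intros H. apply hol2_analytic2 in H. destruct H as (a & r & M & Hr & _ & H).
  exists (fun n => a n O), r. split; [easy|]. now apply hol1_series.
Qed.

Lemma analytic1_hol1_iff f (z : C) : analytic1_at f z <-> hol1 f z.
Proof. split; [apply analytic1_hol1|apply hol1_analytic1]. Qed.

(** * Zeros, poles and the identity theorem in one variable *)

(** Division by the power shifts the coefficients by [k]. The value [a k] at the centre, where the
    quotient is 0/0, makes the shifted series converge to [g] there as well. *)
Lemma series_factor (f : C -> C) (z : C) a r k : (0 < r)%R ->
  (forall x, (Cmod (x - z) < r)%R -> is_series (fun n => a n * (x - z) ^ n) (f x)) ->
  (forall i, (i < k)%nat -> a i = 0) ->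
  exists g, hol1 g z /\ g z = a k /\
    forall x, (Cmod (x - z) < r)%R -> f x = (x - z) ^ k * g x.
Proof.
  intros Hr H Ha.
  set (g := fun x => if excluded_middle_informative (x = z) then a k else f x / (x - z) ^ k).
  assert (Gz : g z = a k).
  { unfold g. now destruct (excluded_middle_informative (z = z)). }
  exists g. split; [|split].
  - apply analytic1_hol1. exists (fun n => a (k + n)%nat), r. split; [easy|].
    intros x Hx. unfold g. destruct (excluded_middle_informative (x = z)) as [->|N].
    + replace (a k) with (a (k + 0)%nat * (z - z) ^ 0) by (rewrite Nat.add_0_r; simpl; ring).
      apply (is_series_first (fun n => a (k + n)%nat * (z - z) ^ n)).
      intros n. replace (z - z) with (RtoC 0) by ring. rewrite Cpow_0 by lia. ring.
    + assert (N' : x - z <> 0) by now apply Cminus_eq_contra.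
      assert (NP : (x - z) ^ k <> 0) by now apply Cpow_nz.
      assert (S1 : is_series (fun n => a (k + n)%nat * (x - z) ^ (k + n)) (f x)).
      { destruct k as [|k]; [now apply H|].
        pose proof (is_series_incr_n (V := C_NormedModule) (fun n => a n * (x - z) ^ n) (S k) (f x) ltac:(lia)) as D.
        assert (Z : sum_n (fun n => a n * (x - z) ^ n) (pred (S k)) = RtoC 0).
        { simpl pred. rewrite sum_n_single.
          - rewrite Ha by lia. exact (Cmult_0_l _).
          - intros i Hi. rewrite Ha by lia. exact (Cmult_0_l _). }
        apply D. replace (plus _ _) with (f x); [now apply H|].
        change (f x = f x + sum_n (fun n => a n * (x - z) ^ n) (pred (S k))).
        etransitivity; [|apply f_equal; symmetry; exact Z]. ring. }
      replace (f x / (x - z) ^ k) with (/ (x - z) ^ k * f x) by (unfold Cdiv; ring).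
      refine (is_series_ext _ _ _ _ (is_series_scal (V := C_NormedModule) (/ (x - z) ^ k) _ _ S1)).
      intros n. change (/ (x - z) ^ k * (a (k + n)%nat * (x - z) ^ (k + n)) = a (k + n)%nat * (x - z) ^ n).
      rewrite Cpow_add_r. field. exact NP.
  - exact Gz.
  - intros x Hx. unfold g. destruct (excluded_middle_informative (x = z)) as [->|N].
    + assert (E : f z = a O).
      { apply (is_series_C_unique _ _ _ (H z Hx)).
        replace (a O) with (a O * (z - z) ^ 0) by (simpl; ring).
        apply (is_series_first (fun n => a n * (z - z) ^ n)).
        intros n. replace (z - z) with (RtoC 0) by ring. rewrite Cpow_0 by lia. ring. }
      replace (z - z) with (RtoC 0) by ring. destruct k as [|k].
      * rewrite E. simpl. ring.
      * rewrite E, Ha by lia. rewrite Cpow_0 by lia. ring.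
    + assert (N' : x - z <> 0) by now apply Cminus_eq_contra.
      field. now apply Cpow_nz.
Qed.

Lemma zero_order f (z : C) : hol1 f z ->
  locally z (fun t => f t = 0) \/
  exists k g, hol1 g z /\ g z <> 0 /\ locally z (fun t => f t = (t - z) ^ k * g t).
Proof.
  intros H. apply hol1_analytic1 in H. destruct H as (a & r & Hr & H).
  destruct (classic (forall n, a n = 0)) as [A|A].
  - left. apply locally_Cmod. exists r. split; [easy|]. intros y Hy.
    apply (is_series_C_unique _ _ _ (H y Hy)).
    replace (RtoC 0) with (a O * (y - z) ^ 0) by (rewrite A; ring).
    apply (is_series_first (fun n => a n * (y - z) ^ n)). intros n. rewrite A. ring.
  - right. apply not_all_ex_not in A.
    destruct (dec_inh_nat_subset_has_unique_least_element (fun n => a n <> 0)) as [k [[Hk Hm] _]].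
    { intros n. destruct (Ceq_dec (a n) 0); tauto. }
    { exact A. }
    destruct (series_factor f z a r k Hr H) as (g & Hg & Gz & E).
    { intros i Hi. apply NNPP. intros N. specialize (Hm i N). lia. }
    exists k, g. split; [easy|split; [now rewrite Gz|]].
    apply locally_Cmod. eauto.
Qed.

(** * Punctured neighbourhoods and meromorphic germs *)

Lemma locally'_Cmod (z : C) (P : C -> Prop) :
  locally' z P <-> exists r, (0 < r)%R /\ forall y, (Cmod (y - z) < r)%R -> y <> z -> P y.
Proof.
  unfold locally', within. rewrite locally_Cmod. easy.
Qed.

(** Properness yields uniqueness of punctured limits, and a point in any finite intersection of
    punctured neighbourhoods; generic points are picked this way. *)
Global Instance locally'_C_proper (z : C) : ProperFilter (locally' z).
Proof.
  constructor.
  - intros P HP. apply locally'_Cmod in HP. destruct HP as (r & Hr & H).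
    exists (z + RtoC (r / 2)). apply H.
    + replace (z + RtoC (r / 2) - z) with (RtoC (r / 2)) by ring.
      rewrite Cmod_R, Rabs_pos_eq; lra.
    + intros E. assert (E' : RtoC (r / 2) = 0).
      { replace (RtoC (r / 2)) with (z + RtoC (r / 2) - z) by ring. rewrite E. ring. }
      apply RtoC_inj in E'. lra.
  - apply locally'_filter.
Qed.

Lemma locally_locally' (z : C) P : locally z P -> locally' z P.
Proof. unfold locally', within. apply filter_imp. auto. Qed.

Lemma locally'_ne (z : C) : locally' z (fun y => y <> z).
Proof. apply locally'_Cmod. exists 1%R. split; [lra|auto]. Qed.

Lemma locally'_locally (z : C) P : locally' z P -> locally' z (fun y => locally y P).
Proof.
  intros H. apply locally'_Cmod in H. destruct H as (r & Hr & H).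
  apply locally'_Cmod. exists r. split; [easy|]. intros y Hy N.
  assert (D : (0 < Rmin (r - Cmod (y - z)) (Cmod (y - z)))%R).
  { apply Rmin_glb_lt; [lra|]. apply Cmod_gt_0. now apply Cminus_eq_contra. }
  apply locally_Cmod. exists (Rmin (r - Cmod (y - z)) (Cmod (y - z))). split; [easy|].
  intros u Hu. pose proof (Rmin_l (r - Cmod (y - z)) (Cmod (y - z))).
  pose proof (Rmin_r (r - Cmod (y - z)) (Cmod (y - z))). apply H.
  - pose proof (Cmod_triangle_3 u y z). lra.
  - intros ->. rewrite Cmod_minus_sym in Hu. lra.
Qed.

(** Only the germ off [z] counts. Thus sums, products and substitutions stay in the class whatever
    the junk value at [z], which fails for [meromorphic1]. *)
Definition merop (f : C -> C) (z : C) : Prop :=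
  exists n g, hol1 g z /\ locally' z (fun t => f t = g t / (t - z) ^ n).

Lemma locally'_pow_nz (z : C) n : locally' z (fun t => (t - z) ^ n <> 0).
Proof.
  generalize (locally'_ne z). apply filter_imp. intros y N. apply Cpow_nz.
  now apply Cminus_eq_contra.
Qed.

Lemma merop_ext f g (z : C) : locally' z (fun t => f t = g t) -> merop f z -> merop g z.
Proof.
  intros E (n & h & Hh & H). exists n, h. split; [easy|].
  generalize (filter_and _ _ E H). apply filter_imp. now intros t [<- ->].
Qed.

Lemma merop_hol1 f (z : C) : hol1 f z -> merop f z.
Proof.
  intros H. exists O, f. split; [easy|]. apply filter_forall. intros t. simpl. field.
Qed.

Lemma hol1_shift (z w : C) : hol1 (fun t => t - z) w.
Proof. apply hol1_sub; [apply hol1_id|apply hol1_const]. Qed.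

Lemma merop_add f g (z : C) : merop f z -> merop g z -> merop (fun t => f t + g t) z.
Proof.
  intros (n & f1 & Hf & Ef) (m & g1 & Hg & Eg).
  exists (n + m)%nat, (fun t => f1 t * (t - z) ^ m + g1 t * (t - z) ^ n). split.
  - apply hol1_add; apply hol1_mul; auto; apply hol1_pow, hol1_shift.
  - generalize (filter_and _ _ (filter_and _ _ Ef Eg)
      (filter_and _ _ (locally'_pow_nz z n) (locally'_pow_nz z m))).
    apply filter_imp. intros t [[-> ->] [N M]]. rewrite Cpow_add_r. field. auto.
Qed.

Lemma merop_mul f g (z : C) : merop f z -> merop g z -> merop (fun t => f t * g t) z.
Proof.
  intros (n & f1 & Hf & Ef) (m & g1 & Hg & Eg).
  exists (n + m)%nat, (fun t => f1 t * g1 t). split.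
  - now apply hol1_mul.
  - generalize (filter_and _ _ (filter_and _ _ Ef Eg)
      (filter_and _ _ (locally'_pow_nz z n) (locally'_pow_nz z m))).
    apply filter_imp. intros t [[-> ->] [N M]]. rewrite Cpow_add_r. field. auto.
Qed.

Lemma merop_const c (z : C) : merop (fun _ => c) z.
Proof. apply merop_hol1, hol1_const. Qed.

Lemma merop_opp f (z : C) : merop f z -> merop (fun t => - f t) z.
Proof.
  intros H. apply (merop_ext (fun t => - (1) * f t)).
  - apply filter_forall. intros; ring.
  - apply merop_mul; [apply merop_const|easy].
Qed.

Lemma merop_sub f g (z : C) : merop f z -> merop g z -> merop (fun t => f t - g t) z.
Proof. intros H1 H2. apply merop_add; [easy|now apply merop_opp]. Qed.

Lemma merop_pow f n (z : C) : merop f z -> merop (fun t => f t ^ n) z.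
Proof. intros H. induction n; simpl; [apply merop_const|now apply merop_mul]. Qed.

Lemma merop_cases f (z : C) : merop f z ->
  locally' z (fun t => f t = 0) \/
  exists n k g, hol1 g z /\ g z <> 0 /\ locally' z (fun t => f t = (t - z) ^ k * g t / (t - z) ^ n).
Proof.
  intros (n & g & Hg & E). destruct (zero_order g z Hg) as [Z|(k & h & Hh & N & F)].
  - left. generalize (filter_and _ _ E (locally_locally' _ _ Z)). apply filter_imp.
    intros t [-> ->]. unfold Cdiv. ring.
  - right. exists n, k, h. split; [easy|split; [easy|]].
    generalize (filter_and _ _ E (locally_locally' _ _ F)). apply filter_imp.
    now intros t [-> ->].
Qed.

Lemma locally_nz f (z : C) : hol1 f z -> f z <> 0 -> locally z (fun t => f t <> 0).
Proof. intros H N. apply (Clim_nz f (f z)); [now apply hol1_Clim|easy]. Qed.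

Lemma merop_dichotomy f (z : C) : merop f z ->
  locally' z (fun t => f t = 0) \/ locally' z (fun t => f t <> 0).
Proof.
  intros H. destruct (merop_cases f z H) as [Z|(n & k & g & Hg & N & E)]; [now left|].
  right. generalize (filter_and _ _ (filter_and _ _ E (locally_locally' _ _ (locally_nz g z Hg N)))
    (filter_and _ _ (locally'_pow_nz z n) (locally'_pow_nz z k))).
  apply filter_imp. intros t [[-> Ng] [Nn Nk]] E0.
  apply Ng. replace (g t) with ((t - z) ^ k * g t / (t - z) ^ n * ((t - z) ^ n / (t - z) ^ k))
    by (field; auto).
  rewrite E0. ring.
Qed.

Lemma merop_hol1_near f (z : C) : merop f z -> locally' z (hol1 f).
Proof.
  intros (n & g & Hg & E).
  generalize (filter_and _ _ (locally'_locally _ _ E)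
    (filter_and _ _ (locally_locally' _ _ (hol1_open _ _ Hg)) (locally'_pow_nz z n))).
  apply filter_imp. intros t [Et [Gt Nt]].
  apply (hol1_ext (fun t => g t / (t - z) ^ n)).
  - revert Et. apply filter_imp. auto.
  - apply hol1_div; auto. apply hol1_pow, hol1_shift.
Qed.

Lemma locally'_affine (c d z : C) P : c <> 0 ->
  locally' (c * z + d) P -> locally' z (fun t => P (c * t + d)).
Proof.
  intros Hc H. apply locally'_Cmod in H. destruct H as (r & Hr & H).
  assert (Hc' : (0 < Cmod c)%R) by now apply Cmod_gt_0.
  apply locally'_Cmod. exists (r / Cmod c)%R. split; [now apply Rdiv_lt_0_compat|].
  intros y Hy N. assert (E : c * y + d - (c * z + d) = c * (y - z)) by ring.
  apply H.
  - rewrite E, Cmod_mult.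
    apply Rlt_le_trans with (Cmod c * (r / Cmod c))%R; [now apply Rmult_lt_compat_l|].
    right. field. lra.
  - intros E2. rewrite E2 in E.
    assert (Z : c * (y - z) <> 0).
    { apply Cmult_neq_0; [easy|]. now apply Cminus_eq_contra. }
    apply Z. rewrite <- E. ring.
Qed.

Lemma merop_affine f (c d z : C) : c <> 0 -> merop f (c * z + d) -> merop (fun t => f (c * t + d)) z.
Proof.
  intros Hc (n & g & Hg & E). exists n, (fun t => g (c * t + d) / c ^ n). split.
  - apply hol1_div; [|apply hol1_const|now apply Cpow_nz].
    apply (hol1_comp g (fun t => c * t + d)); [easy|].
    apply hol1_add; [apply hol1_mul; [apply hol1_const|apply hol1_id]|apply hol1_const].
  - generalize (filter_and _ _ (locally'_affine c d z _ Hc E) (locally'_pow_nz z n)).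
    apply filter_imp. intros t [-> N].
    replace (c * t + d - (c * z + d)) with (c * (t - z)) by ring.
    rewrite Cpow_mult_l. field. split; auto using Cpow_nz.
Qed.

(** Connectedness of the unit interval: a property which is locally either always true or always
    false cannot change at the supremum of the initial interval on which it holds. *)
Lemma interval_induction (Q : R -> Prop) :
  (forall t, (0 <= t <= 1)%R -> exists d, (0 < d)%R /\
     ((forall s, (Rabs (s - t) < d)%R -> Q s) \/ (forall s, (Rabs (s - t) < d)%R -> ~ Q s))) ->
  Q 0%R -> Q 1%R.
Proof.
  intros H Q0.
  set (E := fun t => (0 <= t <= 1)%R /\ forall s, (0 <= s <= t)%R -> Q s).
  assert (E0 : E 0%R).
  { split; [lra|]. intros s Hs. replace s with 0%R by lra. easy. }
  destruct (completeness E) as [m [U L]].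
  { exists 1%R. intros t [Ht _]. lra. }
  { now exists 0%R. }
  assert (M : (0 <= m <= 1)%R).
  { split; [now apply U|]. apply L. intros t [Ht _]. lra. }
  destruct (H m M) as (d & Hd & [A|A]).
  - assert (B : forall s, (0 <= s < m + d)%R -> Q s).
    { intros s Hs. destruct (Rlt_dec (m - d) s) as [H1|H1].
      - apply A. apply Rabs_def1; lra.
      - assert (X : ~ is_upper_bound E (m - d / 2)).
        { intros X. apply L in X. lra. }
        apply not_all_ex_not in X. destruct X as [t X]. apply imply_to_and in X.
        destruct X as [[T1 T2] T3]. apply T2. lra. }
    destruct (Rle_dec (m + d / 2) 1) as [H1|H1].
    + assert (EE : E (m + d / 2)%R).
      { split; [lra|]. intros s Hs. apply B. lra. }
      apply U in EE. lra.
    + apply B. lra.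
  - exfalso. assert (X : is_upper_bound E (m - d / 2)).
    { intros t [Ht Qt]. destruct (Rle_dec t (m - d / 2)) as [|N]; [easy|].
      exfalso. apply (A t).
      - assert (t <= m)%R by now apply U. apply Rabs_def1; lra.
      - apply Qt. lra. }
    apply L in X. lra.
Qed.

(** By [merop_dichotomy] the property of vanishing near a point of the segment is locally constant.
    Requiring the germs on a segment only lets it serve for functions defined on a ball. *)
Lemma merop_identity_segment f (z1 z : C) :
  (forall t : R, (0 <= t <= 1)%R -> merop f (z1 + RtoC t * (z - z1))) ->
  locally' z1 (fun t => f t = 0) -> locally' z (fun t => f t = 0).
Proof.
  intros Hf H1.
  set (c := fun t : R => z1 + RtoC t * (z - z1)).
  set (Q := fun t : R => locally' (c t) (fun t => f t = 0)).
  replace z with (c 1%R) by (unfold c; ring).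
  apply (interval_induction Q).
  - intros t Ht.
    assert (D : forall r, (0 < r)%R -> exists d, (0 < d)%R /\ forall s, (Rabs (s - t) < d)%R ->
       (Cmod (c s - c t) < r)%R).
    { intros r Hr. pose proof (Cmod_ge_0 (z - z1)) as G.
      exists (r / (Cmod (z - z1) + 1))%R. split; [apply Rdiv_lt_0_compat; lra|].
      intros s Hs. unfold c.
      replace (z1 + RtoC s * (z - z1) - (z1 + RtoC t * (z - z1))) with (RtoC (s - t) * (z - z1))
        by (rewrite RtoC_minus; ring).
      rewrite Cmod_mult, Cmod_R.
      apply Rle_lt_trans with (Rabs (s - t) * (Cmod (z - z1) + 1))%R.
      - apply Rmult_le_compat_l; [apply Rabs_pos|lra].
      - now apply Rlt_div_r in Hs; [|lra]. }
    destruct (merop_dichotomy f (c t) (Hf t Ht)) as [Z|NZ].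
    + destruct (proj1 (locally'_Cmod _ _) (filter_and _ _ Z (locally'_locally _ _ Z))) as (r & Hr & L).
      destruct (D r Hr) as (d & Hd & Ld). exists d. split; [easy|]. left. intros s Hs.
      unfold Q. destruct (classic (c s = c t)) as [->|N]; [easy|].
      apply locally_locally'. now apply L, N; apply Ld.
    + destruct (proj1 (locally'_Cmod _ _) (filter_and _ _ NZ (locally'_locally _ _ NZ))) as (r & Hr & L).
      destruct (D r Hr) as (d & Hd & Ld). exists d. split; [easy|]. right. intros s Hs Qs.
      assert (NN : locally' (c s) (fun t => f t <> 0)).
      { destruct (classic (c s = c t)) as [->|N]; [easy|].
        apply locally_locally'. now apply L, N; apply Ld. }
      destruct (filter_ex _ (filter_and _ _ Qs NN)) as [y [E1 E2]]. easy.
  - unfold Q. now replace (c 0%R) with z1 by (unfold c; ring).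
Qed.

Lemma merop_identity f (z1 : C) : (forall z, merop f z) -> locally' z1 (fun t => f t = 0) ->
  forall z : C, locally' z (fun t => f t = 0).
Proof. intros Hf H z. now apply (merop_identity_segment f z1 z). Qed.

Lemma hol1_zero_punctured f (z : C) : hol1 f z -> locally' z (fun t => f t = 0) -> f z = 0.
Proof.
  intros H L. apply (Clim_unique (F := locally' z) f).
  - intros e He. apply locally_locally'. now apply hol1_Clim.
  - intros e He. revert L. apply filter_imp. intros t ->. now rewrite Cmod_minus_0.
Qed.

Lemma meromorphic1_merop f (z : C) : meromorphic1 f -> merop f z.
Proof.
  intros H. destruct (H z) as [(g & h & Hg & Hh & N & E) _].
  apply analytic1_hol1 in Hg, Hh.
  destruct (zero_order h z Hh) as [Z|(k & h1 & Hh1 & N1 & F)]; [easy|].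
  exists k, (fun t => g t / h1 t). split; [now apply hol1_div|].
  generalize (filter_and _ _ (filter_and _ _ (locally_locally' _ _ E) (locally_locally' _ _ F))
    (filter_and _ _ (locally'_pow_nz z k) (locally_locally' _ _ (locally_nz h1 z Hh1 N1)))).
  apply filter_imp. intros t [[E1 F1] [N2 N3]]. rewrite E1.
  - rewrite F1. field. auto.
  - rewrite F1. now apply Cmult_neq_0.
Qed.

Lemma meromorphic1_removable f g (z : C) :
  meromorphic1 f -> hol1 g z -> locally' z (fun t => f t = g t) -> hol1 f z.
Proof.
  intros H Hg E. apply analytic1_hol1. destruct (H z) as [_ R].
  (* The thin set off which [f] and [g] agree is the point [z] itself, cut out by [t - z]. *)
  apply (R g (fun t => t - z)).
  - now apply hol1_analytic1.
  - apply hol1_analytic1, hol1_shift.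
  - intros L. apply locally_locally' in L.
    destruct (filter_ex _ (filter_and _ _ L (locally'_ne z))) as [y [E1 N]].
    now apply Cminus_eq_contra in N.
  - apply locally'_Cmod in E. destruct E as (r & Hr & E). apply locally_Cmod.
    exists r. split; [easy|]. intros y Hy N. apply E; [easy|]. intros ->. apply N. ring.
Qed.

Lemma meromorphic1_cases f (z : C) : meromorphic1 f ->
  hol1 f z \/
  exists k g, hol1 g z /\ g z <> 0 /\ locally' z (fun t => f t = g t / (t - z) ^ S k).
Proof.
  intros H. destruct (merop_cases f z (meromorphic1_merop f z H)) as [Z|(n & k & g & Hg & N & E)].
  - left. apply (meromorphic1_removable f (fun _ => RtoC 0)); auto. apply hol1_const.
  - destruct (Nat.le_gt_cases n k) as [L|L].
    + left. apply (meromorphic1_removable f (fun t => (t - z) ^ (k - n) * g t)); auto.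
      * apply hol1_mul; auto. apply hol1_pow, hol1_shift.
      * generalize (filter_and _ _ E (locally'_pow_nz z n)). apply filter_imp.
        intros t [-> Nt]. replace k with (n + (k - n))%nat at 1 by lia.
        rewrite Cpow_add_r. field. easy.
    + right. exists (n - k - 1)%nat, g. split; [easy|split; [easy|]].
      generalize (filter_and _ _ E (filter_and _ _ (locally'_pow_nz z k) (locally'_pow_nz z (S (n - k - 1))))).
      apply filter_imp. intros t [-> [Nt Nt2]].
      replace n with (k + S (n - k - 1))%nat at 1 by lia. rewrite Cpow_add_r.
      field. auto.
Qed.

Lemma pole_unbounded f g (z : C) k M : hol1 g z -> g z <> 0 ->
  locally' z (fun t => f t = g t / (t - z) ^ S k) -> locally' z (fun t => (M < Cmod (f t))%R).
Proof.
  intros Hg N E. set (m := Cmod (g z)). assert (Hm : (0 < m)%R) by now apply Cmod_gt_0.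
  assert (Hm2 : (0 < m / 2)%R) by lra.
  pose proof (locally_locally' _ _ (hol1_Clim g z Hg _ Hm2)) as L1.
  assert (L2 : locally' z (fun t => (Cmod (t - z) < Rmin 1 (m / (2 * (Rabs M + 1))))%R)).
  { apply locally'_Cmod. exists (Rmin 1 (m / (2 * (Rabs M + 1)))). split; [|auto].
    apply Rmin_glb_lt; [lra|]. apply Rdiv_lt_0_compat; [easy|]. pose proof (Rabs_pos M). lra. }
  generalize (filter_and _ _ (filter_and _ _ E (locally'_ne z)) (filter_and _ _ L1 L2)).
  apply filter_imp. intros t [[-> Nt] [H1 H2]].
  assert (Nt' : t - z <> 0) by now apply Cminus_eq_contra.
  pose proof (Rmin_l 1 (m / (2 * (Rabs M + 1)))). pose proof (Rmin_r 1 (m / (2 * (Rabs M + 1)))).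
  pose proof (Rabs_pos M) as RM.
  rewrite Cmod_div, Cmod_pow by now apply Cpow_nz.
  set (u := Cmod (t - z)) in *. assert (U : (0 < u)%R) by now apply Cmod_gt_0.
  assert (UP : (u ^ S k <= u)%R).
  { simpl. rewrite <- (Rmult_1_r u) at 3. apply Rmult_le_compat_l; [lra|].
    rewrite <- (pow1 k). apply pow_incr. lra. }
  assert (UP0 : (0 < u ^ S k)%R) by now apply pow_lt.
  assert (G : (m / 2 <= Cmod (g t))%R).
  { pose proof (Cmod_triangle_3 (g z) (g t) 0) as T.
    pose proof (Cmod_triangle (g t) (g z - g t)) as T2.
    replace (g t + (g z - g t)) with (g z) in T2 by ring. fold m in T2.
    rewrite Cmod_minus_sym in H1. lra. }
  apply Rle_lt_trans with (Rabs M); [apply Rle_abs|].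
  apply Rlt_div_r; [easy|]. apply Rlt_le_trans with (m / 2)%R; [|easy].
  apply Rle_lt_trans with (Rabs M * u)%R; [now apply Rmult_le_compat_l|].
  apply Rle_lt_trans with (Rabs M * (m / (2 * (Rabs M + 1))))%R; [apply Rmult_le_compat_l; lra|].
  apply Rlt_le_trans with ((Rabs M + 1) * (m / (2 * (Rabs M + 1))))%R.
  - apply Rmult_lt_compat_r; [apply Rdiv_lt_0_compat|]; lra.
  - right. field. lra.
Qed.

(** A bound at some points arbitrarily near [z] is enough, since at a pole the modulus tends to
    infinity. Later such bounds are known only at generic points or on the real axis. *)
Lemma meromorphic1_bounded f M (z : C) : meromorphic1 f ->
  (forall P, locally' z P -> exists t, P t /\ (Cmod (f t) <= M)%R) -> hol1 f z.
Proof.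
  intros H B. destruct (meromorphic1_cases f z H) as [|(k & g & Hg & N & E)]; [easy|].
  destruct (B _ (pole_unbounded f g z k M Hg N E)) as (t & H1 & H2). lra.
Qed.

Lemma meromorphic1_limit f (z : C) l : meromorphic1 f -> Clim (locally' z) f l ->
  hol1 f z /\ f z = l.
Proof.
  intros H L. assert (Hf : hol1 f z).
  { apply meromorphic1_bounded with (Cmod l + 1)%R; [easy|]. intros P HP.
    destruct (filter_ex _ (filter_and _ _ HP (L 1%R Rlt_0_1))) as [t [H1 H2]].
    exists t. split; [easy|]. replace (f t) with (l + (f t - l)) by ring.
    eapply Rle_trans; [apply Cmod_triangle|]. lra. }
  split; [easy|]. apply (Clim_unique (F := locally' z) f); [|easy].
  intros e He. apply locally_locally'. now apply hol1_Clim.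
Qed.

(** The derivative is the first Taylor coefficient, which by [cauchy_expansion] is at most
    [4 M / rho] for every radius [rho]. *)
Lemma liouville (f : C -> C) M : (forall z, hol1 f z) -> (forall z, (Cmod (f z) <= M)%R) ->
  forall z : C, is_derive f z (RtoC 0).
Proof.
  intros Hf HM z. destruct (hol1_derive f z (Hf z)) as [l D].
  assert (B : forall rho, (0 < rho)%R -> (Cmod l * rho <= 4 * M)%R).
  { intros rho Hrho.
    destruct (cauchy_expansion (fun q => f (fst q)) (z, RtoC 0) (rho + 1) rho M) as (a & Ha & S).
    - lra.
    - intros q _ _. apply hol1_hol2_fst. auto.
    - intros q _ _. auto.
    - simpl in S.
      pose proof (hol1_series f z a rho Hrho S) as S1.
      destruct (series_factor (fun t => f t - a O O) z
        (fun n => match n with O => RtoC 0 | S _ => a n O end) rho 1 Hrho) as (g & Hg & Gz & E).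
      + intros x Hx.
        apply (is_series_ext (fun n => minus (a n O * (x - z) ^ n) (match n with O => a O O | _ => RtoC 0 end))).
        * intros [|n]; change (@minus _ ?a ?b) with (a - b);
          match goal with |- ?a = ?b => change (@eq C a b) end; simpl; ring.
        * apply (is_series_minus (V := C_NormedModule)); [now apply S1|].
          apply (is_series_first (fun n => match n with O => a O O | _ => RtoC 0 end)). easy.
      + intros i Hi. now replace i with O by lia.
      + assert (D1 : is_derive f z (a 1%nat O)).
        { rewrite <- Gz. apply is_derive_C. intros e He.
          destruct (proj1 (locally_Cmod _ _) (hol1_Clim g z Hg e He)) as (r & Hr & L).
          exists (Rmin r rho). split; [now apply Rmin_glb_lt|]. intros y Hy.
          pose proof (Rmin_l r rho). pose proof (Rmin_r r rho).
          assert (E0 := E z ltac:(rewrite Cmod_minus_0; lra)). assert (E1 := E y ltac:(lra)).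
          simpl in E0, E1.
          replace (f y - f z - g z * (y - z)) with ((g y - g z) * (y - z)).
          - rewrite Cmod_mult. apply Rmult_le_compat_r; [apply Cmod_ge_0|].
            left. apply L. lra.
          - replace (f y) with (f y - a O O + a O O) by ring.
            replace (f z) with (f z - a O O + a O O) by ring. rewrite E0, E1. ring. }
        rewrite (is_derive_C_unique f z l _ D D1).
        specialize (Ha 1%nat O). simpl in Ha. now rewrite Rmult_1_r in Ha. }
  replace (RtoC 0) with l; [easy|]. apply Cmod_eq_0. apply Rle_antisym; [|apply Cmod_ge_0].
  destruct (Rle_dec (Cmod l) 0) as [|N]; [easy|]. exfalso.
  assert (P : (0 < Cmod l)%R) by lra.
  assert (M0 : (0 <= M)%R) by (eapply Rle_trans; [apply Cmod_ge_0|apply (HM z)]).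
  (* With this radius the estimate would read [4 M + 1 <= 4 M]. *)
  specialize (B ((4 * M + 1) / Cmod l)%R ltac:(apply Rdiv_lt_0_compat; lra)).
  replace (Cmod l * ((4 * M + 1) / Cmod l))%R with (4 * M + 1)%R in B by (field; lra). lra.
Qed.

(** * Two variables: thin sets and removal of singularities *)

Definition thin (h : C * C -> C) (p : C * C) : Prop :=
  hol2 h p /\ ~ locally_dst p (fun q => h q = 0).

Lemma dst_segment p q q' r (t : R) : (dst p q < r)%R -> (dst p q' < r)%R -> (0 <= t <= 1)%R ->
  (dst p (fst q + RtoC t * (fst q' - fst q), snd q + RtoC t * (snd q' - snd q))%C < r)%R.
Proof.
  intros H H' Ht. unfold dst in *. simpl.
  assert (A : forall u v w : C, (Cmod (v + RtoC t * (w - v) - u)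
     <= (1 - t) * Cmod (v - u) + t * Cmod (w - u))%R).
  { intros u v w. replace (v + RtoC t * (w - v) - u)
      with (RtoC (1 - t) * (v - u) + RtoC t * (w - u)) by (rewrite RtoC_minus; ring).
    eapply Rle_trans; [apply Cmod_triangle|].
    rewrite !Cmod_mult, !Cmod_R, !Rabs_pos_eq by lra. lra. }
  pose proof (A (fst p) (fst q) (fst q')) as A1. pose proof (A (snd p) (snd q) (snd q')) as A2.
  set (a := Cmod (fst q - fst p)) in *. set (b := Cmod (snd q - snd p)) in *.
  set (a' := Cmod (fst q' - fst p)) in *. set (b' := Cmod (snd q' - snd p)) in *.
  apply Rle_lt_trans with ((1 - t) * (a + b) + t * (a' + b'))%R; [lra|].
  destruct (Req_dec t 0) as [->|N]; [lra|].
  assert (t * (a' + b') < t * r)%R by (apply Rmult_lt_compat_l; lra).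
  assert ((1 - t) * (a + b) <= (1 - t) * r)%R by (apply Rmult_le_compat_l; lra). lra.
Qed.

Lemma hol1_line f (x y u v : C) (t : C) : hol2 f (x + t * u, y + t * v) ->
  hol1 (fun t => f (x + t * u, y + t * v)) t.
Proof.
  intros H. apply (hol1_of_hol2 f (fun t => x + t * u) (fun t => y + t * v)); [easy| |];
  apply hol1_add; try apply hol1_const; apply hol1_mul; try apply hol1_const; apply hol1_id.
Qed.

(** If [h] vanished near some [q] close to [p], the one-variable identity theorem on the complex
    lines through [q] would make it vanish on a whole ball around [p]. *)
Lemma thin_dense h p : thin h p ->
  locally_dst p (fun q => forall P, locally_dst q P -> exists q', P q' /\ h q' <> 0).
Proof.
  intros [H N]. destruct (hol2_open _ _ H) as (r & Hr & L). exists r. split; [easy|].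
  intros q Hq P HP. apply NNPP. intros E. apply N.
  assert (Z : locally_dst q (fun q' => h q' = 0)).
  { revert HP. apply locally_dst_imp. intros q' Pq'. apply NNPP. eauto. }
  exists r. split; [easy|]. intros q' Hq'.
  set (phi := fun t : C => h (fst q + t * (fst q' - fst q), snd q + t * (snd q' - snd q))).
  assert (Hphi : forall t : R, (0 <= t <= 1)%R -> hol1 phi (RtoC t)).
  { intros t Ht. apply hol1_line. apply L. now apply dst_segment. }
  assert (Z1 : locally' (RtoC 1) (fun t => phi t = 0)).
  { apply (merop_identity_segment phi 0 1).
    - intros t Ht. replace (0 + RtoC t * (1 - 0)) with (RtoC t) by ring.
      now apply merop_hol1, Hphi.
    - destruct Z as (d & Hd & Z). apply locally_locally'. apply locally_Cmod.
      set (K := (Cmod (fst q' - fst q) + Cmod (snd q' - snd q) + 1)%R).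
      assert (HK : (0 < K)%R) by (unfold K; pose proof (Cmod_ge_0 (fst q' - fst q));
        pose proof (Cmod_ge_0 (snd q' - snd q)); lra).
      exists (d / K)%R. split; [now apply Rdiv_lt_0_compat|]. intros t Ht. apply Z.
      unfold dst. simpl.
      replace (fst q + t * (fst q' - fst q) - fst q) with (t * (fst q' - fst q)) by ring.
      replace (snd q + t * (snd q' - snd q) - snd q) with (t * (snd q' - snd q)) by ring.
      rewrite !Cmod_mult. replace (t - 0) with t in Ht by ring.
      pose proof (Cmod_ge_0 t). apply Rle_lt_trans with (Cmod t * K)%R; [unfold K; lra|].
      now apply Rlt_div_r in Ht. }
  apply hol1_zero_punctured in Z1; [|apply Hphi; lra].
  unfold phi in Z1. rewrite <- Z1. f_equal. rewrite (surjective_pairing q') at 1. f_equal; ring.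
Qed.

Lemma thin_mul h k p : thin h p -> thin k p -> thin (fun q => h q * k q) p.
Proof.
  intros Hh Hk. split; [now apply hol2_mul; [apply Hh|apply Hk]|]. intros Z.
  assert (NK : locally_dst p (fun q => hol2 k q)) by apply hol2_open, Hk.
  destruct (locally_dst_self _ _ (thin_dense k p Hk) _
    (locally_dst_and _ _ _ NK (locally_dst_and _ _ _ (locally_dst_open _ _ Z)
      (thin_dense h p Hh)))) as (q1 & (K1 & Z2 & D1) & Nk1).
  destruct (D1 _ (locally_dst_and _ _ _ Z2 (cont2_nz _ _ (hol2_cont _ _ K1) Nk1)))
    as (q2 & [E2 K2] & H2).
  exact (Cmult_neq_0 _ _ H2 K2 E2).
Qed.

Lemma thin_nz h p : hol2 h p -> h p <> 0 -> thin h p.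
Proof. intros H N. split; [easy|]. intros Z. apply N. now apply locally_dst_self in Z. Qed.

Lemma thin_ext_eq (h g1 g2 : C * C -> C) p : thin h p -> hol2 g1 p -> hol2 g2 p ->
  locally_dst p (fun q => h q <> 0 -> g1 q = g2 q) -> locally_dst p (fun q => g1 q = g2 q).
Proof.
  intros T H1 H2 E.
  generalize (locally_dst_and _ _ _ (thin_dense h p T) (locally_dst_and _ _ _
    (locally_dst_open _ _ E) (hol2_open _ _ (hol2_sub _ _ _ H1 H2)))).
  apply locally_dst_imp. intros q (D & E' & H). apply NNPP. intros N.
  assert (N' : g1 q - g2 q <> 0) by now apply Cminus_eq_contra.
  destruct (D _ (locally_dst_and _ _ _ E' (cont2_nz _ _ (hol2_cont _ _ H) N')))
    as (q' & [A B] & Nh).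
  apply B. rewrite A by easy. ring.
Qed.

(** * Removal of singularities in two variables *)

Definition extends_at (f g : C * C -> C) (p : C * C) : Prop :=
  hol2 g p /\ exists h, thin h p /\ locally_dst p (fun q => h q <> 0 -> f q = g q).

Lemma thin_open h p : thin h p -> locally_dst p (thin h).
Proof.
  intros T. generalize (locally_dst_and _ _ _ (hol2_open _ _ (proj1 T)) (thin_dense h p T)).
  apply locally_dst_imp. intros q [H D]. split; [easy|]. intros Z.
  destruct (D _ Z) as (q' & A & B). easy.
Qed.

Lemma extends_at_open f g p : extends_at f g p -> locally_dst p (extends_at f g).
Proof.
  intros (H & h & T & E).
  generalize (locally_dst_and _ _ _ (hol2_open _ _ H)
    (locally_dst_and _ _ _ (thin_open h p T) (locally_dst_open _ _ E))).
  apply locally_dst_imp. intros q (A & B & D). split; eauto.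
Qed.

Lemma extends_at_unique f g1 g2 p : extends_at f g1 p -> extends_at f g2 p -> g1 p = g2 p.
Proof.
  intros (H1 & h1 & T1 & E1) (H2 & h2 & T2 & E2).
  apply (locally_dst_self p (fun q => g1 q = g2 q)).
  apply (thin_ext_eq (fun q => h1 q * h2 q)); auto using thin_mul.
  generalize (locally_dst_and _ _ _ E1 E2). apply locally_dst_imp. intros q [A B] N.
  rewrite <- A, <- B; [easy| |]; intros Z; apply N; rewrite Z; ring.
Qed.

(** Replaces the junk values of [f] at removable singularities, as the second
    clause of [meromorphic2] demands. *)
Definition regularize (f : C * C -> C) (p : C * C) : C :=
  epsilon (inhabits (RtoC 0)) (fun v => exists g, extends_at f g p /\ g p = v).

Lemma regularize_eq f g p : extends_at f g p -> locally_dst p (fun q => regularize f q = g q).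
Proof.
  intros E. generalize (extends_at_open f g p E). apply locally_dst_imp. intros q Eq.
  assert (X : exists g', extends_at f g' q /\ g' q = regularize f q).
  { apply (epsilon_spec (inhabits (RtoC 0)) (fun v => exists g', extends_at f g' q /\ g' q = v)).
    eauto. }
  destruct X as (g' & E' & <-). now apply (extends_at_unique f).
Qed.

Lemma regularize_hol2 f g p : extends_at f g p -> hol2 (regularize f) p.
Proof.
  intros E. apply (hol2_ext g); [|apply E].
  generalize (regularize_eq f g p E). apply locally_dst_imp. auto.
Qed.

Definition local_quotient (f : C * C -> C) (p : C * C) : Prop :=
  exists g h, hol2 g p /\ thin h p /\ locally_dst p (fun q => h q <> 0 -> f q = g q / h q).

(** Where [h] does not vanish, [g / h] is itself a holomorphic extension of [f], so by uniqueness of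
    extensions regularization changes nothing there. *)
Lemma local_quotient_regularize f p : local_quotient f p ->
  exists g h, hol2 g p /\ thin h p /\
    locally_dst p (fun q => h q <> 0 -> f q = g q / h q /\ regularize f q = g q / h q).
Proof.
  intros (g & h & Hg & Th & E). exists g, h. split; [easy|split; [easy|]].
  generalize (locally_dst_and _ _ _ E (locally_dst_and _ _ _ (locally_dst_open _ _ E)
    (locally_dst_and _ _ _ (hol2_open _ _ Hg) (hol2_open _ _ (proj1 Th))))).
  apply locally_dst_imp. intros q (E1 & E2 & G & H) N. split; [auto|].
  apply (locally_dst_self q (fun q => regularize f q = g q / h q)).
  apply (regularize_eq f (fun q => g q / h q) q). split; [now apply hol2_div|].
  exists h. split; [now apply thin_nz|easy].
Qed.

Lemma regularize_meromorphic2 f : (forall p, local_quotient f p) -> meromorphic2 (regularize f).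
Proof.
  intros H p. destruct (local_quotient_regularize f p (H p)) as (g & h & Hg & Th & E). split.
  - exists g, h. repeat split.
    + now apply hol2_analytic2.
    + apply hol2_analytic2, Th.
    + rewrite locally_CC. apply Th.
    + rewrite locally_CC. revert E. apply locally_dst_imp. intros q E N. now apply E.
  - intros g' h' Hg' Hh' N' E'. apply hol2_analytic2. apply analytic2_hol2 in Hg', Hh'.
    rewrite locally_CC in N', E'.
    apply (regularize_hol2 f g'). split; [easy|]. exists (fun q => h q * h' q).
    split; [now apply thin_mul|].
    generalize (locally_dst_and _ _ _ E E'). apply locally_dst_imp. intros q [A B] N.
    assert (N1 : h q <> 0) by (intros Z; apply N; rewrite Z; ring).
    assert (N2 : h' q <> 0) by (intros Z; apply N; rewrite Z; ring).
    destruct (A N1) as [A1 A2]. now rewrite A1, <- A2, B.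
Qed.

(** * Cube roots *)

(** The primitive cube root of unity [exp (2 pi i / 3)]. *)
Definition om : C := (-1 / 2, sqrt 3 / 2)%R.

Lemma om_sum : om * om + om + 1 = 0.
Proof.
  unfold om, Cmult, Cplus, RtoC. simpl.
  assert (sqrt 3 * sqrt 3 = 3)%R by (apply sqrt_sqrt; lra). f_equal; nra.
Qed.

Lemma om3 : om * om * om = 1.
Proof.
  replace (om * om * om) with ((om * om + om + 1) * (om - 1) + 1) by ring. rewrite om_sum. ring.
Qed.

Lemma Cmod_om : Cmod om = 1%R.
Proof.
  unfold Cmod, om. simpl. replace (_ + _)%R with 1%R; [apply sqrt_1|].
  assert (sqrt 3 * sqrt 3 = 3)%R by (apply sqrt_sqrt; lra). nra.
Qed.

Lemma om_nz : om <> 0.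
Proof. apply Cmod_gt_0. rewrite Cmod_om. lra. Qed.

Lemma cube_factor (x y : C) :
  x ^ 3 - y ^ 3 = (x - y) * (x - om * y) * (x - om * om * y).
Proof.
  replace ((x - y) * (x - om * y) * (x - om * om * y))
    with (x ^ 3 - (om * om + om + 1) * (x ^ 2 * y) + (om * (om * om + om + 1)) * (x * y ^ 2)
          - om * om * om * y ^ 3) by ring.
  rewrite om_sum, om3. ring.
Qed.

Lemma Cmult_integral (x y : C) : x * y = 0 -> x = 0 \/ y = 0.
Proof.
  intros H. destruct (Ceq_dec x 0) as [|N]; [now left|]. right.
  apply NNPP. intros N2. now apply (Cmult_neq_0 _ _ N N2).
Qed.

Lemma Cminus_0_eq (x y : C) : x - y = 0 -> x = y.
Proof. intros H. replace x with (x - y + y) by ring. rewrite H. ring. Qed.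

Lemma cube_eq (x y : C) : x ^ 3 = y ^ 3 -> x = y \/ x = om * y \/ x = om * om * y.
Proof.
  intros H. assert (E : (x - y) * (x - om * y) * (x - om * om * y) = 0).
  { rewrite <- cube_factor, H. ring. }
  apply Cmult_integral in E. destruct E as [E|E].
  - apply Cmult_integral in E. destruct E as [E|E]; apply Cminus_0_eq in E; auto.
  - apply Cminus_0_eq in E. auto.
Qed.

Lemma expi_add s t : expi (s + t) = expi s * expi t.
Proof. unfold expi, Cmult. simpl. rewrite cos_plus, sin_plus. f_equal; ring. Qed.

Lemma unit_circle (u : C) : Cmod u = 1%R -> exists t, u = expi t.
Proof.
  intros H. destruct u as [a b]. unfold Cmod in H. simpl in H.
  assert (E : (a * a + b * b = 1)%R).
  { replace (a * a + b * b)%R with (a * (a * 1) + b * (b * 1))%R by ring.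
    rewrite <- (sqrt_sqrt (a * (a * 1) + b * (b * 1))) by nra. rewrite H. ring. }
  assert (A : (-1 <= a <= 1)%R) by nra.
  assert (S : sin (acos a) = Rabs b).
  { rewrite sin_acos by easy. replace (1 - a²)%R with (b²)%R by (unfold Rsqr; lra).
    apply sqrt_Rsqr_abs. }
  destruct (Rle_dec 0 b) as [B|B].
  - exists (acos a). unfold expi. rewrite cos_acos, S by easy. now rewrite Rabs_pos_eq.
  - exists (- acos a)%R. unfold expi. rewrite cos_neg, sin_neg, cos_acos, S by easy.
    rewrite Rabs_left by lra. f_equal. lra.
Qed.

Lemma cube_root (z : C) : exists v, v ^ 3 = z.
Proof.
  destruct (Ceq_dec z 0) as [->|N]; [exists 0; ring|].
  assert (P : (0 < Cmod z)%R) by now apply Cmod_gt_0.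
  assert (PC : RtoC (Cmod z) <> 0) by (intros E; apply RtoC_inj in E; lra).
  destruct (unit_circle (z / RtoC (Cmod z))) as [t Ht].
  { rewrite Cmod_div, Cmod_R, Rabs_pos_eq by (auto; lra). field. lra. }
  exists (RtoC (exp (ln (Cmod z) / 3)) * expi (t / 3)).
  assert (E1 : (exp (ln (Cmod z) / 3) * exp (ln (Cmod z) / 3) * exp (ln (Cmod z) / 3) = Cmod z)%R).
  { rewrite <- !exp_plus. replace (_ + _ + _)%R with (ln (Cmod z)) by field. now apply exp_ln. }
  assert (E2 : expi (t / 3) * expi (t / 3) * expi (t / 3) = expi t).
  { rewrite <- !expi_add. f_equal. field. }
  set (r := exp (ln (Cmod z) / 3)) in *.
  replace ((RtoC r * expi (t / 3)) ^ 3)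
    with (RtoC r * RtoC r * RtoC r * (expi (t / 3) * expi (t / 3) * expi (t / 3))) by ring.
  rewrite E2, <- Ht, <- !RtoC_mult, E1. field. easy.
Qed.

(** The branch picks the root closest to [v0]. In [u ^ 3 - v ^ 3 = (u - v) (u ^ 2 + u v + v ^ 2)]
    the last factor is bounded away from 0 near [v0], and this gives continuity and
    differentiability of the branch at once. *)
Lemma cube_root_branch (v0 : C) : v0 <> 0 ->
  exists br : C -> C, hol1 br (v0 ^ 3) /\ br (v0 ^ 3) = v0 /\
    locally (v0 ^ 3) (fun w => br w ^ 3 = w).
Proof.
  intros N. set (m := Cmod v0). assert (Hm : (0 < m)%R) by now apply Cmod_gt_0.
  set (good := fun w v => v ^ 3 = w /\ (Cmod (v - v0) < m / 8)%R).
  set (br := fun w => epsilon (inhabits (RtoC 0)) (good w)).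
  (* If all three factors of [z ^ 3 - v0 ^ 3] had modulus at least [m / 8], the difference would
     reach [dl]; so one of the three roots lies within [m / 8] of [v0]. The same radius gives the
     lower bound [m ^ 2] in [B]. *)
  set (dl := (m / 8 * (m / 8) * (m / 8))%R).
  assert (Hdl : (0 < dl)%R) by (repeat apply Rmult_lt_0_compat; lra).
  assert (G : forall w, (Cmod (w - v0 ^ 3) < dl)%R -> good w (br w)).
  { intros w Hw. unfold br. apply epsilon_spec. destruct (cube_root w) as [z Hz].
    rewrite <- Hz, cube_factor, !Cmod_mult in Hw.
    destruct (Rlt_dec (Cmod (z - v0)) (m / 8)) as [H1|H1]; [exists z; now split|].
    destruct (Rlt_dec (Cmod (z - om * v0)) (m / 8)) as [H2|H2].
    { exists (om * om * z). split.
      - replace ((om * om * z) ^ 3) with ((om * om * om) ^ 2 * z ^ 3) by ring.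
        rewrite om3, Hz. ring.
      - replace (om * om * z - v0) with (om * om * (z - om * v0) + (om * om * om - 1) * v0) by ring.
        rewrite om3. replace (om * om * (z - om * v0) + (1 - 1) * v0)
          with (om * om * (z - om * v0)) by ring.
        rewrite !Cmod_mult, Cmod_om. lra. }
    destruct (Rlt_dec (Cmod (z - om * om * v0)) (m / 8)) as [H3|H3].
    { exists (om * z). split.
      - replace ((om * z) ^ 3) with ((om * om * om) * z ^ 3) by ring.
        rewrite om3, Hz. ring.
      - replace (om * z - v0) with (om * (z - om * om * v0) + (om * om * om - 1) * v0) by ring.
        rewrite om3. replace (om * (z - om * om * v0) + (1 - 1) * v0)
          with (om * (z - om * om * v0)) by ring.
        rewrite !Cmod_mult, Cmod_om. lra. }
    exfalso. apply (Rlt_not_le _ _ Hw). unfold dl.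
    apply Rmult_le_compat; [nra|lra| |lra]. apply Rmult_le_compat; lra. }
  assert (B : forall u v, (Cmod (u - v0) < m / 8)%R -> (Cmod (v - v0) < m / 8)%R ->
     (m * m <= Cmod (u * u + u * v + v * v))%R).
  { intros u v Hu Hv. set (e := u - v0) in *. set (d := v - v0) in *.
    replace (u * u + u * v + v * v) with (3 * (v0 * v0) + (v0 * (3 * e + 3 * d) + (e * e + e * d + d * d)))
      by (unfold e, d; ring).
    set (X := v0 * (3 * e + 3 * d)). set (Y := e * e + e * d + d * d).
    assert (T1 : (Cmod (3 * (v0 * v0)) <= Cmod (3 * (v0 * v0) + (X + Y)) + Cmod (X + Y))%R).
    { replace (3 * (v0 * v0)) with ((3 * (v0 * v0) + (X + Y)) - (X + Y)) at 1 by ring.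
      apply Cmod_triangle_minus. }
    rewrite !Cmod_mult, Cmod_R, Rabs_pos_eq in T1 by lra. fold m in T1.
    pose proof (Cmod_triangle X Y) as T2.
    assert (TX : (Cmod X <= m * (3 * (m / 8) + 3 * (m / 8)))%R).
    { unfold X. rewrite Cmod_mult. fold m. apply Rmult_le_compat_l; [lra|].
      eapply Rle_trans; [apply Cmod_triangle|]. rewrite !Cmod_mult, Cmod_R, Rabs_pos_eq by lra. lra. }
    assert (TY : (Cmod Y <= 3 * (m / 8 * (m / 8)))%R).
    { unfold Y. eapply Rle_trans; [apply Cmod_triangle|].
      eapply Rle_trans; [apply Rplus_le_compat_r, Cmod_triangle|]. rewrite !Cmod_mult.
      pose proof (Cmod_ge_0 e). pose proof (Cmod_ge_0 d).
      assert (Cmod e * Cmod e <= m / 8 * (m / 8))%R by (apply Rmult_le_compat; lra).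
      assert (Cmod e * Cmod d <= m / 8 * (m / 8))%R by (apply Rmult_le_compat; lra).
      assert (Cmod d * Cmod d <= m / 8 * (m / 8))%R by (apply Rmult_le_compat; lra). lra. }
    nra. }
  assert (LIP : forall w w', (Cmod (w - v0 ^ 3) < dl)%R -> (Cmod (w' - v0 ^ 3) < dl)%R ->
     w' - w = (br w' - br w) * (br w' * br w' + br w' * br w + br w * br w)).
  { intros w w' H1 H2. destruct (G w H1) as [E1 _], (G w' H2) as [E2 _].
    rewrite <- E1 at 1. rewrite <- E2 at 1. ring. }
  assert (CONT : forall w, (Cmod (w - v0 ^ 3) < dl)%R -> Clim (locally w) br (br w)).
  { intros w Hw e He. apply locally_Cmod.
    exists (Rmin (dl - Cmod (w - v0 ^ 3)) (e * (m * m))). split.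
    { apply Rmin_glb_lt; [lra|]. apply Rmult_lt_0_compat; nra. }
    intros w' Hw'. pose proof (Rmin_l (dl - Cmod (w - v0 ^ 3)) (e * (m * m))).
    pose proof (Rmin_r (dl - Cmod (w - v0 ^ 3)) (e * (m * m))).
    assert (Hw2 : (Cmod (w' - v0 ^ 3) < dl)%R).
    { pose proof (Cmod_triangle_3 w' w (v0 ^ 3)). lra. }
    pose proof (LIP w w' Hw Hw2) as E. apply (f_equal Cmod) in E. rewrite Cmod_mult in E.
    pose proof (B _ _ (proj2 (G w' Hw2)) (proj2 (G w Hw))) as BB.
    apply Rmult_lt_reg_r with (m * m)%R; [nra|].
    apply Rle_lt_trans with (Cmod (w' - w)); [|lra]. rewrite E.
    apply Rmult_le_compat_l; [apply Cmod_ge_0|easy]. }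
  assert (M3 : forall w, (Cmod (w - v0 ^ 3) < dl)%R -> br w * br w + br w * br w + br w * br w <> 0).
  { intros w Hw. pose proof (B _ _ (proj2 (G w Hw)) (proj2 (G w Hw))) as BB.
    apply Cmod_gt_0. nra. }
  exists br. split; [|split].
  (* The derivative [1 / (3 br ^ 2)], in the shape that [LIP] takes on the diagonal. *)
  - exists (fun q => / (br (fst q) * br (fst q) + br (fst q) * br (fst q) + br (fst q) * br (fst q))),
      (fun _ => RtoC 0).
    exists dl. split; [easy|]. intros q Hq.
    assert (Hw : (Cmod (fst q - v0 ^ 3) < dl)%R).
    { pose proof (dst_fst (v0 ^ 3, RtoC 0) q). simpl in *. lra. }
    set (w := fst q) in *.
    assert (Cq : cont2 (fun q => br (fst q)) q).
    { intros e He. destruct (proj1 (locally_Cmod _ _) (CONT w Hw e He)) as (r & Hr & L).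
      exists r. split; [easy|]. intros s Hs. apply L. pose proof (dst_fst q s). unfold w. lra. }
    split; [|split; [|apply cont2_const]].
    + apply is_derive_D2. apply is_derive_C. intros e He.
      assert (CL : Clim (locally w) (fun w' => / (br w' * br w' + br w' * br w + br w * br w))
        (/ (br w * br w + br w * br w + br w * br w))).
      { pose proof (CONT w Hw) as Cw. apply Clim_inv; [|now apply M3].
        apply Clim_add; [apply Clim_add|apply Clim_const]; apply Clim_mul; auto; apply Clim_const. }
      destruct (proj1 (locally_Cmod _ _) (CL e He)) as (r & Hr & L).
      exists (Rmin r (dl - Cmod (w - v0 ^ 3))). split; [apply Rmin_glb_lt; lra|].
      intros w' Hw'. pose proof (Rmin_l r (dl - Cmod (w - v0 ^ 3))).
      pose proof (Rmin_r r (dl - Cmod (w - v0 ^ 3))). fold w in Hw'.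
      assert (Hw2 : (Cmod (w' - v0 ^ 3) < dl)%R).
      { pose proof (Cmod_triangle_3 w' w (v0 ^ 3)). lra. }
      specialize (L w' ltac:(lra)). fold w.
      assert (NB : br w' * br w' + br w' * br w + br w * br w <> 0).
      { pose proof (B _ _ (proj2 (G w' Hw2)) (proj2 (G w Hw))) as BB. apply Cmod_gt_0. nra. }
      replace (br w' - br w - / (br w * br w + br w * br w + br w * br w) * (w' - w))
        with ((/ (br w' * br w' + br w' * br w + br w * br w)
               - / (br w * br w + br w * br w + br w * br w)) * (w' - w)).
      * rewrite Cmod_mult. apply Rmult_le_compat_r; [apply Cmod_ge_0|lra].
      * rewrite (LIP w w' Hw Hw2) at 1 2. field. split; [now apply M3|easy].
    + apply (cont2_pair (fun s => / fst s) (fun q => br (fst q) * br (fst q) + br (fst q) * br (fst q) + br (fst q) * br (fst q)) (fun _ => RtoC 0)).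
      * eapply D2_cont. apply D2_inv_fst. simpl. now apply M3.
      * apply cont2_add; [apply cont2_add|]; now apply cont2_mul.
      * apply cont2_const.
  - assert (Z : (Cmod (v0 ^ 3 - v0 ^ 3) < dl)%R) by now rewrite Cmod_minus_0.
    destruct (G _ Z) as [E1 E2].
    assert (V0 : (Cmod (v0 - v0) < m / 8)%R) by (rewrite Cmod_minus_0; lra).
    pose proof (B _ _ E2 V0) as BB.
    assert (P : (br (v0 ^ 3) - v0) * (br (v0 ^ 3) * br (v0 ^ 3) + br (v0 ^ 3) * v0 + v0 * v0) = 0).
    { transitivity (br (v0 ^ 3) ^ 3 - v0 ^ 3); [ring|]. rewrite E1. ring. }
    apply Cmult_integral in P. destruct P as [P|P]; [now apply Cminus_0_eq|].
    rewrite P, Cmod_0 in BB. nra.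
  - apply locally_Cmod. exists dl. split; [easy|]. intros w Hw. apply (G w Hw).
Qed.

(** * Complex derivatives *)

Definition dC (f : C -> C) (z l : C) : Prop := is_derive f z l.

Lemma dC_D2 f z l : dC f z l <-> D2 (fun q => f (fst q)) (z, RtoC 0) l 0.
Proof. apply (is_derive_D2 f (z, RtoC 0) l). Qed.

Lemma dC_eq f z l m : l = m -> dC f z l -> dC f z m.
Proof. now intros <-. Qed.

Lemma dC_pair F g h z A B l m :
  D2 F (g z, h z) A B -> dC g z l -> dC h z m -> dC (fun t => F (g t, h t)) z (A * l + B * m).
Proof.
  intros HF Hg Hh. apply dC_D2 in Hg, Hh. apply dC_D2.
  pose proof (D2_pair F (fun q => g (fst q)) (fun q => h (fst q)) (z, RtoC 0) A B l 0 m 0 HF Hg Hh) as D.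
  replace (RtoC 0) with (A * 0 + B * 0) at 2 by ring. exact D.
Qed.

Lemma dC_const c z : dC (fun _ => c) z 0.
Proof. apply dC_D2, D2_const. Qed.

Lemma dC_id z : dC (fun t => t) z 1.
Proof. apply dC_D2, D2_fst. Qed.

Lemma dC_add f g z l m : dC f z l -> dC g z m -> dC (fun t => f t + g t) z (l + m).
Proof.
  intros Hf Hg. apply dC_eq with (1 * l + 1 * m); [ring|].
  apply (dC_pair (fun q => fst q + snd q)); auto. apply D2_add.
Qed.

Lemma dC_mul f g z l m : dC f z l -> dC g z m -> dC (fun t => f t * g t) z (g z * l + f z * m).
Proof.
  intros Hf Hg. apply (dC_pair (fun q => fst q * snd q)); auto. apply D2_mul.
Qed.

Lemma dC_opp f z l : dC f z l -> dC (fun t => - f t) z (- l).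
Proof.
  intros Hf. apply dC_eq with (- (1) * l + 0 * 0); [ring|].
  apply (dC_pair (fun q => - fst q) f (fun _ => RtoC 0)); auto using dC_const. apply D2_opp_fst.
Qed.

Lemma dC_sub f g z l m : dC f z l -> dC g z m -> dC (fun t => f t - g t) z (l - m).
Proof. intros Hf Hg. apply dC_add; [easy|now apply dC_opp]. Qed.

Lemma dC_inv f z l : dC f z l -> f z <> 0 -> dC (fun t => / f t) z (- l / (f z * f z)).
Proof.
  intros Hf N. apply dC_eq with (- / (f z * f z) * l + 0 * 0); [field; auto|].
  apply (dC_pair (fun q => / fst q) f (fun _ => RtoC 0)); auto using dC_const.
  now apply (D2_inv_fst (f z, RtoC 0)).
Qed.

Lemma dC_div f g z l m : dC f z l -> dC g z m -> g z <> 0 ->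
  dC (fun t => f t / g t) z ((l * g z - f z * m) / (g z * g z)).
Proof.
  intros Hf Hg N. eapply dC_eq; [|apply dC_mul; [exact Hf|apply dC_inv; [exact Hg|exact N]]].
  cbv beta. field. auto.
Qed.

Lemma dC_comp F g z l m : dC F (g z) l -> dC g z m -> dC (fun t => F (g t)) z (l * m).
Proof.
  intros HF Hg. apply dC_eq with (l * m + 0 * 0); [ring|].
  apply (dC_pair (fun q => F (fst q)) g (fun _ => RtoC 0)); auto using dC_const.
  now apply (is_derive_D2 F (g z, RtoC 0)).
Qed.

Lemma hol1_dC f (z : C) : hol1 f z -> exists l, dC f z l.
Proof. apply hol1_derive. Qed.

Lemma dR_segment f (z u : C) (t : R) l : dC f (z + RtoC t * u) l ->
  dR (fun s => f (z + RtoC s * u)) t (l * u).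
Proof.
  intros H. apply (dR_comp f (fun s => z + RtoC s * u) t l u); [exact H|].
  eapply dR_eq; [|apply dR_add; [apply dR_const|apply dR_mul; [apply dR_id|apply dR_const]]].
  cbv beta. ring.
Qed.

Lemma Cmod_segment (z y : C) r (t : R) : (Cmod (y - z) < r)%R -> (0 <= t <= 1)%R ->
  (Cmod (z + RtoC t * (y - z) - z) < r)%R.
Proof.
  intros H Ht. replace (z + RtoC t * (y - z) - z) with (RtoC t * (y - z)) by ring.
  rewrite Cmod_mult, Cmod_R, Rabs_pos_eq by lra. pose proof (Cmod_ge_0 (y - z)). nra.
Qed.

Lemma dC_zero_const f (z : C) r : (forall y, (Cmod (y - z) < r)%R -> dC f y 0) ->
  forall y, (Cmod (y - z) < r)%R -> f y = f z.
Proof.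
  intros H y Hy.
  pose proof (dR_zero_const (fun t => f (z + RtoC t * (y - z))) 0 1 ltac:(lra)) as E.
  simpl in E. replace (z + 1 * (y - z)) with y in E by ring.
  replace (z + 0 * (y - z)) with z in E by ring. symmetry. apply E.
  intros t Ht. apply dR_eq with (0 * (y - z)); [ring|]. apply dR_segment. apply H.
  now apply Cmod_segment.
Qed.

(** The mean value theorem has no exact complex form; applying it to the real and imaginary parts
    costs the factor 2. *)
Lemma mean_value_bound f f' (z : C) r M :
  (forall y, (Cmod (y - z) < r)%R -> dC f y (f' y) /\ (Cmod (f' y) <= M)%R) ->
  forall y, (Cmod (y - z) < r)%R -> (Cmod (f y - f z) <= 2 * M * Cmod (y - z))%R.
Proof.
  intros H y Hy.
  assert (D : forall t, (0 <= t <= 1)%R ->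
    dR (fun t => f (z + RtoC t * (y - z))) t (f' (z + RtoC t * (y - z)) * (y - z))).
  { intros t Ht. apply dR_segment. apply H. now apply Cmod_segment. }
  assert (B : forall t, (0 <= t <= 1)%R ->
    (Cmod (f' (z + RtoC t * (y - z))%C * (y - z)) <= M * Cmod (y - z))%R).
  { intros t Ht. rewrite Cmod_mult. apply Rmult_le_compat_r; [apply Cmod_ge_0|].
    apply H. now apply Cmod_segment. }
  assert (MV : forall g dg : R -> R, (forall t, (0 <= t <= 1)%R -> is_derive g t (dg t)) ->
     (forall t, (0 <= t <= 1)%R -> (Rabs (dg t) <= M * Cmod (y - z))%R) ->
     (Rabs (g 1 - g 0) <= M * Cmod (y - z))%R).
  { intros g dg Hg Hd. destruct (MVT_gen g 0 1 dg) as (c & Hc & E).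
    - rewrite Rmin_left, Rmax_right by lra. intros t Ht. apply Hg. lra.
    - rewrite Rmin_left, Rmax_right by lra. intros t Ht. apply continuity_pt_filterlim.
      apply (ex_derive_continuous (V := R_NormedModule) g). eexists. now apply Hg.
    - rewrite Rmin_left, Rmax_right in Hc by lra. rewrite E, Rminus_0_r, Rmult_1_r. auto. }
  assert (R1 := MV _ _ (fun t Ht => dR_Re _ _ _ (D t Ht))
    (fun t Ht => Rle_trans _ _ _ (Re_le_Cmod _) (B t Ht))).
  assert (R2 := MV _ _ (fun t Ht => dR_Im _ _ _ (D t Ht))
    (fun t Ht => Rle_trans _ _ _ (Im_le_Cmod _) (B t Ht))).
  cbv beta in R1, R2.
  replace (z + RtoC 1 * (y - z)) with y in R1, R2 by ring.
  replace (z + RtoC 0 * (y - z)) with z in R1, R2 by ring.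
  eapply Rle_trans; [apply Cmod_le_ReIm|].
  change (Re (f y - f z)) with (Re (f y) - Re (f z))%R.
  change (Im (f y - f z)) with (Im (f y) - Im (f z))%R. lra.
Qed.

(** * Conjugation *)

Lemma D2_conj f p a b : D2 f (Cconj (fst p), Cconj (snd p)) a b ->
  D2 (fun q => Cconj (f (Cconj (fst q), Cconj (snd q)))) p (Cconj a) (Cconj b).
Proof.
  intros H e He. destruct (H e He) as [r [Hr L]]. exists r. split; [easy|].
  assert (E : forall q, dst (Cconj (fst p), Cconj (snd p)) (Cconj (fst q), Cconj (snd q)) = dst p q).
  { intros q. unfold dst. simpl. now rewrite <- !Cminus_conj, !Cmod_conj. }
  intros q Hq. specialize (L (Cconj (fst q), Cconj (snd q))). rewrite E in L.
  specialize (L Hq). simpl in L. eapply Rle_trans; [|exact L]. right.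
  rewrite <- (Cmod_conj (f (Cconj (fst q), Cconj (snd q)) - _ - _)). f_equal.
  rewrite !Cminus_conj, Cplus_conj, !Cmult_conj, !Cminus_conj, !Cconj_conj. easy.
Qed.

Lemma cont2_conj f p : cont2 f (Cconj (fst p), Cconj (snd p)) ->
  cont2 (fun q => Cconj (f (Cconj (fst q), Cconj (snd q)))) p.
Proof.
  intros H e He. destruct (H e He) as [r [Hr L]]. exists r. split; [easy|].
  intros q Hq. rewrite <- Cminus_conj, Cmod_conj. apply L.
  unfold dst. simpl. now rewrite <- !Cminus_conj, !Cmod_conj.
Qed.

Lemma hol1_conj f (z : C) : hol1 f (Cconj z) -> hol1 (fun t => Cconj (f (Cconj t))) z.
Proof.
  intros (fx & fy & r & Hr & H).
  exists (fun q => Cconj (fx (Cconj (fst q), Cconj (snd q)))),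
    (fun q => Cconj (fy (Cconj (fst q), Cconj (snd q)))).
  exists r. split; [easy|]. intros q Hq.
  destruct (H (Cconj (fst q), Cconj (snd q))) as (H1 & H2 & H3).
  { unfold dst in *. simpl in *. replace (Cconj (snd q) - 0) with (Cconj (snd q - 0)).
    - now rewrite <- Cminus_conj, !Cmod_conj.
    - rewrite Cminus_conj. f_equal. unfold Cconj, RtoC. simpl. f_equal. ring. }
  split; [|split].
  - apply (D2_conj (fun q => f (fst q))). exact H1.
  - now apply cont2_conj.
  - now apply cont2_conj.
Qed.

Lemma dC_conj f z l : dC f (Cconj z) l -> dC (fun t => Cconj (f (Cconj t))) z (Cconj l).
Proof.
  intros H. apply dC_D2.
  assert (D : D2 (fun q => f (fst q)) (Cconj z, Cconj (RtoC 0)) l 0)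
    by (apply (is_derive_D2 f (Cconj z, Cconj (RtoC 0))); exact H).
  apply (D2_conj (fun q => f (fst q)) (z, RtoC 0)) in D.
  replace (Cconj (RtoC 0)) with (RtoC 0) in D; [exact D|].
  unfold Cconj, RtoC. simpl. f_equal. ring.
Qed.

Lemma locally'_conj (z : C) P : locally' (Cconj z) P -> locally' z (fun t => P (Cconj t)).
Proof.
  intros H. apply locally'_Cmod in H. destruct H as (r & Hr & H).
  apply locally'_Cmod. exists r. split; [easy|]. intros y Hy N. apply H.
  - now rewrite <- Cminus_conj, Cmod_conj.
  - intros E. apply N. now rewrite <- (Cconj_conj y), E, Cconj_conj.
Qed.

Lemma merop_conj f (z : C) : merop f (Cconj z) -> merop (fun t => Cconj (f (Cconj t))) z.
Proof.
  intros (n & g & Hg & E). exists n, (fun t => Cconj (g (Cconj t))). split; [now apply hol1_conj|].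
  generalize (filter_and _ _ (locally'_conj _ _ E) (locally'_pow_nz z n)).
  apply filter_imp. intros t [-> N].
  assert (N' : (Cconj t - Cconj z) ^ n <> 0).
  { rewrite <- Cminus_conj, <- Cpow_conj. intros X. apply N.
    rewrite <- (Cconj_conj ((t - z) ^ n)), X. unfold Cconj, RtoC. simpl. f_equal. ring. }
  rewrite Cdiv_conj by exact N'. now rewrite Cpow_conj, Cminus_conj, !Cconj_conj.
Qed.

(** The bridge from identities on punctured neighbourhoods to exact points: a limit computed from a
    functional equation yields both analyticity at the image point and the value there. *)
Lemma meromorphic1_transport f (c d z l : C) : meromorphic1 f -> c <> 0 ->
  Clim (locally' z) (fun t => f (c * t + d)) l -> hol1 f (c * z + d) /\ f (c * z + d) = l.
Proof.
  intros Hf Hc H. apply meromorphic1_limit; [easy|]. intros e He.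
  assert (Hc' : / c <> 0).
  { intros E. apply C1_nz. rewrite <- (Cinv_r c Hc), E. ring. }
  assert (H1 : locally' (/ c * (c * z + d) + (- d / c)) (fun t => (Cmod (f (c * t + d)%C - l) < e)%R)).
  { assert (Ez : / c * (c * z + d) + (- d / c) = z) by (field; exact Hc).
    rewrite Ez. now apply H. }
  generalize (locally'_affine _ _ _ _ Hc' H1). apply filter_imp. intros t.
  assert (Et : c * (/ c * t + - d / c) + d = t) by (field; exact Hc).
  now rewrite Et.
Qed.

(** * The Dixonian functions *)

Section Dixon.

Variables (sm cm : C -> C).
Hypothesis Hdix : dixonian sm cm.

Definition reg (z : C) : Prop := hol1 sm z /\ hol1 cm z.

Lemma sm_mero : meromorphic1 sm.
Proof. apply Hdix. Qed.

Lemma cm_mero : meromorphic1 cm.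
Proof. apply Hdix. Qed.

Lemma sm_merop z : merop sm z.
Proof. apply meromorphic1_merop, sm_mero. Qed.

Lemma cm_merop z : merop cm z.
Proof. apply meromorphic1_merop, cm_mero. Qed.

Lemma sm_0 : sm 0 = 0.
Proof. apply Hdix. Qed.

Lemma cm_0 : cm 0 = 1.
Proof. apply Hdix. Qed.

Lemma reg_0 : reg 0.
Proof. split; apply analytic1_hol1, Hdix. Qed.

Lemma sm_deriv z : reg z -> dC sm z (cm z ^ 2).
Proof.
  intros [H1 H2]. destruct Hdix as (_ & _ & _ & _ & _ & _ & D).
  apply D; now apply hol1_analytic1.
Qed.

Lemma cm_deriv z : reg z -> dC cm z (- sm z ^ 2).
Proof.
  intros [H1 H2]. destruct Hdix as (_ & _ & _ & _ & _ & _ & D).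
  apply D; now apply hol1_analytic1.
Qed.

Lemma reg_near z : locally' z reg.
Proof.
  apply filter_and; apply merop_hol1_near; [apply sm_merop|apply cm_merop].
Qed.

Lemma reg_open z : reg z -> locally z reg.
Proof. intros [H1 H2]. apply filter_and; now apply hol1_open. Qed.

Lemma sm_Clim z : reg z -> Clim (locally z) sm (sm z).
Proof. intros [H _]. now apply hol1_Clim. Qed.

Lemma cm_Clim z : reg z -> Clim (locally z) cm (cm z).
Proof. intros [_ H]. now apply hol1_Clim. Qed.

Lemma Clim_locally' (f : C -> C) (z l : C) : Clim (locally z) f l -> Clim (locally' z) f l.
Proof. intros H e He. apply locally_locally'. auto. Qed.

Lemma cubic_near z : locally' z (fun t => sm t ^ 3 + cm t ^ 3 - 1 = 0).
Proof.
  apply (merop_identity _ 0).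
  - intros t. apply merop_sub; [apply merop_add|apply merop_const]; apply merop_pow;
    [apply sm_merop|apply cm_merop].
  - apply locally_locally'. destruct (proj1 (locally_Cmod _ _) (reg_open 0 reg_0)) as (r & Hr & H).
    apply locally_Cmod. exists r. split; [easy|]. intros y Hy.
    rewrite (dC_zero_const (fun t => sm t ^ 3 + cm t ^ 3 - 1) 0 r); [|clear y Hy|exact Hy].
    + rewrite sm_0, cm_0. ring.
    + intros y Hy. specialize (H y Hy).
      pose proof (sm_deriv y H) as Ds. pose proof (cm_deriv y H) as Dc.
      eapply dC_eq; [|apply dC_sub; [apply dC_add; (apply dC_mul; [|apply dC_mul; [|apply dC_mul; [|apply dC_const]]])|apply dC_const]];
      try exact Ds; try exact Dc. cbv beta. simpl. ring.
Qed.

Lemma cubic z : reg z -> sm z ^ 3 + cm z ^ 3 = 1.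
Proof.
  intros [H1 H2]. apply Cminus_0_eq.
  apply (hol1_zero_punctured (fun t => sm t ^ 3 + cm t ^ 3 - 1)); [|apply cubic_near].
  apply hol1_sub; [apply hol1_add|apply hol1_const]; now apply hol1_pow.
Qed.

Lemma cube_sum_bound (a b : C) B : a ^ 3 + b ^ 3 = 1 -> (Cmod a <= B)%R ->
  (Cmod b <= 1 + (1 + B) ^ 3)%R.
Proof.
  intros E Ha.
  assert (B0 : (0 <= B)%R) by (eapply Rle_trans; [apply Cmod_ge_0|exact Ha]).
  assert (Eb : b ^ 3 = 1 - a ^ 3) by (rewrite <- E; ring).
  apply (f_equal Cmod) in Eb. rewrite Cmod_pow in Eb.
  assert (T : (Cmod (1 - a ^ 3) <= 1 + B ^ 3)%R).
  { eapply Rle_trans; [apply Cmod_triangle_minus|]. rewrite Cmod_1.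
    pose proof (Cmod_pow_le a B 3 Ha). lra. }
  rewrite <- Eb in T.
  assert (P : (B ^ 3 <= (1 + B) ^ 3)%R) by (apply pow_incr; lra).
  assert (P2 : (1 <= (1 + B) ^ 3)%R).
  { rewrite <- (pow1 3). apply pow_incr. lra. }
  destruct (Rle_dec (Cmod b) (1 + (1 + B) ^ 3)) as [|N]; [easy|]. exfalso.
  set (c := Cmod b) in *. assert (c < c ^ 3)%R by (simpl; nra). lra.
Qed.

(** Where [sm] stays bounded, [cm ^ 3 = 1 - sm ^ 3] does too, so [cm] has no pole there. *)
Lemma reg_of_sm z : hol1 sm z -> reg z.
Proof.
  intros H. split; [easy|].
  apply meromorphic1_bounded with (1 + (1 + (Cmod (sm z) + 1)) ^ 3)%R; [apply cm_mero|].
  intros P HP.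
  destruct (filter_ex _ (filter_and _ _ (filter_and _ _ HP (cubic_near z))
    (Clim_locally' _ _ _ (hol1_Clim _ _ H) 1%R Rlt_0_1))) as (t & [Pt Et] & Bt).
  exists t. split; [easy|]. apply (cube_sum_bound (sm t)); [now apply Cminus_0_eq|].
  replace (sm t) with (sm z + (sm t - sm z)) by ring.
  eapply Rle_trans; [apply Cmod_triangle|]. lra.
Qed.

(** By contraction on a small disc. *)
Lemma ode_unique (s c : C -> C) : hol1 s 0 -> hol1 c 0 -> s 0 = 0 -> c 0 = 1 ->
  locally (0 : C) (fun z => dC s z (c z ^ 2) /\ dC c z (- s z ^ 2)) ->
  locally (0 : C) (fun z => s z = sm z /\ c z = cm z).
Proof.
  intros Hs Hc s0 c0 D. destruct reg_0 as [Hsm Hcm].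
  assert (L := filter_and _ _ (filter_and _ _ D (reg_open 0 reg_0))
    (filter_and _ _ (filter_and _ _ (hol1_Clim s 0 Hs 1%R Rlt_0_1) (hol1_Clim c 0 Hc 1%R Rlt_0_1))
      (filter_and _ _ (hol1_Clim sm 0 Hsm 1%R Rlt_0_1) (hol1_Clim cm 0 Hcm 1%R Rlt_0_1)))).
  apply (proj1 (locally_Cmod _ _)) in L. destruct L as (r0 & Hr0 & L).
  (* Each pass gains a factor [2 * 4 * (1 / 16) = 1 / 2]: 2 from [mean_value_bound], 4 from the
     bound on the sum of two functions of modulus at most 2, and [1 / 16] from the radius. *)
  set (r := Rmin r0 (1 / 16)). assert (Hr : (0 < r)%R) by (apply Rmin_glb_lt; lra).
  pose proof (Rmin_l r0 (1 / 16)) as M1. pose proof (Rmin_r r0 (1 / 16)) as M2. fold r in M1, M2.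
  assert (BD : forall z, (Cmod (z - 0) < r)%R -> (Cmod (s z) <= 2)%R /\ (Cmod (c z) <= 2)%R /\
     (Cmod (sm z) <= 2)%R /\ (Cmod (cm z) <= 2)%R).
  { intros z Hz. destruct (L z ltac:(lra)) as [_ [[L1 L2] [L3 L4]]].
    rewrite s0 in L1. rewrite c0 in L2. rewrite sm_0 in L3. rewrite cm_0 in L4.
    assert (T : forall v w : C, (Cmod w <= 1)%R -> (Cmod (v - w) < 1)%R -> (Cmod v <= 2)%R).
    { intros v w Hw Hv. replace v with (w + (v - w)) by ring.
      eapply Rle_trans; [apply Cmod_triangle|]. lra. }
    repeat split; (eapply T; [|eassumption]); rewrite ?Cmod_0, ?Cmod_1; lra. }
  assert (IND : forall n z, (Cmod (z - 0) < r)%R ->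
    (Cmod (s z - sm z) <= 4 * (1 / 2) ^ n)%R /\ (Cmod (c z - cm z) <= 4 * (1 / 2) ^ n)%R).
  { induction n as [|n IH]; intros z Hz.
    - destruct (BD z Hz) as (B1 & B2 & B3 & B4). simpl.
      split; (eapply Rle_trans; [apply Cmod_triangle_minus|]); lra.
    - set (B := (4 * (1 / 2) ^ n)%R) in *.
      assert (HB : (0 <= B)%R).
      { eapply Rle_trans; [apply Cmod_ge_0|apply (IH z Hz)]. }
      assert (DS : forall y, (Cmod (y - 0) < r)%R ->
        dC (fun t => s t - sm t) y (c y ^ 2 - cm y ^ 2) /\ (Cmod (c y ^ 2 - cm y ^ 2) <= 4 * B)%R).
      { intros y Hy. destruct (L y ltac:(lra)) as [[[D1 D2] Ry] _]. split.
        - apply dC_sub; [easy|now apply sm_deriv].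
        - replace (c y ^ 2 - cm y ^ 2) with ((c y + cm y) * (c y - cm y)) by ring.
          rewrite Cmod_mult. destruct (BD y Hy) as (B1 & B2 & B3 & B4).
          apply Rmult_le_compat; try apply Cmod_ge_0.
          + eapply Rle_trans; [apply Cmod_triangle|]. lra.
          + now apply IH. }
      assert (DC : forall y, (Cmod (y - 0) < r)%R ->
        dC (fun t => c t - cm t) y (- s y ^ 2 - - sm y ^ 2) /\ (Cmod (- s y ^ 2 - - sm y ^ 2) <= 4 * B)%R).
      { intros y Hy. destruct (L y ltac:(lra)) as [[[D1 D2] Ry] _]. split.
        - apply dC_sub; [easy|now apply cm_deriv].
        - replace (- s y ^ 2 - - sm y ^ 2) with (- ((s y + sm y) * (s y - sm y))) by ring.
          rewrite Cmod_opp, Cmod_mult. destruct (BD y Hy) as (B1 & B2 & B3 & B4).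
          apply Rmult_le_compat; try apply Cmod_ge_0.
          + eapply Rle_trans; [apply Cmod_triangle|]. lra.
          + now apply IH. }
      pose proof (mean_value_bound _ _ _ _ _ DS z Hz) as E1.
      pose proof (mean_value_bound _ _ _ _ _ DC z Hz) as E2. cbv beta in E1, E2.
      rewrite s0, sm_0 in E1. rewrite c0, cm_0 in E2.
      replace (s z - sm z - (0 - 0)) with (s z - sm z) in E1 by ring.
      replace (c z - cm z - (1 - 1)) with (c z - cm z) in E2 by ring.
      replace (4 * (1 / 2) ^ S n)%R with (2 * (4 * B) * (1 / 16))%R by (unfold B; simpl; field).
      split; (eapply Rle_trans; [eassumption|]); apply Rmult_le_compat_l; lra. }
  assert (ZERO : forall v : C, (forall n, (Cmod v <= 4 * (1 / 2) ^ n)%R) -> v = 0).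
  { intros v Hv. apply Cmod_eq_0. apply Rle_antisym; [|apply Cmod_ge_0].
    apply le_epsilon. intros e He. rewrite Rplus_0_l.
    destruct (pow_lt_1_zero (1 / 2) ltac:(rewrite Rabs_pos_eq; lra) (e / 4) ltac:(lra)) as [N HN].
    specialize (HN N (Nat.le_refl N)). specialize (Hv N).
    rewrite Rabs_pos_eq in HN by (apply pow_le; lra). lra. }
  apply locally_Cmod. exists r. split; [easy|]. intros z Hz.
  split; apply Cminus_0_eq; apply ZERO; intros n; now apply IND.
Qed.

(** * Rotation and reflection of the argument *)

Lemma near_everywhere (F : C -> C) : (forall z, merop F z) -> locally (0 : C) (fun t => F t = 0) ->
  forall z : C, locally' z (fun t => F t = 0).
Proof. intros H L. apply (merop_identity F 0 H). now apply locally_locally'. Qed.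

Lemma merop_scale f (c z : C) : (forall z, merop f z) -> c <> 0 -> merop (fun t => f (c * t)) z.
Proof.
  intros H N. apply (merop_ext (fun t => f (c * t + 0))).
  - apply filter_forall. intros t. f_equal. ring.
  - apply merop_affine; [exact N|apply H].
Qed.

Lemma locally_scale (c : C) (P : C -> Prop) : (Cmod c = 1)%R -> locally (0 : C) P -> locally (0 : C) (fun t => P (c * t)).
Proof.
  intros Hc L. apply (proj1 (locally_Cmod _ _)) in L. destruct L as (r & Hr & L).
  apply locally_Cmod. exists r. split; [easy|]. intros y Hy. apply L.
  replace (c * y - 0) with (c * (y - 0)) by ring. rewrite Cmod_mult, Hc. lra.
Qed.

Lemma hol1_scale f (c z : C) : hol1 f (c * z) -> hol1 (fun t => f (c * t)) z.
Proof.
  intros H. apply (hol1_comp f (fun t => c * t)); [easy|].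
  apply hol1_mul; [apply hol1_const|apply hol1_id].
Qed.

Lemma dC_scale f (c z l : C) : dC f (c * z) l -> dC (fun t => f (c * t)) z (l * c).
Proof.
  intros H. apply (dC_comp f (fun t => c * t)); [easy|].
  eapply dC_eq; [|apply dC_mul; [apply dC_const|apply dC_id]]. cbv beta. ring.
Qed.

(** The functions [om ^ 2 sm (om z)] and [cm (om z)] solve the same initial value problem. This
    symmetry is what makes the choice of the cube root immaterial. *)
Lemma om_near z : locally' z (fun t => sm (om * t) = om * sm t /\ cm (om * t) = cm t).
Proof.
  assert (L : locally (0 : C) (fun z => om * om * sm (om * z) = sm z /\ cm (om * z) = cm z)).
  { destruct reg_0 as [Hs Hc].
    apply (ode_unique (fun z => om * om * sm (om * z)) (fun z => cm (om * z))).
    - apply hol1_mul; [apply hol1_const|]. apply hol1_scale. now replace (om * 0) with (RtoC 0) by ring.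
    - apply hol1_scale. now replace (om * 0) with (RtoC 0) by ring.
    - replace (om * 0) with (RtoC 0) by ring. rewrite sm_0. ring.
    - replace (om * 0) with (RtoC 0) by ring. apply cm_0.
    - generalize (locally_scale om _ Cmod_om (reg_open 0 reg_0)). apply filter_imp.
      intros y Ry. split.
      + eapply dC_eq; [|apply dC_mul; [apply dC_const|apply dC_scale, sm_deriv, Ry]].
        cbv beta. transitivity ((om * om * om) * cm (om * y) ^ 2); [ring|]. rewrite om3. ring.
      + eapply dC_eq; [|apply dC_scale, cm_deriv, Ry].
        cbv beta. transitivity (- (om * om * om) * sm (om * y) ^ 2 * om); [rewrite om3; ring|].
        ring. }
  apply filter_and.
  - generalize (near_everywhere (fun t => sm (om * t) - om * sm t)
     (fun z => merop_sub _ _ _ (merop_scale sm om z sm_merop om_nz) (merop_mul _ _ _ (merop_const _ _) (sm_merop z)))).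
    intros G. eapply filter_imp; [|apply G].
    + intros t. apply Cminus_0_eq.
    + revert L. apply filter_imp. intros t [<- _].
      transitivity ((1 - om * om * om) * sm (om * t)); [ring|]. rewrite om3. ring.
  - generalize (near_everywhere (fun t => cm (om * t) - cm t)
     (fun z => merop_sub _ _ _ (merop_scale cm om z cm_merop om_nz) (cm_merop z))).
    intros G. eapply filter_imp; [|apply G].
    + intros t. apply Cminus_0_eq.
    + revert L. apply filter_imp. intros t [_ ->]. ring.
Qed.

Lemma reg_om z : reg z -> reg (om * z) /\ sm (om * z) = om * sm z /\ cm (om * z) = cm z.
Proof.
  intros R.
  destruct (meromorphic1_transport sm om 0 z (om * sm z) sm_mero om_nz) as [H1 E1].
  { apply (Clim_ext_eq (fun t => om * sm t) _ (om * sm z)); [|easy|].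
    - generalize (om_near z). apply filter_imp. intros t [<- _]. f_equal. ring.
    - apply Clim_mul; [apply Clim_const|now apply Clim_locally', sm_Clim]. }
  destruct (meromorphic1_transport cm om 0 z (cm z) cm_mero om_nz) as [H2 E2].
  { apply (Clim_ext_eq cm _ (cm z)); [|easy|].
    - generalize (om_near z). apply filter_imp. intros t [_ <-]. f_equal. ring.
    - now apply Clim_locally', cm_Clim. }
  replace (om * z + 0) with (om * z) in * by ring. now repeat split.
Qed.

(** By the cubic relation, [- sm (- z) / cm (- z)] and [1 / cm (- z)] solve the same initial value
    problem. Clearing denominators leaves germs built by sums and products only. *)
Lemma neg_near z : locally' z (fun t => sm (- (1) * t) * cm t = - sm t /\ cm (- (1) * t) * cm t = 1).
Proof.
  assert (N1 : - (1) <> 0).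
  { intros E. apply C1_nz. transitivity (- - (1)); [ring|]. rewrite E. ring. }
  assert (M1 : Cmod (- (1)) = 1%R) by (rewrite Cmod_opp; apply Cmod_1).
  destruct reg_0 as [Hs Hc].
  assert (NC : locally (0 : C) (fun t => cm t <> 0)).
  { apply locally_nz; [easy|]. rewrite cm_0. apply C1_nz. }
  assert (Z : - (1) * 0 = 0) by ring.
  assert (L : locally (0 : C) (fun z => - sm (- (1) * z) / cm (- (1) * z) = sm z /\ / cm (- (1) * z) = cm z)).
  { apply (ode_unique (fun z => - sm (- (1) * z) / cm (- (1) * z)) (fun z => / cm (- (1) * z))).
    - apply hol1_div.
      + apply hol1_opp. apply hol1_scale. now rewrite Z.
      + apply hol1_scale. now rewrite Z.
      + rewrite Z, cm_0. apply C1_nz.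
    - apply hol1_inv; [apply hol1_scale; now rewrite Z|]. rewrite Z, cm_0. apply C1_nz.
    - rewrite Z, sm_0, cm_0. field.
    - rewrite Z, cm_0. field.
    - generalize (locally_scale _ _ M1 (filter_and _ _ (reg_open 0 reg_0) NC)). apply filter_imp.
      intros y [Ry Ny]. pose proof (cubic _ Ry) as Cu.
      assert (Ds : dC (fun z => sm (- (1) * z)) y (cm (- (1) * y) ^ 2 * - (1))) by now apply dC_scale, sm_deriv.
      assert (Dc : dC (fun z => cm (- (1) * z)) y (- sm (- (1) * y) ^ 2 * - (1))) by now apply dC_scale, cm_deriv.
      set (s := sm (- (1) * y)) in *. set (c := cm (- (1) * y)) in *. split.
      + eapply dC_eq; [|apply dC_div; [apply dC_opp, Ds|apply Dc|exact Ny]]. cbv beta. fold s c.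
        transitivity ((s ^ 3 + c ^ 3) / (c * c)); [field; exact Ny|]. rewrite Cu. field. exact Ny.
      + eapply dC_eq; [|apply dC_inv; [apply Dc|exact Ny]]. cbv beta. fold s c. field. exact Ny. }
  assert (NC' := locally_scale _ _ M1 NC).
  apply filter_and.
  - generalize (near_everywhere (fun t => sm (- (1) * t) * cm t + sm t)
     (fun z => merop_add _ _ _ (merop_mul _ _ _ (merop_scale sm _ z sm_merop N1) (cm_merop z)) (sm_merop z))).
    intros G. eapply filter_imp; [|apply G].
    + intros t E. apply Cminus_0_eq. rewrite <- E. ring.
    + generalize (filter_and _ _ L NC'). apply filter_imp. intros t [[<- <-] N]. field. exact N.
  - generalize (near_everywhere (fun t => cm (- (1) * t) * cm t - 1)
     (fun z => merop_sub _ _ _ (merop_mul _ _ _ (merop_scale cm _ z cm_merop N1) (cm_merop z)) (merop_const 1 z))).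
    intros G. eapply filter_imp; [|apply G].
    + intros t E. now apply Cminus_0_eq.
    + generalize (filter_and _ _ L NC'). apply filter_imp. intros t [[_ <-] N]. field. exact N.
Qed.

Lemma reg_neg z : reg z -> cm z <> 0 -> reg (- z) /\ sm (- z) = - sm z / cm z /\ cm (- z) = / cm z.
Proof.
  intros R N.
  assert (N1 : - (1) <> 0).
  { intros E. apply C1_nz. transitivity (- - (1)); [ring|]. rewrite E. ring. }
  assert (NL := locally_locally' _ _ (locally_nz cm z (proj2 R) N)).
  destruct (meromorphic1_transport sm (- (1)) 0 z (- sm z / cm z) sm_mero N1) as [H1 E1].
  { apply (Clim_ext_eq (fun t => - sm t / cm t) _ (- sm z / cm z)); [|easy|].
    - generalize (filter_and _ _ (neg_near z) NL). apply filter_imp. intros t [[E _] Nt].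
      rewrite <- E. replace (- (1) * t + 0) with (- (1) * t) by ring. field. exact Nt.
    - apply Clim_div; auto.
      + apply Clim_opp. now apply Clim_locally', sm_Clim.
      + now apply Clim_locally', cm_Clim. }
  destruct (meromorphic1_transport cm (- (1)) 0 z (/ cm z) cm_mero N1) as [H2 E2].
  { apply (Clim_ext_eq (fun t => / cm t) _ (/ cm z)); [|easy|].
    - generalize (filter_and _ _ (neg_near z) NL). apply filter_imp. intros t [[_ E] Nt].
      replace (- (1) * t + 0) with (- (1) * t) by ring.
      transitivity (cm (- (1) * t) * cm t * / cm t); [|field; exact Nt]. rewrite E. ring.
    - apply Clim_inv; auto. now apply Clim_locally', cm_Clim. }
  replace (- (1) * z + 0) with (- z) in * by ring. now repeat split.
Qed.

(** ** Addition formulas *)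

(** The addition formulas read [sm (u + v) = add_s / add_d] and [cm (u + v) = add_c / add_d]. All
    three expressions vanish at [u = v], so these formulas say nothing about doubling. *)
Definition add_s (s1 c1 s2 c2 : C) : C := s1 ^ 2 * c2 - s2 ^ 2 * c1.
Definition add_c (s1 c1 s2 c2 : C) : C := s1 * c1 - s2 * c2.
Definition add_d (s1 c1 s2 c2 : C) : C := s1 * c2 ^ 2 - s2 * c1 ^ 2.

Lemma sm_nz_near z : locally' z (fun t => sm t <> 0).
Proof.
  destruct (merop_dichotomy sm z (sm_merop z)) as [Z|]; [|easy]. exfalso.
  pose proof (merop_identity sm z sm_merop Z 0) as Z0.
  assert (L : locally (0 : C) (fun t => sm t = 0)).
  { apply (proj1 (locally'_Cmod _ _)) in Z0. destruct Z0 as (r & Hr & Z0).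
    apply locally_Cmod. exists r. split; [easy|]. intros y Hy.
    destruct (Ceq_dec y 0) as [->|N]; [apply sm_0|auto]. }
  assert (D : dC sm 0 0).
  { apply dC_D2. apply (D2_ext (fun _ => RtoC 0)); [|apply D2_const].
    apply (proj2 (locally_dst_fst 0 (fun t => RtoC 0 = sm t))). revert L. apply filter_imp. auto. }
  pose proof (is_derive_C_unique _ _ _ _ D (sm_deriv 0 reg_0)) as E.
  rewrite cm_0 in E. apply C1_nz. rewrite E. ring.
Qed.

Lemma cm_nz_near z : locally' z (fun t => cm t <> 0).
Proof.
  destruct (merop_dichotomy cm z (cm_merop z)) as [Z|]; [|easy]. exfalso.
  pose proof (merop_identity cm z cm_merop Z 0) as Z0.
  apply hol1_zero_punctured in Z0; [|apply reg_0]. rewrite cm_0 in Z0. now apply C1_nz.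
Qed.

Lemma dC_reflect f (t z l : C) : dC f (t - z) l -> dC (fun z => f (t - z)) z (- l).
Proof.
  intros H. eapply dC_eq; [|apply (dC_comp f (fun z => t - z)); [exact H|]].
  2: apply dC_sub; [apply dC_const|apply dC_id].
  ring.
Qed.

Lemma hol1_reflect f (t z : C) : hol1 f (t - z) -> hol1 (fun z => f (t - z)) z.
Proof.
  intros H. apply (hol1_comp f (fun z => t - z)); [easy|].
  apply hol1_sub; [apply hol1_const|apply hol1_id].
Qed.

Lemma merop_reflect f (t z : C) : (forall z, merop f z) -> merop (fun z => f (t - z)) z.
Proof.
  intros H. apply (merop_ext (fun z => f (- (1) * z + t))).
  - apply filter_forall. intros y. f_equal. ring.
  - apply merop_affine; [|apply H]. intros E. apply C1_nz.
    transitivity (- - (1)); [ring|]. rewrite E. ring.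
Qed.

Lemma dC_pow2 f z l : dC f z l -> dC (fun t => f t ^ 2) z (2 * f z * l).
Proof.
  intros H. eapply dC_eq; [|apply dC_mul; [exact H|apply dC_mul; [exact H|apply dC_const]]].
  cbv beta. simpl. ring.
Qed.

(** Along [z |-> (t - z, z)] the quotients in the addition formulas have zero
    derivative, so they keep the value [sm t], [cm t] they have at [z = 0]. *)
Lemma addition_near t z : reg t -> sm t <> 0 ->
  locally' z (fun z =>
    add_s (sm (t - z)) (cm (t - z)) (sm z) (cm z)
      - sm t * add_d (sm (t - z)) (cm (t - z)) (sm z) (cm z) = 0 /\
    add_c (sm (t - z)) (cm (t - z)) (sm z) (cm z)
      - cm t * add_d (sm (t - z)) (cm (t - z)) (sm z) (cm z) = 0).
Proof.
  intros Rt Nt.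
  set (Ns := fun z => add_s (sm (t - z)) (cm (t - z)) (sm z) (cm z)).
  set (Nc := fun z => add_c (sm (t - z)) (cm (t - z)) (sm z) (cm z)).
  set (Dn := fun z => add_d (sm (t - z)) (cm (t - z)) (sm z) (cm z)).
  assert (T0 : t - 0 = t) by ring.
  (* The common denominator is non-zero at the starting point because [sm t] is. *)
  assert (D0 : Dn 0 = sm t) by (unfold Dn, add_d; rewrite T0, sm_0, cm_0; ring).
  assert (S0 : Ns 0 = sm t * sm t) by (unfold Ns, add_s; rewrite T0, sm_0, cm_0; ring).
  assert (C0 : Nc 0 = cm t * sm t) by (unfold Nc, add_c; rewrite T0, sm_0, cm_0; ring).
  assert (HH : forall y, reg (t - y) -> reg y -> hol1 Dn y).
  { intros y [H1 H2] [H3 H4]. apply hol1_sub; apply hol1_mul; try apply hol1_pow; auto using hol1_reflect. }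
  assert (NR : locally (0 : C) (fun y => reg (t - y) /\ reg y /\ Dn y <> 0)).
  { assert (A : locally (0 : C) (fun y => reg (t - y))).
    { assert (L := reg_open t Rt). apply (proj1 (locally_Cmod _ _)) in L. destruct L as (r & Hr & L).
      apply locally_Cmod. exists r. split; [easy|]. intros y Hy. apply L.
      replace (t - y - t) with (- (y - 0)) by ring. now rewrite Cmod_opp. }
    apply filter_and; [exact A|apply filter_and; [apply reg_open, reg_0|]].
    apply locally_nz.
    - apply HH; [rewrite T0; exact Rt|exact reg_0].
    - now rewrite D0. }
  apply (proj1 (locally_Cmod _ _)) in NR. destruct NR as (r & Hr & NR).
  assert (DER : forall y, (Cmod (y - 0) < r)%R ->
     dC (fun y => Ns y / Dn y) y 0 /\ dC (fun y => Nc y / Dn y) y 0).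
  { intros y Hy. destruct (NR y Hy) as (R1 & R2 & Nz).
    pose proof (dC_reflect _ _ _ _ (sm_deriv _ R1)) as d1.
    pose proof (dC_reflect _ _ _ _ (cm_deriv _ R1)) as d2.
    pose proof (sm_deriv _ R2) as d3. pose proof (cm_deriv _ R2) as d4.
    pose proof (cubic _ R1) as Q1. pose proof (cubic _ R2) as Q2.
    assert (e1 : dC Dn y (cm y ^ 2 * - (cm (t - y) ^ 2) + sm (t - y) * (2 * cm y * (- sm y ^ 2))
       - (cm (t - y) ^ 2 * (cm y ^ 2) + sm y * (2 * cm (t - y) * - - sm (t - y) ^ 2)))).
    { exact (dC_sub _ _ _ _ _ (dC_mul _ _ _ _ _ d1 (dC_pow2 cm y _ d4))
        (dC_mul _ _ _ _ _ d3 (dC_pow2 (fun y => cm (t - y)) y _ d2))). }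
    assert (e2 : dC Ns y (cm y * (2 * sm (t - y) * - (cm (t - y) ^ 2)) + sm (t - y) ^ 2 * (- sm y ^ 2)
       - (cm (t - y) * (2 * sm y * (cm y ^ 2)) + sm y ^ 2 * - - sm (t - y) ^ 2))).
    { exact (dC_sub _ _ _ _ _ (dC_mul _ _ _ _ _ (dC_pow2 (fun y => sm (t - y)) y _ d1) d4)
        (dC_mul _ _ _ _ _ (dC_pow2 sm y _ d3) d2)). }
    assert (e3 : dC Nc y (cm (t - y) * - (cm (t - y) ^ 2) + sm (t - y) * - - sm (t - y) ^ 2
       - (cm y * (cm y ^ 2) + sm y * (- sm y ^ 2)))).
    { exact (dC_sub _ _ _ _ _ (dC_mul _ _ _ _ _ d1 d2) (dC_mul _ _ _ _ _ d3 d4)). }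
    split.
    - eapply dC_eq; [|apply dC_div; [exact e2|exact e1|exact Nz]].
      unfold Ns, Dn, add_s, add_d in *.
      set (s1 := sm (t - y)) in *. set (c1 := cm (t - y)) in *. set (s2 := sm y) in *. set (c2 := cm y) in *.
      (* The numerator of the derivative is a multiple of the difference of the two cubic sums, both
         of which equal 1. *)
      match goal with |- ?X / _ = _ => replace X with
        (2 * c1 * c2 * s1 * s2 * ((s1 ^ 3 + c1 ^ 3) - (s2 ^ 3 + c2 ^ 3))) by ring end.
      rewrite Q1, Q2. field. exact Nz.
    - eapply dC_eq; [|apply dC_div; [exact e3|exact e1|exact Nz]].
      unfold Nc, Dn, add_c, add_d in *.
      set (s1 := sm (t - y)) in *. set (c1 := cm (t - y)) in *. set (s2 := sm y) in *. set (c2 := cm y) in *.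
      match goal with |- ?X / _ = _ => replace X with
        ((c1 ^ 2 * s2 + c2 ^ 2 * s1) * ((s1 ^ 3 + c1 ^ 3) - (s2 ^ 3 + c2 ^ 3))) by ring end.
      rewrite Q1, Q2. field. exact Nz. }
  assert (L1 : locally (0 : C) (fun y => Ns y - sm t * Dn y = 0)).
  { apply locally_Cmod. exists r. split; [easy|]. intros y Hy.
    pose proof (dC_zero_const _ _ _ (fun y Hy => proj1 (DER y Hy)) y Hy) as E. cbv beta in E.
    rewrite D0, S0 in E. destruct (NR y Hy) as (_ & _ & Nz).
    replace (Ns y) with (Ns y / Dn y * Dn y) by (field; exact Nz). rewrite E. field. exact Nt. }
  assert (L2 : locally (0 : C) (fun y => Nc y - cm t * Dn y = 0)).
  { apply locally_Cmod. exists r. split; [easy|]. intros y Hy.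
    pose proof (dC_zero_const _ _ _ (fun y Hy => proj2 (DER y Hy)) y Hy) as E. cbv beta in E.
    rewrite D0, C0 in E. destruct (NR y Hy) as (_ & _ & Nz).
    replace (Nc y) with (Nc y / Dn y * Dn y) by (field; exact Nz). rewrite E. field. exact Nt. }
  assert (m1 := fun z => merop_reflect sm t z sm_merop).
  assert (m2 := fun z => merop_reflect cm t z cm_merop).
  assert (MD : forall z, merop Dn z).
  { intros y. apply merop_sub; apply merop_mul; auto using sm_merop, merop_pow, cm_merop. }
  apply filter_and.
  - apply (near_everywhere (fun y => Ns y - sm t * Dn y)); [|exact L1].
    intros y. apply merop_sub; [|apply merop_mul; [apply merop_const|apply MD]].
    apply merop_sub; apply merop_mul; auto using sm_merop, merop_pow, cm_merop.
  - apply (near_everywhere (fun y => Nc y - cm t * Dn y)); [|exact L2].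
    intros y. apply merop_sub; [|apply merop_mul; [apply merop_const|apply MD]].
    apply merop_sub; apply merop_mul; auto using sm_merop, merop_pow, cm_merop.
Qed.

Lemma addition_cross u v : reg u -> reg v -> reg (u + v) -> sm (u + v) <> 0 ->
  add_s (sm u) (cm u) (sm v) (cm v) = sm (u + v) * add_d (sm u) (cm u) (sm v) (cm v) /\
  add_c (sm u) (cm u) (sm v) (cm v) = cm (u + v) * add_d (sm u) (cm u) (sm v) (cm v).
Proof.
  intros Ru Rv Rt Nt. pose proof (addition_near (u + v) v Rt Nt) as L.
  assert (E : u + v - v = u) by ring.
  assert (H1 : hol1 (fun z => sm (u + v - z)) v) by (apply hol1_reflect; rewrite E; apply Ru).
  assert (H2 : hol1 (fun z => cm (u + v - z)) v) by (apply hol1_reflect; rewrite E; apply Ru).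
  destruct Rv as [Rv1 Rv2].
  assert (Hd : hol1 (fun z => add_d (sm (u + v - z)) (cm (u + v - z)) (sm z) (cm z)) v).
  { apply hol1_sub; apply hol1_mul; auto using hol1_pow. }
  split; apply Cminus_0_eq.
  - rewrite <- E at 1 2 4 5.
    apply (hol1_zero_punctured (fun z => add_s (sm (u + v - z)) (cm (u + v - z)) (sm z) (cm z)
      - sm (u + v) * add_d (sm (u + v - z)) (cm (u + v - z)) (sm z) (cm z))).
    + apply hol1_sub; [|apply hol1_mul; [apply hol1_const|exact Hd]].
      apply hol1_sub; apply hol1_mul; auto using hol1_pow.
    + revert L. apply filter_imp. easy.
  - rewrite <- E at 1 2 4 5.
    apply (hol1_zero_punctured (fun z => add_c (sm (u + v - z)) (cm (u + v - z)) (sm z) (cm z)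
      - cm (u + v) * add_d (sm (u + v - z)) (cm (u + v - z)) (sm z) (cm z))).
    + apply hol1_sub; [|apply hol1_mul; [apply hol1_const|exact Hd]].
      apply hol1_sub; apply hol1_mul; auto using hol1_pow.
    + revert L. apply filter_imp. easy.
Qed.

Lemma locally'_shift (v z : C) (P : C -> Prop) : (forall z, locally' z P) -> locally' z (fun t => P (t + v)).
Proof.
  intros H. assert (L := locally'_affine 1 v z P C1_nz (H _)). revert L. apply filter_imp.
  intros t. replace (1 * t + v) with (t + v) by ring. easy.
Qed.

Ltac clim := repeat first [apply Clim_const | assumption | apply Clim_sub | apply Clim_add
  | apply Clim_opp | apply Clim_mul | apply Clim_pow].

(** Regularity of [u + v], and the case [sm (u + v) = 0], are obtained by letting the first argument
    vary: nearby arguments satisfy the hypotheses of [addition_cross], and the quotients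
    converge. *)
Lemma addition u v : reg u -> reg v -> add_d (sm u) (cm u) (sm v) (cm v) <> 0 ->
  reg (u + v) /\
  sm (u + v) = add_s (sm u) (cm u) (sm v) (cm v) / add_d (sm u) (cm u) (sm v) (cm v) /\
  cm (u + v) = add_c (sm u) (cm u) (sm v) (cm v) / add_d (sm u) (cm u) (sm v) (cm v).
Proof.
  intros Ru Rv N.
  assert (Cs := Clim_locally' _ _ _ (sm_Clim u Ru)). assert (Cc := Clim_locally' _ _ _ (cm_Clim u Ru)).
  set (d := fun t => add_d (sm t) (cm t) (sm v) (cm v)).
  assert (Cd : Clim (locally' u) d (d u)).
  { unfold d, add_d. clim. }
  pose proof (filter_and _ _ (filter_and _ _ (locally_locally' _ _ (reg_open u Ru)) (Clim_nz _ _ Cd N))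
    (filter_and _ _ (locally'_shift v u reg reg_near) (locally'_shift v u (fun t => sm t <> 0) sm_nz_near))) as L.
  destruct (meromorphic1_transport sm 1 v u (add_s (sm u) (cm u) (sm v) (cm v) / d u) sm_mero C1_nz) as [H1 E1].
  { apply (Clim_ext_eq (fun t => add_s (sm t) (cm t) (sm v) (cm v) / d t) _
      (add_s (sm u) (cm u) (sm v) (cm v) / d u)); [|easy|].
    - revert L. apply filter_imp. intros t [[R1 Nt] [R2 Ns]].
      destruct (addition_cross t v R1 Rv R2 Ns) as [A _].
      replace (1 * t + v) with (t + v) by ring. rewrite A. fold (d t). field. exact Nt.
    - apply Clim_div; auto. unfold add_s, add_c. clim. }
  destruct (meromorphic1_transport cm 1 v u (add_c (sm u) (cm u) (sm v) (cm v) / d u) cm_mero C1_nz) as [H2 E2].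
  { apply (Clim_ext_eq (fun t => add_c (sm t) (cm t) (sm v) (cm v) / d t) _
      (add_c (sm u) (cm u) (sm v) (cm v) / d u)); [|easy|].
    - revert L. apply filter_imp. intros t [[R1 Nt] [R2 Ns]].
      destruct (addition_cross t v R1 Rv R2 Ns) as [_ A].
      replace (1 * t + v) with (t + v) by ring. rewrite A. fold (d t). field. exact Nt.
    - apply Clim_div; auto. unfold add_s, add_c. clim. }
  replace (1 * u + v) with (u + v) in * by ring. now repeat split.
Qed.

(** ** Periods *)

(** The initial value problem has real coefficients, so it is preserved by conjugation. Hence [sm]
    and [cm] are real on the real axis, where monotonicity arguments become available. *)
Lemma conj_near z : locally' z (fun t => Cconj (sm (Cconj t)) = sm t /\ Cconj (cm (Cconj t)) = cm t).
Proof.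
  assert (J0 : Cconj 0 = 0) by (unfold Cconj, RtoC; simpl; f_equal; ring).
  assert (J1 : Cconj 1 = 1) by (unfold Cconj, RtoC; simpl; f_equal; ring).
  destruct reg_0 as [Hs Hc].
  assert (L : locally (0 : C) (fun z => Cconj (sm (Cconj z)) = sm z /\ Cconj (cm (Cconj z)) = cm z)).
  { apply (ode_unique (fun z => Cconj (sm (Cconj z))) (fun z => Cconj (cm (Cconj z)))).
    - apply hol1_conj. now rewrite J0.
    - apply hol1_conj. now rewrite J0.
    - now rewrite J0, sm_0, J0.
    - now rewrite J0, cm_0, J1.
    - assert (O := reg_open 0 reg_0). apply (proj1 (locally_Cmod _ _)) in O. destruct O as (r & Hr & O).
      apply locally_Cmod. exists r. split; [easy|]. intros y Hy.
      assert (Ry : reg (Cconj y)).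
      { apply O. rewrite <- J0, <- Cminus_conj, Cmod_conj. exact Hy. }
      split.
      + rewrite <- Cpow_conj. apply dC_conj. now apply sm_deriv.
      + rewrite <- Cpow_conj, <- Copp_conj. apply dC_conj. now apply cm_deriv. }
  apply filter_and.
  - generalize (near_everywhere (fun t => Cconj (sm (Cconj t)) - sm t)
     (fun z => merop_sub _ _ _ (merop_conj _ _ (sm_merop _)) (sm_merop z))).
    intros G. eapply filter_imp; [|apply G].
    + intros t. apply Cminus_0_eq.
    + revert L. apply filter_imp. intros t [-> _]. ring.
  - generalize (near_everywhere (fun t => Cconj (cm (Cconj t)) - cm t)
     (fun z => merop_sub _ _ _ (merop_conj _ _ (cm_merop _)) (cm_merop z))).
    intros G. eapply filter_imp; [|apply G].
    + intros t. apply Cminus_0_eq.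
    + revert L. apply filter_imp. intros t [_ ->]. ring.
Qed.

Lemma conj_RtoC (x : R) : Cconj (RtoC x) = RtoC x.
Proof. unfold Cconj, RtoC. simpl. f_equal. ring. Qed.

Lemma conj_fixed (z : C) : Cconj z = z -> z = RtoC (Re z).
Proof.
  destruct z as [a b]. unfold Cconj, RtoC, Re. simpl. intros E. injection E as E.
  f_equal. lra.
Qed.

Lemma real_on_real (x : R) : reg (RtoC x) ->
  sm (RtoC x) = RtoC (Re (sm (RtoC x))) /\ cm (RtoC x) = RtoC (Re (cm (RtoC x))).
Proof.
  intros [H1 H2].
  split; apply conj_fixed; apply Cminus_0_eq.
  - rewrite <- (conj_RtoC x) at 1.
    apply (hol1_zero_punctured (fun t => Cconj (sm (Cconj t)) - sm t)).
    + apply hol1_sub; [|easy]. apply hol1_conj. now rewrite conj_RtoC.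
    + generalize (conj_near (RtoC x)). apply filter_imp. intros t [-> _]. ring.
  - rewrite <- (conj_RtoC x) at 1.
    apply (hol1_zero_punctured (fun t => Cconj (cm (Cconj t)) - cm t)).
    + apply hol1_sub; [|easy]. apply hol1_conj. now rewrite conj_RtoC.
    + generalize (conj_near (RtoC x)). apply filter_imp. intros t [_ ->]. ring.
Qed.

(** Continuous induction: the supremum of the initial intervals on which [Q] holds is attained by
    the third premise and passed by the second. *)
Lemma half_line_induction (Q : R -> Prop) : Q 0%R ->
  (forall t, (0 <= t)%R -> Q t -> exists d, (0 < d)%R /\ forall s, (t < s < t + d)%R -> Q s) ->
  (forall t, (0 < t)%R -> (forall s, (0 <= s < t)%R -> Q s) -> Q t) ->
  forall t, (0 <= t)%R -> Q t.
Proof.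
  intros Q0 Hr Hl t Ht. apply NNPP. intros NQ.
  set (E := fun u => (0 <= u)%R /\ forall s, (0 <= s <= u)%R -> Q s).
  assert (UB : forall u, E u -> (u < t)%R).
  { intros u [U0 U]. destruct (Rlt_dec u t) as [|N]; [easy|]. exfalso. apply NQ, U. lra. }
  destruct (completeness E) as [m [U L]].
  { exists t. intros u Eu. left. auto. }
  { exists 0%R. split; [lra|]. intros s Hs. now replace s with 0%R by lra. }
  assert (M0 : (0 <= m)%R).
  { apply U. split; [lra|]. intros s Hs. now replace s with 0%R by lra. }
  assert (B : forall s, (0 <= s < m)%R -> Q s).
  { intros s Hs. apply NNPP. intros N. assert (m <= s)%R; [|lra].
    apply L. intros u [U0 Uu]. destruct (Rle_dec u s) as [|N2]; [easy|]. exfalso. apply N, Uu. lra. }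
  assert (Qm : Q m).
  { destruct (Rle_lt_or_eq_dec 0 m M0) as [P|<-]; [now apply Hl|easy]. }
  destruct (Hr m M0 Qm) as (d & Hd & D).
  assert (EE : E (m + d / 2)%R).
  { split; [lra|]. intros s Hs. destruct (Rtotal_order s m) as [H|[->|H]]; [apply B; lra|easy|apply D; lra]. }
  apply U in EE. lra.
Qed.

Lemma locally_real (x : R) (P : C -> Prop) : locally (RtoC x) P ->
  exists d, (0 < d)%R /\ forall s, (Rabs (s - x) < d)%R -> P (RtoC s).
Proof.
  intros L. apply (proj1 (locally_Cmod _ _)) in L. destruct L as (r & Hr & L).
  exists r. split; [easy|]. intros s Hs. apply L. now rewrite <- RtoC_minus, Cmod_R.
Qed.

(** On the positive real axis [cm] decreases at a rate bounded below as long as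
    it stays positive, so it must vanish. *)
Lemma exists_zero_cm : exists K : R, reg (RtoC K) /\ cm (RtoC K) = 0.
Proof.
  apply NNPP. intros NK.
  set (S := fun t : R => Re (sm (RtoC t))). set (Cf := fun t : R => Re (cm (RtoC t))).
  set (Q := fun t : R => reg (RtoC t) /\ (0 < Cf t)%R).
  assert (DS : forall t, reg (RtoC t) -> is_derive S t (Cf t * Cf t)%R).
  { intros t Rt. destruct (real_on_real t Rt) as [_ E].
    replace (Cf t * Cf t)%R with (Re (cm (RtoC t) ^ 2 * 1)).
    - apply (dR_Re (fun t => sm (RtoC t))). apply dR_comp; [now apply sm_deriv|apply dR_id].
    - rewrite E. fold (Cf t). replace (RtoC (Cf t) ^ 2 * 1) with (RtoC (Cf t * Cf t))
        by (rewrite RtoC_mult; ring). easy. }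
  assert (DC : forall t, reg (RtoC t) -> is_derive Cf t (- (S t * S t))%R).
  { intros t Rt. destruct (real_on_real t Rt) as [E _].
    replace (- (S t * S t))%R with (Re (- sm (RtoC t) ^ 2 * 1)).
    - apply (dR_Re (fun t => cm (RtoC t))). apply dR_comp; [now apply cm_deriv|apply dR_id].
    - rewrite E. fold (S t). replace (- RtoC (S t) ^ 2 * 1) with (RtoC (- (S t * S t)))
        by (rewrite RtoC_opp, RtoC_mult; ring). easy. }
  assert (MV : forall (f df : R -> R) a b, (a <= b)%R -> (forall t, (a <= t <= b)%R -> is_derive f t (df t)) ->
     exists c, (a <= c <= b)%R /\ (f b - f a = df c * (b - a))%R).
  { intros f df a b Hab H. destruct (MVT_gen f a b df) as (c & Hc & E).
    - rewrite Rmin_left, Rmax_right by lra. intros t Ht. apply H. lra.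
    - rewrite Rmin_left, Rmax_right by lra. intros t Ht. apply continuity_pt_filterlim.
      apply (ex_derive_continuous (V := R_NormedModule) f). eexists. now apply H.
    - rewrite Rmin_left, Rmax_right in Hc by lra. eauto. }
  assert (S0 : S 0%R = 0%R) by (unfold S; now rewrite sm_0).
  assert (C0 : Cf 0%R = 1%R) by (unfold Cf; now rewrite cm_0).
  assert (POS : forall u, (0 <= u)%R -> (forall s, (0 <= s <= u)%R -> Q s) -> (0 <= S u)%R).
  { intros u Hu H. destruct (MV S (fun t => Cf t * Cf t)%R 0%R u Hu) as (c & Hc & E).
    - intros t Ht. apply DS, H. lra.
    - rewrite S0 in E. nra. }
  assert (CUB : forall t, reg (RtoC t) -> (S t ^ 3 + Cf t ^ 3 = 1)%R).
  { intros t Rt. destruct (real_on_real t Rt) as [E1 E2]. pose proof (cubic _ Rt) as E.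
    rewrite E1, E2 in E. fold (S t) (Cf t) in E. rewrite <- !RtoC_pow, <- RtoC_plus in E.
    now apply RtoC_inj in E. }
  assert (BND : forall u, (0 <= u)%R -> (forall s, (0 <= s <= u)%R -> Q s) -> (S u <= 1)%R).
  { intros u Hu H. destruct (H u ltac:(lra)) as [Ru Cu]. pose proof (CUB u Ru) as E.
    pose proof (POS u Hu H) as P. destruct (Rle_dec (S u) 1) as [|N]; [easy|]. exfalso.
    assert (0 < Cf u ^ 3)%R by now apply pow_lt.
    assert (1 < S u ^ 3)%R by (simpl; nra). lra. }
  assert (ALL : forall t, (0 <= t)%R -> Q t).
  { apply half_line_induction.
    - split; [apply reg_0|]. rewrite C0. lra.
    - intros t Ht [Rt Ct].
      assert (L := filter_and _ _ (reg_open _ Rt) (cm_Clim _ Rt (Cf t) Ct)).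
      destruct (locally_real t _ L) as (d & Hd & D). exists d. split; [easy|]. intros s Hs.
      destruct (D s) as [Rs B]; [apply Rabs_def1; lra|]. split; [easy|].
      pose proof (Re_le_Cmod (cm (RtoC s) - cm (RtoC t))) as E.
      change (Re (cm (RtoC s) - cm (RtoC t))) with (Cf s - Cf t)%R in E.
      pose proof (Rle_abs (- (Cf s - Cf t))) as A. rewrite Rabs_Ropp in A. lra.
    (* At a limit point [sm] has values in [[0, 1]] to the left of [t], so [t] is no pole. By
       continuity [cm t] is not negative, and [NK] excludes the value 0. *)
    - intros t Ht H.
      assert (Hs : hol1 sm (RtoC t)).
      { apply meromorphic1_bounded with 1%R; [apply sm_mero|]. intros P HP.
        apply (proj1 (locally'_Cmod _ _)) in HP. destruct HP as (r & Hr & HP).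
        set (s := Rmax 0 (t - r / 2)).
        assert (B1 : (0 <= s)%R) by apply Rmax_l.
        assert (B2 : (t - r / 2 <= s)%R) by apply Rmax_r.
        assert (B3 : (s < t)%R) by (apply Rmax_lub_lt; lra).
        exists (RtoC s). split.
        - apply HP.
          + rewrite <- RtoC_minus, Cmod_R. apply Rabs_def1; lra.
          + intros E. apply RtoC_inj in E. lra.
        - assert (H' : forall s0, (0 <= s0 <= s)%R -> Q s0) by (intros; apply H; lra).
          destruct (H' s ltac:(lra)) as [Rs _]. destruct (real_on_real s Rs) as [E _].
          rewrite E, Cmod_R. fold (S s). rewrite Rabs_pos_eq; [now apply BND|now apply POS]. }
      assert (Rt := reg_of_sm _ Hs). split; [easy|].
      destruct (real_on_real t Rt) as [_ E]. fold (Cf t) in E.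
      destruct (Rtotal_order (Cf t) 0) as [N|[Z|P]]; [|exfalso; apply NK; exists t; now rewrite E, Z|easy].
      exfalso. assert (Nt : (0 < - Cf t)%R) by lra.
      destruct (locally_real t _ (cm_Clim _ Rt (- Cf t)%R Nt)) as (d & Hd & D).
      set (s := Rmax 0 (t - d / 2)).
      assert (B1 : (0 <= s)%R) by apply Rmax_l.
      assert (B2 : (t - d / 2 <= s)%R) by apply Rmax_r.
      assert (B3 : (s < t)%R) by (apply Rmax_lub_lt; lra).
      specialize (D s ltac:(apply Rabs_def1; lra)). destruct (H s ltac:(lra)) as [_ Cs].
      pose proof (Re_le_Cmod (cm (RtoC s) - cm (RtoC t))) as A.
      change (Re (cm (RtoC s) - cm (RtoC t))) with (Cf s - Cf t)%R in A.
      pose proof (Rle_abs (Cf s - Cf t)). lra. }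
  assert (S1 : (0 < S 1)%R).
  { destruct (MV S (fun t => Cf t * Cf t)%R 0%R 1%R ltac:(lra)) as (c & Hc & E).
    - intros t Ht. apply DS, ALL. lra.
    - rewrite S0 in E. destruct (ALL c ltac:(lra)) as [_ P]. nra. }
  assert (MON : forall u, (1 <= u)%R -> (S 1 <= S u)%R).
  { intros u Hu. destruct (MV S (fun t => Cf t * Cf t)%R 1%R u Hu) as (c & Hc & E).
    - intros t Ht. apply DS, ALL. lra.
    - nra. }
  (* Beyond 1 the slope of [Cf] is at most [- S 1 ^ 2], so at this [u] the value would be at most
     -1. *)
  set (u := (1 + (Cf 1 + 1) / (S 1 * S 1))%R).
  assert (C1 : (0 < Cf 1)%R) by (apply ALL; lra).
  assert (Hu : (1 <= u)%R).
  { unfold u. assert (0 <= (Cf 1 + 1) / (S 1 * S 1))%R; [|lra].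
    apply Rdiv_le_0_compat; nra. }
  destruct (MV Cf (fun t => - (S t * S t))%R 1%R u Hu) as (c & Hc & E).
  - intros t Ht. apply DC, ALL. lra.
  - destruct (ALL u ltac:(lra)) as [_ Cu]. pose proof (MON c ltac:(lra)) as Mc.
    assert (A : (S 1 * S 1 * (u - 1) <= S c * S c * (u - 1))%R).
    { apply Rmult_le_compat_r; [lra|]. apply Rmult_le_compat; lra. }
    replace (S 1 * S 1 * (u - 1))%R with (Cf 1 + 1)%R in A by (unfold u; field; lra). lra.
Qed.

(** If [cm K = 0] and [e = sm K], then [e ^ 3 = 1] and translation by [K] sends the pair [(s, c)] to
    [(e / c, - s / (e c))]. This substitution has order three, so [3 K] is a period. *)
Lemma period_near : exists P : R, (0 < P)%R /\ forall z, locally' z (fun t => sm (t + RtoC P) = sm t /\ cm (t + RtoC P) = cm t).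
Proof.
  destruct exists_zero_cm as (K & RK & CK).
  set (e := sm (RtoC K)).
  assert (E3 : e ^ 3 = 1).
  { pose proof (cubic _ RK) as E. rewrite CK in E. rewrite <- E. fold e. ring. }
  assert (Ne : e <> 0).
  { intros E. rewrite E in E3. apply C1_nz. rewrite <- E3. ring. }
  assert (K0 : K <> 0%R) by (intros ->; rewrite cm_0 in CK; now apply C1_nz).
  assert (SH : forall z, locally' z (fun t => cm (t + RtoC K) <> 0 /\ sm (t + RtoC K) <> 0 /\ cm t <> 0 /\
      sm (t + RtoC K) = e / cm t /\ cm (t + RtoC K) = - sm t / (e * cm t))).
  { intros z.
    generalize (filter_and _ _ (filter_and _ _ (reg_near z) (cm_nz_near z))
     (filter_and _ _ (locally'_shift (RtoC K) z _ cm_nz_near) (locally'_shift (RtoC K) z _ sm_nz_near))).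
    apply filter_imp. intros t [[Rt Nt] [N1 N2]].
    destruct (addition t (RtoC K) Rt RK) as (_ & A1 & A2).
    - unfold add_d. rewrite CK. fold e.
      replace (sm t * 0 ^ 2 - e * cm t ^ 2) with (- (e * cm t ^ 2)) by ring.
      intros E. apply (Cmult_neq_0 _ _ Ne (Cpow_nz _ 2 Nt)).
      transitivity (- - (e * cm t ^ 2)); [ring|]. rewrite E. ring.
    - repeat split; auto.
      + rewrite A1. unfold add_s, add_d. rewrite CK. fold e. field. auto.
      + rewrite A2. unfold add_c, add_d. rewrite CK. fold e. field. auto. }
  assert (P3 : forall z, locally' z (fun t => sm (t + RtoC (3 * K)) = sm t /\ cm (t + RtoC (3 * K)) = cm t)).
  { intros z.
    generalize (filter_and _ _ (filter_and _ _ (SH z) (sm_nz_near z)) (filter_and _ _ (locally'_shift (RtoC K) z _ SH)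
      (locally'_shift (RtoC (2 * K)) z _ SH))).
    apply filter_imp. intros t [[(_ & _ & N0 & A1 & A2) NS] [(_ & _ & N1 & B1 & B2) (_ & _ & N2 & D1 & D2)]].
    replace (t + RtoC K + RtoC K) with (t + RtoC (2 * K)) in * by (rewrite RtoC_mult; ring).
    replace (t + RtoC (2 * K) + RtoC K) with (t + RtoC (3 * K)) in * by (rewrite !RtoC_mult; ring).
    assert (B2' : cm (t + RtoC (2 * K)) = e / sm t).
    { rewrite B2, A1, A2. field. auto. }
    assert (B1' : sm (t + RtoC (2 * K)) = - e ^ 2 * cm t / sm t).
    { rewrite B1, A2. field. auto. }
    split.
    - rewrite D1, B2'. field. auto.
    - rewrite D2, B1', B2'. field. auto. }
  destruct (Rlt_dec 0 K) as [PK|NK].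
  - exists (3 * K)%R. split; [lra|exact P3].
  - exists (- (3 * K))%R. split; [lra|]. intros z.
    generalize (locally'_shift (RtoC (- (3 * K))) z _ P3). apply filter_imp. intros t [E1 E2].
    assert (E0 : forall t : C, t + RtoC (- (3 * K)) + RtoC (3 * K) = t)
      by (intros; rewrite RtoC_opp; ring).
    rewrite E0 in E1, E2. easy.
Qed.

Definition is_period (w : C) : Prop :=
  forall z, locally' z (fun t => sm (t + w) = sm t /\ cm (t + w) = cm t).

Lemma period_reg w z : is_period w -> reg z -> reg (z + w) /\ sm (z + w) = sm z /\ cm (z + w) = cm z.
Proof.
  intros H R.
  destruct (meromorphic1_transport sm 1 w z (sm z) sm_mero C1_nz) as [H1 E1].
  { apply (Clim_ext_eq sm _ (sm z)); [|easy|now apply Clim_locally', sm_Clim].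
    generalize (H z). apply filter_imp. intros t [<- _]. f_equal. ring. }
  destruct (meromorphic1_transport cm 1 w z (cm z) cm_mero C1_nz) as [H2 E2].
  { apply (Clim_ext_eq cm _ (cm z)); [|easy|now apply Clim_locally', cm_Clim].
    generalize (H z). apply filter_imp. intros t [_ <-]. f_equal. ring. }
  replace (1 * z + w) with (z + w) in * by ring. now repeat split.
Qed.

Lemma period_opp w : is_period w -> is_period (- w).
Proof.
  intros H z. generalize (locally'_shift (- w) z _ H). apply filter_imp. intros t [E1 E2].
  assert (E0 : forall t : C, t + - w + w = t) by (intros; ring).
  rewrite E0 in E1, E2. easy.
Qed.

Lemma locally'_scale (c z : C) (P : C -> Prop) : c <> 0 -> (forall z, locally' z P) ->
  locally' z (fun t => P (c * t)).
Proof.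
  intros Hc H. assert (L := locally'_affine c 0 z P Hc (H _)). revert L. apply filter_imp.
  intros t. replace (c * t + 0) with (c * t) by ring. easy.
Qed.

(** The rotation symmetry turns the real period into a second one, independent of it over the
    reals. *)
Lemma period_om w : is_period w -> is_period (om * w).
Proof.
  intros H z.
  assert (N2 : om * om <> 0) by (apply Cmult_neq_0; apply om_nz).
  generalize (filter_and _ _ (reg_near z) (filter_and _ _ (locally'_scale (om * om) z _ N2 reg_near)
    (locally'_scale (om * om) z _ N2 H))).
  apply filter_imp. intros t [R1 [R2 [E1 E2]]].
  destruct (period_reg w _ H R2) as [R3 _].
  destruct (reg_om _ R3) as (_ & A1 & A2).
  destruct (reg_om _ R1) as (R4 & B1 & B2). destruct (reg_om _ R4) as (_ & D1 & D2).
  assert (E : om * (om * om * t + w) = t + om * w).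
  { transitivity (om * om * om * t + om * w); [ring|]. rewrite om3. ring. }
  rewrite E in A1, A2. rewrite A1, A2, E1, E2.
  assert (E' : om * om * t = om * (om * t)) by ring. rewrite E', D1, D2, B1, B2. split; [|easy].
  transitivity (om * om * om * sm t); [ring|]. rewrite om3. ring.
Qed.

(** Compactness in gauge form gives one [d] below suitable values of the gauge. The gauge is chosen
    so that its inverse also bounds [f] locally, and then [/ d] bounds [f] everywhere. *)
Lemma compact_bound (f : C -> C) (a b : C) : (forall z : C, Clim (locally z) f (f z)) ->
  exists M, forall s t : R, (0 <= s <= 1)%R -> (0 <= t <= 1)%R ->
    (Cmod (f (RtoC s * a + RtoC t * b)%C) <= M)%R.
Proof.
  intros Hf.
  assert (L : forall s t : R, exists d : posreal, forall s' t' : R,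
     (Rabs (s' - s) < d)%R -> (Rabs (t' - t) < d)%R ->
     (Cmod (f (RtoC s' * a + RtoC t' * b)%C) <= / d)%R).
  { intros s t. set (z := RtoC s * a + RtoC t * b).
    destruct (proj1 (locally_Cmod _ _) (Hf z 1%R Rlt_0_1)) as (r & Hr & L).
    set (A := (Cmod a + Cmod b + 1)%R).
    assert (HA : (0 < A)%R) by (unfold A; pose proof (Cmod_ge_0 a); pose proof (Cmod_ge_0 b); lra).
    set (B := (Cmod (f z) + 1)%R). assert (HB : (0 < B)%R) by (unfold B; pose proof (Cmod_ge_0 (f z)); lra).
    assert (D : (0 < Rmin (r / A) (/ B))%R).
    { apply Rmin_glb_lt; [now apply Rdiv_lt_0_compat|now apply Rinv_0_lt_compat]. }
    exists (mkposreal _ D). simpl. intros s' t' Hs Ht.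
    pose proof (Rmin_l (r / A) (/ B)). pose proof (Rmin_r (r / A) (/ B)).
    apply Rle_trans with B.
    - unfold B. set (z' := RtoC s' * a + RtoC t' * b).
      assert (Hz : (Cmod (z' - z) < r)%R).
      { replace (z' - z) with (RtoC (s' - s) * a + RtoC (t' - t) * b)
          by (unfold z, z'; rewrite !RtoC_minus; ring).
        eapply Rle_lt_trans; [apply Cmod_triangle|]. rewrite !Cmod_mult, !Cmod_R.
        apply Rle_lt_trans with (Rmin (r / A) (/ B) * (Cmod a + Cmod b))%R.
        - rewrite Rmult_plus_distr_l. apply Rplus_le_compat; apply Rmult_le_compat_r;
            try apply Cmod_ge_0; lra.
        - apply Rlt_le_trans with (Rmin (r / A) (/ B) * A)%R.
          + apply Rmult_lt_compat_l; [easy|unfold A; lra].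
          + apply Rle_trans with (r / A * A)%R; [apply Rmult_le_compat_r; lra|]. right. field. lra. }
      specialize (L z' Hz). replace (f z') with (f z + (f z' - f z)) by ring.
      eapply Rle_trans; [apply Cmod_triangle|]. lra.
    - rewrite <- (Rinv_inv B) at 1. apply Rinv_le_contravar; lra. }
  set (delta := fun s t => proj1_sig (constructive_indefinite_description _ (L s t))).
  assert (HD : forall s t s' t' : R, (Rabs (s' - s) < delta s t)%R -> (Rabs (t' - t) < delta s t)%R ->
     (Cmod (f (RtoC s' * a + RtoC t' * b)%C) <= / delta s t)%R).
  { intros s t. unfold delta. now destruct (constructive_indefinite_description _ (L s t)). }
  destruct (compactness_value_2d 0 1 0 1 delta) as [d Hd].
  exists (/ d)%R. intros s t Hs Ht. apply NNPP. intros N. apply (Hd s t Hs Ht).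
  intros (x & y & Hx & Hy & D1 & D2 & D3). apply N.
  eapply Rle_trans; [apply (HD x y); easy|].
  apply Rinv_le_contravar; [apply cond_pos|easy].
Qed.

Lemma periodic_IZR (f : C -> C) (w : C) : (forall z, f (z + w) = f z) ->
  forall (n : Z) z, f (z + RtoC (IZR n) * w) = f z.
Proof.
  intros H.
  assert (A : forall (n : nat) z, f (z + RtoC (INR n) * w) = f z).
  { induction n as [|n IH]; intros z.
    - simpl INR. f_equal. ring.
    - rewrite S_INR, RtoC_plus.
      replace (z + (RtoC (INR n) + 1) * w) with (z + w + RtoC (INR n) * w) by ring.
      now rewrite IH, H. }
  intros n z. destruct (Z.le_gt_cases 0 n) as [P|P].
  - rewrite <- (Z2Nat.id n P), <- INR_IZR_INZ. apply A.
  - rewrite <- (A (Z.to_nat (- n)) (z + RtoC (IZR n) * w)). f_equal.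
    rewrite INR_IZR_INZ, Z2Nat.id by lia. rewrite opp_IZR, RtoC_opp. ring.
Qed.

Lemma bounded_periodic (f : C -> C) (P : R) : (forall z : C, Clim (locally z) f (f z)) -> (0 < P)%R ->
  (forall z, f (z + RtoC P) = f z) -> (forall z, f (z + om * RtoC P) = f z) ->
  exists M, forall z, (Cmod (f z) <= M)%R.
Proof.
  intros Hf HP H1 H2.
  destruct (compact_bound f (RtoC P) (om * RtoC P) Hf) as [M HM]. exists M.
  intros z. destruct z as [a b].
  assert (S3 : (0 < sqrt 3)%R) by (apply sqrt_lt_R0; lra).
  (* The coordinates of the point in the basis [P], [om P]; subtracting their integral parts moves
     it into the fundamental parallelogram. *)
  set (t := (b / (P * (sqrt 3 / 2)))%R). set (s := ((a + t * P / 2) / P)%R).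
  assert (Ez : (a, b) = RtoC s * RtoC P + RtoC t * (om * RtoC P)).
  { unfold om, RtoC, Cmult, Cplus. simpl. unfold s, t. f_equal; field; lra. }
  set (m := Int_part s). set (n := Int_part t).
  destruct (base_Int_part s) as [S1 S2]. destruct (base_Int_part t) as [T1 T2].
  fold m in S1, S2. fold n in T1, T2.
  replace (f (a, b)) with (f (RtoC (s - IZR m) * RtoC P + RtoC (t - IZR n) * (om * RtoC P))).
  - apply HM; lra.
  - rewrite Ez.
    rewrite <- (periodic_IZR f _ H1 m (RtoC (s - IZR m) * RtoC P + RtoC (t - IZR n) * (om * RtoC P))).
    rewrite <- (periodic_IZR f _ H2 n). f_equal. rewrite !RtoC_minus. ring.
Qed.

(** If [sm] omitted [b] then [1 / (sm - b)] would be a non-constant bounded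
    entire function. *)
Lemma sm_onto b : exists u, reg u /\ sm u = b.
Proof.
  apply NNPP. intros NE.
  assert (NB : forall z, reg z -> sm z - b <> 0).
  { intros z R E. apply NE. exists z. split; [easy|now apply Cminus_0_eq]. }
  (* Where [reg] fails [sm] has a pole, and [1 / (sm - b)] tends to 0 there. *)
  set (f := fun z => if excluded_middle_informative (reg z) then / (sm z - b) else 0).
  assert (Fr : forall z, reg z -> f z = / (sm z - b)).
  { intros z R. unfold f. now destruct (excluded_middle_informative (reg z)). }
  assert (Fn : forall z, ~ reg z -> f z = 0).
  { intros z R. unfold f. now destruct (excluded_middle_informative (reg z)). }
  assert (HF : forall z, hol1 f z).
  { intros z. destruct (classic (reg z)) as [R|R].
    - apply (hol1_ext (fun z => / (sm z - b))).
      + generalize (reg_open z R). apply filter_imp. intros t Rt. now rewrite Fr.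
      + apply hol1_inv; [|auto]. apply hol1_sub; [apply R|apply hol1_const].
    - destruct (meromorphic1_cases sm z sm_mero) as [H|(k & g & Hg & Ng & E)].
      { exfalso. apply R. now apply reg_of_sm. }
      (* At a pole [1 / (sm - b)] equals [(t - z) ^ S k / dn], which is holomorphic since
         [dn z = g z]. *)
      set (dn := fun t => g t - b * (t - z) ^ S k).
      assert (Hd : hol1 dn z).
      { apply hol1_sub; [easy|]. apply hol1_mul; [apply hol1_const|apply hol1_pow, hol1_shift]. }
      assert (Z0 : (z - z) ^ S k = 0).
      { replace (z - z) with (RtoC 0) by ring. apply Cpow_0. lia. }
      assert (Nd : dn z <> 0).
      { unfold dn. rewrite Z0. replace (g z - b * 0) with (g z) by ring. easy. }
      apply (hol1_ext (fun t => (t - z) ^ S k / dn t)).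
      + pose proof (filter_and _ _ (filter_and _ _ E (reg_near z))
          (filter_and _ _ (locally_locally' _ _ (locally_nz dn z Hd Nd)) (locally'_pow_nz z (S k)))) as L.
        apply (proj1 (locally'_Cmod _ _)) in L. destruct L as (r & Hr & L).
        apply locally_Cmod. exists r. split; [easy|]. intros t Ht.
        destruct (Ceq_dec t z) as [->|N].
        * rewrite Z0, Fn by easy. unfold Cdiv. ring.
        * destruct (L t Ht N) as [[Et Rt] [Nt Np]]. rewrite Fr by easy. rewrite Et.
          unfold dn in *. field. repeat split; auto.
      + apply hol1_div; auto. apply hol1_pow, hol1_shift. }
  destruct period_near as (P & HP & PP).
  assert (PER : forall w, is_period w -> forall z, f (z + w) = f z).
  { intros w Hw z. destruct (classic (reg z)) as [R|R].
    - destruct (period_reg w z Hw R) as (R' & E & _). rewrite !Fr by easy. now rewrite E.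
    - rewrite (Fn z R). apply Fn. intros R'. apply R.
      destruct (period_reg (- w) _ (period_opp w Hw) R') as (R'' & _).
      now replace (z + w + - w) with z in R'' by ring. }
  destruct (bounded_periodic f P) as [M HM].
  - intros z. apply hol1_Clim, HF.
  - exact HP.
  - apply PER. exact PP.
  - apply PER. apply period_om. exact PP.
  (* The contradiction is at 0, where the derivative of [1 / (sm - b)] is [- 1 / b ^ 2]; omitting
     [b] implies [b <> 0], as [sm 0 = 0]. *)
  - pose proof (liouville f M HF HM 0) as D0.
    assert (Nb : b <> 0).
    { intros ->. apply (NB 0 reg_0). rewrite sm_0. ring. }
    assert (N0 : sm 0 - b <> 0) by apply (NB 0 reg_0).
    assert (D1 : dC (fun z => / (sm z - b)) 0 (- (cm 0 ^ 2 - 0) / ((sm 0 - b) * (sm 0 - b)))).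
    { exact (dC_inv (fun z => sm z - b) 0 _ (dC_sub sm (fun _ => b) _ _ _ (sm_deriv 0 reg_0) (dC_const b 0)) N0). }
    assert (D2 : dC f 0 (- (cm 0 ^ 2 - 0) / ((sm 0 - b) * (sm 0 - b)))).
    { apply dC_D2. apply dC_D2 in D1. revert D1. apply D2_ext.
      apply (proj2 (locally_dst_fst 0 (fun t => / (sm t - b) = f t))).
      generalize (reg_open 0 reg_0). apply filter_imp. intros t Rt. now rewrite Fr. }
    pose proof (is_derive_C_unique _ _ _ _ D0 D2) as E. rewrite sm_0, cm_0 in E.
    apply C1_nz. transitivity (- (- (1 ^ 2 - 0) / ((0 - b) * (0 - b))) * (b * b)).
    + field. exact Nb.
    + rewrite <- E. ring.
Qed.

(** ** Uniformization of the level curves [x y (x - y) = vs ^ 3] *)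

Definition good (u : C) : Prop := reg u /\ sm u <> 0 /\ cm u <> 0.

Definition Phi (vs u : C) : C * C := (vs / (sm u * cm u), vs * cm u ^ 2 / sm u).

(** On the image of [Phi] the ratio [y / x] is [cm u ^ 3], so [sm u] has to be a cube root of
    [1 - y / x]. Then [x] is right up to a cube root of unity, which is corrected by replacing [u]
    with [om u] or [om ^ 2 u]: this multiplies [sm] and keeps [cm]. *)
Lemma Phi_onto (x y vs : C) : vs <> 0 -> vs ^ 3 = x * y * (x - y) -> exists u, good u /\ (x, y) = Phi vs u.
Proof.
  intros Nv E.
  assert (NE : x * y * (x - y) <> 0) by (rewrite <- E; now apply Cpow_nz).
  assert (Nx : x <> 0) by (intros ->; apply NE; ring).
  assert (Ny : y <> 0) by (intros ->; apply NE; ring).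
  assert (Nxy : x - y <> 0) by (intros Z; apply NE; rewrite Z; ring).
  destruct (cube_root (1 - y / x)) as [b Hb].
  destruct (sm_onto b) as (u & Ru & Su).
  pose proof (cubic u Ru) as Cu. rewrite Su, Hb in Cu.
  assert (C3 : cm u ^ 3 = y / x).
  { replace (cm u ^ 3) with (1 - y / x + cm u ^ 3 - (1 - y / x)) by ring. rewrite Cu. ring. }
  assert (Nc : cm u <> 0).
  { intros Z. apply Ny. replace y with (y / x * x) by (field; exact Nx).
    rewrite <- C3, Z. ring. }
  assert (Ns : sm u <> 0).
  { intros Z. apply Nxy. replace (x - y) with ((1 - y / x) * x) by (field; exact Nx).
    rewrite <- Hb, <- Su, Z. ring. }
  assert (G : exists v, good v /\ cm v ^ 3 = y / x /\ x = vs / (sm v * cm v)).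
  { destruct (reg_om u Ru) as (R1 & S1 & D1). destruct (reg_om _ R1) as (R2 & S2 & D2).
    rewrite D1 in D2. rewrite S1 in S2.
    assert (Nsc : sm u * cm u <> 0) by now apply Cmult_neq_0.
    assert (X3 : (vs / (sm u * cm u)) ^ 3 = x ^ 3).
    { transitivity (vs ^ 3 / (sm u ^ 3 * cm u ^ 3)); [field; auto|].
      rewrite E, Su, Hb, C3. field. repeat split; auto. }
    destruct (cube_eq _ _ X3) as [X|[X|X]].
    - exists u. repeat split; auto; apply Ru.
    - exists (om * u). split; [split; [easy|]|].
      + rewrite S1, D1. split; [apply Cmult_neq_0; auto using om_nz|easy].
      + rewrite D1. split; [easy|]. rewrite S1.
        transitivity (vs / (sm u * cm u) / om); [rewrite X; field; apply om_nz|].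
        field. repeat split; auto using om_nz.
    - exists (om * (om * u)). split; [split; [easy|]|].
      + rewrite S2, D2. split; [repeat apply Cmult_neq_0; auto using om_nz|easy].
      + rewrite D2. split; [easy|]. rewrite S2.
        transitivity (vs / (sm u * cm u) / (om * om)); [rewrite X; field; apply om_nz|].
        field. repeat split; auto using om_nz. }
  destruct G as (v & Gv & Cv & Xv). exists v. split; [easy|]. unfold Phi. f_equal; [easy|].
  destruct Gv as (_ & N1 & N2).
  transitivity (cm v ^ 3 * x); [rewrite Cv; field; exact Nx|]. rewrite Xv. field. auto.
Qed.

Lemma Phi_level vs u : good u ->
  fst (Phi vs u) * snd (Phi vs u) * (fst (Phi vs u) - snd (Phi vs u)) = vs ^ 3.
Proof.
  intros (R & N1 & N2). pose proof (cubic u R) as E. unfold Phi. simpl fst; simpl snd.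
  transitivity (vs ^ 3 * ((sm u ^ 3 + cm u ^ 3) - cm u ^ 3) / sm u ^ 3).
  - rewrite E. field. auto.
  - field. auto.
Qed.

Lemma Phi_scale k vs u : Phi (k * vs) u = scale k (Phi vs u).
Proof. unfold Phi, scale. simpl. f_equal; unfold Cdiv; ring. Qed.

Lemma good_neg u : good u -> good (- u).
Proof.
  intros (R & N1 & N2). destruct (reg_neg u R N2) as (R' & E1 & E2). split; [easy|].
  rewrite E1, E2. split.
  - intros Z. apply N1. transitivity (- (- sm u / cm u) * cm u); [field; exact N2|]. rewrite Z. ring.
  - intros Z. apply C1_nz. transitivity (/ cm u * cm u); [field; exact N2|]. rewrite Z. ring.
Qed.

Lemma Phi_neg vs u : good u -> Phi (- vs) (- u) = swap (Phi vs u).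
Proof.
  intros (R & N1 & N2). destruct (reg_neg u R N2) as (R' & E1 & E2).
  unfold Phi, swap. simpl. rewrite E1, E2. f_equal; field; auto.
Qed.

(** * Generic parameters *)

Lemma good_near z : locally' z good.
Proof.
  apply filter_and; [apply reg_near|]. apply filter_and; [apply sm_nz_near|apply cm_nz_near].
Qed.

(** The points [u], [v] at which the addition formulas apply and their values
    are finite and non-zero. *)
Definition gen0 (v u : C) : Prop :=
  good u /\ reg v /\ add_s (sm u) (cm u) (sm v) (cm v) <> 0 /\
  add_c (sm u) (cm u) (sm v) (cm v) <> 0 /\ add_d (sm u) (cm u) (sm v) (cm v) <> 0.

(** The second half serves the second coordinate of [Lambda], because exchanging the coordinates of
    [Phi v u] negates both parameters. *)
Definition generic (v u : C) : Prop := gen0 v u /\ gen0 (- v) (- u).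

Lemma gen0_good v u : gen0 v u -> good (u + v).
Proof.
  intros ((Ru & _) & Rv & N1 & N2 & N3). destruct (addition u v Ru Rv N3) as (R & E1 & E2).
  split; [easy|]. rewrite E1, E2.
  assert (NI : / add_d (sm u) (cm u) (sm v) (cm v) <> 0).
  { intros Z. apply C1_nz. rewrite <- (Cinv_l _ N3), Z. ring. }
  split; now apply Cmult_neq_0.
Qed.

Lemma merop_aff f (a b z : C) : (forall z, merop f z) -> merop (fun t => f (a * t + b)) z.
Proof.
  intros H. destruct (Ceq_dec a 0) as [->|N]; [|now apply merop_affine].
  apply (merop_ext (fun _ => f b)); [|apply merop_const].
  apply filter_forall. intros t. f_equal. ring.
Qed.

Lemma near_aff (P : C -> Prop) (a b s z : C) : (forall z, locally' z P) -> P (a * s + b) ->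
  locally' z (fun t => P (a * t + b)).
Proof.
  intros H Hs. destruct (Ceq_dec a 0) as [->|N].
  - apply filter_forall. intros t. replace (0 * t + b) with (0 * s + b) by ring. easy.
  - apply locally'_affine; auto.
Qed.

(** Along an affine family of parameters the three expressions are meromorphic in [t]. At [t = s]
    the shift is 0 and they become [sm ^ 2], [sm cm] and [sm] of a good point, so by the identity
    theorem none of them vanishes identically near any [z]. *)
Lemma gen0_near (a b c d s z : C) : a * s + b = 0 -> good (c * s + d) ->
  locally' z (fun t => gen0 (a * t + b) (c * t + d)).
Proof.
  intros E G.
  assert (NZ : forall A : C -> C -> C -> C -> C,
    (forall t, merop (fun t => A (sm (c * t + d)) (cm (c * t + d)) (sm (a * t + b)) (cm (a * t + b))) t) ->
    hol1 (fun t => A (sm (c * t + d)) (cm (c * t + d)) (sm (a * t + b)) (cm (a * t + b))) s ->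
    A (sm (c * s + d)) (cm (c * s + d)) 0 1 <> 0 ->
    locally' z (fun t => A (sm (c * t + d)) (cm (c * t + d)) (sm (a * t + b)) (cm (a * t + b)) <> 0)).
  { intros A M H N. destruct (merop_dichotomy _ z (M z)) as [Z|]; [|easy]. exfalso.
    pose proof (merop_identity _ z M Z s) as Zs. apply hol1_zero_punctured in Zs; [|exact H].
    cbv beta in Zs. rewrite E, sm_0, cm_0 in Zs. easy. }
  pose proof (fun t => merop_aff sm c d t sm_merop) as M1.
  pose proof (fun t => merop_aff cm c d t cm_merop) as M2.
  pose proof (fun t => merop_aff sm a b t sm_merop) as M3.
  pose proof (fun t => merop_aff cm a b t cm_merop) as M4.
  assert (HA : forall (f : C -> C) (a b : C), hol1 f (a * s + b) -> hol1 (fun t => f (a * t + b)) s).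
  { intros f a' b' H. apply (hol1_comp f (fun t => a' * t + b')); [easy|].
    apply hol1_add; [apply hol1_mul; [apply hol1_const|apply hol1_id]|apply hol1_const]. }
  destruct G as (R & N1 & N2).
  pose proof (HA sm c d (proj1 R)) as H1. pose proof (HA cm c d (proj2 R)) as H2.
  assert (H3 := HA sm a b). assert (H4 := HA cm a b). rewrite E in H3, H4.
  specialize (H3 (proj1 reg_0)). specialize (H4 (proj2 reg_0)).
  apply filter_and; [|apply filter_and; [|apply filter_and; [|apply filter_and]]].
  - apply (near_aff good c d s); [apply good_near|]. repeat split; auto; apply R.
  - apply (near_aff reg a b s); [apply reg_near|]. rewrite E. apply reg_0.
  - apply (NZ add_s).
    + intros t. exact (merop_sub _ _ _ (merop_mul _ _ _ (merop_pow _ 2 _ (M1 t)) (M4 t))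
        (merop_mul _ _ _ (merop_pow _ 2 _ (M3 t)) (M2 t))).
    + exact (hol1_sub _ _ _ (hol1_mul _ _ _ (hol1_pow _ 2 _ H1) H4)
        (hol1_mul _ _ _ (hol1_pow _ 2 _ H3) H2)).
    + unfold add_s. replace (sm (c * s + d) ^ 2 * 1 - 0 ^ 2 * cm (c * s + d)) with (sm (c * s + d) ^ 2) by ring.
      now apply Cpow_nz.
  - apply (NZ add_c).
    + intros t. exact (merop_sub _ _ _ (merop_mul _ _ _ (M1 t) (M2 t)) (merop_mul _ _ _ (M3 t) (M4 t))).
    + exact (hol1_sub _ _ _ (hol1_mul _ _ _ H1 H2) (hol1_mul _ _ _ H3 H4)).
    + unfold add_c. replace (sm (c * s + d) * cm (c * s + d) - 0 * 1) with (sm (c * s + d) * cm (c * s + d)) by ring.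
      now apply Cmult_neq_0.
  - apply (NZ add_d).
    + intros t. exact (merop_sub _ _ _ (merop_mul _ _ _ (M1 t) (merop_pow _ 2 _ (M4 t)))
        (merop_mul _ _ _ (M3 t) (merop_pow _ 2 _ (M2 t)))).
    + exact (hol1_sub _ _ _ (hol1_mul _ _ _ H1 (hol1_pow _ 2 _ H4))
        (hol1_mul _ _ _ H3 (hol1_pow _ 2 _ H2))).
    + unfold add_d. replace (sm (c * s + d) * 1 ^ 2 - 0 * cm (c * s + d) ^ 2) with (sm (c * s + d)) by ring.
      easy.
Qed.

Lemma generic_near (a b c d s z : C) : a * s + b = 0 -> good (c * s + d) ->
  locally' z (fun t => generic (a * t + b) (c * t + d)).
Proof.
  intros E G. apply filter_and; [now apply (gen0_near a b c d s)|].
  assert (G' : good (- c * s + - d)).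
  { replace (- c * s + - d) with (- (c * s + d)) by ring. now apply good_neg. }
  assert (E' : - a * s + - b = 0) by (transitivity (- (a * s + b)); [ring|rewrite E; ring]).
  generalize (gen0_near _ _ _ _ s z E' G'). apply filter_imp. intros t.
  replace (- a * t + - b) with (- (a * t + b)) by ring.
  now replace (- c * t + - d) with (- (c * t + d)) by ring.
Qed.

(** ** The solution *)

Definition level (q : C * C) : C := fst q * snd q * (fst q - snd q).

(** An arbitrary choice without any continuity; wherever it is used the result depends only on the
    cube. *)
Definition crt (z : C) : C := epsilon (inhabits (RtoC 0)) (fun v => v ^ 3 = z).

Lemma crt_spec z : crt z ^ 3 = z.
Proof. unfold crt. apply epsilon_spec. apply cube_root. Qed.

(** At [q = Phi v u] these are [add_s] and [add_c] of [u] and [v], multiplied by [v ^ 2 / sm u ^ 2]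
    and [v / (sm u cm u)]. *)
Definition den1 (q : C * C) (v : C) : C := v ^ 2 * cm v - sm v ^ 2 * (fst q * snd q).
Definition den2 (q : C * C) (v : C) : C := v - sm v * cm v * fst q.

(** The first coordinate of [Phi v (u + v)], by the addition formulas, in terms
    of [q = Phi v u]. *)
Definition expr (q : C * C) (v : C) : C :=
  fst q * v * (v * cm v ^ 2 - sm v * snd q) ^ 2 / (den1 q v * den2 q v).

Definition nondeg (q : C * C) (v : C) : Prop := reg v /\ den1 q v <> 0 /\ den2 q v <> 0.

Definition lam0 (q : C * C) : C := expr q (crt (level q)).

Definition lam : C * C -> C := regularize lam0.

Lemma den_om q v : reg v -> den1 q (om * v) = om * om * den1 q v /\ den2 q (om * v) = om * den2 q v.
Proof.
  intros R. destruct (reg_om v R) as (_ & E1 & E2). unfold den1, den2. rewrite E1, E2.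
  split; ring.
Qed.

(** Numerator and denominator are both multiplied by [om ^ 3 = 1], so the formula depends only on
    [v ^ 3], that is, on the point [q]. *)
Lemma expr_om q v : reg v -> expr q (om * v) = expr q v.
Proof.
  intros R. destruct (reg_om v R) as (_ & E1 & E2). destruct (den_om q v R) as [D1 D2].
  unfold expr. rewrite D1, D2, E1, E2.
  replace (om * om * den1 q v * (om * den2 q v)) with (om * om * om * (den1 q v * den2 q v)) by ring.
  replace (fst q * (om * v) * (om * v * cm v ^ 2 - om * sm v * snd q) ^ 2)
    with (om * om * om * (fst q * v * (v * cm v ^ 2 - sm v * snd q) ^ 2)) by ring.
  rewrite om3, !Cmult_1_l. easy.
Qed.

Lemma nondeg_om q v : nondeg q v -> nondeg q (om * v).
Proof.
  intros (R & N1 & N2). destruct (den_om q v R) as [D1 D2]. split; [apply (reg_om v R)|].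
  rewrite D1, D2. split; repeat apply Cmult_neq_0; auto using om_nz.
Qed.

Lemma nondeg_cube q v v' : nondeg q v -> v' ^ 3 = v ^ 3 -> nondeg q v'.
Proof.
  intros H E. destruct (cube_eq _ _ E) as [-> | [-> | ->]]; auto using nondeg_om.
  rewrite <- Cmult_assoc. auto using nondeg_om.
Qed.

Lemma lam0_eq q v : reg v -> v ^ 3 = level q -> lam0 q = expr q v.
Proof.
  intros R E. unfold lam0. rewrite <- E.
  destruct (cube_eq _ _ (crt_spec (v ^ 3))) as [-> | [-> | ->]]; [easy|now apply expr_om|].
  rewrite <- Cmult_assoc. rewrite !expr_om; auto. apply (reg_om v R).
Qed.

Lemma level_hol2 q : hol2 level q.
Proof.
  unfold level. apply hol2_mul; [apply hol2_mul|apply hol2_sub]; auto using hol2_fst, hol2_snd.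
Qed.

Lemma level_scale t q : level (scale t q) = t ^ 3 * level q.
Proof. unfold level, scale. simpl. ring. Qed.

Lemma level_thin p : thin level p.
Proof.
  split; [apply level_hol2|]. intros (r & Hr & Z).
  (* The complex line from [p] to [(2, 1)], a point of level 2. *)
  set (phi := fun t : C => level (fst p + t * (2 - fst p), snd p + t * (1 - snd p))).
  assert (H : forall t, hol1 phi t) by (intros t; apply hol1_line, level_hol2).
  assert (Z0 : locally' (0 : C) (fun t => phi t = 0)).
  { apply locally_locally'. apply locally_Cmod.
    set (K := (Cmod (2 - fst p) + Cmod (1 - snd p) + 1)%R).
    assert (HK : (0 < K)%R) by (unfold K; pose proof (Cmod_ge_0 (2 - fst p));
      pose proof (Cmod_ge_0 (1 - snd p)); lra).
    exists (r / K)%R. split; [now apply Rdiv_lt_0_compat|]. intros t Ht. apply Z.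
    unfold dst. simpl.
    replace (fst p + t * (2 - fst p) - fst p) with (t * (2 - fst p)) by ring.
    replace (snd p + t * (1 - snd p) - snd p) with (t * (1 - snd p)) by ring.
    rewrite !Cmod_mult. replace (t - 0) with t in Ht by ring.
    pose proof (Cmod_ge_0 t). apply Rle_lt_trans with (Cmod t * K)%R; [unfold K; lra|].
    now apply Rlt_div_r in Ht. }
  pose proof (merop_identity phi 0 (fun z => merop_hol1 _ _ (H z)) Z0 1) as Z1.
  apply hol1_zero_punctured in Z1; [|apply H]. unfold phi, level in Z1. simpl in Z1.
  apply C1_nz. apply (f_equal (fun z => z / 2)) in Z1.
  transitivity ((fst p + 1 * (2 - fst p)) * (snd p + 1 * (1 - snd p)) *
       (fst p + 1 * (2 - fst p) - (snd p + 1 * (1 - snd p))) / 2).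
  - field.
  - rewrite Z1. unfold Cdiv. ring.
Qed.

Lemma level_dense p P : locally_dst p P -> exists q, P q /\ level q <> 0.
Proof. intros H. exact (locally_dst_self _ _ (thin_dense level p (level_thin p)) P H). Qed.

Lemma merop_nz_near (f : C -> C) (s z : C) : (forall t, merop f t) -> hol1 f s -> f s <> 0 ->
  locally' z (fun t => f t <> 0).
Proof.
  intros M H N. destruct (merop_dichotomy f z (M z)) as [Z|]; [|easy]. exfalso. apply N.
  apply hol1_zero_punctured; [easy|]. now apply (merop_identity f z M Z).
Qed.

(** On the ray, [den1] and [den2] are [t ^ 2] and [t] times meromorphic functions of [t] whose
    values at [t = 0] are [v ^ 2] and [v], hence do not vanish identically. *)
Lemma nondeg_near p (v z : C) : v ^ 3 = level p -> v <> 0 ->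
  locally' z (fun t : C => t <> 0 /\ nondeg (scale t p) (t * v)).
Proof.
  intros E N.
  assert (Nz : locally' z (fun t : C => t <> 0)).
  { apply (merop_nz_near (fun t : C => t) 1); [|apply hol1_id|apply C1_nz].
    intros t. apply merop_hol1, hol1_id. }
  assert (M : forall f : C -> C, (forall z, merop f z) -> forall t, merop (fun t => f (t * v)) t).
  { intros f H t. apply (merop_ext (fun t => f (v * t))).
    - apply filter_forall. intros s. f_equal. ring.
    - now apply merop_scale. }
  assert (Z0 : 0 * v = 0) by ring.
  assert (H : forall f : C -> C, hol1 f 0 -> hol1 (fun t => f (t * v)) 0).
  { intros f Hf. apply (hol1_comp f (fun t => t * v)); [now rewrite Z0|].
    apply hol1_mul; [apply hol1_id|apply hol1_const]. }
  assert (RN : locally' z (fun t => reg (t * v))).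
  { generalize (locally'_scale v z reg N reg_near). apply filter_imp. intros t.
    now rewrite Cmult_comm. }
  assert (D1 : locally' z (fun t => v ^ 2 * cm (t * v) - sm (t * v) ^ 2 * (fst p * snd p) <> 0)).
  { apply (merop_nz_near _ 0).
    - intros t. exact (merop_sub _ _ _ (merop_mul _ _ _ (merop_const _ _) (M cm cm_merop t))
        (merop_mul _ _ _ (merop_pow _ 2 _ (M sm sm_merop t)) (merop_const _ _))).
    - exact (hol1_sub _ _ _ (hol1_mul _ _ _ (hol1_const _ _) (H cm (proj2 reg_0)))
        (hol1_mul _ _ _ (hol1_pow _ 2 _ (H sm (proj1 reg_0))) (hol1_const _ _))).
    - rewrite Z0, sm_0, cm_0. replace (v ^ 2 * 1 - 0 ^ 2 * (fst p * snd p)) with (v ^ 2) by ring.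
      now apply Cpow_nz. }
  assert (D2 : locally' z (fun t => v - sm (t * v) * cm (t * v) * fst p <> 0)).
  { apply (merop_nz_near _ 0).
    - intros t. exact (merop_sub _ _ _ (merop_const _ _) (merop_mul _ _ _
        (merop_mul _ _ _ (M sm sm_merop t) (M cm cm_merop t)) (merop_const _ _))).
    - exact (hol1_sub _ _ _ (hol1_const _ _) (hol1_mul _ _ _
        (hol1_mul _ _ _ (H sm (proj1 reg_0)) (H cm (proj2 reg_0))) (hol1_const _ _))).
    - rewrite Z0, sm_0, cm_0. now replace (v - 0 * 1 * fst p) with v by ring. }
  generalize (filter_and _ _ (filter_and _ _ Nz RN) (filter_and _ _ D1 D2)).
  apply filter_imp. intros t [[T R] [A B]]. split; [easy|split; [easy|]].
  unfold den1, den2, scale. simpl fst; simpl snd. split.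
  - replace ((t * v) ^ 2 * cm (t * v) - sm (t * v) ^ 2 * (t * fst p * (t * snd p)))
      with (t ^ 2 * (v ^ 2 * cm (t * v) - sm (t * v) ^ 2 * (fst p * snd p))) by ring.
    apply Cmult_neq_0; [now apply Cpow_nz|easy].
  - replace (t * v - sm (t * v) * cm (t * v) * (t * fst p))
      with (t * (v - sm (t * v) * cm (t * v) * fst p)) by ring.
    now apply Cmult_neq_0.
Qed.

Lemma scale_Clim p : Clim (locally' (1 : C)) (fun t : C => fst (scale t p)) (fst p) /\
  Clim (locally' (1 : C)) (fun t : C => snd (scale t p)) (snd p).
Proof.
  assert (L : Clim (locally' (1 : C)) (fun t : C => t) 1).
  { apply Clim_locally'. apply (hol1_Clim (fun t => t)), hol1_id. }
  unfold scale. simpl. split.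
  - apply (Clim_ext_eq (fun t => t * fst p) _ (1 * fst p)); [now apply filter_forall|ring|].
    apply Clim_mul; [easy|apply Clim_const].
  - apply (Clim_ext_eq (fun t => t * snd p) _ (1 * snd p)); [now apply filter_forall|ring|].
    apply Clim_mul; [easy|apply Clim_const].
Qed.

Lemma locally_dst_Clim {T} {F : (T -> Prop) -> Prop} {FF : Filter F} (P : C * C -> Prop) (f : T -> C * C) p :
  Clim F (fun t => fst (f t)) (fst p) -> Clim F (fun t => snd (f t)) (snd p) ->
  locally_dst p P -> F (fun t => P (f t)).
Proof.
  intros H1 H2 (r & Hr & L). assert (Hr2 : (0 < r / 2)%R) by lra.
  generalize (filter_and _ _ (H1 _ Hr2) (H2 _ Hr2)). apply filter_imp.
  intros t [A B]. apply L. unfold dst. lra.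
Qed.

Lemma scale_near p P : locally_dst p P -> locally' (1 : C) (fun t => P (scale t p)).
Proof. intros L. destruct (scale_Clim p). now apply (locally_dst_Clim P (fun t => scale t p) p). Qed.

(** Averaging over the cube roots of unity keeps the exponents divisible by 3. *)
Lemma cube_invariant (f : C -> C) : hol1 f 0 -> locally (0 : C) (fun z => f (om * z) = f z) ->
  exists F, hol1 F 0 /\ locally (0 : C) (fun z => f z = F (z ^ 3)).
Proof.
  intros Hf L. apply hol1_analytic1 in Hf. destruct Hf as (a & r0 & Hr0 & H0).
  apply (proj1 (locally_Cmod _ _)) in L. destruct L as (r1 & Hr1 & L).
  set (r := Rmin r0 r1). assert (Hr : (0 < r)%R) by now apply Rmin_glb_lt.
  pose proof (Rmin_l r0 r1) as M1. pose proof (Rmin_r r0 r1) as M2. fold r in M1, M2.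
  assert (M0 : forall z : C, Cmod (z - 0) = Cmod z) by (intros z; f_equal; ring).
  assert (H : forall z, (Cmod z < r)%R -> is_series (fun n => a n * z ^ n) (f z)).
  { intros z Hz. refine (is_series_ext _ _ _ _ (H0 z _)).
    - intros n. replace (z - 0) with z by ring. easy.
    - rewrite M0. lra. }
  assert (I : forall z, (Cmod z < r)%R -> f (om * z) = f z) by (intros z Hz; apply L; rewrite M0; lra).
  assert (MO : forall z, Cmod (om * z) = Cmod z) by (intros; rewrite Cmod_mult, Cmod_om; ring).
  set (e := fun n => 1 + om ^ n + (om * om) ^ n).
  assert (T3 : RtoC 3 <> 0) by (intros E; apply RtoC_inj in E; lra).
  assert (e3 : forall k, e (3 * k)%nat = 3 /\ e (3 * k + 1)%nat = 0 /\ e (3 * k + 2)%nat = 0).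
  { intros k. assert (P : om ^ (3 * k) = 1 /\ (om * om) ^ (3 * k) = 1).
    { rewrite !Cpow_mult_r. replace (om ^ 3) with (om * om * om) by ring.
      replace ((om * om) ^ 3) with (om * om * om * (om * om * om)) by ring.
      rewrite om3. replace (1 * 1) with (RtoC 1) by ring. rewrite Cpow_1_l. easy. }
    destruct P as [P1 P2]. unfold e. rewrite !Cpow_add_r, P1, P2. split; [ring|]. split.
    - transitivity (om * om + om + 1); [ring|apply om_sum].
    - transitivity (om * om * om * om + om * om + 1); [ring|]. rewrite om3.
      rewrite <- om_sum. ring. }
  assert (S3 : forall z, (Cmod z < r)%R -> is_series (fun n => e n / 3 * (a n * z ^ n)) (f z)).
  { intros z Hz.
    assert (A1 := H z Hz). assert (A2 := H (om * z) ltac:(now rewrite MO)).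
    assert (A3 := H (om * (om * z)) ltac:(now rewrite !MO)).
    rewrite I in A3 by now rewrite MO. rewrite I in A2, A3 by easy.
    pose proof (is_series_scal (V := C_NormedModule) (/ 3) _ _
      (is_series_plus (V := C_NormedModule) _ _ _ _ (is_series_plus (V := C_NormedModule) _ _ _ _ A1 A2) A3)) as A.
    replace (f z) with (/ 3 * (f z + f z + f z)) by field.
    refine (is_series_ext _ _ _ _ A). intros n.
    change (/ 3 * (a n * z ^ n + a n * (om * z) ^ n + a n * (om * (om * z)) ^ n) = e n / 3 * (a n * z ^ n)).
    rewrite !Cpow_mult_l. unfold e. rewrite Cpow_mult_l. field. }
  assert (S1 : forall z, (Cmod z < r)%R -> is_series (fun k => a (3 * k)%nat * (z ^ 3) ^ k) (f z)).
  { intros z Hz. apply (proj2 (filterlim_Clim eventually _ _)). intros eps He.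
    assert (A := proj1 (filterlim_Clim eventually _ _) (S3 z Hz) eps He).
    destruct A as [N HN]. exists N. intros k Hk.
    assert (Q : forall k, @sum_n (NormedModule.AbelianMonoid C_AbsRing C_NormedModule)
       (fun k => a (3 * k)%nat * (z ^ 3) ^ k) k =
       @sum_n (NormedModule.AbelianMonoid C_AbsRing C_NormedModule)
       (fun n => e n / 3 * (a n * z ^ n)) (3 * k)).
    { clear k Hk. induction k as [|k IH].
      - rewrite Nat.mul_0_r, !sum_O. destruct (e3 O) as [E _]. rewrite Nat.mul_0_r in E. rewrite E.
        simpl. change (a 0%nat * 1 = 3 / 3 * (a 0%nat * 1)). field.
      - destruct (e3 k) as (_ & E1 & E2). destruct (e3 (S k)) as (E0 & _ & _).
        replace (3 * S k)%nat with (S (S (S (3 * k)))) in * by lia.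
        rewrite !sum_Sn, IH. replace (3 * S k)%nat with (S (S (S (3 * k)))) by lia.
        replace (3 * k + 1)%nat with (S (3 * k)) in E1 by lia.
        replace (3 * k + 2)%nat with (S (S (3 * k))) in E2 by lia.
        rewrite E1, E2, E0.
        set (X := sum_n _ _). change (plus ?u ?v) with (u + v).
        rewrite <- Cpow_mult_r. replace (3 * S k)%nat with (S (S (S (3 * k)))) by lia.
        change (plus (plus ?x ?b) ?c) with (x + b + c).
        generalize (z ^ S (S (S (3 * k)))) (z ^ S (S (3 * k))) (z ^ S (3 * k)). intros Y3 Y2 Y1.
        match goal with |- ?u = ?v => change (@eq C u v) end. field. }
    rewrite Q. apply HN. lia. }
  (* Although [crt] need not be continuous, this is analytic: its value at [w] is the sum of a power
     series in [crt w ^ 3 = w]. *)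
  exists (fun w => f (crt w)). split.
  - apply analytic1_hol1. exists (fun k => a (3 * k)%nat), (r * r * r)%R.
    split; [repeat apply Rmult_lt_0_compat; easy|]. intros w Hw. rewrite M0 in Hw.
    assert (Hc : (Cmod (crt w) < r)%R).
    { pose proof (crt_spec w) as E. apply (f_equal Cmod) in E. rewrite Cmod_pow in E.
      rewrite <- E in Hw. simpl in Hw. pose proof (Cmod_ge_0 (crt w)).
      destruct (Rlt_dec (Cmod (crt w)) r) as [|N]; [easy|]. exfalso.
      apply Rnot_lt_le in N. set (c := Cmod (crt w)) in *.
      assert (r * r * r <= c * c * c)%R by (repeat apply Rmult_le_compat; try lra; nra). lra. }
    refine (is_series_ext _ _ _ _ (S1 _ Hc)). intros k. rewrite crt_spec.
    now replace (w - 0) with w by ring.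
  - apply locally_Cmod. exists r. split; [easy|]. intros z Hz. rewrite M0 in Hz.
    destruct (cube_eq _ _ (crt_spec (z ^ 3))) as [-> | [-> | ->]].
    + easy.
    + now rewrite I.
    + rewrite <- Cmult_assoc. rewrite I; [now rewrite I|now rewrite MO].
Qed.

(** Both [sm v / v] and [cm v] are invariant under [v |-> om v], so near 0 they are analytic in
    [v ^ 3], the level. This removes the branching of the cube root along the curve of level 0,
    where single-valuedness is at stake. *)
Lemma sm_cm_of_cube : exists Sf Cf : C -> C,
  hol1 Sf 0 /\ hol1 Cf 0 /\ Sf 0 = 1 /\ Cf 0 = 1 /\
  locally (0 : C) (fun v => reg v /\ sm v = v * Sf (v ^ 3) /\ cm v = Cf (v ^ 3)).
Proof.
  assert (J : RtoC 0 ^ 3 = 0) by ring.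
  destruct (cube_invariant cm) as (Cf & HC & EC).
  { apply reg_0. }
  { generalize (reg_open 0 reg_0). apply filter_imp. intros t R. now apply reg_om. }
  destruct (zero_order sm (RtoC 0) (proj1 reg_0)) as [Z|(k & g & Hg & Ng & Eg)].
  { exfalso. destruct (filter_ex _ (filter_and _ _ (locally_locally' _ _ Z) (sm_nz_near (RtoC 0)))) as [y [A B]].
    easy. }
  assert (C0 : Cf 0 = 1).
  { pose proof (locally_singleton _ _ EC) as E. cbv beta in E. rewrite cm_0, J in E. now symmetry. }
  set (g1 := fun z : C => if excluded_middle_informative (z = 0) then RtoC 1 else sm z / z).
  assert (G0 : g1 0 = 1).
  { unfold g1. now destruct (excluded_middle_informative (RtoC 0 = 0)). }
  assert (Gn : forall z : C, z <> 0 -> g1 z = sm z / z).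
  { intros z N. unfold g1. now destruct (excluded_middle_informative (z = 0)). }
  assert (Hg1 : hol1 g1 0).
  { destruct (hol1_analytic1 sm 0 (proj1 reg_0)) as (a & r & Hr & Ha).
    assert (A0 : a O = 0).
    { pose proof (Ha 0 ltac:(now rewrite Cmod_minus_0)) as S.
      assert (S' : is_series (fun n => a n * (0 - 0) ^ n) (a O * (0 - 0) ^ 0)).
      { apply (is_series_first (fun n => a n * (0 - 0) ^ n)). intros n.
        replace (0 - 0) with (RtoC 0) by ring. rewrite Cpow_0 by lia. ring. }
      pose proof (is_series_C_unique _ _ _ S S') as E. rewrite sm_0 in E. rewrite E. simpl. ring. }
    destruct (series_factor sm 0 a r 1 Hr Ha) as (h & Hh & _ & Eh).
    { intros i Hi. now replace i with O by lia. }
    assert (E1 : forall x, (Cmod (x - 0) < r)%R -> sm x = x * h x).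
    { intros x Hx. rewrite Eh by easy. simpl. ring. }
    assert (H1 : h 0 = 1).
    { assert (D : dC sm 0 (0 * 0 + h 0 * 1)).
      { destruct (hol1_dC h 0 Hh) as [l Dl]. apply dC_D2.
        apply (D2_ext (fun q => fst q * h (fst q))).
        - apply (proj2 (locally_dst_fst 0 (fun t => t * h t = sm t))). apply locally_Cmod.
          exists r. split; [easy|]. intros y Hy. now rewrite E1.
        - pose proof (dC_mul (fun t => t) h 0 1 l (dC_id 0) Dl) as D. apply dC_D2 in D.
          replace (0 * 0 + h 0 * 1) with (h 0 * 1 + 0 * l) by ring. exact D. }
      pose proof (is_derive_C_unique _ _ _ _ D (sm_deriv 0 reg_0)) as E. rewrite cm_0 in E.
      transitivity (0 * 0 + h 0 * 1); [ring|]. rewrite E. ring. }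
    apply (hol1_ext h); [|easy]. apply locally_Cmod. exists r. split; [easy|]. intros y Hy.
    destruct (Ceq_dec y 0) as [->|N]; [now rewrite G0|]. rewrite Gn by easy. rewrite E1 by easy.
    field. easy. }
  destruct (cube_invariant g1 Hg1) as (Sf & HS & ES).
  { generalize (reg_open 0 reg_0). apply filter_imp. intros t R.
    destruct (Ceq_dec t 0) as [->|N].
    - f_equal. ring.
    - rewrite !Gn; [|easy|apply Cmult_neq_0; auto using om_nz].
      destruct (reg_om t R) as (_ & -> & _). field. split; auto using om_nz. }
  exists Sf, Cf. split; [easy|split; [easy|]].
  split; [|split; [easy|]].
  - pose proof (locally_singleton _ _ ES) as E. cbv beta in E. rewrite G0, J in E. now symmetry.
  - generalize (filter_and _ _ (reg_open 0 reg_0) (filter_and _ _ EC ES)).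
    apply filter_imp. intros v (R & E1 & E2). split; [easy|split; [|easy]].
    rewrite <- E2. destruct (Ceq_dec v 0) as [->|N].
    + rewrite sm_0. ring.
    + rewrite Gn by easy. field. easy.
Qed.

Lemma small_cube_root (P : C -> Prop) : locally (0 : C) P ->
  locally (0 : C) (fun w => forall v, v ^ 3 = w -> P v).
Proof.
  intros L. apply (proj1 (locally_Cmod _ _)) in L. destruct L as (r & Hr & L).
  apply locally_Cmod. exists (r * r * r)%R. split; [repeat apply Rmult_lt_0_compat; easy|].
  intros w Hw v E. apply L. replace (w - 0) with w in Hw by ring. replace (v - 0) with v by ring.
  rewrite <- E, Cmod_pow in Hw. simpl in Hw. pose proof (Cmod_ge_0 v).
  destruct (Rlt_dec (Cmod v) r) as [|N]; [easy|]. exfalso. apply Rnot_lt_le in N.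
  set (c := Cmod v) in *.
  assert (r * r * r <= c * c * c)%R by (repeat apply Rmult_le_compat; try lra; nra). lra.
Qed.

Lemma hol2_locally (f : C * C -> C) (p : C * C) (P : C -> Prop) : hol2 f p -> locally (f p) P ->
  locally_dst p (fun q => P (f q)).
Proof.
  intros H L. apply (proj1 (locally_Cmod _ _)) in L. destruct L as (r & Hr & L).
  generalize (hol2_cont _ _ H r Hr). apply locally_dst_imp. intros q. apply L.
Qed.

(** The formula in terms of [sm v / v] and [cm v], seen as functions of [v ^ 3]. *)
Definition dA (Sf Cf : C -> C) (q : C * C) : C :=
  Cf (level q) - Sf (level q) ^ 2 * (fst q * snd q).
Definition dB (Sf Cf : C -> C) (q : C * C) : C :=
  1 - Sf (level q) * Cf (level q) * fst q.
Definition nA (Sf Cf : C -> C) (q : C * C) : C :=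
  fst q * (Cf (level q) ^ 2 - Sf (level q) * snd q) ^ 2.

Lemma cube_form (Sf Cf : C -> C) q (v : C) : v <> 0 -> v ^ 3 = level q -> reg v ->
  sm v = v * Sf (v ^ 3) -> cm v = Cf (v ^ 3) ->
  den1 q v = v ^ 2 * dA Sf Cf q /\ den2 q v = v * dB Sf Cf q /\
  (dA Sf Cf q * dB Sf Cf q <> 0 -> lam0 q = nA Sf Cf q / (dA Sf Cf q * dB Sf Cf q)).
Proof.
  intros N E R E1 E2.
  assert (D1 : den1 q v = v ^ 2 * dA Sf Cf q).
  { unfold den1, dA. rewrite E1, E2, E. ring. }
  assert (D2 : den2 q v = v * dB Sf Cf q).
  { unfold den2, dB. rewrite E1, E2, E. ring. }
  split; [easy|split; [easy|]]. intros Nd.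
  assert (NA : dA Sf Cf q <> 0) by (intros Z; apply Nd; rewrite Z; ring).
  assert (NB : dB Sf Cf q <> 0) by (intros Z; apply Nd; rewrite Z; ring).
  rewrite (lam0_eq q v R E). unfold expr. rewrite D1, D2, E1, E2, E. unfold nA.
  field. auto.
Qed.

Lemma dAB_hol2 Sf Cf p : level p = 0 -> hol1 Sf 0 -> hol1 Cf 0 ->
  hol2 (dA Sf Cf) p /\ hol2 (dB Sf Cf) p /\ hol2 (nA Sf Cf) p.
Proof.
  intros Z HS HC.
  assert (h1 : hol2 (fun q => Sf (level q)) p) by (apply hol2_of_hol1; [now rewrite Z|apply level_hol2]).
  assert (h2 : hol2 (fun q => Cf (level q)) p) by (apply hol2_of_hol1; [now rewrite Z|apply level_hol2]).
  pose proof (hol2_fst p) as h3. pose proof (hol2_snd p) as h4.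
  split; [|split].
  - exact (hol2_sub _ _ _ h2 (hol2_mul _ _ _ (hol2_pow _ 2 _ h1) (hol2_mul _ _ _ h3 h4))).
  - exact (hol2_sub _ _ _ (hol2_const _ _) (hol2_mul _ _ _ (hol2_mul _ _ _ h1 h2) h3)).
  - exact (hol2_mul _ _ _ h3 (hol2_pow _ 2 _ (hol2_sub _ _ _ (hol2_pow _ 2 _ h2) (hol2_mul _ _ _ h1 h4)))).
Qed.

(** With a common power in both denominators, a polynomial expression in [sm] and [cm] is cleared by
    powers of one function. *)
Lemma merop_common (z : C) : exists n gs gc, hol1 gs z /\ hol1 gc z /\
  locally' z (fun t => sm t = gs t / (t - z) ^ n /\ cm t = gc t / (t - z) ^ n).
Proof.
  destruct (sm_merop z) as (n & gs & Hs & Es). destruct (cm_merop z) as (m & gc & Hc & Ec).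
  exists (n + m)%nat, (fun t => gs t * (t - z) ^ m), (fun t => gc t * (t - z) ^ n).
  split; [|split].
  - apply hol1_mul; auto. apply hol1_pow, hol1_shift.
  - apply hol1_mul; auto. apply hol1_pow, hol1_shift.
  - generalize (filter_and _ _ (filter_and _ _ Es Ec) (filter_and _ _ (locally'_pow_nz z n) (locally'_pow_nz z m))).
    apply filter_imp. intros t [[-> ->] [N M]]. rewrite Cpow_add_r. split; field; auto.
Qed.

Lemma lam0_local_quotient_zero p : level p = 0 -> local_quotient lam0 p.
Proof.
  intros Z. destruct sm_cm_of_cube as (Sf & Cf & HS & HC & _ & _ & L).
  destruct (dAB_hol2 Sf Cf p Z HS HC) as (H1 & H2 & H3).
  assert (L2 : locally_dst p (fun q => forall v, v ^ 3 = level q ->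
     reg v /\ sm v = v * Sf (v ^ 3) /\ cm v = Cf (v ^ 3))).
  { apply (hol2_locally level p (fun w => forall v, v ^ 3 = w -> reg v /\ sm v = v * Sf (v ^ 3) /\ cm v = Cf (v ^ 3)));
      [apply level_hol2|]. rewrite Z. now apply small_cube_root. }
  (* The common factor [level] confines the comparison to points of non-zero level, where the powers
     of the cube root can be cancelled. *)
  exists (fun q => nA Sf Cf q * level q), (fun q => dA Sf Cf q * dB Sf Cf q * level q).
  split; [apply hol2_mul; [easy|apply level_hol2]|]. split; [split|].
  - apply hol2_mul; [now apply hol2_mul|apply level_hol2].
  - intros ZZ.
    destruct (level_dense p _ (locally_dst_open _ _ (locally_dst_and _ _ _ L2 ZZ))) as (p' & Lp & Np).
    set (v := crt (level p')). assert (Ev : v ^ 3 = level p') by apply crt_spec.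
    assert (Nv : v <> 0) by (intros X; apply Np; rewrite <- Ev, X; ring).
    destruct (filter_ex _ (filter_and _ _ (scale_near _ _ Lp) (nondeg_near p' v 1 Ev Nv)))
      as (t & [A B] & T & _ & N1 & N2).
    assert (Ntv : t * v <> 0) by now apply Cmult_neq_0.
    assert (Etv : (t * v) ^ 3 = level (scale t p')) by (rewrite level_scale, <- Ev; ring).
    destruct (A _ Etv) as (R & E1 & E2).
    destruct (cube_form Sf Cf _ _ Ntv Etv R E1 E2) as (D1 & D2 & _).
    rewrite D1 in N1. rewrite D2 in N2.
    assert (X1 : dA Sf Cf (scale t p') <> 0) by (intros X; apply N1; rewrite X; ring).
    assert (X2 : dB Sf Cf (scale t p') <> 0) by (intros X; apply N2; rewrite X; ring).
    assert (X3 : level (scale t p') <> 0) by (rewrite <- Etv; now apply Cpow_nz).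
    exact (Cmult_neq_0 _ _ (Cmult_neq_0 _ _ X1 X2) X3 B).
  - revert L2. apply locally_dst_imp. intros q A N.
    assert (N1 : level q <> 0) by (intros X; apply N; rewrite X; ring).
    assert (N2 : dA Sf Cf q * dB Sf Cf q <> 0) by (intros X; apply N; rewrite X; ring).
    set (v := crt (level q)). assert (Ev : v ^ 3 = level q) by apply crt_spec.
    assert (Nv : v <> 0) by (intros X; apply N1; rewrite <- Ev, X; ring).
    destruct (A v Ev) as (R & E1 & E2).
    destruct (cube_form Sf Cf q v Nv Ev R E1 E2) as (_ & _ & D). rewrite (D N2).
    field. split; [easy|].
    split; intros X; apply N2; rewrite X; ring.
Qed.

Lemma branch_near (v : C) p : v ^ 3 = level p -> v <> 0 ->
  exists br, hol2 br p /\ br p = v /\ locally_dst p (fun q => br q ^ 3 = level q).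
Proof.
  intros E N. destruct (cube_root_branch v N) as (br & H & Eb & L). rewrite E in H, Eb, L.
  exists (fun q => br (level q)). split; [|split; [easy|]].
  - apply hol2_of_hol1; [easy|apply level_hol2].
  - apply (hol2_locally level p (fun w => br w ^ 3 = w)); [apply level_hol2|easy].
Qed.

(** Off level 0 a holomorphic branch [br] of the cube root exists, but its value [v0] at [p] may be
    a pole of [sm] and [cm]. These are therefore replaced by quotients with denominator
    [(br - v0) ^ n], and the powers are cleared. *)
Lemma lam0_local_quotient p : local_quotient lam0 p.
Proof.
  destruct (Ceq_dec (level p) 0) as [Z|NZ]; [now apply lam0_local_quotient_zero|].
  set (v0 := crt (level p)). assert (Ev : v0 ^ 3 = level p) by apply crt_spec.
  assert (Nv : v0 <> 0) by (intros X; apply NZ; rewrite <- Ev, X; ring).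
  destruct (branch_near v0 p Ev Nv) as (br & Hbr & Ebr & Lbr).
  destruct (merop_common v0) as (n & gs & gc & Hs & Hc & L).
  pose proof (filter_and _ _ (filter_and _ _ L (reg_near v0)) (locally'_pow_nz v0 n)) as LL.
  assert (L2 : locally_dst p (fun q => br q <> v0 ->
     (sm (br q) = gs (br q) / (br q - v0) ^ n /\ cm (br q) = gc (br q) / (br q - v0) ^ n) /\
     reg (br q) /\ (br q - v0) ^ n <> 0)).
  { apply (hol2_locally br p (fun v => v <> v0 -> (sm v = gs v / (v - v0) ^ n /\ cm v = gc v / (v - v0) ^ n) /\
     reg v /\ (v - v0) ^ n <> 0)); [easy|]. rewrite Ebr.
    apply (proj1 (locally'_Cmod _ _)) in LL. destruct LL as (r & Hr & LL).
    apply locally_Cmod. exists r. split; [easy|]. intros y Hy N. destruct (LL y Hy N) as [[A B] D]. now split. }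
  set (S := fun q => gs (br q)). set (Cq := fun q => gc (br q)). set (D := fun q => (br q - v0) ^ n).
  assert (hS : hol2 S p) by (apply hol2_of_hol1; [now rewrite Ebr|easy]).
  assert (hC : hol2 Cq p) by (apply hol2_of_hol1; [now rewrite Ebr|easy]).
  assert (hb : hol2 (fun q => br q - v0) p) by (apply hol2_sub; [easy|apply hol2_const]).
  assert (hD : hol2 D p) by now apply hol2_pow.
  pose proof (hol2_fst p) as h3. pose proof (hol2_snd p) as h4.
  (* [h1] and [h2] are [den1] and [den2] multiplied by [D ^ 2]. *)
  set (h1 := fun q => br q ^ 2 * (Cq q * D q) - S q ^ 2 * (fst q * snd q)).
  set (h2 := fun q => br q * D q ^ 2 - S q * Cq q * fst q).
  assert (Hh1 : hol2 h1 p) by exact (hol2_sub _ _ _ (hol2_mul _ _ _ (hol2_pow _ 2 _ Hbr) (hol2_mul _ _ _ hC hD))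
     (hol2_mul _ _ _ (hol2_pow _ 2 _ hS) (hol2_mul _ _ _ h3 h4))).
  assert (Hh2 : hol2 h2 p) by exact (hol2_sub _ _ _ (hol2_mul _ _ _ Hbr (hol2_pow _ 2 _ hD))
     (hol2_mul _ _ _ (hol2_mul _ _ _ hS hC) h3)).
  assert (FORM : forall q, br q <> v0 ->
     (sm (br q) = gs (br q) / (br q - v0) ^ n /\ cm (br q) = gc (br q) / (br q - v0) ^ n) /\
     reg (br q) /\ (br q - v0) ^ n <> 0 ->
     den1 q (br q) * D q ^ 2 = h1 q /\ den2 q (br q) * D q ^ 2 = h2 q).
  { intros q _ ([E1 E2] & _ & N). unfold den1, den2, h1, h2, S, Cq, D. rewrite E1, E2.
    split; field; exact N. }
  exists (fun q => fst q * br q * (br q * Cq q ^ 2 - S q * D q * snd q) ^ 2 * (br q - v0)),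
    (fun q => h1 q * h2 q * (br q - v0)).
  split; [|split; [split|]].
  - exact (hol2_mul _ _ _ (hol2_mul _ _ _ (hol2_mul _ _ _ h3 Hbr)
      (hol2_pow _ 2 _ (hol2_sub _ _ _ (hol2_mul _ _ _ Hbr (hol2_pow _ 2 _ hC))
        (hol2_mul _ _ _ (hol2_mul _ _ _ hS hD) h4)))) hb).
  - exact (hol2_mul _ _ _ (hol2_mul _ _ _ Hh1 Hh2) hb).
  - intros ZZ.
    (* At [scale t p] the branch is a cube root of [(t v0) ^ 3], so it differs from [v0] as soon as
       [t ^ 3 <> 1]. *)
    assert (T1 : locally' (1 : C) (fun t : C => t ^ 3 - 1 <> 0)).
    { apply (merop_nz_near (fun t : C => t ^ 3 - 1) 0).
      - intros t. apply merop_hol1. apply hol1_sub; [apply hol1_pow, hol1_id|apply hol1_const].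
      - apply hol1_sub; [apply hol1_pow, hol1_id|apply hol1_const].
      - replace (0 ^ 3 - 1) with (- (1)) by ring. intros X. apply C1_nz.
        transitivity (- - (1)); [ring|]. rewrite X. ring. }
    destruct (filter_ex _ (filter_and _ _ T1 (filter_and _ _
      (scale_near _ _ (locally_dst_and _ _ _ ZZ (locally_dst_and _ _ _ Lbr L2)))
      (nondeg_near p v0 1 Ev Nv)))) as (t & A & (B & Eb & F) & T & ND).
    set (q := scale t p) in *.
    assert (E3 : br q ^ 3 = (t * v0) ^ 3).
    { rewrite Eb. unfold q. rewrite level_scale, <- Ev. ring. }
    assert (Nb : br q <> v0).
    { intros X. apply A. rewrite X in E3.
      transitivity (((t * v0) ^ 3 - v0 ^ 3) / v0 ^ 3); [field; exact Nv|].
      rewrite <- E3. field. exact Nv. }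
    destruct (nondeg_cube q _ _ ND E3) as (R & N1 & N2).
    destruct (FORM q Nb (F Nb)) as [F1 F2]. destruct (F Nb) as (_ & _ & ND0).
    apply (Cmult_neq_0 (h1 q * h2 q) (br q - v0)); [|now apply Cminus_eq_contra|exact B].
    rewrite <- F1, <- F2. apply Cmult_neq_0; apply Cmult_neq_0; auto; now apply Cpow_nz.
  - generalize (locally_dst_and _ _ _ Lbr L2). apply locally_dst_imp. intros q [Eb F] N.
    assert (Nb : br q <> v0) by (intros X; apply N; rewrite X; ring).
    assert (N1 : h1 q <> 0) by (intros X; apply N; rewrite X; ring).
    assert (N2 : h2 q <> 0) by (intros X; apply N; rewrite X; ring).
    destruct (FORM q Nb (F Nb)) as [F1 F2]. destruct (F Nb) as ([E1 E2] & R & ND0).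
    rewrite (lam0_eq q (br q) R Eb). unfold expr.
    assert (NN : br q - v0 <> 0) by now apply Cminus_eq_contra.
    assert (D1 : den1 q (br q) <> 0) by (intros X; apply N1; rewrite <- F1, X; ring).
    assert (D2 : den2 q (br q) <> 0) by (intros X; apply N2; rewrite <- F2, X; ring).
    rewrite <- F1, <- F2. rewrite E1, E2. unfold Cq, S, D. field. auto.
Qed.

Lemma lam_meromorphic2 : meromorphic2 lam.
Proof. apply regularize_meromorphic2, lam0_local_quotient. Qed.

Lemma lam_nondeg q (v : C) : v ^ 3 = level q -> v <> 0 -> nondeg q v -> hol2 lam q /\ lam q = expr q v.
Proof.
  intros E N (R & N1 & N2). destruct (branch_near v q E N) as (br & Hbr & Ebr & Lbr).
  assert (hS : hol2 (fun q => sm (br q)) q) by (apply hol2_of_hol1; [rewrite Ebr; apply R|easy]).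
  assert (hC : hol2 (fun q => cm (br q)) q) by (apply hol2_of_hol1; [rewrite Ebr; apply R|easy]).
  pose proof (hol2_fst q) as h3. pose proof (hol2_snd q) as h4.
  assert (EX : extends_at lam0 (fun s => expr s (br s)) q).
  { split.
    - apply hol2_div.
      + exact (hol2_mul _ _ _ (hol2_mul _ _ _ h3 Hbr) (hol2_pow _ 2 _
          (hol2_sub _ _ _ (hol2_mul _ _ _ Hbr (hol2_pow _ 2 _ hC)) (hol2_mul _ _ _ hS h4)))).
      + apply hol2_mul.
        * exact (hol2_sub _ _ _ (hol2_mul _ _ _ (hol2_pow _ 2 _ Hbr) hC)
            (hol2_mul _ _ _ (hol2_pow _ 2 _ hS) (hol2_mul _ _ _ h3 h4))).
        * exact (hol2_sub _ _ _ Hbr (hol2_mul _ _ _ (hol2_mul _ _ _ hS hC) h3)).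
      + rewrite Ebr. now apply Cmult_neq_0.
    - exists (fun _ => RtoC 1). split; [apply thin_nz; [apply hol2_const|apply C1_nz]|].
      assert (LR : locally_dst q (fun s => reg (br s))).
      { apply (hol2_locally br q reg); [easy|]. rewrite Ebr. now apply reg_open. }
      generalize (locally_dst_and _ _ _ Lbr LR). apply locally_dst_imp. intros s [E1 R1] _.
      now apply lam0_eq. }
  split; [now apply (regularize_hol2 _ _ _ EX)|].
  pose proof (locally_dst_self _ _ (regularize_eq _ _ _ EX)) as A. cbv beta in A.
  now rewrite Ebr in A.
Qed.

(** The origin has level 0, so the uniformization with [vs <> 0] never reaches it. The invariant
    form of the formula does, and its denominator takes the value 1 there. *)
Lemma lam_near_zero : exists Sf Cf : C -> C,
  hol1 Sf 0 /\ hol1 Cf 0 /\ Sf 0 = 1 /\ Cf 0 = 1 /\ hol2 lam (RtoC 0, RtoC 0) /\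
  locally_dst (RtoC 0, RtoC 0) (fun q => dA Sf Cf q <> 0 /\ dB Sf Cf q <> 0 /\
    lam q = nA Sf Cf q / (dA Sf Cf q * dB Sf Cf q)).
Proof.
  destruct sm_cm_of_cube as (Sf & Cf & HS & HC & S0 & C0 & L).
  exists Sf, Cf. split; [easy|split; [easy|split; [easy|split; [easy|]]]].
  assert (Z : level (RtoC 0, RtoC 0) = 0) by (unfold level; simpl; ring).
  destruct (dAB_hol2 Sf Cf _ Z HS HC) as (H1 & H2 & H3).
  assert (A0 : dA Sf Cf (RtoC 0, RtoC 0) <> 0).
  { unfold dA. rewrite Z, C0, S0. simpl. replace (1 - 1 * (1 * 1) * (0 * 0)) with (RtoC 1) by ring. apply C1_nz. }
  assert (B0 : dB Sf Cf (RtoC 0, RtoC 0) <> 0).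
  { unfold dB. rewrite Z, C0, S0. simpl. replace (1 - 1 * 1 * 0) with (RtoC 1) by ring. apply C1_nz. }
  assert (L2 : locally_dst (RtoC 0, RtoC 0) (fun q => forall v, v ^ 3 = level q ->
     reg v /\ sm v = v * Sf (v ^ 3) /\ cm v = Cf (v ^ 3))).
  { apply (hol2_locally level _ (fun w => forall v, v ^ 3 = w -> reg v /\ sm v = v * Sf (v ^ 3) /\ cm v = Cf (v ^ 3)));
      [apply level_hol2|]. rewrite Z. now apply small_cube_root. }
  assert (LA := cont2_nz _ _ (hol2_cont _ _ H1) A0). assert (LB := cont2_nz _ _ (hol2_cont _ _ H2) B0).
  assert (EX : extends_at lam0 (fun q => nA Sf Cf q / (dA Sf Cf q * dB Sf Cf q)) (RtoC 0, RtoC 0)).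
  { split.
    - apply hol2_div; [easy|now apply hol2_mul|now apply Cmult_neq_0].
    - exists level. split; [apply level_thin|].
      generalize (locally_dst_and _ _ _ L2 (locally_dst_and _ _ _ LA LB)).
      apply locally_dst_imp. intros q (A & NA & NB) N.
      set (v := crt (level q)). assert (Ev : v ^ 3 = level q) by apply crt_spec.
      assert (Nv : v <> 0) by (intros X; apply N; rewrite <- Ev, X; ring).
      destruct (A v Ev) as (R & E1 & E2).
      destruct (cube_form Sf Cf q v Nv Ev R E1 E2) as (_ & _ & D). apply D. now apply Cmult_neq_0. }
  split; [now apply (regularize_hol2 _ _ _ EX)|].
  generalize (locally_dst_and _ _ _ (regularize_eq _ _ _ EX) (locally_dst_and _ _ _ LA LB)).
  apply locally_dst_imp. intros q (A & B & D). auto.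
Qed.

(** At [Phi vs u] the factors of [expr] turn into [add_s], [add_c] and [add_d], and what remains is
    [vs add_d ^ 2 / (add_s add_c)], or [vs / (sm cm)] at [u + vs]. *)
Lemma lam_Phi (vs u : C) : vs <> 0 -> gen0 vs u ->
  hol2 lam (Phi vs u) /\ lam (Phi vs u) = fst (Phi vs (u + vs)).
Proof.
  intros N ((Ru & Ns & Nc) & Rv & N1 & N2 & N3).
  assert (E : vs ^ 3 = level (Phi vs u)).
  { symmetry. apply Phi_level. exact (conj Ru (conj Ns Nc)). }
  destruct (addition u vs Ru Rv N3) as (_ & A1 & A2).
  unfold add_s, add_c, add_d in *.
  assert (D1 : den1 (Phi vs u) vs = vs ^ 2 * (sm u ^ 2 * cm vs - sm vs ^ 2 * cm u) / sm u ^ 2).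
  { unfold den1, Phi. simpl fst; simpl snd. field. auto. }
  assert (D2 : den2 (Phi vs u) vs = vs * (sm u * cm u - sm vs * cm vs) / (sm u * cm u)).
  { unfold den2, Phi. simpl fst. field. auto. }
  assert (D3 : vs * cm vs ^ 2 - sm vs * snd (Phi vs u) = vs * (sm u * cm vs ^ 2 - sm vs * cm u ^ 2) / sm u).
  { unfold Phi. simpl snd. field. auto. }
  assert (ND : nondeg (Phi vs u) vs).
  { split; [easy|]. rewrite D1, D2. split.
    - apply Cmult_neq_0.
      + apply Cmult_neq_0; auto. now apply Cpow_nz.
      + intros X. apply C1_nz. rewrite <- (Cinv_l (sm u ^ 2)), X; [ring|]. now apply Cpow_nz.
    - apply Cmult_neq_0.
      + now apply Cmult_neq_0.
      + intros X. apply C1_nz. rewrite <- (Cinv_l (sm u * cm u)), X; [ring|]. now apply Cmult_neq_0. }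
  destruct (lam_nondeg _ _ E N ND) as [H1 H2]. split; [easy|].
  rewrite H2. unfold expr. rewrite D1, D2, D3. unfold Phi at 2. simpl fst. rewrite A1, A2.
  unfold Phi. simpl fst. field. auto 10.
Qed.

Lemma Lambda_Phi (vs u : C) : vs <> 0 -> generic vs u ->
  hol2 lam (Phi vs u) /\ hol2 lam (swap (Phi vs u)) /\ Lambda lam (Phi vs u) = Phi vs (u + vs).
Proof.
  intros N [G1 G2]. destruct (lam_Phi vs u N G1) as [H1 E1].
  assert (N' : - vs <> 0) by (intros X; apply N; transitivity (- - vs); [ring|rewrite X; ring]).
  destruct (lam_Phi (- vs) (- u) N' G2) as [H2 E2].
  replace (- u + - vs) with (- (u + vs)) in E2 by ring.
  rewrite Phi_neg in H2, E2 by apply G1. rewrite Phi_neg in E2 by now apply gen0_good.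
  split; [easy|split; [easy|]]. unfold Lambda. rewrite E1, E2.
  now destruct (Phi vs (u + vs)).
Qed.

(** ** Identities along the uniformization *)

(** The common engine of the identities below. Points of level 0 are limits of others, each other
    point is some [Phi v u], and the ray through it moves it to parameters [t v], [u] with [t] near
    1, among which the generic ones are dense. *)
Lemma dense_zero p G : hol2 G p ->
  (forall vs u : C, vs <> 0 -> good u -> locally' (1 : C) (fun t => G (Phi (t * vs) u) = 0)) ->
  G p = 0.
Proof.
  intros HG H. apply NNPP. intros N.
  pose proof (cont2_nz G p (hol2_cont _ _ HG) N) as L.
  destruct (level_dense p _ (locally_dst_open _ _ L)) as ([x y] & L' & Nl).
  set (v := crt (level (x, y))). pose proof (crt_spec (level (x, y))) as Ev. fold v in Ev.
  assert (Nv : v <> 0). { intros Z. apply Nl. rewrite <- Ev, Z. ring. }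
  destruct (Phi_onto x y v Nv Ev) as (u & Gu & E).
  destruct (filter_ex _ (filter_and _ _ (H v u Nv Gu) (scale_near _ _ L'))) as [t [A B]].
  apply B. rewrite E, <- Phi_scale. exact A.
Qed.

Lemma hol2_scale (f : C * C -> C) k p : hol2 f (scale k p) -> hol2 (fun q => f (scale k q)) p.
Proof.
  intros H. unfold scale. apply (hol2_pair f (fun q => k * fst q) (fun q => k * snd q)); [easy| |];
    apply hol2_mul; auto using hol2_const, hol2_fst, hol2_snd.
Qed.

Lemma hol2_swap (f : C * C -> C) p : hol2 f (swap p) -> hol2 (fun q => f (swap q)) p.
Proof. intros H. apply (hol2_pair f snd fst); [easy|apply hol2_snd|apply hol2_fst]. Qed.

Lemma Lambda_ray (a : C) (vs u : C) : vs <> 0 -> a <> 0 -> good u ->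
  locally' (1 : C) (fun t => Lambda lam (Phi (a * (t * vs)) u) = Phi (a * (t * vs)) (u + a * (t * vs))).
Proof.
  intros N Na G.
  assert (E : a * vs * 0 + 0 = 0) by ring.
  assert (G0 : good (0 * 0 + u)) by (now replace (0 * 0 + u) with u by ring).
  generalize (filter_and _ _ (generic_near _ _ _ _ 0 1 E G0) (merop_nz_near (fun t : C => t) 1 1
    (fun t => merop_hol1 _ _ (hol1_id t)) (hol1_id 1) C1_nz)).
  apply filter_imp. intros t [A B].
  replace (a * vs * t + 0) with (a * (t * vs)) in A by ring. replace (0 * t + u) with u in A by ring.
  apply Lambda_Phi; [|exact A]. repeat apply Cmult_neq_0; auto.
Qed.

Lemma Lambda_eq p a b : Lambda lam p = (a, b) -> lam p = a /\ lam (swap p) = b.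
Proof. unfold Lambda. intros E. now injection E. Qed.

Lemma level_Lambda p : hol2 lam p -> hol2 lam (swap p) -> level (Lambda lam p) = level p.
Proof.
  intros H1 H2. apply Cminus_0_eq.
  apply (dense_zero p (fun q => level (Lambda lam q) - level q)).
  - apply hol2_sub; [|apply level_hol2]. unfold level, Lambda. simpl.
    apply hol2_mul; [apply hol2_mul|apply hol2_sub]; auto using hol2_swap.
  - intros vs u N G.
    assert (G0 : good (vs * 0 + u)) by (now replace (vs * 0 + u) with u by ring).
    generalize (filter_and _ _ (Lambda_ray 1 vs u N C1_nz G) (near_aff good vs u 0 1 good_near G0)).
    apply filter_imp. intros t [A B].
    replace (1 * (t * vs)) with (t * vs) in A by ring. replace (vs * t + u) with (u + t * vs) in B by ring.
    rewrite A. unfold level. rewrite !Phi_level by easy. ring.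
Qed.

Lemma lam_zero : hol2 lam (RtoC 0, RtoC 0) /\ lam (RtoC 0, RtoC 0) = 0.
Proof.
  destruct lam_near_zero as (Sf & Cf & _ & _ & _ & _ & H & L). split; [easy|].
  apply locally_dst_self in L. destruct L as (_ & _ & E). rewrite E. unfold nA. simpl.
  unfold Cdiv. ring.
Qed.

Definition flow_point (z : C) (p : C * C) : C * C := scale ((1 - z) / z) (Lambda lam (scale z p)).

Lemma flow_point_hol2 (f : C * C -> C) z p : hol2 lam (scale z p) -> hol2 lam (swap (scale z p)) ->
  hol2 f (flow_point z p) -> hol2 (fun q => f (flow_point z q)) p.
Proof.
  intros H1 H2 Hf. unfold flow_point, scale, Lambda. simpl.
  apply (hol2_pair f (fun q => (1 - z) / z * lam (scale z q)) (fun q => (1 - z) / z * lam (swap (scale z q)))).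
  - exact Hf.
  - apply hol2_mul; [apply hol2_const|now apply hol2_scale].
  - apply hol2_mul; [apply hol2_const|].
    apply (hol2_scale (fun q => lam (swap q))). now apply hol2_swap.
Qed.

Lemma flow_fst (z : C) p : z <> 0 -> hol2 lam p -> hol2 lam (scale z p) -> hol2 lam (swap (scale z p)) ->
  hol2 lam (flow_point z p) -> (1 - z) * lam p = lam (flow_point z p).
Proof.
  (* For [z = 1] the second translation is 0 and no generic parameter exists; there both sides are
     0, the flow point being the origin. *)
  intros Nz H1 H2 H3 H4. destruct (Ceq_dec z 1) as [->|N1].
  { unfold flow_point, scale. replace ((1 - 1) / 1) with (RtoC 0) by (field; apply C1_nz).
    rewrite !Cmult_0_l, (proj2 lam_zero). ring. }
  assert (N1' : 1 - z <> 0) by (intros Z; apply N1; symmetry; now apply Cminus_0_eq).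
  apply Cminus_0_eq. apply (dense_zero p (fun q => (1 - z) * lam q - lam (flow_point z q))).
  - apply hol2_sub; [apply hol2_mul; [apply hol2_const|easy]|]. now apply flow_point_hol2.
  - intros vs u N G.
    assert (E : (1 - z) * vs * 0 + 0 = 0) by ring.
    assert (G0 : good (z * vs * 0 + u)) by (now replace (z * vs * 0 + u) with u by ring).
    generalize (filter_and _ _ (filter_and _ _ (Lambda_ray 1 vs u N C1_nz G) (Lambda_ray z vs u N Nz G))
      (filter_and _ _ (generic_near _ _ _ _ 0 1 E G0) (merop_nz_near (fun t : C => t) 1 1
        (fun t => merop_hol1 _ _ (hol1_id t)) (hol1_id 1) C1_nz))).
    apply filter_imp. intros t [[A B] [D T]].
    replace (1 * (t * vs)) with (t * vs) in A by ring.
    replace ((1 - z) * vs * t + 0) with ((1 - z) * (t * vs)) in D by ring.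
    replace (z * vs * t + u) with (u + z * (t * vs)) in D by ring.
    assert (NN : (1 - z) * (t * vs) <> 0) by (repeat apply Cmult_neq_0; auto).
    destruct (Lambda_Phi _ _ NN D) as (_ & _ & F).
    replace (u + z * (t * vs) + (1 - z) * (t * vs)) with (u + t * vs) in F by ring.
    unfold flow_point. rewrite <- Phi_scale, B, <- Phi_scale.
    replace ((1 - z) / z * (z * (t * vs))) with ((1 - z) * (t * vs)) by (field; exact Nz).
    destruct (Lambda_eq _ _ _ A) as [-> _]. destruct (Lambda_eq _ _ _ F) as [-> _].
    unfold Cdiv. ring.
Qed.

Lemma flow (z : C) p : z <> 0 -> hol2 lam p -> hol2 lam (swap p) ->
  hol2 lam (scale z p) -> hol2 lam (swap (scale z p)) ->
  hol2 lam (flow_point z p) -> hol2 lam (swap (flow_point z p)) ->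
  scale (1 - z) (Lambda lam p) = Lambda lam (flow_point z p).
Proof.
  intros Nz H1 H2 H3 H4 H5 H6. unfold Lambda at 1 2. unfold scale at 1. simpl. f_equal.
  - now apply flow_fst.
  (* Scaling and [flow_point] commute with [swap] by conversion, so this is the first coordinate at
     the swapped point. *)
  - now apply (flow_fst z (swap p)).
Qed.

(** ** The explicit formulas *)

Definition fA (x y v s c : C) : C := c * v ^ 2 - s * c ^ 2 * y * v + s ^ 2 * x * y.
Definition fB (x y v s c : C) : C := c ^ 2 * v ^ 2 - s * x * v + s ^ 2 * c * x * y.

(** [A], [B] and [1 - c1 ^ 3 c2 ^ 3] are what the three factors of the stated formulas become at
    [Phi v u], up to monomials. The identities make them proportional to [add_d], [add_c] and
    [add_s], with common ratio [A / add_d]. *)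
Lemma formula_identities (s1 c1 s2 c2 : C) : s1 ^ 3 + c1 ^ 3 = 1 -> s2 ^ 3 + c2 ^ 3 = 1 ->
  let A := c2 * s1 ^ 2 - s1 * s2 * c1 ^ 2 * c2 ^ 2 + s2 ^ 2 * c1 in
  let B := c2 ^ 2 * s1 ^ 2 * c1 - s1 * s2 + s2 ^ 2 * c2 * c1 ^ 2 in
  A * add_c s1 c1 s2 c2 = add_d s1 c1 s2 c2 * B /\
  A * add_s s1 c1 s2 c2 = add_d s1 c1 s2 c2 * (1 - c1 ^ 3 * c2 ^ 3).
Proof.
  intros E1 E2 A B. unfold A, B, add_s, add_c, add_d.
  assert (Z1 : s1 ^ 3 + c1 ^ 3 - 1 = 0) by (rewrite E1; ring).
  assert (Z2 : s2 ^ 3 + c2 ^ 3 - 1 = 0) by (rewrite E2; ring).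
  split; apply Cminus_0_eq.
  (* Membership in the ideal of the two cubic relations, with explicit cofactors; likewise in the
     second case. *)
  - transitivity (c1 * c2 * s2 ^ 3 * (s1 ^ 3 + c1 ^ 3 - 1) - c1 * c2 * s1 ^ 3 * (s2 ^ 3 + c2 ^ 3 - 1));
      [ring|rewrite Z1, Z2; ring].
  - transitivity ((c2 ^ 2 * s1 - c1 ^ 2 * c2 ^ 3 * s2) * (s1 ^ 3 + c1 ^ 3 - 1)
      + (c1 ^ 3 * c2 ^ 2 * s1 - c1 ^ 2 * s2) * (s2 ^ 3 + c2 ^ 3 - 1));
      [ring|rewrite Z1, Z2; ring].
Qed.

Lemma Cmult_nz_r (a b : C) : a * b <> 0 -> b <> 0.
Proof. intros H Z. apply H. rewrite Z. ring. Qed.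

Lemma formula_generic (v u : C) : v <> 0 -> generic v u ->
  let x := fst (Phi v u) in let y := snd (Phi v u) in let s := sm v in let c := cm v in
  fA x y v s c <> 0 \/ fB x y v s c <> 0 ->
  lam (Phi v u) = v * fA x y v s c ^ 2 / (y * (x - c ^ 3 * y) * fB x y v s c) /\
  lam (swap (Phi v u)) = v * fB x y v s c ^ 2 / (x * (x - c ^ 3 * y) * fA x y v s c).
Proof.
  intros Nv G. destruct (Lambda_Phi v u Nv G) as (_ & _ & E). destruct G as [(Gu & Rv & N1 & N2 & N3) _].
  destruct Gu as (Ru & Ns & Nc). destruct (addition u v Ru Rv N3) as (_ & S1 & C1).
  unfold Phi in E at 2. rewrite S1, C1 in E. apply Lambda_eq in E. destruct E as [-> ->].
  pose proof (formula_identities _ _ _ _ (cubic u Ru) (cubic v Rv)) as I. cbv zeta in I.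
  unfold fA, fB, Phi. cbn [fst snd].
  set (s1 := sm u) in *. set (c1 := cm u) in *. set (s2 := sm v) in *. set (c2 := cm v) in *.
  cbv zeta. destruct I as [I1 I2].
  set (A := c2 * s1 ^ 2 - s1 * s2 * c1 ^ 2 * c2 ^ 2 + s2 ^ 2 * c1) in *.
  set (B := c2 ^ 2 * s1 ^ 2 * c1 - s1 * s2 + s2 ^ 2 * c2 * c1 ^ 2) in *.
  set (E := 1 - c1 ^ 3 * c2 ^ 3) in *.
  set (S := add_s s1 c1 s2 c2) in *. set (K := add_c s1 c1 s2 c2) in *. set (D := add_d s1 c1 s2 c2) in *.
  replace (c2 * v ^ 2 - s2 * c2 ^ 2 * (v * c1 ^ 2 / s1) * v + s2 ^ 2 * (v / (s1 * c1)) * (v * c1 ^ 2 / s1))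
    with (v ^ 2 * A / s1 ^ 2) by (unfold A; field; auto).
  replace (c2 ^ 2 * v ^ 2 - s2 * (v / (s1 * c1)) * v + s2 ^ 2 * c2 * (v / (s1 * c1)) * (v * c1 ^ 2 / s1))
    with (v ^ 2 * B / (s1 ^ 2 * c1)) by (unfold B; field; auto).
  replace (v / (s1 * c1) - c2 ^ 3 * (v * c1 ^ 2 / s1)) with (v * E / (s1 * c1)) by (unfold E; field; auto).
  (* Since [K] and [D] do not vanish, [A K = D B] makes [A] and [B] vanish together, so one of them
     being non-zero is enough. *)
  intros NAB. assert (NA : A <> 0).
  { intros Z. rewrite Z, Cmult_0_l in I1. symmetry in I1. destruct (Cmult_integral _ _ I1) as [|ZB]; [easy|].
    destruct NAB as [X|X]; apply X; [rewrite Z|rewrite ZB]; unfold Cdiv; ring. }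
  assert (EB : B = A * K / D) by (rewrite I1; field; auto).
  assert (EE : E = A * S / D) by (rewrite I2; field; auto).
  clearbody A B E. subst B E. split; field; auto 10.
Qed.

Lemma Clim_ray (f : C -> C) (v : C) : hol1 f v -> Clim (locally' (1 : C)) (fun t : C => f (t * v)) (f v).
Proof.
  intros H. assert (E : 1 * v = v) by ring.
  assert (H1 : hol1 (fun t => f (t * v)) 1).
  { apply (hol1_comp f (fun t => t * v)); [now rewrite E|].
    apply hol1_mul; [apply hol1_id|apply hol1_const]. }
  apply hol1_Clim in H1. apply Clim_locally' in H1. cbv beta in H1. now rewrite E in H1.
Qed.

Lemma lam_ray p : hol2 lam p -> Clim (locally' (1 : C)) (fun t => lam (scale t p)) (lam p).
Proof.
  intros H. destruct (scale_Clim p) as [S1 S2].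
  exact (Clim_cont2 lam _ _ p (hol2_cont _ _ H) S1 S2).
Qed.

(** Both sides are continuous along the ray [t |-> t (x, y)] at [t = 1], and for [t] near 1 the
    parameters are generic, so the formula passes to the limit. *)
Lemma formulas (x y vs : C) : vs ^ 3 = x * y * (x - y) -> reg vs ->
  let s := sm vs in let c := cm vs in
  (hol2 lam (x, y) -> y * (x - c ^ 3 * y) * fB x y vs s c <> 0 ->
   lam (x, y) = vs * fA x y vs s c ^ 2 / (y * (x - c ^ 3 * y) * fB x y vs s c)) /\
  (hol2 lam (y, x) -> x * (x - c ^ 3 * y) * fA x y vs s c <> 0 ->
   lam (y, x) = vs * fB x y vs s c ^ 2 / (x * (x - c ^ 3 * y) * fA x y vs s c)).
Proof.
  intros E R. cbv zeta. destruct (Ceq_dec vs 0) as [-> | N].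
  (* At [vs = 0] both [fA] and [fB] vanish, against the assumption on the denominators. *)
  { split; intros _ H; apply Cmult_nz_r in H; exfalso; apply H; unfold fA, fB;
      rewrite sm_0, cm_0; ring. }
  destruct (Phi_onto x y vs N E) as (u & Gu & P).
  assert (Es : vs * 0 + 0 = 0) by ring.
  assert (G0 : good (0 * 0 + u)) by (now replace (0 * 0 + u) with u by ring).
  pose proof (filter_and _ _ (generic_near _ _ _ _ 0 1 Es G0) (merop_nz_near (fun t : C => t) 1 1
    (fun t => merop_hol1 _ _ (hol1_id t)) (hol1_id 1) C1_nz)) as L.
  assert (Lx := Clim_ray (fun t => t) x (hol1_id x)). assert (Ly := Clim_ray (fun t => t) y (hol1_id y)).
  assert (Lv := Clim_ray (fun t => t) vs (hol1_id vs)).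
  assert (Ls := Clim_ray sm vs (proj1 R)). assert (Lc := Clim_ray cm vs (proj2 R)). cbv beta in *.
  set (s := sm vs) in *. set (c := cm vs) in *.
  assert (LA : Clim (locally' (1 : C))
    (fun t => fA (t * x) (t * y) (t * vs) (sm (t * vs)) (cm (t * vs))) (fA x y vs s c)).
  { unfold fA. clim. }
  assert (LB : Clim (locally' (1 : C))
    (fun t => fB (t * x) (t * y) (t * vs) (sm (t * vs)) (cm (t * vs))) (fB x y vs s c)).
  { unfold fB. clim. }
  assert (LE : Clim (locally' (1 : C)) (fun t => t * x - cm (t * vs) ^ 3 * (t * y)) (x - c ^ 3 * y)).
  { clim. }
  assert (K : forall t : C, t <> 0 -> generic (vs * t + 0) (0 * t + u) ->
    fA (t * x) (t * y) (t * vs) (sm (t * vs)) (cm (t * vs)) <> 0 \/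
    fB (t * x) (t * y) (t * vs) (sm (t * vs)) (cm (t * vs)) <> 0 ->
    lam (scale t (x, y)) = t * vs * fA (t * x) (t * y) (t * vs) (sm (t * vs)) (cm (t * vs)) ^ 2 /
      (t * y * (t * x - cm (t * vs) ^ 3 * (t * y)) *
       fB (t * x) (t * y) (t * vs) (sm (t * vs)) (cm (t * vs))) /\
    lam (scale t (y, x)) = t * vs * fB (t * x) (t * y) (t * vs) (sm (t * vs)) (cm (t * vs)) ^ 2 /
      (t * x * (t * x - cm (t * vs) ^ 3 * (t * y)) *
       fA (t * x) (t * y) (t * vs) (sm (t * vs)) (cm (t * vs)))).
  { intros t T G Nz. replace (vs * t + 0) with (t * vs) in G by ring. replace (0 * t + u) with u in G by ring.
    assert (Nt : t * vs <> 0) by now apply Cmult_neq_0.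
    pose proof (formula_generic _ _ Nt G) as F. rewrite Phi_scale, <- P in F. exact (F Nz). }
  split; intros H Nz.
  - apply (Clim_unique (F := locally' (1 : C)) _ _ _ (lam_ray _ H)).
    pose proof (Clim_nz _ _ LB (Cmult_nz_r _ _ Nz)) as LN.
    eapply Clim_ext_eq; [|reflexivity|].
    2: { apply Clim_div; [| |exact Nz]; [apply Clim_mul; [exact Lv|apply Clim_pow, LA]|].
      apply Clim_mul; [apply Clim_mul; [exact Ly|exact LE]|exact LB]. }
    generalize (filter_and _ _ L LN). apply filter_imp. intros t [[G T] Bn].
    symmetry. apply (K t T G). now right.
  - apply (Clim_unique (F := locally' (1 : C)) _ _ _ (lam_ray _ H)).
    pose proof (Clim_nz _ _ LA (Cmult_nz_r _ _ Nz)) as LN.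
    eapply Clim_ext_eq; [|reflexivity|].
    2: { apply Clim_div; [| |exact Nz]; [apply Clim_mul; [exact Lv|apply Clim_pow, LB]|].
      apply Clim_mul; [apply Clim_mul; [exact Lx|exact LE]|exact LA]. }
    generalize (filter_and _ _ L LN). apply filter_imp. intros t [[G T] Bn].
    symmetry. apply (K t T G). now left.
Qed.

(** ** Symmetries *)

(** Applying the same sign [eps] to [v] and to [u] is what makes such a map commute with the
    translation [u |-> u + v]; the constant [k] is harmless. *)
Definition symmetry (f : C * C -> C * C) : Prop :=
  exists eps k : C, (eps = 1 \/ eps = - (1)) /\
    forall u : C, (good (eps * u + k) <-> good u) /\
      forall v : C, good u -> f (Phi v u) = Phi (eps * v) (eps * u + k).

Lemma symmetry_id : symmetry (fun p => p).
Proof.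
  exists 1, 0. split; [now left|]. intros u. replace (1 * u + 0) with u by ring.
  split; [easy|]. intros v _. now rewrite Cmult_1_l.
Qed.

Lemma symmetry_swap : symmetry swap.
Proof.
  exists (- (1)), 0. split; [now right|]. intros u. replace (- (1) * u + 0) with (- u) by ring.
  split.
  - split; intros G; apply good_neg in G; trivial. now replace (- - u) with u in G by ring.
  - intros v G. rewrite <- Phi_neg by easy. f_equal. ring.
Qed.

Lemma symmetry_comp f g : symmetry f -> symmetry g -> symmetry (fun p => f (g p)).
Proof.
  intros (e1 & k1 & E1 & H1) (e2 & k2 & E2 & H2). exists (e1 * e2), (e1 * k2 + k1). split.
  { destruct E1 as [-> | ->], E2 as [-> | ->]; [left|right|right|left]; ring. }
  intros u. replace (e1 * e2 * u + (e1 * k2 + k1)) with (e1 * (e2 * u + k2) + k1) by ring.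
  destruct (H1 (e2 * u + k2)) as [G1 F1]. destruct (H2 u) as [G2 F2]. split.
  - now rewrite G1.
  - intros v G. rewrite F2 by easy. rewrite F1 by now apply G2. f_equal. ring.
Qed.

Lemma symmetry_inv f g : symmetry f -> mutually_inverse f g -> symmetry g.
Proof.
  intros (e & k & E & H) [I _]. exists e, (- e * k). split; [easy|].
  assert (E2 : e * e = 1) by (destruct E as [-> | ->]; ring).
  intros u. replace (e * u + - e * k) with (e * (u - k)) by ring.
  assert (Eu : e * (e * (u - k)) + k = u).
  { transitivity (e * e * (u - k) + k); [ring|rewrite E2; ring]. }
  destruct (H (e * (u - k))) as [G F]. rewrite Eu in G, F. split.
  - now rewrite G.
  - intros v Gu. specialize (F (e * v) (proj1 G Gu)).
    replace (e * (e * v)) with v in F by (transitivity (e * e * v); [rewrite E2|]; ring).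
    now rewrite <- F, I.
Qed.

(** [tau] is the reflection [u |-> 2 K - u] at a zero [K] of [cm]. It sends [(s, c)] to
    [(e ^ 2 / s, - e c / s)] with [e ^ 3 = 1], and [x - y] is recognized through the cubic
    relation. *)
Lemma symmetry_tau : symmetry tau.
Proof.
  destruct exists_zero_cm as (K & RK & CK). pose proof (cubic _ RK) as E.
  set (e := sm (RtoC K)) in *. rewrite CK in E.
  assert (E3 : e ^ 3 = 1) by (rewrite <- E; ring).
  assert (Ne : e <> 0) by (intros Z; apply C1_nz; rewrite <- E3, Z; ring).
  assert (H : forall u, reg u -> cm u <> 0 ->
    reg (u + RtoC K) /\ sm (u + RtoC K) = e / cm u /\ cm (u + RtoC K) = - sm u / (e * cm u)).
  { intros u R N. destruct (addition u (RtoC K) R RK) as (R' & S' & C').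
    - unfold add_d. rewrite CK. fold e. intros Z. apply (Cmult_neq_0 e (cm u ^ 2)); auto.
      + now apply Cpow_nz.
      + transitivity (- (sm u * 0 ^ 2 - e * cm u ^ 2)); [ring|]. rewrite Z. ring.
    - split; [easy|]. rewrite S', C'. unfold add_s, add_c, add_d. rewrite CK. fold e.
      split; field; auto. }
  (* [2 K - u] is reached by adding [K] twice to [- u], since the addition formulas are 0/0 for
     [K + K]. *)
  assert (H2 : forall u, good u -> good (2 * RtoC K - u) /\
    sm (2 * RtoC K - u) = e ^ 2 / sm u /\ cm (2 * RtoC K - u) = - e * cm u / sm u).
  { intros u G. pose proof (good_neg u G) as (R1 & Ns1 & Nc1). destruct G as (R & Ns & Nc).
    destruct (reg_neg u R Nc) as (_ & S0 & C0).
    destruct (H _ R1 Nc1) as (R2 & S2 & C2).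
    assert (Nc2 : cm (- u + RtoC K) <> 0).
    { rewrite C2. intros Z. apply Ns1.
      transitivity (- (- sm (- u) / (e * cm (- u))) * (e * cm (- u))); [field; auto|].
      rewrite Z. ring. }
    destruct (H _ R2 Nc2) as (R3 & S3 & C3). rewrite S2, C2 in C3. rewrite C2 in S3.
    rewrite S0, C0 in S3, C3.
    replace (- u + RtoC K + RtoC K) with (2 * RtoC K - u) in * by ring.
    assert (S4 : sm (2 * RtoC K - u) = e ^ 2 / sm u) by (rewrite S3; field; auto).
    assert (C4 : cm (2 * RtoC K - u) = - e * cm u / sm u) by (rewrite C3; field; auto).
    split; [|easy]. split; [easy|]. rewrite S4, C4. split; intros Z.
    - apply (Cpow_nz e 2 Ne). transitivity (e ^ 2 / sm u * sm u); [field; exact Ns|]. rewrite Z. ring.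
    - apply (Cmult_neq_0 e (cm u) Ne Nc).
      transitivity (- (- e * cm u / sm u) * sm u); [field; exact Ns|]. rewrite Z. ring. }
  exists (- (1)), (2 * RtoC K). split; [now right|]. intros u.
  replace (- (1) * u + 2 * RtoC K) with (2 * RtoC K - u) by ring. split.
  - split; intros G; [|now apply H2]. replace u with (2 * RtoC K - (2 * RtoC K - u)) by ring. now apply H2.
  - intros v G. destruct (H2 u G) as (_ & S & D). destruct G as (R & Ns & Nc).
    unfold Phi, tau. cbn [fst snd]. rewrite S, D. f_equal.
    + transitivity (v * ((sm u ^ 3 + cm u ^ 3) - cm u ^ 3) / (sm u * cm u)).
      * rewrite cubic by easy. field. auto.
      * transitivity (v * sm u ^ 2 / (cm u * e ^ 3)); [rewrite E3; field; auto|]. field. auto.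
    + field. auto.
Qed.

Lemma Sigma_symmetry f : Sigma f -> symmetry f.
Proof.
  induction 1; eauto using symmetry_id, symmetry_swap, symmetry_tau, symmetry_comp, symmetry_inv.
Qed.

Definition linear_map (f : C * C -> C * C) : Prop :=
  exists a b c d : C, forall p, f p = (a * fst p + b * snd p, c * fst p + d * snd p).

Lemma hol2_linear (g : C * C -> C) f p : linear_map f -> hol2 g (f p) -> hol2 (fun q => g (f q)) p.
Proof.
  intros (a & b & c & d & L) H. rewrite L in H.
  apply (hol2_ext (fun q => g (a * fst q + b * snd q, c * fst q + d * snd q))).
  - exists 1%R. split; [lra|]. intros q _. now rewrite L.
  - apply (hol2_pair g (fun q => a * fst q + b * snd q) (fun q => c * fst q + d * snd q)); [easy| |];
      apply hol2_add; apply hol2_mul; auto using hol2_const, hol2_fst, hol2_snd.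
Qed.

Lemma symmetry_ray f (vs u : C) : symmetry f -> vs <> 0 -> good u ->
  locally' (1 : C) (fun t => Lambda lam (f (Phi (t * vs) u)) = f (Lambda lam (Phi (t * vs) u))).
Proof.
  intros (e & k & E & H) N G. destruct (H u) as [Gu F].
  assert (Ne : e <> 0).
  { destruct E as [-> | ->]; [apply C1_nz|]. intros Z. apply C1_nz.
    transitivity (- - (1)); [ring|rewrite Z; ring]. }
  assert (G0 : good (vs * 0 + u)) by (now replace (vs * 0 + u) with u by ring).
  generalize (filter_and _ _ (near_aff good vs u 0 1 good_near G0)
    (filter_and _ _ (Lambda_ray 1 vs u N C1_nz G) (Lambda_ray e vs _ N Ne (proj2 Gu G)))).
  apply filter_imp. intros t (A & B & D).
  replace (vs * t + u) with (u + t * vs) in A by ring. replace (1 * (t * vs)) with (t * vs) in B by ring.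
  rewrite F, B, D by easy. destruct (H (u + t * vs)) as [_ F']. rewrite F' by easy. f_equal. ring.
Qed.

Lemma Lambda_symmetry f p : symmetry f -> linear_map f -> hol2 lam p -> hol2 lam (swap p) ->
  hol2 lam (f p) -> hol2 lam (swap (f p)) -> Lambda lam (f p) = f (Lambda lam p).
Proof.
  intros S L H1 H2 H3 H4. assert (L' := L). destruct L' as (a & b & c & d & E).
  rewrite (E (Lambda lam p)). unfold Lambda. cbn [fst snd]. f_equal; apply Cminus_0_eq.
  - apply (dense_zero p (fun q => lam (f q) - (a * lam q + b * lam (swap q)))).
    + apply hol2_sub; [now apply hol2_linear|].
      apply hol2_add; apply hol2_mul; auto using hol2_const, hol2_swap.
    + intros vs u N G. generalize (symmetry_ray f vs u S N G). apply filter_imp. intros t R.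
      rewrite (E (Lambda _ _)) in R. apply Lambda_eq in R. destruct R as [-> _].
      unfold Lambda. simpl. ring.
  - apply (dense_zero p (fun q => lam (swap (f q)) - (c * lam q + d * lam (swap q)))).
    + apply hol2_sub; [now apply (hol2_linear (fun q => lam (swap q))); [|apply hol2_swap]|].
      apply hol2_add; apply hol2_mul; auto using hol2_const, hol2_swap.
    + intros vs u N G. generalize (symmetry_ray f vs u S N G). apply filter_imp. intros t R.
      rewrite (E (Lambda _ _)) in R. apply Lambda_eq in R. destruct R as [_ ->].
      unfold Lambda. simpl. ring.
Qed.

Lemma linear_map_intro (f : C * C -> C * C) (a b c d : C) :
  (forall p, f p = (a * fst p + b * snd p, c * fst p + d * snd p)) -> linear_map f.
Proof. intros H. now exists a, b, c, d. Qed.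

(** The two rotations of order three send [Lambda = (a, b)] to pairs with first coordinates [- b]
    and [b - a], which cancel against [a] and the remaining coordinate relation: evaluated at the
    three points, the terms are [a], [- b] and [b - a]. *)
Lemma lam_three_terms (x y : C) : hol2 lam (x, y) -> hol2 lam (- y, x - y) -> hol2 lam (y - x, - x) ->
  lam (x, y) + lam (- y, x - y) + lam (y - x, - x) = 0.
Proof.
  intros H1 H2 H3.
  pose proof (symmetry_comp _ _ symmetry_swap symmetry_tau) as S1.
  pose proof (symmetry_comp _ _ symmetry_tau symmetry_swap) as S2.
  apply (dense_zero (x, y) (fun q => lam q + lam (swap (tau q)) + lam (tau (swap q)))).
  - apply hol2_add; [apply hol2_add; [easy|]|].
    + apply (hol2_linear lam (fun q => swap (tau q))); [|easy].
      apply (linear_map_intro _ 0 (- (1)) 1 (- (1))). intros q. unfold swap, tau. simpl. f_equal; ring.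
    + apply (hol2_linear lam (fun q => tau (swap q))); [|easy].
      apply (linear_map_intro _ (- (1)) 1 (- (1)) 0). intros q. unfold swap, tau. simpl. f_equal; ring.
  - intros vs u N G. generalize (filter_and _ _ (symmetry_ray _ vs u S1 N G) (symmetry_ray _ vs u S2 N G)).
    apply filter_imp. intros t [A B]. apply Lambda_eq in A, B.
    destruct A as [-> _], B as [-> _]. unfold Lambda, swap. simpl. ring.
Qed.

(** The reflection [swap tau swap] sends [(a, b)] to [(- a, b - a)]. *)
Lemma lam_two_terms (x y : C) : hol2 lam (x, y) -> hol2 lam (- x, y - x) ->
  lam (x, y) + lam (- x, y - x) = 0.
Proof.
  intros H1 H2.
  pose proof (symmetry_comp _ _ symmetry_swap (symmetry_comp _ _ symmetry_tau symmetry_swap)) as S1.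
  apply (dense_zero (x, y) (fun q => lam q + lam (swap (tau (swap q))))).
  - apply hol2_add; [easy|].
    apply (hol2_linear lam (fun q => swap (tau (swap q)))); [|easy].
    apply (linear_map_intro _ (- (1)) 0 (- (1)) 1). intros q. unfold swap, tau. simpl. f_equal; ring.
  - intros vs u N G. generalize (symmetry_ray _ vs u S1 N G).
    apply filter_imp. intros t A. apply Lambda_eq in A.
    destruct A as [-> _]. unfold Lambda, swap. simpl. ring.
Qed.

(** ** The differential equation *)

(** Value and derivative travel together, so a first-order expansion of a composite expression is
    assembled by rules alone. *)
Definition jet (f : C -> C) (z a l : C) : Prop := hol1 f z /\ f z = a /\ dC f z l.

Lemma jet_const c z : jet (fun _ => c) z c 0.
Proof. split; [apply hol1_const|split; [easy|apply dC_const]]. Qed.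

Lemma jet_id z : jet (fun t => t) z z 1.
Proof. split; [apply hol1_id|split; [easy|apply dC_id]]. Qed.

Lemma jet_sub f g z a b l m : jet f z a l -> jet g z b m -> jet (fun t => f t - g t) z (a - b) (l - m).
Proof.
  intros (H1 & <- & D1) (H2 & <- & D3). split; [now apply hol1_sub|split; [easy|now apply dC_sub]].
Qed.

Lemma jet_mul f g z a b l m : jet f z a l -> jet g z b m ->
  jet (fun t => f t * g t) z (a * b) (b * l + a * m).
Proof.
  intros (H1 & <- & D1) (H2 & <- & D3). split; [now apply hol1_mul|split; [easy|now apply dC_mul]].
Qed.

Lemma jet_div f g z a b l m : jet f z a l -> jet g z b m -> b <> 0 ->
  jet (fun t => f t / g t) z (a / b) ((l * b - a * m) / (b * b)).
Proof.
  intros (H1 & <- & D1) (H2 & <- & D3) N.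
  split; [now apply hol1_div|split; [easy|now apply dC_div]].
Qed.

Lemma jet_comp F f z a l c m : jet F a c m -> jet f z a l -> jet (fun t => F (f t)) z c (m * l).
Proof.
  intros (H1 & <- & D1) (H2 & <- & D3).
  split; [now apply hol1_comp|split; [easy|now apply dC_comp]].
Qed.

Lemma jet_eq f z a b l m : a = b -> l = m -> jet f z a l -> jet f z b m.
Proof. now intros <- <-. Qed.

Lemma hol1_jet f z : hol1 f z -> exists l, jet f z (f z) l.
Proof. intros H. destruct (hol1_dC f z H) as [l D]. exists l. now split. Qed.

Lemma small_scale (x y : C) P : locally_dst (RtoC 0, RtoC 0) P ->
  locally (0 : C) (fun z => P (x * z, y * z)).
Proof.
  assert (L : forall a : C, Clim (locally (0 : C)) (fun z => a * z) 0).
  { intros a. pose proof (hol1_Clim _ _ (hol1_mul _ _ _ (hol1_const a 0) (hol1_id 0))) as H.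
    cbv beta in H. now rewrite Cmult_0_r in H. }
  intros H. apply (locally_dst_Clim P (fun z => (x * z, y * z)) (RtoC 0, RtoC 0)); [apply L|apply L|exact H].
Qed.

(** The expansion of [lam] to second order at the origin. Its quadratic part [x ^ 2 - 2 x y] is
    where the coefficients of the differential equation come from. *)
Lemma lam_line (x y : C) : exists P, jet P 0 x (x ^ 2 - 2 * x * y) /\
  locally (0 : C) (fun z => lam (x * z, y * z) = z * P z).
Proof.
  destruct lam_near_zero as (Sf & Cf & HS & HC & S0 & C0 & _ & L).
  destruct (hol1_jet Sf 0 HS) as [ls JS]. destruct (hol1_jet Cf 0 HC) as [lc JC]. rewrite S0 in JS. rewrite C0 in JC.
  assert (JX : forall a : C, jet (fun z => a * z) 0 0 a).
  { intros a. refine (jet_eq _ _ _ _ _ _ _ _ (jet_mul _ _ _ _ _ _ _ (jet_const a 0) (jet_id 0))); ring. }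
  (* The level has order three on a line through the origin, so [Sf] and [Cf] enter only through
     their values 1. *)
  assert (JL : jet (fun z => level (x * z, y * z)) 0 0 0).
  { unfold level. cbn [fst snd].
    refine (jet_eq _ _ _ _ _ _ _ _ (jet_mul _ _ _ _ _ _ _ (jet_mul _ _ _ _ _ _ _ (JX x) (JX y))
      (jet_sub _ _ _ _ _ _ _ (JX x) (JX y)))); ring. }
  pose proof (jet_comp Sf _ _ _ _ _ _ JS JL) as J1. pose proof (jet_comp Cf _ _ _ _ _ _ JC JL) as J2.
  cbv beta in J1, J2.
  pose proof (jet_sub _ _ _ _ _ _ _ (jet_mul _ _ _ _ _ _ _ J2 J2) (jet_mul _ _ _ _ _ _ _ J1 (JX y))) as J3.
  pose proof (jet_sub _ _ _ _ _ _ _ J2 (jet_mul _ _ _ _ _ _ _ (jet_mul _ _ _ _ _ _ _ J1 J1)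
    (jet_mul _ _ _ _ _ _ _ (JX x) (JX y)))) as JA.
  pose proof (jet_sub _ _ _ _ _ _ _ (jet_const 1 0) (jet_mul _ _ _ _ _ _ _ (jet_mul _ _ _ _ _ _ _ J1 J2)
    (JX x))) as JB.
  pose proof (jet_mul _ _ _ _ _ _ _ JA JB) as JD.
  apply (jet_eq _ _ _ 1 _ (- x)) in JD; [|ring|ring].
  pose proof (jet_div _ _ _ _ _ _ _ (jet_mul _ _ _ _ _ _ _ (jet_const x 0) (jet_mul _ _ _ _ _ _ _ J3 J3))
    JD C1_nz) as JP. cbv beta in JP.
  eexists. split.
  - refine (jet_eq _ _ _ _ _ _ _ _ JP); field; exact C1_nz.
  - generalize (small_scale x y _ L). apply filter_imp. intros z (A & B & E). rewrite E.
    unfold dA, dB, nA in *. cbn [fst snd] in *. field. split; [exact B|].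
    intros Z. apply A. rewrite <- Z. ring.
Qed.

Lemma lam_boundary : boundary_condition lam.
Proof.
  intros x y. apply (proj2 (filterlim_Clim (locally' (0 : C)) _ _)). destruct (lam_line x y) as (P & (H & P0 & _) & L).
  pose proof (Clim_locally' _ _ _ (hol1_Clim P 0 H)) as CP. rewrite P0 in CP.
  apply (Clim_ext_eq P _ x x); [|easy|exact CP].
  generalize (filter_and _ _ (locally_locally' _ _ L) (locally'_ne (RtoC 0))). apply filter_imp.
  intros z [E N]. rewrite E. field. exact N.
Qed.

Lemma swap_near_zero P : locally_dst (RtoC 0, RtoC 0) P -> locally_dst (RtoC 0, RtoC 0) (fun q => P (swap q)).
Proof.
  intros (r & Hr & H). exists r. split; [easy|]. intros q Hq. apply H. revert Hq. unfold dst, swap.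
  cbn [fst snd]. lra.
Qed.

Lemma lam_pde p : hol2 lam p -> pde_at lam p.
Proof.
  intros H. destruct (hol2_D2 _ _ H) as (A & B & D). destruct p as [x y].
  exists A, B. cbn [fst snd]. split; [exact (D2_is_derive_fst _ _ _ _ D)|].
  split; [exact (D2_is_derive_snd _ _ _ _ D)|].
  destruct (lam_line x y) as (P & JP & LP). destruct (lam_line y x) as (Q & JQ & LQ).
  assert (J1 := jet_sub _ _ _ _ _ _ _ (jet_const 1 0) (jet_id 0)). cbv beta in J1.
  pose proof (jet_mul _ _ _ _ _ _ _ J1 JP) as JX. pose proof (jet_mul _ _ _ _ _ _ _ J1 JQ) as JY.
  cbv beta in JX, JY.
  set (X := fun t : C => (1 - t) * P t) in *. set (Y := fun t : C => (1 - t) * Q t) in *.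
  assert (E0 : (X 0, Y 0) = (x, y)).
  { unfold X, Y. destruct JP as (_ & -> & _), JQ as (_ & -> & _). f_equal; ring. }
  assert (LH : locally' (0 : C) (fun t => hol2 lam (X t, Y t))).
  { rewrite <- E0 in H. apply (locally_dst_Clim _ (fun t => (X t, Y t)) (X 0, Y 0)).
    - apply Clim_locally', hol1_Clim, JX.
    - apply Clim_locally', hol1_Clim, JY.
    - exact (hol2_open _ _ H). }
  pose proof (small_scale x y _ (locally_dst_and _ _ _ (hol2_open _ _ (proj1 lam_zero))
    (swap_near_zero _ (hol2_open _ _ (proj1 lam_zero))))) as LS.
  assert (LF : locally' (0 : C) (fun t => lam (X t, Y t) - (1 - t) * lam (x, y) = 0)).
  { generalize (filter_and _ _ (filter_and _ _ LH (locally'_ne (RtoC 0)))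
      (filter_and _ _ (locally_locally' _ _ LS)
        (filter_and _ _ (locally_locally' _ _ LP) (locally_locally' _ _ LQ)))).
    apply filter_imp. intros t [[A1 N] [[A2 A3] [A4 A5]]].
    assert (F : flow_point t (x, y) = (X t, Y t)).
    { unfold flow_point, scale, Lambda, swap, X, Y. cbn [fst snd].
      rewrite (Cmult_comm t x), (Cmult_comm t y), A4, A5. f_equal; field; exact N. }
    assert (S : scale t (x, y) = (x * t, y * t)) by (unfold scale; cbn [fst snd]; f_equal; ring).
    rewrite <- F. rewrite <- (flow_fst t (x, y)); rewrite ?F, ?S; auto. ring. }
  assert (E0' : lam (X 0, Y 0) - (1 - 0) * lam (x, y) = 0) by (rewrite E0; ring).
  assert (DG : dC (fun t => lam (X t, Y t) - (1 - t) * lam (x, y)) 0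
    ((A * (x * (0 - 1) + (1 - 0) * (x ^ 2 - 2 * x * y)) +
      B * (y * (0 - 1) + (1 - 0) * (y ^ 2 - 2 * y * x))) - (lam (x, y) * (0 - 1) + (1 - 0) * 0))).
  { apply dC_sub.
    - apply (dC_pair lam X Y); [now rewrite E0|apply JX|apply JY].
    - exact (dC_mul _ (fun _ => lam (x, y)) _ _ _ (proj2 (proj2 J1)) (dC_const _ _)). }
  assert (DZ : dC (fun t => lam (X t, Y t) - (1 - t) * lam (x, y)) 0 0).
  { apply (is_derive_ext_loc (fun _ : C => RtoC 0)); [|apply dC_const].
    apply (proj1 (locally'_Cmod _ _)) in LF. destruct LF as (r & Hr & LF). apply (proj2 (locally_C_AbsRing _ _)).
    exists r. split; [easy|]. intros t Ht. destruct (Ceq_dec t 0) as [-> | N]; [now rewrite E0'|].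
    symmetry. now apply LF. }
  pose proof (is_derive_C_unique _ _ _ _ DG DZ) as E. apply Cminus_0_eq. rewrite <- E. ring.
Qed.

(** ** Uniqueness *)

Lemma dC_quotient (h : C -> C) (z l : C) : dC h z l ->
  Clim (locally' z) (fun t => (h t - h z) / (t - z)) l.
Proof.
  intros D e He. apply (proj2 (locally'_Cmod _ _)).
  destruct (proj1 (is_derive_C _ _ _) D (e / 2)%R ltac:(lra)) as (r & Hr & H).
  exists r. split; [easy|]. intros t Ht N. specialize (H t Ht).
  assert (N' : t - z <> 0) by (intros Z; apply N; now apply Cminus_0_eq).
  assert (P : (0 < Cmod (t - z))%R) by now apply Cmod_gt_0.
  replace ((h t - h z) / (t - z) - l) with ((h t - h z - l * (t - z)) / (t - z)) by (field; exact N').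
  rewrite Cmod_div by exact N'. apply Rlt_div_l; [easy|]. nra.
Qed.

(** The boundary condition prescribes every directional derivative at the origin, hence the whole
    differential. *)
Lemma boundary_D2 f : hol2 f (RtoC 0, RtoC 0) -> boundary_condition f ->
  f (RtoC 0, RtoC 0) = 0 /\ D2 f (RtoC 0, RtoC 0) 1 0.
Proof.
  intros H Bd.
  assert (BC : forall x y : C, Clim (locally' (0 : C)) (fun z => f (x * z, y * z) / z) x).
  { intros x y. exact (proj1 (filterlim_Clim (locally' (0 : C)) _ _) (Bd x y)). }
  destruct (hol2_D2 _ _ H) as (a & b & D).
  assert (DL : forall x y : C, dC (fun z => f (x * z, y * z)) 0 (a * x + b * y)).
  { intros x y. apply (dC_pair f (fun z => x * z) (fun z => y * z)).
    - now rewrite !Cmult_0_r.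
    - refine (dC_eq _ _ _ _ _ (dC_mul _ _ _ _ _ (dC_const x 0) (dC_id 0))). ring.
    - refine (dC_eq _ _ _ _ _ (dC_mul _ _ _ _ _ (dC_const y 0) (dC_id 0))). ring. }
  assert (Cz : Clim (locally' (0 : C)) (fun z => z) 0) by apply Clim_locally', hol1_Clim, hol1_id.
  assert (F0 : f (RtoC 0, RtoC 0) = 0).
  { assert (H1 : hol1 (fun z => f (1 * z, 0 * z)) 0).
    { apply (hol1_of_hol2 f (fun z => 1 * z) (fun z => 0 * z)).
      - now rewrite !Cmult_0_r.
      - apply hol1_mul; [apply hol1_const|apply hol1_id].
      - apply hol1_mul; [apply hol1_const|apply hol1_id]. }
    pose proof (Clim_locally' _ _ _ (hol1_Clim _ _ H1)) as C1. cbv beta in C1. rewrite !Cmult_0_r in C1.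
    pose proof (Clim_mul _ _ _ _ (BC 1 0) Cz) as C2. rewrite Cmult_0_r in C2.
    refine (Clim_unique (F := locally' (0 : C)) _ _ _ C1 _).
    apply (Clim_ext_eq (fun t => f (1 * t, 0 * t) / t * t) _ 0 0); [|easy|exact C2].
    generalize (locally'_ne (RtoC 0)). apply filter_imp. intros t N. field. exact N. }
  split; [easy|].
  assert (Q : forall x y : C, x = a * x + b * y).
  { intros x y. apply (Clim_unique (F := locally' (0 : C)) _ _ _ (BC x y)).
    apply (Clim_ext_eq (fun z => (f (x * z, y * z) - f (x * 0, y * 0)) / (z - 0)) _ (a * x + b * y) _);
      [|easy|exact (dC_quotient _ _ _ (DL x y))].
    apply filter_forall. intros t. rewrite !Cmult_0_r, F0. f_equal; ring. }
  assert (Ea : a = 1) by (transitivity (a * 1 + b * 0); [ring|symmetry; apply Q]).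
  assert (Eb : b = 0) by (transitivity (a * 0 + b * 1); [ring|symmetry; apply Q]).
  now rewrite Ea, Eb in D.
Qed.

(** The curve [t |-> Lambda (t p) / t], an integral curve of the quadratic part
    of the vector field of the differential equation. *)
Definition curve (p : C * C) (t : R) : C * C :=
  if excluded_middle_informative (t = 0%R) then p
  else scale (/ RtoC t) (Lambda lam (scale (RtoC t) p)).

Lemma curve_0 p : curve p 0 = p.
Proof. unfold curve. now destruct (excluded_middle_informative (0 = 0)%R). Qed.

Lemma curve_ne p (t : R) : t <> 0%R -> curve p t = scale (/ RtoC t) (Lambda lam (scale (RtoC t) p)).
Proof. intros N. unfold curve. now destruct (excluded_middle_informative (t = 0)%R). Qed.

Lemma swap_curve p t : curve (swap p) t = swap (curve p t).
Proof. unfold curve. now destruct (excluded_middle_informative (t = 0)%R); [|destruct p]. Qed.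

Definition zero2 : C * C := (RtoC 0, RtoC 0).

Lemma dst_zero_scale (k : C) q : dst zero2 (scale k q) = (Cmod k * dst zero2 q)%R.
Proof.
  unfold dst, zero2, scale. cbn [fst snd].
  replace (k * fst q - 0) with (k * (fst q - 0)) by ring.
  replace (k * snd q - 0) with (k * (snd q - 0)) by ring. rewrite !Cmod_mult. ring.
Qed.

Lemma dst_zero_swap q : dst zero2 (swap q) = dst zero2 q.
Proof. unfold dst, zero2, swap. cbn [fst snd]. ring. Qed.

Lemma dst_zero_pair (x y : C) : dst zero2 (x, y) = (Cmod x + Cmod y)%R.
Proof. unfold dst, zero2. cbn [fst snd]. f_equal; f_equal; ring. Qed.

(** A linear bound on [lam] bounds the curve [Lambda (t p) / t] uniformly in [t], down to
    [t = 0]. *)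
Definition tame (K r : R) : Prop := (1 <= K)%R /\ forall q, (dst zero2 q < r)%R ->
  hol2 lam q /\ hol2 lam (swap q) /\
  (Cmod (lam q) <= K * dst zero2 q)%R /\ (Cmod (lam (swap q)) <= K * dst zero2 q)%R.

Lemma tame_exists : exists K r, (0 < r)%R /\ tame K r.
Proof.
  destruct lam_zero as [H Z]. destruct (hol2_D2 _ _ H) as (a & b & D).
  pose proof (locally_dst_and _ _ _ (hol2_open _ _ H) (D2_lip _ _ _ _ D)) as L.
  destruct (locally_dst_and _ _ _ L (swap_near_zero _ L)) as (r & Hr & T).
  exists (Cmod a + Cmod b + 1)%R, r. split; [easy|]. split.
  - pose proof (Cmod_ge_0 a). pose proof (Cmod_ge_0 b). lra.
  - intros q Hq. destruct (T q Hq) as [[T1 T2] [T3 T4]]. rewrite Z in T2, T4.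
    fold zero2 in T2, T4. rewrite dst_zero_swap in T4.
    replace (lam q - 0) with (lam q) in T2 by ring.
    now replace (lam (swap q) - 0) with (lam (swap q)) in T4 by ring.
Qed.

Lemma curve_bound K r p (t : R) : tame K r -> (dst zero2 p < r)%R -> (0 <= t <= 1)%R ->
  (Cmod (fst (curve p t)) <= K * dst zero2 p)%R /\ (Cmod (snd (curve p t)) <= K * dst zero2 p)%R.
Proof.
  intros [HK T] Hp Ht. pose proof (dst_ge_0 zero2 p) as P0.
  destruct (Req_dec t 0) as [-> | N].
  - rewrite curve_0. pose proof (dst_fst zero2 p) as F. pose proof (dst_snd zero2 p) as S.
    cbn [zero2 fst snd] in F, S.
    replace (fst p - 0) with (fst p) in F by ring. replace (snd p - 0) with (snd p) in S by ring.
    split; nra.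
  - rewrite curve_ne by easy. unfold scale at 1 3, Lambda. cbn [fst snd].
    assert (Mt : Cmod (RtoC t) = t) by (rewrite Cmod_R; apply Rabs_pos_eq; lra).
    assert (Nt : RtoC t <> 0) by (intros E; apply N; now apply RtoC_inj).
    destruct (T (scale (RtoC t) p)) as (_ & _ & B1 & B2).
    { rewrite dst_zero_scale, Mt. nra. }
    rewrite dst_zero_scale, Mt in B1, B2. rewrite !Cmod_mult, !Cmod_inv, Mt by easy.
    assert (Pt : (0 < t)%R) by lra.
    split; (apply Rmult_le_reg_l with t; [easy|]; rewrite <- Rmult_assoc, Rinv_r, Rmult_1_l by lra; nra).
Qed.

(** By the flow equation the curve can be restarted: at time [s] it is the curve issued from
    [q = curve p t] at time [s - t]. The derivative at [t] is thus the one at time 0, which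
    [lam_line] provides. *)
Lemma curve_deriv_fst K r p (t : R) : tame K r -> (4 * K * dst zero2 p < r)%R -> (0 <= t <= 1)%R ->
  let q := curve p t in
  dR (fun s => fst (curve p s)) t (fst q ^ 2 - 2 * fst q * snd q).
Proof.
  intros TM Hp Ht q. pose proof TM as [HK T]. pose proof (dst_ge_0 zero2 p) as P0.
  assert (Hp1 : (dst zero2 p < r)%R) by nra.
  destruct (curve_bound K r p t TM Hp1 Ht) as [B1 B2]. fold q in B1, B2.
  destruct (lam_line (fst q) (snd q)) as (P & (_ & P0' & DP) & LP).
  destruct (proj1 (locally_Cmod _ _) LP) as (d0 & Hd0 & L0).
  assert (L : exists d, (0 < d)%R /\ forall s : R, (Rabs (s - t) < d)%R ->
    fst (curve p s) = P (RtoC s - RtoC t)).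
  { destruct (Req_dec t 0) as [-> | N].
    - exists d0. split; [easy|]. intros s Hs. unfold q in *. rewrite curve_0 in *.
      destruct (Req_dec s 0) as [-> | Ns].
      + rewrite curve_0. replace (RtoC 0 - RtoC 0) with (RtoC 0) by ring. now symmetry.
      + rewrite curve_ne by easy. unfold scale, Lambda. cbn [fst snd].
        assert (Ns' : RtoC s <> 0) by (intros E; apply Ns; now apply RtoC_inj).
        replace (RtoC s - RtoC 0) with (RtoC s) by ring.
        rewrite (Cmult_comm (RtoC s) (fst p)), (Cmult_comm (RtoC s) (snd p)), L0.
        * field. exact Ns'.
        * rewrite <- RtoC_minus, Cmod_R. easy.
    - assert (Pt : (0 < t)%R) by lra.
      exists (Rmin d0 t). split; [now apply Rmin_glb_lt|]. intros s Hs.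
      assert (Hs1 : (Rabs (s - t) < d0)%R) by (pose proof (Rmin_l d0 t); lra).
      assert (Hs2 : (Rabs (s - t) < t)%R) by (pose proof (Rmin_r d0 t); lra).
      assert (Ps : (0 < s < 2)%R) by (apply Rabs_def2 in Hs2; lra).
      destruct (Req_dec s t) as [-> | Nst].
      { replace (RtoC t - RtoC t) with (RtoC 0) by ring. now symmetry. }
      assert (Ns' : RtoC s <> 0) by (intros E; apply RtoC_inj in E; lra).
      assert (Nt' : RtoC t <> 0) by (intros E; apply N; now apply RtoC_inj).
      assert (Nd : RtoC s - RtoC t <> 0).
      { intros E. apply Nst. apply RtoC_inj. now apply Cminus_0_eq. }
      assert (Ms : Cmod (RtoC s) = s) by (rewrite Cmod_R; apply Rabs_pos_eq; lra).
      assert (Mt : Cmod (RtoC t) = t) by (rewrite Cmod_R; apply Rabs_pos_eq; lra).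
      assert (Md : (Cmod (RtoC s - RtoC t) <= 1)%R) by (rewrite <- RtoC_minus, Cmod_R; lra).
      rewrite curve_ne by lra. unfold scale at 1, Lambda. cbn [fst snd].
      assert (S1 : scale (RtoC t / RtoC s) (scale (RtoC s) p) = scale (RtoC t) p).
      { unfold scale. cbn [fst snd]. f_equal; field; exact Ns'. }
      (* The flow equation is used at [s p] with ratio [t / s]; its inner point is then [t p], and
         the outer one [q] scaled by [s - t]. *)
      assert (S2 : flow_point (RtoC t / RtoC s) (scale (RtoC s) p)
                   = (fst q * (RtoC s - RtoC t), snd q * (RtoC s - RtoC t))).
      { unfold flow_point. rewrite S1. unfold q. rewrite curve_ne by easy. unfold scale. cbn [fst snd].
        f_equal; field; auto. }
      destruct (T (scale (RtoC s) p)) as (A1 & _).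
      { rewrite dst_zero_scale, Ms. nra. }
      destruct (T (scale (RtoC t) p)) as (A2 & A3 & _).
      { rewrite dst_zero_scale, Mt. nra. }
      destruct (T (fst q * (RtoC s - RtoC t), snd q * (RtoC s - RtoC t))) as (A4 & _).
      { rewrite dst_zero_pair, !Cmod_mult. pose proof (Cmod_ge_0 (fst q)). pose proof (Cmod_ge_0 (snd q)).
        pose proof (Cmod_ge_0 (RtoC s - RtoC t)). nra. }
      assert (F := flow_fst (RtoC t / RtoC s) (scale (RtoC s) p)). rewrite S1, S2 in F.
      rewrite L0 in F by (replace (RtoC s - RtoC t - 0) with (RtoC (s - t)) by (rewrite RtoC_minus; ring);
        now rewrite Cmod_R).
      assert (NZ : RtoC t / RtoC s <> 0).
      { intros E. apply Nt'. transitivity (RtoC t / RtoC s * RtoC s); [field; exact Ns'|]. rewrite E. ring. }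
      specialize (F NZ A1 A2 A3 A4).
      transitivity ((1 - RtoC t / RtoC s) * lam (scale (RtoC s) p) / (RtoC s - RtoC t)); [field; auto|].
      rewrite F. field. exact Nd. }
  destruct L as (d & Hd & L).
  assert (D : dR (fun s => P (RtoC s - RtoC t)) t (fst q ^ 2 - 2 * fst q * snd q)).
  { refine (dR_eq _ _ _ _ _ (dR_comp P (fun s => RtoC s - RtoC t) t _ _ _
      (dR_sub _ _ _ _ _ (dR_id t) (dR_const (RtoC t) t)))).
    - instantiate (1 := fst q ^ 2 - 2 * fst q * snd q). ring.
    - replace (RtoC t - RtoC t) with (RtoC 0) by ring. exact DP. }
  intros e He. destruct (D e He) as (d1 & Hd1 & D1). exists (Rmin d d1).
  split; [now apply Rmin_glb_lt|]. intros s Hs.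
  rewrite L by (pose proof (Rmin_l d d1); lra). rewrite (L t) by (rewrite Rminus_diag, Rabs_R0; lra).
  apply D1. pose proof (Rmin_r d d1). lra.
Qed.

Lemma curve_deriv_snd K r p (t : R) : tame K r -> (4 * K * dst zero2 p < r)%R -> (0 <= t <= 1)%R ->
  let q := curve p t in
  dR (fun s => snd (curve p s)) t (snd q ^ 2 - 2 * fst q * snd q).
Proof.
  intros TM Hp Ht q. rewrite <- dst_zero_swap in Hp.
  pose proof (curve_deriv_fst K r (swap p) t TM Hp Ht) as D. cbv zeta in D.
  rewrite swap_curve in D. fold q in D. unfold swap in D at 2 3 4. cbn [fst snd] in D.
  apply (dR_eq _ _ _ (snd q ^ 2 - 2 * fst q * snd q)) in D; [|ring].
  intros e He. destruct (D e He) as (d & Hd & D'). exists d. split; [easy|]. intros s Hs.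
  specialize (D' s Hs). cbv beta in D'. now rewrite !swap_curve in D'.
Qed.

Lemma pde_at_D2 f p A B : D2 f p A B -> pde_at f p ->
  A * (fst p ^ 2 - 2 * fst p * snd p - fst p) + B * (snd p ^ 2 - 2 * fst p * snd p - snd p) = - f p.
Proof.
  intros D (fx & fy & H1 & H2 & E).
  rewrite (is_derive_C_unique _ _ _ _ (D2_is_derive_fst _ _ _ _ D) H1).
  rewrite (is_derive_C_unique _ _ _ _ (D2_is_derive_snd _ _ _ _ D) H2). now destruct p.
Qed.

Lemma local_solution_unique mu : local_solution mu ->
  locally (RtoC 0, RtoC 0) (fun p => mu p = lam p).
Proof.
  intros (Hmu & Pmu & Bmu). apply analytic2_hol2_iff in Hmu.
  destruct (boundary_D2 mu Hmu Bmu) as [Z0 D0].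
  apply (proj1 (locally_CC _ _)) in Pmu.
  destruct (locally_dst_and _ _ _ Pmu (hol2_open _ _ Hmu)) as (r1 & Hr1 & H1).
  destruct tame_exists as (K & r & Hr & TM). pose proof TM as [HK T].
  apply (proj2 (locally_CC _ _)).
  (* The factor [4 K] meets the hypothesis of [curve_deriv_fst] and keeps the points [g t] below, of
     size at most [2 K dst zero2 p], where [mu] solves the equation. *)
  exists (Rmin r r1 / (4 * K))%R.
  split. { apply Rdiv_lt_0_compat; [now apply Rmin_glb_lt|lra]. }
  intros p Hp. fold zero2 in *. apply Rlt_div_r in Hp; [|lra].
  pose proof (Rmin_l r r1) as M1. pose proof (Rmin_r r r1) as M2.
  assert (P0 := dst_ge_0 zero2 p).
  set (M := (2 * K * dst zero2 p)%R).
  assert (Hp0 : (4 * K * dst zero2 p < r)%R) by lra.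
  assert (HM : (0 <= M < r1)%R) by (unfold M; nra).
  assert (CB : forall t, (0 <= t <= 1)%R -> (Cmod (fst (curve p t)) + Cmod (snd (curve p t)) <= M)%R).
  { intros t Ht. destruct (curve_bound K r p t TM ltac:(nra) Ht). unfold M. lra. }
  set (g := fun t : R => scale (1 - RtoC t) (curve p t)).
  assert (Gd : forall t, (0 <= t <= 1)%R -> (dst zero2 (g t) <= (1 - t) * M)%R).
  { intros t Ht. unfold g. rewrite dst_zero_scale, (surjective_pairing (curve p t)), dst_zero_pair.
    replace (Cmod (1 - RtoC t)) with (1 - t)%R.
    - apply Rmult_le_compat_l; [lra|]. now apply CB.
    - rewrite <- RtoC_minus, Cmod_R. rewrite Rabs_pos_eq; lra. }
  (* [g] is a characteristic up to reparametrization: [(1 - t) g'] is the vector field of the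
     equation at [g]. Hence [(1 - t)] times the derivative of [mu (g t)] is [- mu (g t)], and this
     quotient is constant. *)
  set (e := fun t : R => mu (fst (g t), snd (g t)) * / (1 - RtoC t)).
  assert (De : forall t, (0 <= t < 1)%R -> dR e t 0).
  { intros t Ht. assert (Ht1 : (0 <= t <= 1)%R) by lra.
    pose proof (curve_deriv_fst K r p t TM Hp0 Ht1) as DX.
    pose proof (curve_deriv_snd K r p t TM Hp0 Ht1) as DY. cbv zeta in DX, DY.
    assert (N1 : 1 - RtoC t <> 0).
    { intros E. rewrite <- RtoC_minus in E. apply RtoC_inj in E. lra. }
    pose proof (dR_sub _ _ _ _ _ (dR_const 1 t) (dR_id t)) as D1. cbv beta in D1.
    destruct (H1 (g t)) as [PD HH]. { pose proof (Gd t Ht1). nra. }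
    destruct (hol2_D2 _ _ HH) as (A & B & D).
    pose proof (pde_at_D2 _ _ _ _ D PD) as E. rewrite (surjective_pairing (g t)) in D.
    refine (dR_eq _ _ _ _ _ (dR_mul _ _ _ _ _
      (dR_pair mu (fun s => fst (g s)) (fun s => snd (g s)) t _ _ _ _ D (dR_mul _ _ _ _ _ D1 DX)
        (dR_mul _ _ _ _ _ D1 DY)) (dR_inv _ _ _ D1 N1))).
    cbv beta. rewrite <- (surjective_pairing (g t)).
    replace (mu (g t)) with (- (A * (fst (g t) ^ 2 - 2 * fst (g t) * snd (g t) - fst (g t)) +
      B * (snd (g t) ^ 2 - 2 * fst (g t) * snd (g t) - snd (g t)))) by (rewrite E; ring).
    unfold g, scale. cbn [fst snd]. field. exact N1. }
  assert (Ce : forall t, (0 <= t < 1)%R -> e t = mu p).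
  { intros t Ht. rewrite <- (dR_zero_const e 0 t) by (try lra; intros s Hs; apply De; lra).
    unfold e, g. rewrite curve_0. replace (1 - RtoC 0) with (RtoC 1) by ring.
    unfold scale. cbn [fst snd]. rewrite !Cmult_1_l, <- (surjective_pairing p).
    rewrite <- (Cmult_1_r (mu p)) at 2. f_equal. field. }
  assert (L1 : Clim (at_left 1) (fun t => fst (curve p t)) (lam p)).
  { pose proof (dR_Clim _ _ _ (curve_deriv_fst K r p 1 TM Hp0 ltac:(lra))) as C.
    cbv beta in C. rewrite (curve_ne p 1) in C by lra.
    replace (fst (scale (/ RtoC 1) (Lambda lam (scale (RtoC 1) p)))) with (lam p) in C.
    - intros eps He. apply filter_le_within. now apply C.
    - unfold scale, Lambda. cbn [fst snd]. rewrite !Cmult_1_l, <- (surjective_pairing p).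
      field. }
  (* As [t] tends to 1, [g t] tends to the origin, where [mu] is the first coordinate to first
     order, and [fst (g t)] divided by [1 - t] is the first coordinate of the curve. *)
  assert (L2 : Clim (at_left 1) (fun t => e t - fst (curve p t)) 0).
  { intros eps He.
    assert (He2 : (0 < eps / (2 * (M + 1)))%R) by (apply Rdiv_lt_0_compat; lra).
    destruct (D0 _ He2) as (d & Hd & L).
    assert (Hd2 : (0 < Rmin 1 (d / (M + 1)))%R).
    { apply Rmin_glb_lt; [lra|]. apply Rdiv_lt_0_compat; lra. }
    exists (mkposreal _ Hd2). intros t Bt Ht.
    assert (Bt' : (Rabs (t - 1) < Rmin 1 (d / (M + 1)))%R) by exact Bt.
    pose proof (Rmin_l 1 (d / (M + 1))) as N1. pose proof (Rmin_r 1 (d / (M + 1))) as N2.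
    rewrite Rabs_left in Bt' by lra.
    assert (Ht1 : (0 <= t <= 1)%R) by lra. pose proof (Gd t Ht1) as G.
    assert (Q : ((1 - t) * (M + 1) < d)%R).
    { apply Rlt_div_r; lra. }
    specialize (L (g t)). unfold zero2 in L, Z0. rewrite Z0 in L. cbn [fst snd] in L.
    fold zero2 in L. specialize (L ltac:(nra)).
    assert (N0 : 1 - RtoC t <> 0).
    { intros E. rewrite <- RtoC_minus in E. apply RtoC_inj in E. lra. }
    assert (M0 : Cmod (1 - RtoC t) = (1 - t)%R).
    { rewrite <- RtoC_minus, Cmod_R. apply Rabs_pos_eq. lra. }
    unfold e. rewrite <- (surjective_pairing (g t)).
    replace (mu (g t) * / (1 - RtoC t) - fst (curve p t) - 0)
      with ((mu (g t) - 0 - (1 * (fst (g t) - 0) + 0 * (snd (g t) - 0))) / (1 - RtoC t)).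
    - rewrite Cmod_div by exact N0. rewrite M0. apply Rlt_div_l; [lra|].
      assert (X : (eps / (2 * (M + 1)) * dst zero2 (g t) <= eps / (2 * (M + 1)) * ((1 - t) * M))%R)
        by (apply Rmult_le_compat_l; lra).
      assert (Y : (eps / (2 * (M + 1)) * ((1 - t) * (M + 1)) = eps / 2 * (1 - t))%R) by (field; lra).
      assert (W : (eps / (2 * (M + 1)) * ((1 - t) * M) <= eps / (2 * (M + 1)) * ((1 - t) * (M + 1)))%R)
        by (apply Rmult_le_compat_l; nra).
      nra.
    - unfold g, scale. cbn [fst snd]. field. exact N0. }
  apply (Clim_unique (F := at_left 1) (fun _ => mu p)); [apply Clim_const|].
  apply (Clim_ext_eq (fun t => e t - fst (curve p t) + fst (curve p t)) _ (0 + lam p)).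
  - exists (mkposreal 1 Rlt_0_1). intros t Bt Ht. assert (Bt' : (Rabs (t - 1) < 1)%R) by exact Bt.
    rewrite Rabs_left in Bt' by lra. rewrite Ce by lra. ring.
  - ring.
  - now apply Clim_add.
Qed.

(** ** The level curves *)

(** Off a local denominator [lam] is a quotient of holomorphic functions, hence analytic. So
    comparing [lam] with [g] at the points of analyticity is enough for the second clause of
    [meromorphic2]. *)
Lemma lam_removable g p : hol2 g p -> locally_dst p (fun q => hol2 lam q -> lam q = g q) ->
  hol2 lam p /\ lam p = g p.
Proof.
  intros Hg L. destruct (lam_meromorphic2 p) as [(G & H & HG & HH & NH & E) R].
  assert (A : hol2 lam p); [|split; [easy|exact (locally_dst_self _ _ L A)]].
  apply analytic2_hol2_iff. apply (R g H); [now apply analytic2_hol2_iff|easy|easy|].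
  apply analytic2_hol2_iff in HG, HH. apply (proj1 (locally_CC _ _)) in E.
  apply (proj2 (locally_CC _ _)).
  pose proof (locally_dst_and _ _ _ (locally_dst_and _ _ _ L (locally_dst_open _ _ E))
    (locally_dst_and _ _ _ (hol2_open _ _ HG) (hol2_open _ _ HH))) as W.
  revert W. apply locally_dst_imp. intros q [[Lq Eq] [Gq Hq]] N. apply Lq.
  apply (hol2_ext (fun q => G q / H q)); [|now apply hol2_div].
  generalize (locally_dst_and _ _ _ Eq (cont2_nz H q (hol2_cont _ _ Hq) N)).
  apply locally_dst_imp. intros q' [A B]. symmetry. auto.
Qed.

Lemma locally_dst_pair f g p P : cont2 f p -> cont2 g p -> locally_dst (f p, g p) P ->
  locally_dst p (fun q => P (f q, g q)).
Proof.
  intros Hf Hg (r & Hr & H). assert (Hr2 : (0 < r / 2)%R) by lra.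
  generalize (locally_dst_and _ _ _ (Hf _ Hr2) (Hg _ Hr2)). apply locally_dst_imp.
  intros q [A B]. apply H. unfold dst. cbn [fst snd]. lra.
Qed.

Lemma locally_dst_scale (k : C) p P : locally_dst (scale k p) P -> locally_dst p (fun q => P (scale k q)).
Proof.
  apply (locally_dst_pair (fun q => k * fst q) (fun q => k * snd q)); apply hol2_cont, hol2_mul;
    auto using hol2_const, hol2_fst, hol2_snd.
Qed.

Lemma locally_dst_swap p P : locally_dst (swap p) P -> locally_dst p (fun q => P (swap q)).
Proof.
  apply (locally_dst_pair snd fst); apply hol2_cont; auto using hol2_fst, hol2_snd.
Qed.

(** Only the end points need to be good; [v] itself may be a pole of [sm]. The translation by [v] is
    split into generic ones by [z v] and [(1 - z) v]. *)
Lemma lam_Phi_good (v u : C) : v <> 0 -> good u -> good (u + v) ->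
  hol2 lam (Phi v u) /\ lam (Phi v u) = fst (Phi v (u + v)).
Proof.
  intros Nv G1 G2.
  assert (E1 : v * 0 + 0 = 0) by ring. assert (E2 : - v * 1 + v = 0) by ring.
  assert (G1' : good (0 * 0 + u)) by (now replace (0 * 0 + u) with u by ring).
  assert (G2' : good (v * 1 + u)) by (now replace (v * 1 + u) with (u + v) by ring).
  destruct (filter_ex _ (filter_and _ _ (filter_and _ _ (generic_near _ _ _ _ 0 0 E1 G1')
    (generic_near _ _ _ _ 1 0 E2 G2')) (filter_and _ _ (locally'_ne (RtoC 0))
    (merop_nz_near (fun t => 1 - t) 0 0 (fun t => merop_hol1 _ _ (hol1_sub _ _ _ (hol1_const 1 t) (hol1_id t)))
      (hol1_sub _ _ _ (hol1_const 1 0) (hol1_id 0))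
      (fun Z : 1 - 0 = 0 => C1_nz (Cminus_0_eq _ _ Z)))))) as (z & [A B] & N0 & N1).
  replace (v * z + 0) with (z * v) in A by ring. replace (0 * z + u) with u in A by ring.
  replace (- v * z + v) with ((1 - z) * v) in B by ring. replace (v * z + u) with (u + z * v) in B by ring.
  destruct (Lambda_Phi _ _ (Cmult_neq_0 _ _ N0 Nv) A) as (H1 & H2 & F1).
  destruct (Lambda_Phi _ _ (Cmult_neq_0 _ _ N1 Nv) B) as (H3 & _ & F2).
  replace (u + z * v + (1 - z) * v) with (u + v) in F2 by ring.
  rewrite Phi_scale in H1, H2.
  assert (FP : flow_point z (Phi v u) = Phi ((1 - z) * v) (u + z * v)).
  { unfold flow_point. rewrite <- Phi_scale, F1, <- Phi_scale. f_equal. field. exact N0. }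
  rewrite <- FP in H3, F2.
  (* The flow equation solved for [lam q] has a right-hand side that is holomorphic at [Phi v u]
     even if [expr] degenerates there. *)
  destruct (lam_removable (fun q => / (1 - z) * lam (flow_point z q)) (Phi v u)) as [R1 R2].
  - apply hol2_mul; [apply hol2_const|]. now apply flow_point_hol2.
  - assert (HX : hol2 (fun q => (1 - z) / z * lam (scale z q)) (Phi v u)).
    { apply hol2_mul; [apply hol2_const|now apply hol2_scale]. }
    assert (HY : hol2 (fun q => (1 - z) / z * lam (swap (scale z q))) (Phi v u)).
    { apply hol2_mul; [apply hol2_const|]. apply (hol2_scale (fun q => lam (swap q))). now apply hol2_swap. }
    pose proof (locally_dst_and _ _ _ (locally_dst_pair _ _ _ (hol2 lam) (hol2_cont _ _ HX) (hol2_cont _ _ HY)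
       (hol2_open _ _ H3))
      (locally_dst_and _ _ _ (locally_dst_scale z _ _ (hol2_open _ _ H1))
         (locally_dst_scale z _ (fun q => hol2 lam (swap q)) (locally_dst_swap _ _ (hol2_open _ _ H2))))) as L.
    revert L. apply locally_dst_imp. intros q (A1 & A2 & A3) A4.
    rewrite <- (flow_fst z q); auto. field. exact N1.
  - split; [easy|]. rewrite R2. apply (f_equal fst) in F2. rewrite Phi_scale in F2.
    unfold Lambda in F2. cbn [fst] in F2. rewrite F2.
    generalize (Phi v (u + v)). intros q. unfold scale. cbn [fst]. field. exact N1.
Qed.

Lemma Lambda_Phi_good (v u : C) : v <> 0 -> good u -> good (u + v) ->
  hol2 lam (Phi v u) /\ hol2 lam (swap (Phi v u)) /\ Lambda lam (Phi v u) = Phi v (u + v).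
Proof.
  intros N G1 G2. destruct (lam_Phi_good v u N G1 G2) as [H1 E1].
  assert (N' : - v <> 0) by (intros X; apply N; transitivity (- - v); [ring|rewrite X; ring]).
  assert (G2' : good (- u + - v)) by (replace (- u + - v) with (- (u + v)) by ring; now apply good_neg).
  destruct (lam_Phi_good (- v) (- u) N' (good_neg _ G1) G2') as [H2 E2].
  replace (- u + - v) with (- (u + v)) in E2 by ring.
  rewrite Phi_neg in H2, E2 by easy. rewrite Phi_neg in E2 by easy.
  split; [easy|split; [easy|]]. unfold Lambda. rewrite E1, E2.
  now destruct (Phi v (u + v)).
Qed.

(** Supplies a non-zero translation when the start and the target on the level curve are the same
    point. *)
Lemma good_period u : good u -> exists w, w <> u /\ good w /\ forall v, Phi v w = Phi v u.
Proof.
  destruct period_near as (P & HP & PP). intros (R & N1 & N2).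
  destruct (period_reg (RtoC P) u PP R) as (R' & E1 & E2).
  exists (u + RtoC P). split; [|split].
  - intros E. assert (Z : RtoC P = 0) by (transitivity (u + RtoC P - u); [ring|rewrite E; ring]).
    apply RtoC_inj in Z. lra.
  - split; [easy|]. now rewrite E1, E2.
  - intros v. unfold Phi. now rewrite E1, E2.
Qed.

(** If [u] and [w] are parameters of the two points for the same cube root [v], the time is
    [z = (w - u) / v]: scaling by [z] makes the translation [z v = w - u]. *)
Lemma level_curve_onto (x y a b : C) : x * y * (x - y) <> 0 -> a * b * (a - b) = x * y * (x - y) ->
  exists z : C, z <> 0 /\ hol2 lam (x * z, y * z) /\ hol2 lam (y * z, x * z) /\
    lam (x * z, y * z) / z = a /\ lam (y * z, x * z) / z = b.
Proof.
  intros N E. set (v := crt (x * y * (x - y))).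
  assert (Ev : v ^ 3 = x * y * (x - y)) by apply crt_spec.
  assert (Nv : v <> 0) by (intros Z; apply N; rewrite <- Ev, Z; ring).
  destruct (Phi_onto x y v Nv Ev) as (u & Gu & Pu). rewrite <- E in Ev.
  destruct (Phi_onto a b v Nv Ev) as (w0 & Gw0 & Pw0).
  assert (W : exists w, w <> u /\ good w /\ (a, b) = Phi v w).
  { destruct (Ceq_dec w0 u) as [-> | Nw]; [|now exists w0].
    destruct (good_period u Gu) as (w & Nw & Gw & Pw). exists w. now rewrite Pw. }
  destruct W as (w & Nw & Gw & Pw).
  assert (Nd : w - u <> 0) by (intros Z; apply Nw; now apply Cminus_0_eq).
  assert (Ew : u + (w - u) = w) by ring.
  destruct (Lambda_Phi_good (w - u) u Nd Gu) as (H1 & H2 & L); [now rewrite Ew|].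
  rewrite Ew in L. set (z := (w - u) / v).
  assert (Nz : z <> 0).
  { intros Z. apply Nd. transitivity (z * v); [unfold z; field; exact Nv|]. rewrite Z. ring. }
  replace (w - u) with (z * v) in * by (unfold z; field; exact Nv).
  rewrite !Phi_scale, <- Pu in *. rewrite <- Pw in L. unfold scale, swap in *. cbn [fst snd] in *.
  rewrite (Cmult_comm z x), (Cmult_comm z y) in *.
  apply Lambda_eq in L. unfold swap in L. cbn [fst snd] in L. destruct L as [L1 L2].
  exists z. split; [easy|split; [easy|split; [easy|]]]. rewrite L1, L2. split; field; exact Nz.
Qed.

End Dixon.

(** * The symmetry group *)

Module SymmetryGroup.

Import ssrbool fintype fingroup perm.

Definition o0 : 'I_3 := @Ordinal 3 0 isT.
Definition o1 : 'I_3 := @Ordinal 3 1 isT.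
Definition o2 : 'I_3 := @Ordinal 3 2 isT.

Lemma ord3_cases (i : 'I_3) : i = o0 \/ i = o1 \/ i = o2.
Proof.
  destruct i as [[|[|[|m]]] H]; [left|right; left|right; right|discriminate]; now apply ord_inj.
Qed.

Lemma o01 : o0 <> o1. Proof. discriminate. Qed.

Lemma o02 : o0 <> o2. Proof. discriminate. Qed.

Lemma o12 : o1 <> o2. Proof. discriminate. Qed.

(** Three linear forms with sum zero which [swap] and [tau] permute. *)
Definition form (p : C * C) (i : 'I_3) : C :=
  match nat_of_ord i with
  | 0%nat => fst p + snd p
  | 1%nat => fst p - 2 * snd p
  | _ => snd p - 2 * fst p
  end.

(** A point is recovered from its forms by [form 0 - form 2 = 3 x] and [form 0 - form 1 = 3 y]; here
    this is applied to the permuted forms. The inverse makes products act in the order of ['S_3]. *)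
Definition act (s : {perm 'I_3}) (p : C * C) : C * C :=
  ((form p (s^-1 o0)%g - form p (s^-1 o2)%g) / 3, (form p (s^-1 o0)%g - form p (s^-1 o1)%g) / 3).

Lemma perm3_cases (P : 'I_3 -> 'I_3 -> 'I_3 -> Prop) (s : {perm 'I_3}) :
  P o0 o1 o2 -> P o0 o2 o1 -> P o1 o0 o2 -> P o1 o2 o0 -> P o2 o0 o1 -> P o2 o1 o0 ->
  P (s o0) (s o1) (s o2).
Proof.
  intros H1 H2 H3 H4 H5 H6.
  assert (I : forall i j, s i = s j -> i = j) by (intros i j; apply perm_inj).
  destruct (ord3_cases (s o0)) as [E0|[E0|E0]], (ord3_cases (s o1)) as [E1|[E1|E1]],
    (ord3_cases (s o2)) as [E2|[E2|E2]]; rewrite E0, E1, E2; try assumption; exfalso.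
  all: try (apply o01, I; congruence); try (apply o02, I; congruence); apply o12, I; congruence.
Qed.

Lemma form_act s p i : form (act s p) i = form p (s^-1 i)%g.
Proof.
  destruct (ord3_cases i) as [-> | [-> | ->]]; unfold act; generalize (s^-1)%g; intros t.
  - apply (perm3_cases (fun a b c => form ((form p a - form p c) / 3, (form p a - form p b) / 3) o0 = form p a) t);
      unfold form; cbn; field.
  - apply (perm3_cases (fun a b c => form ((form p a - form p c) / 3, (form p a - form p b) / 3) o1 = form p b) t);
      unfold form; cbn; field.
  - apply (perm3_cases (fun a b c => form ((form p a - form p c) / 3, (form p a - form p b) / 3) o2 = form p c) t);
      unfold form; cbn; field.
Qed.

Lemma act_mul (s t : {perm 'I_3}) p : act (s * t)%g p = act t (act s p).
Proof.
  assert (E : forall i, ((s * t)^-1)%g i = (s^-1)%g ((t^-1)%g i)).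
  { intros i. rewrite <- permM. f_equal. exact (invMg s t). }
  unfold act at 2. rewrite !form_act, <- !E. easy.
Qed.

Lemma act_inj (s t : {perm 'I_3}) : (forall p, act s p = act t p) -> s = t.
Proof.
  intros H. assert (K : forall i, (s^-1)%g i = (t^-1)%g i); [|apply invg_inj, permP; exact K]. intros i.
  (* At [(2, 1)] the three forms take the distinct values 3, 0 and -3, so this point separates
     permutations. *)
  assert (E : form (RtoC 2, RtoC 1) (s^-1 i)%g = form (RtoC 2, RtoC 1) (t^-1 i)%g) by (rewrite <- !form_act; congruence).
  revert E.
  destruct (ord3_cases (s^-1 i)%g) as [-> | [-> | ->]], (ord3_cases (t^-1 i)%g) as [-> | [-> | ->]];
    intros E; try reflexivity; exfalso; unfold form in E; cbn in E;
    rewrite <- ?RtoC_mult, <- ?RtoC_plus, <- ?RtoC_minus in E; apply RtoC_inj in E; lra.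
Qed.

Lemma act_1 p : act 1%g p = p.
Proof.
  assert (E : forall i, ((1 : {perm 'I_3})^-1)%g i = i).
  { intros i. rewrite <- (perm1 i) at 2. f_equal. apply invg1. }
  unfold act. rewrite !E. destruct p as [x y]. unfold form. cbn. f_equal; field.
Qed.

Lemma act_Sigma s : exists f, Sigma f /\ linear_map f /\ forall p, act s p = f p.
Proof.
  unfold act. generalize (s^-1)%g. intros t.
  apply (perm3_cases (fun a b c => exists f, Sigma f /\ linear_map f /\ forall p,
    ((form p a - form p c) / 3, (form p a - form p b) / 3) = f p) t).
  - exists (fun p => p). split; [constructor|]. split.
    + apply (linear_map_intro _ 1 0 0 1). intros [x y]. unfold swap, tau. cbn [fst snd]. f_equal; ring.
    + intros [x y]. unfold form. cbn. f_equal; field.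
  - exists swap. split; [constructor|]. split.
    + apply (linear_map_intro _ 0 1 1 0). intros [x y]. unfold swap, tau. cbn [fst snd]. f_equal; ring.
    + intros [x y]. unfold form, swap. cbn. f_equal; field.
  - exists tau. split; [constructor|]. split.
    + apply (linear_map_intro _ 1 (- (1)) 0 (- (1))). intros [x y]. unfold swap, tau. cbn [fst snd]. f_equal; ring.
    + intros [x y]. unfold form, tau. cbn. f_equal; field.
  - exists (fun p => swap (tau p)). split; [repeat constructor|]. split.
    + apply (linear_map_intro _ 0 (- (1)) 1 (- (1))). intros [x y]. unfold swap, tau. cbn [fst snd]. f_equal; ring.
    + intros [x y]. unfold form, swap, tau. cbn. f_equal; field.
  - exists (fun p => tau (swap p)). split; [repeat constructor|]. split.
    + apply (linear_map_intro _ (- (1)) 1 (- (1)) 0). intros [x y]. unfold swap, tau. cbn [fst snd]. f_equal; ring.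
    + intros [x y]. unfold form, swap, tau. cbn. f_equal; field.
  - exists (fun p => swap (tau (swap p))).
    split; [apply (Sigma_comp Sigma_swap (Sigma_comp Sigma_tau Sigma_swap))|]. split.
    + apply (linear_map_intro _ (- (1)) 0 (- (1)) 1). intros [x y]. unfold swap, tau. cbn [fst snd]. f_equal; ring.
    + intros [x y]. unfold form, swap, tau. cbn. f_equal; field.
Qed.

Lemma act_tperm (i j k : 'I_3) : ((tperm i j)^-1)%g k = tperm i j k.
Proof. f_equal. apply tpermV. Qed.

Lemma Sigma_act f : Sigma f -> exists s, forall p, f p = act s p.
Proof.
  induction 1 as [| | |f g _ [s Hs] _ [t Ht]|f g _ [s Hs] [I _]].
  - exists 1%g. intros p. now rewrite act_1.
  - exists (tperm o1 o2). intros [x y]. unfold act.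
    rewrite !act_tperm, tpermL, tpermR, tpermD by easy. unfold form, swap. cbn. f_equal; field.
  - exists (tperm o0 o1). intros [x y]. unfold act.
    rewrite !act_tperm, tpermL, tpermR, tpermD by easy. unfold form, tau. cbn. f_equal; field.
  - exists (t * s)%g. intros p. now rewrite act_mul, Hs, Ht.
  - exists (s^-1)%g. intros p. rewrite <- (I (act s^-1%g p)), Hs, <- act_mul.
    f_equal. transitivity (act 1%g p); [now rewrite act_1|]. f_equal. symmetry. exact (mulVg s).
Qed.

Lemma Sigma_S3 : isomorphic_to_S3 Sigma.
Proof.
  exists act. split; [exact act_mul|split; [exact act_inj|]]. intros f. split; [apply Sigma_act|].
  intros [s Hs]. destruct (act_Sigma s) as (g & Sg & _ & E).
  replace f with g; [easy|]. apply functional_extensionality. intros p. now rewrite Hs, E.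
Qed.

Lemma Sigma_linear f : Sigma f -> linear_map f.
Proof.
  intros H. destruct (Sigma_act f H) as [s Hs]. destruct (act_Sigma s) as (g & _ & (a & b & c & d & L) & E).
  exists a, b, c, d. intros p. now rewrite Hs, E.
Qed.

End SymmetryGroup.

Theorem theorem2 (sm cm : C -> C) (Hdix : dixonian sm cm) :
  (exists lam : C * C -> C,
    (* lam is the local solution, unique near the origin *)
    local_solution lam /\
    (forall mu : C * C -> C, local_solution mu ->
       locally (RtoC 0, RtoC 0) (fun p => mu p = lam p)) /\
    (* and it is a single-valued function on the whole plane *)
    meromorphic2 lam /\
    (* explicit formulas *)
    (forall x y vs : C,
       vs ^ 3 = x * y * (x - y) ->
       analytic1_at sm vs -> analytic1_at cm vs ->
       let s := sm vs in
       let c := cm vs in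
       let A := c * vs ^ 2 - s * c ^ 2 * y * vs + s ^ 2 * x * y in
       let B := c ^ 2 * vs ^ 2 - s * x * vs + s ^ 2 * c * x * y in
       (analytic2_at lam (x, y) ->
        y * (x - c ^ 3 * y) * B <> 0 ->
        lam (x, y) = vs * A ^ 2 / (y * (x - c ^ 3 * y) * B)) /\
       (analytic2_at lam (y, x) ->
        x * (x - c ^ 3 * y) * A <> 0 ->
        lam (y, x) = vs * B ^ 2 / (x * (x - c ^ 3 * y) * A))) /\
    (* PDE *)
    (forall p : C * C, analytic2_at lam p -> pde_at lam p) /\
    boundary_condition lam /\
    (* FLOW *)
    (forall (p : C * C) (z : C),
       z <> 0 ->
       Lambda_defined lam p ->
       Lambda_defined lam (scale z p) ->
       let q := scale ((1 - z) / z) (Lambda lam (scale z p)) in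
       Lambda_defined lam q ->
       scale (1 - z) (Lambda lam p) = Lambda lam q) /\
    (* SYMM *)
    isomorphic_to_S3 Sigma /\
    (forall gamma gamma_inv : C * C -> C * C,
       Sigma gamma -> mutually_inverse gamma gamma_inv ->
       forall p : C * C,
         Lambda_defined lam p -> Lambda_defined lam (gamma p) ->
         gamma_inv (Lambda lam (gamma p)) = Lambda lam p) /\
    (forall x y : C,
       analytic2_at lam (x, y) -> analytic2_at lam (- y, x - y) ->
       analytic2_at lam (y - x, - x) ->
       lam (x, y) + lam (- y, x - y) + lam (y - x, - x) = 0) /\
    (forall x y : C,
       analytic2_at lam (x, y) -> analytic2_at lam (- x, y - x) ->
       lam (x, y) + lam (- x, y - x) = 0) /\
    (* ELL *)
    (forall x y : C,
       x * y * (x - y) <> 0 ->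
       let X := fun z : C => lam (x * z, y * z) / z in
       let Y := fun z : C => lam (y * z, x * z) / z in
       let defined := fun z : C =>
         z <> 0 /\ analytic2_at lam (x * z, y * z) /\
         analytic2_at lam (y * z, x * z) in
       (forall z : C, defined z ->
          X z * Y z * (X z - Y z) = x * y * (x - y)) /\
       (forall a b : C, a * b * (a - b) = x * y * (x - y) ->
          exists z : C, defined z /\ X z = a /\ Y z = b)))%C.
Proof.
  exists (lam sm cm).
  pose proof (lam_meromorphic2 sm cm Hdix) as Mero. pose proof (lam_zero sm cm Hdix) as [H0 _].
  split; [|split; [|split; [|split; [|split; [|split; [|split; [|split; [|split; [|split; [|split]]]]]]]]]].
  - split; [|split].
    + now apply analytic2_hol2_iff.
    + apply (proj2 (locally_CC _ _)). generalize (hol2_open _ _ H0). apply locally_dst_imp.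
      intros q. now apply lam_pde.
    + now apply lam_boundary.
  - intros mu Hmu. now apply local_solution_unique.
  - exact Mero.
  - intros x y vs E R1 R2. apply analytic1_hol1_iff in R1, R2.
    destruct (formulas sm cm Hdix x y vs E (conj R1 R2)) as [F1 F2]. cbv zeta.
    split; intros H; apply analytic2_hol2_iff in H; auto.
  - intros p H. apply lam_pde; [easy|]. now apply analytic2_hol2_iff.
  - now apply lam_boundary.
  - intros p z Nz [H1 H2] [H3 H4] q [H5 H6]. apply flow; auto; now apply analytic2_hol2_iff.
  - exact SymmetryGroup.Sigma_S3.
  - intros gamma gamma_inv S [I _] p [H1 H2] [H3 H4].
    rewrite (Lambda_symmetry sm cm Hdix gamma p); [apply I| | | | | |];
      try (now apply analytic2_hol2_iff); [now apply (Sigma_symmetry sm cm)|now apply SymmetryGroup.Sigma_linear].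
  - intros x y H1 H2 H3. apply lam_three_terms; auto; now apply analytic2_hol2_iff.
  - intros x y H1 H2. apply lam_two_terms; auto; now apply analytic2_hol2_iff.
  - intros x y N X Y defined. split.
    + intros z (Nz & H1 & H2). apply analytic2_hol2_iff in H1, H2.
      pose proof (level_Lambda sm cm Hdix (x * z, y * z) H1 H2) as L.
      unfold level, Lambda, swap in L. cbn [fst snd] in L. unfold X, Y.
      transitivity (lam sm cm (x * z, y * z) * lam sm cm (y * z, x * z) *
        (lam sm cm (x * z, y * z) - lam sm cm (y * z, x * z)) / (z * z * z)); [field; exact Nz|].
      rewrite L. field. exact Nz.
    + intros a b E. destruct (level_curve_onto sm cm Hdix x y a b N E) as (z & Nz & H1 & H2 & E1 & E2).
      exists z. split; [|easy]. split; [easy|]. split; now apply analytic2_hol2_iff.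
Qed.
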